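(* 1. Let $G$ be a polynomial semigroup in $\mathcal{G}$. Then $J(G)$ is uniformly perfect. Moreover, if $z_0\in J(G)$ is a superattracting fixed point of an element of $G$, then $z_0\in\mathrm{int}(J(G))$. 2. If $G\in\mathcal{G}$ and $\infty\in J(G)$, then $G\in\mathcal{G}_{con}$ and $\infty\in\mathrm{int}(J(G))$. 3. Suppose that $G\in\mathcal{G}_{dis}$. Let $z_1\in J(G)\cap\mathbb{C}$ be a superattracting fixed point of $g\in G$. Then $z_1\in\mathrm{int}(J_{\min})$ and $J(g)\subset J_{\min}$.
   Context: $\hat{\mathbb{C}}$ is the Riemann sphere. A polynomial semigroup is a semigroup, under composition, generated by a non-empty family of non-constant polynomial maps $\hat{\mathbb{C}}\to\hat{\mathbb{C}}$ (the family need not be compact). The Fatou set $F(G)$ is the set of $z\in\hat{\mathbb{C}}$ having a neighborhood on which $G$ is a normal family; the Julia set is $J(G)=\hat{\mathbb{C}}\setminus F(G)$; for a single map $g$, $J(g)=J(\langle g\rangle)$. $CV(g)$ is the set of critical values of $g:\hat{\mathbb{C}}\to\hat{\mathbb{C}}$, $P(G)=\overline{\bigcup_{g\in G}CV(g)}$ (closure in $\hat{\mathbb{C}}$), and $P^{\ast}(G)=P(G)\setminus\{\infty\}$. $\mathcal{G}$ is the set of all polynomial semigroups $G$ such that each element of $G$ has degree at least two and $P^{\ast}(G)$ is bounded in $\mathbb{C}$; $\mathcal{G}_{con}$ and $\mathcal{G}_{dis}$ are the sets of $G\in\mathcal{G}$ with $J(G)$ connected, respectively disconnected. $\mathcal{J}_G$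 is the set of all connected components of $J(G)$ contained in $\mathbb{C}$, ordered by the surrounding order: for connected sets $K_1,K_2\subset\mathbb{C}$, $K_1\leq K_2$ means that $K_1=K_2$ or $K_1$ is included in a bounded component of $\mathbb{C}\setminus K_2$. For $G\in\mathcal{G}_{dis}$, $J_{\min}=J_{\min}(G)$ denotes the (existing, unique) minimal element of $(\mathcal{J}_G,\leq)$. $\mathrm{int}$ denotes the set of interior points (in $\hat{\mathbb{C}}$). A compact set $K\subset\hat{\mathbb{C}}$ is uniformly perfect if $\sharp K\geq2$ and there is a constant $C>0$ such that each annulus $A$ (doubly connected domain) that separates $K$ (i.e. $A\cap K=\emptyset$ and both components of $\hat{\mathbb{C}}\setminus A$ meet $K$) satisfies $\mathrm{mod}\,A<C$, where $\mathrm{mod}\,A$ is the modulus of $A$. *)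

(* Defs.v *)
From HB Require Import structures.
From mathcomp Require Import all_boot all_order all_algebra.
From mathcomp Require Import all_classical all_reals all_analysis.
From mathcomp Require Export complex.

Set Implicit Arguments.
Unset Strict Implicit.
Unset Printing Implicit Defensive.

Import Order.TTheory GRing.Theory Num.Theory.
Import numFieldNormedType.Exports.
Import ComplexField.Normc.

Local Open Scope classical_set_scope.
Local Open Scope ring_scope.
Local Open Scope complex_scope.

(* The usual topology and norm of the complex plane are those of a generic
   numeric field. The norm `|z| lives in R[i]; normc z is its real-valued
   version. *)
HB.instance Definition _ (R : rcfType) := NormedModule.copy R[i] R[i]^o.

Definition conn_components (T : topologicalType) (A : set T) : set (set T) :=
  [set connected_component A x | x in A].

Section RiemannSphere.
Variable R : realType.

(* Some z is the finite point z and None is the point at infinity. *)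
Definition sphere : topologicalType := one_point_compactification R[i].

Definition fin (z : R[i]) : sphere := Some z.
Definition infty : sphere := None.

(* The trace on the plane of a subset of the sphere. *)
Definition plane_part (A : set sphere) : set R[i] := fin @^-1` A.

Definition chordal (x y : sphere) : R :=
  match x, y with
  | Some z, Some w => 2 * normc (z - w) /
      (Num.sqrt (1 + normc z ^+ 2) * Num.sqrt (1 + normc w ^+ 2))
  | Some z, None | None, Some z => 2 / Num.sqrt (1 + normc z ^+ 2)
  | None, None => 0
  end.

(* The two charts of the sphere: z around a finite point, 1/z around infinity.
   [chart a x] is the coordinate of x in the chart used around a (with junk
   value 0 at the one point outside its domain), and [chart_inv a w] is the
   point with coordinate w. *)
Definition chart (a x : sphere) : R[i] :=
  if a is Some _ then odflt 0 x else (if x is Some z then z^-1 else 0).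

Definition chart_inv (a : sphere) (w : R[i]) : sphere :=
  if a is Some _ then fin w else (if w == 0 then infty else fin w^-1).

Definition local_expr (f : sphere -> sphere) (a : sphere) : R[i] -> R[i] :=
  fun w => chart (f a) (f (chart_inv a w)).

(* Complex differentiability at every point of an open set. *)
Definition holomorphic_on (A : set sphere) (f : sphere -> sphere) : Prop :=
  open A /\ forall a, A a ->
    {for a, continuous f} /\ derivable (local_expr f a) (chart a a) 1.

Definition critical_point (f : sphere -> sphere) (a : sphere) : Prop :=
  is_derive (chart a a) 1 (local_expr f a) 0.

Definition critical_values (f : sphere -> sphere) : set sphere :=
  f @` [set a | critical_point f a].

(* At a fixed point the local expression is taken in the same chart at the
   source and at the target, so its derivative is the multiplier. *)
Definition superattracting_fixed (f : sphere -> sphere) (a : sphere) : Prop :=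
  f a = a /\ critical_point f a.

Definition normal_on (F : set (sphere -> sphere)) (U : set sphere) : Prop :=
  forall f : nat -> sphere -> sphere, (forall n, F (f n)) ->
  exists phi : nat -> nat, {homo phi : m n / (m < n)%N} /\
  exists g : sphere -> sphere, forall K : set sphere, compact K -> K `<=` U ->
  forall e : R, 0 < e ->
    \forall n \near \oo, forall x, K x -> chordal (f (phi n) x) (g x) < e.

Section Modulus.
Local Open Scope ereal_scope.

Definition round_annulus (r1 r2 : \bar R) : set sphere :=
  fin @` [set z | r1 < (normc z)%:E < r2].

(* An injective holomorphic map has a holomorphic inverse. *)
Definition conformal_equiv (A B : set sphere) : Prop :=
  exists f : sphere -> sphere, holomorphic_on A f /\ set_bij A B f.

(* mod A = log (r2 / r1) if A is conformally equivalent to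
   {r1 < |z| < r2}, 0 <= r1 < r2 <= +oo; since lne 0 = -oo and lne +oo = +oo,
   it is +oo in the degenerate cases r1 = 0 or r2 = +oo. *)
Definition modulus (A : set sphere) : \bar R :=
  get [set m | exists r1 r2 : \bar R,
    [/\ 0 <= r1, r1 < r2, conformal_equiv (round_annulus r1 r2) A
      & m = lne r2 - lne r1]].

End Modulus.

Definition doubly_connected_domain (A : set sphere) : Prop :=
  [/\ open A, A !=set0, connected A &
    exists B1 B2, B1 <> B2 /\ conn_components (~` A) = [set B1; B2]].

Definition separates (A K : set sphere) : Prop :=
  A `&` K = set0 /\ forall B, conn_components (~` A) B -> B `&` K !=set0.

Definition uniformly_perfect (K : set sphere) : Prop :=
  [/\ compact K,
      exists x y, [/\ K x, K y & x <> y] &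
      exists2 C : R, 0 < C &
        forall A, doubly_connected_domain A -> separates A K ->
          (modulus A < C%:E)%E].

(* The map of the sphere induced by a non-constant polynomial. *)
Definition poly_map (p : {poly R[i]}) : sphere -> sphere :=
  fun x => if x is Some z then fin p.[z] else infty.

(* Polynomials are identified with the maps they induce; composition of maps
   is then composition of polynomials. *)
Definition generated_semigroup (S : set {poly R[i]}) : set {poly R[i]} :=
  smallest [set H | forall p q, H p -> H q -> H (p \Po q)] S.

(* [1 < size p] means that p is not constant. *)
Definition polynomial_semigroup (G : set {poly R[i]}) : Prop :=
  exists S : set {poly R[i]},
    [/\ S !=set0, forall p, S p -> (1 < size p)%N & G = generated_semigroup S].

Definition fatou (G : set {poly R[i]}) : set sphere :=
  [set z | exists2 U, nbhs z U & normal_on (poly_map @` G) U].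

Definition julia (G : set {poly R[i]}) : set sphere := ~` fatou G.

Definition julia1 (g : {poly R[i]}) : set sphere :=
  julia (generated_semigroup [set g]).

Definition postcritical (G : set {poly R[i]}) : set sphere :=
  closure (\bigcup_(g in G) critical_values (poly_map g)).

(* [2 < size g] means that g has degree at least two; the bounded set is the
   finite part P^*(G) of the postcritical set. *)
Definition calG (G : set {poly R[i]}) : Prop :=
  [/\ polynomial_semigroup G, forall g, G g -> (2 < size g)%N &
      bounded_set (plane_part (postcritical G `\ infty))].

Definition calG_con (G : set {poly R[i]}) : Prop :=
  calG G /\ connected (julia G).

Definition calG_dis (G : set {poly R[i]}) : Prop :=
  calG G /\ ~ connected (julia G).

Definition finite_julia_components (G : set {poly R[i]}) : set (set sphere) :=
  [set K | conn_components (julia G) K /\ ~ K infty].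

(* The surrounding order on subsets of the plane. *)
Definition surround_le (K1 K2 : set R[i]) : Prop :=
  K1 = K2 \/
  exists B, [/\ conn_components (~` K2) B, bounded_set B & K1 `<=` B].

(* The unique minimal element for the surrounding order, when G is in
   calG_dis. *)
Definition J_min (G : set {poly R[i]}) : set sphere :=
  get [set K | finite_julia_components G K /\
    forall K', finite_julia_components G K' ->
      surround_le (plane_part K') (plane_part K) -> K' = K].

End RiemannSphere.

Arguments infty {R}.

(* Main.v *)
(* J(G) is the closure of the union of the J(h), h in G, as Landau's theorem
   bounds the spherical derivatives of maps omitting two values at a definite
   distance; every J(h) is the connected boundary of a filled Julia set
   containing the finite critical values of G.

   Uniform perfectness. If J(G) is disconnected, it is bounded and the J(h) have
   diameter at least some d > 0. A conformal annulus separating J(G) omits two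
   such points, so by Landau's theorem, if its modulus is large, one of its core
   curves has small spherical diameter. The outside of a small disc around this
   curve is connected and meets the J(h1) and J(h2) lying on either side of it,
   so the curve cannot separate them.

   Superattracting fixed points. Suppose that z0 is in J(G) but not interior.
   Iterates of g near z0 blow up a disc of the Fatou set so much, relative to the
   distance to z0, that its images contain whole circles around z0. A small
   circle in F(G) encloses some J(h) entirely, hence every critical value of G;
   so z0 is the only one and every element of G is z0 + a (z - z0)^d, which acts
   affinely on log |z - z0|, where the claim is elementary. At infinity the same
   circles form annuli of F(G) of large modulus, and a bound for the leading
   coefficients by Lagrange interpolation makes images of these annuli overlap
   their images under a fixed h, so that infinity would not be in J(G).

   Connectedness. If infinity is in J(G), a neighbourhood of it and then the
   whole basin of infinity of each h lie in J(G), so that J(G) is connected. For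
   a superattracting z1 in J(G), the component of z1 contains a neighbourhood of
   z1, its immediate basin and a point of J(g), hence J(g); a component not
   surrounding it could be cut off from z1 by a path to infinity that misses
   every J(h) near that component, although z1 lies in all filled Julia sets. *)
Require Import Defs.
From mathcomp Require Import all_boot all_order all_algebra.
From mathcomp Require Import all_classical all_reals all_analysis.
From mathcomp Require Import ring lra.

Set Implicit Arguments.
Unset Strict Implicit.
Unset Printing Implicit Defensive.

Import Order.TTheory GRing.Theory Num.Theory.
Import numFieldNormedType.Exports.
Import ComplexField.Normc.

Local Open Scope classical_set_scope.
Local Open Scope ring_scope.
Local Open Scope complex_scope.

(* [fatou] alone would refer to Fatou's lemma. *)
Local Notation fatou := Defs.fatou.

(** * The plane *)

(** The generating family may be infinite and unbounded, so no escape radius, degree bound or bound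
    on leading coefficients is shared by the elements of [G]. What they do share is the set of
    finite critical values, which lies in every filled Julia set, and the uniform constants rest on
    it. If there is only one such value, it supplies a single point instead of two, but the elements
    are then monomials about it: hence the recurring case distinction. Function theory is built only
    as far as it is used: Goursat's theorem on rectangles, and then one principle, that a function
    with zero integral around a square cannot be close to 1 / (z - b) on its sides. Cauchy's
    estimate, the maximum principle and the openness of injective maps all come from it. Roots are
    extracted by repeated square roots, so that every root taken has order [2 ^ k]. Connectedness of
    each J(h) comes from following level curves of the iterates down from a large level, without
    covering theory. *)

Section Plane.
Context {R : realType}.
Local Notation C := R[i].
Local Notation Re := (@complex.Re R).
Local Notation Im := (@complex.Im R).
Implicit Types (z w a b : C) (A B : set C) (e r s t : R).

Lemma normc_ge0 z : 0 <= normc z.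
Proof. by case: z => x y; exact: sqrtr_ge0. Qed.

Lemma normc_eq0 z : (normc z == 0) = (z == 0).
Proof. by apply/eqP/eqP => [/eq0_normc|->]; rewrite ?normc0. Qed.

Lemma normc_gt0 z : (0 < normc z) = (z != 0).
Proof. by rewrite lt_def normc_eq0 normc_ge0 andbT. Qed.

Lemma ler_normcD z w : normc (z + w) <= normc z + normc w.
Proof. exact: le_normcD. Qed.

Lemma normc_opp z : normc (- z) = normc z.
Proof. exact: normcN. Qed.

Lemma normc_distC z w : normc (z - w) = normc (w - z).
Proof. by rewrite -normc_opp opprB. Qed.

Lemma ler_normcB z w : normc (z - w) <= normc z + normc w.
Proof. by rewrite -(normc_opp w) ler_normcD. Qed.

Lemma ler_distcD w z a : normc (z - a) <= normc (z - w) + normc (w - a).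
Proof. by rewrite (le_trans _ (ler_normcD _ _))// addrA subrK. Qed.

Lemma lerB_normc z w : normc z - normc w <= normc (z - w).
Proof. by rewrite lerBlDr (le_trans _ (ler_normcD _ _))// subrK. Qed.

Lemma lerB_normcD z w : normc z - normc w <= normc (z + w).
Proof. by rewrite -[w]opprK normc_opp lerB_normc. Qed.

Lemma normcX z n : normc (z ^+ n) = normc z ^+ n.
Proof. by elim: n => [|n IH]; rewrite ?expr0 ?normc1// !exprS normcM IH. Qed.

Lemma normc_real r : normc r%:C = `|r|.
Proof. by rewrite /normc /= expr0n addr0 sqrtr_sqr. Qed.

Lemma normc_nat n : normc (n%:R : C) = n%:R.
Proof. by rewrite -(rmorph_nat (real_complex R)) normc_real normr_nat. Qed.

Lemma normc_i : normc ('i : C) = 1.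
Proof. by rewrite /normc /= expr0n add0r expr1n sqrtr1. Qed.

Lemma normcE z : `|z| = (normc z)%:C.
Proof. by case: z. Qed.

Lemma sqr_normcE z : normc z ^+ 2 = (Re z) ^+ 2 + (Im z) ^+ 2.
Proof. by case: z => x y /=; rewrite sqr_sqrtr// addr_ge0 ?sqr_ge0. Qed.

Lemma normr_Re z : `|Re z| <= normc z.
Proof. by rewrite -lecR -normcE normc_ge_Re. Qed.

Lemma normr_Im z : `|Im z| <= normc z.
Proof.
case: z => x y /=; rewrite -sqrtr_sqr ler_wsqrtr// lerDr sqr_ge0//.
Qed.

Lemma complex_decomp z : z = (Re z)%:C + 'i * (Im z)%:C.
Proof. exact: complexE. Qed.

Lemma normc_le_ReIm z : normc z <= `|Re z| + `|Im z|.
Proof.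
rewrite {1}(complex_decomp z) (le_trans (ler_normcD _ _))//.
by rewrite normcM normc_i mul1r !normc_real.
Qed.

Lemma nbhs_normcP z A : nbhs z A <->
  exists2 e, 0 < e & forall w, normc (w - z) < e -> A w.
Proof.
split.
  move/nbhs_ballP => -[e /= e0 H].
  (* In the ordered field [R[i]] a positive element has zero imaginary part, so the radius is a real
     number. *)
  have [e1 ee] : exists e1, e = e1%:C.
    by exists (Re e); move: e0; rewrite ltcE /= => /andP[/eqP h _]; case: e h {H} => x y /= ->.
  rewrite ee in e0 H; exists e1; first by rewrite -ltcR.
  by move=> w wz; apply: H; rewrite -ball_normE /ball_ /= normcE ltcR normc_distC.
move=> [e e0 H]; apply/nbhs_ballP; exists e%:C; first by rewrite /= ltcR.
by move=> w; rewrite -ball_normE /ball_ /= normcE ltcR normc_distC; exact: H.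
Qed.

Definition cball a r : set C := [set z | normc (z - a) < r].
Definition cdisc a r : set C := [set z | normc (z - a) <= r].

Lemma cball_center a r : 0 < r -> cball a r a.
Proof. by move=> r0; rewrite /cball /= subrr normc0. Qed.

Lemma cball_cdisc a r : cball a r `<=` cdisc a r.
Proof. by move=> z /ltW. Qed.

Lemma nbhs_cball a r : 0 < r -> nbhs a (cball a r).
Proof. by move=> r0; apply/nbhs_normcP; exists r. Qed.

Lemma open_normcP A : open A <->
  forall z, A z -> exists2 e, 0 < e & cball z e `<=` A.
Proof.
rewrite openE /=; split => H z /H; first by move/nbhs_normcP.
by move=> [e e0 h]; apply/nbhs_normcP; exists e.
Qed.

Lemma open_cball a r : open (cball a r).
Proof.
apply/open_normcP => z /= az; exists (r - normc (z - a)); first by rewrite subr_gt0.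
move=> w /= wz; rewrite /cball /= (le_lt_trans (ler_distcD z _ _))//.
by move: wz; rewrite /cball/=; lra.
Qed.

Lemma continuous_normcP (f : C -> C) z : {for z, continuous f} <->
  forall e, 0 < e -> exists2 d, 0 < d &
    forall w, normc (w - z) < d -> normc (f w - f z) < e.
Proof.
split.
  by move=> cf e e0; move: (cf _ (nbhs_cball (f z) e0)) => /nbhs_normcP.
move=> H A /nbhs_normcP[e e0 eA]; have [d d0 h] := H e e0.
by apply/nbhs_normcP; exists d => // w /h /eA.
Qed.

Lemma continuous_normcRP (f : C -> R) z : {for z, continuous f} <->
  forall e, 0 < e -> exists2 d, 0 < d &
    forall w, normc (w - z) < d -> `|f w - f z| < e.
Proof.
split.
  move=> cf e e0; move: (cf _ (nbhsx_ballx (f z) e e0)) => /nbhs_normcP[d d0 h].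
  by exists d => // w /h; rewrite -ball_normE /ball_ /= distrC.
move=> H A /nbhs_ballP[e e0 eA]; have [d d0 h] := H e e0.
apply/nbhs_normcP; exists d => // w /h wf; apply: eA.
by rewrite -ball_normE /ball_ /= distrC.
Qed.

Lemma continuous_rcP (f : R -> C) x : {for x, continuous f} <->
  forall e, 0 < e -> exists2 d, 0 < d &
    forall y, `|y - x| < d -> normc (f y - f x) < e.
Proof.
split.
  move=> cf e e0; move: (cf _ (nbhs_cball (f x) e0)) => /nbhs_ballP[d d0 h].
  exists d => // y yx; apply: h.
  by rewrite -ball_normE /ball_ /= distrC.
move=> H A /nbhs_normcP[e e0 eA]; have [d d0 h] := H e e0.
apply/nbhs_ballP; exists d => // w; rewrite -ball_normE /ball_ /= distrC => /h.
exact: eA.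
Qed.

Lemma continuous_normc_sub a : continuous (fun z => normc (z - a)).
Proof.
move=> z; apply/continuous_normcRP => e e0; exists e => // w wz.
have h1 := ler_distcD w z a; have h2 := ler_distcD z w a.
rewrite (normc_distC z w) in h1.
by rewrite ltr_norml; apply/andP; split; lra.
Qed.

Lemma continuous_normc : continuous (fun z => normc z).
Proof.
move=> z; have := @continuous_normc_sub 0 z.
by under eq_fun do rewrite subr0.
Qed.

Lemma closed_cdisc a r : closed (cdisc a r).
Proof.
have -> : cdisc a r = (fun z => normc (z - a)) @^-1` [set x | x <= r] by [].
apply: closed_comp; last exact: closed_le.
by move=> z _; exact: continuous_normc_sub.
Qed.

Lemma continuous_Complex : continuous (fun p : R * R => p.1 +i* p.2 : C).
Proof.
move=> -[x y] /= A /nbhs_normcP[e e0 eA].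
have e2 : 0 < e / 2 by rewrite divr_gt0.
exists (ball x (e / 2), ball y (e / 2)); first by split; exact: nbhsx_ballx.
move=> [x' y'] /= []; rewrite -!ball_normE /ball_ /= => h1 h2; apply: eA.
rewrite (le_lt_trans (normc_le_ReIm _))//=.
by rewrite distrC (distrC y'); lra.
Qed.

Lemma bounded_closed_compact_c A r : closed A -> A `<=` cdisc 0 r -> compact A.
Proof.
move=> cA Ar; pose Q : set C := (fun p : R * R => p.1 +i* p.2) @` (`[-r, r] `*` `[-r, r]).
have cQ : compact Q.
  apply: continuous_compact; last by apply: compact_setX; exact: segment_compact.
  exact/continuous_subspaceT/continuous_Complex.
apply: (subclosed_compact cA cQ) => z /Ar; rewrite /cdisc /= subr0 => zr.
exists (Re z, Im z); last by case: z zr.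
have h1 := le_trans (normr_Re z) zr; have h2 := le_trans (normr_Im z) zr.
by split; rewrite /= in_itv /= -ler_norml.
Qed.

Lemma hausdorff_c : hausdorff_space C.
Proof. exact: norm_hausdorff. Qed.

Lemma compact_closed_c A : compact A -> closed A.
Proof. by move=> cA; apply: compact_closed => //; exact: hausdorff_c. Qed.

Lemma compact_bounded_c A : compact A -> exists2 r, 0 < r & A `<=` cdisc 0 r.
Proof.
move=> cA; have cf : {within A, continuous (fun z => normc z)}.
  exact/continuous_subspaceT/continuous_normc.
have [->|/set0P A0] := eqVneq A set0; first by exists 1 => // z [].
have [z _ H] := compact_EVT_max A0 cA cf.
exists (normc z + 1); first by rewrite ltr_wpDl// normc_ge0.
by move=> w /mem_set/H; rewrite /cdisc /= subr0; lra.
Qed.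
End Plane.

(** The truth set of [P] is relatively open and closed in [A]. In this form a connectedness argument
    reads as the propagation of a property from [a] to [b]; many of the arguments below are
    instances. *)
Lemma connected_locally_constant (T : topologicalType) (A : set T) (P : T -> Prop) :
  connected A -> (forall x, A x -> \forall y \near x, A y -> (P y <-> P x)) ->
  forall a b, A a -> A b -> P a -> P b.
Proof.
move=> cA loc a b Aa Ab Pa.
suff : A `&` [set x | P x] = A by move=> E; have : A b := Ab; rewrite -E => -[].
apply: cA; first by exists a.
  exists (interior [set y | A y -> P y]); first exact: open_interior.
  apply/seteqP; split => x [Ax]; last by move=> /interior_subset /(_ Ax).
  by move=> Px; split=> //; have := loc x Ax; apply: filterS => y H /H[_ h]; exact: h.
exists (~` interior [set y | A y -> ~ P y]); first exact/open_closedC/open_interior.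
apply/seteqP; split => x [Ax Px]; split => //.
  by move=> /interior_subset /(_ Ax).
apply: contrapT => nP; apply: Px.
by have := loc x Ax; apply: filterS => y H /H[h _] /h.
Qed.

Lemma image_connected (T U : topologicalType) (f : T -> U) (A : set T) : connected A ->
  (forall x, A x -> {for x, continuous f}) -> connected (f @` A).
Proof.
move=> cA cf; apply: connected_continuous_connected => //.
by apply: continuous_in_subspaceT => x /set_mem; exact: cf.
Qed.

Lemma connected_ivt (T : topologicalType) (R : realType) (A : set T) (f : T -> R) (v : R) :
  connected A -> (forall x, A x -> {for x, continuous f}) ->
  forall a b, A a -> A b -> f a < v -> v < f b -> exists2 c, A c & f c = v.
Proof.
move=> cA cf a b Aa Ab fa fb; apply: contrapT => no.
have : f b < v; last by apply/negP; rewrite -leNgt ltW.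
apply: (@connected_locally_constant T A (fun x => f x < v) cA _ a b) => // x Ax.
have [xv|xv|xv] := ltgtP (f x) v; last by exfalso; apply: no; exists x.
  have H : \forall y \near x, f y < v by exact: (cf x Ax _ (lt_nbhsl xv)).
  by near=> y => _; split => // _; near: y.
have H : \forall y \near x, v < f y by exact: (cf x Ax _ (lt_nbhsr xv)).
near=> y => _; split => //; rewrite ltNge => /negP[]; apply: ltW.
by near: y.
Unshelve. all: by end_near. Qed.

Section ConvexConnected.
Context {R : realType}.
Local Notation C := R[i].
Implicit Types (z w a b : C) (A : set C) (r : R).

Definition segc z w : set C := [set z + t%:C * (w - z) | t in `[0, 1]%classic].

Lemma continuous_line z w : continuous (fun t : R => z + t%:C * (w - z)).
Proof.
move=> t; apply/continuous_rcP => e e0; have d0 : 0 < normc (w - z) + 1.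
  by rewrite ltr_wpDl// normc_ge0.
exists (e / (normc (w - z) + 1)); first by rewrite divr_gt0.
move=> y; rewrite ltr_pdivlMr// => yt.
have -> : z + y%:C * (w - z) - (z + t%:C * (w - z)) = (y - t)%:C * (w - z).
  by rewrite rmorphB /=; ring.
by rewrite normcM normc_real; apply: le_lt_trans yt; rewrite ler_wpM2l// lerDl.
Qed.

Lemma segc_connected z w : connected (segc z w).
Proof.
apply: image_connected; first by apply/segment_connected.
by move=> t _; exact: continuous_line.
Qed.

Lemma segc_compact z w : compact (segc z w).
Proof.
apply: continuous_compact; last exact: segment_compact.
exact/continuous_subspaceT/continuous_line.
Qed.

Lemma segc_left z w : segc z w z.
Proof. by exists 0; rewrite /= ?in_itv /= ?lexx ?ler01// rmorph0 mul0r addr0. Qed.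

Lemma segc_right z w : segc z w w.
Proof. by exists 1; rewrite /= ?in_itv /= ?lexx ?ler01// rmorph1 mul1r addrC subrK. Qed.

Lemma starshaped_connected A z : A z -> (forall w, A w -> segc z w `<=` A) -> connected A.
Proof.
move=> Az H; have -> : A = \bigcup_(w in A) segc z w.
  apply/seteqP; split => [w Aw|w [v Av] /(H v Av)//].
  by exists w => //; exact: segc_right.
apply: bigcup_connected; first by exists z => w _; exact: segc_left.
by move=> w _; exact: segc_connected.
Qed.

Lemma segc_cdisc a r z w : cdisc a r z -> cdisc a r w -> segc z w `<=` cdisc a r.
Proof.
rewrite /cdisc /= => zr wr v [t]; rewrite /= in_itv /= => /andP[t0 t1] vE; rewrite -{v}vE.
have -> : z + t%:C * (w - z) - a = (1 - t)%:C * (z - a) + t%:C * (w - a).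
  by rewrite rmorphB /= rmorph1; ring.
apply: (le_trans (ler_normcD _ _)); rewrite !normcM !normc_real !ger0_norm ?subr_ge0//.
have h1 := ler_wpM2l t0 wr; have h2 : (1 - t) * normc (z - a) <= (1 - t) * r by rewrite ler_wpM2l ?subr_ge0.
by clear -h1 h2; lra.
Qed.

Lemma cdisc_connected a r : 0 <= r -> connected (cdisc a r).
Proof.
move=> r0; have aa : cdisc a r a by rewrite /cdisc /= subrr normc0.
by apply: (starshaped_connected aa) => w wr; exact: segc_cdisc.
Qed.

Lemma segc_cball a r z w : cball a r z -> cball a r w -> segc z w `<=` cball a r.
Proof.
rewrite /cball /= => zr wr.
have h : cdisc a (Num.max (normc (z - a)) (normc (w - a))) z by rewrite /cdisc /= le_max lexx.
have h' : cdisc a (Num.max (normc (z - a)) (normc (w - a))) w by rewrite /cdisc /= le_max lexx orbT.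
move=> v /(segc_cdisc h h'); rewrite /cdisc /= => /le_lt_trans; apply.
by rewrite gt_max zr wr.
Qed.

Lemma cball_connected a r : connected (cball a r).
Proof.
have [r0|r0] := ltP 0 r; last first.
  suff -> : cball a r = set0 by exact: connected0.
  by apply/seteqP; split => // z; rewrite /cball /= => /lt_le_trans/(_ r0); rewrite ltNge normc_ge0.
by apply: (starshaped_connected (cball_center a r0)) => w wr; apply: segc_cball => //; exact: cball_center.
Qed.

Lemma connected_setT_c : connected [set: C].
Proof. by apply: (@starshaped_connected _ 0). Qed.
End ConvexConnected.

(** * Cauchy's estimates and the maximum principle *)

Section Integral.
Context {R : realType}.
Local Notation C := R[i].
Local Notation Re := (@complex.Re R).
Local Notation Im := (@complex.Im R).

(* Real induction along [a, b]. *)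
Lemma subadditive_local_bound (D : R -> R -> R) (a b L : R) : a <= b ->
  (forall x y z, D x z <= D x y + D y z) ->
  (forall t, a <= t <= b -> exists2 d, 0 < d & forall s u, a <= s <= t ->
     t <= u <= b -> t - s < d -> u - t < d ->
     D s t <= L * (t - s) /\ D t u <= L * (u - t)) ->
  D a b <= L * (b - a).
Proof.
move=> ab tri loc; pose S := [set x | a <= x <= b /\ D a x <= L * (x - a)].
have Sa : S a.
  split; first by rewrite lexx.
  have [d d0 /(_ a a)] := loc a (ltac:(by rewrite lexx)).
  by rewrite lexx ab subrr => -[].
have hS : has_sup S by split; [exists a | exists b => x [/andP[]]].
set m := sup S.
have am : a <= m by apply: sup_upper_bound.
have mb : m <= b by apply: ge_sup; [exists a|move=> x [/andP[]]].
have [d d0 H] := loc m (ltac:(by rewrite am mb)).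
have Sm : S m.
  split; first by rewrite am mb.
  have [x Sx xm] := sup_adherent d0 hS.
  have xm' : x <= m by apply: sup_upper_bound.
  case: Sx => /andP[ax xb] Dx.
  have [h _] := H x m (ltac:(by rewrite ax xm')) (ltac:(by rewrite lexx mb))
    (ltac:(rewrite -/m in xm; lra)) (ltac:(by rewrite subrr)).
  by have := tri a x m; lra.
have [mb'|] := ltP m b; last first.
  move=> bm. have bE : b = m. by apply/eqP; rewrite eq_le bm mb.
  rewrite bE. by case: Sm.
pose u := Num.min b (m + d / 2).
have mu : m < u by rewrite lt_min mb' ltrDl divr_gt0.
have ub : u <= b by rewrite ge_min lexx.
have um : u <= m + d / 2 by rewrite ge_min lexx orbT.
have [_ h] := H m u (ltac:(by rewrite lexx am)) (ltac:(by rewrite ub ltW))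
    (ltac:(by rewrite subrr)) (ltac:(lra)).
have : u <= m; last by lra.
apply: sup_upper_bound => //; split; first by lra.
by have := tri a m u; case: Sm; lra.
Qed.

Definition has_rcderiv (F : R -> C) (x : R) (l : C) := forall e, 0 < e ->
  exists2 d, 0 < d & forall y, `|y - x| < d ->
    normc (F y - F x - l * (y - x)%:C) <= e * `|y - x|.

Lemma has_rcderivD F G x l k : has_rcderiv F x l -> has_rcderiv G x k ->
  has_rcderiv (fun t => F t + G t) x (l + k).
Proof.
move=> hF hG e e0; have e2 : 0 < e / 2 by rewrite divr_gt0.
have [d d0 h] := hF _ e2; have [d' d'0 h'] := hG _ e2.
exists (Num.min d d') => [|y]; first by rewrite lt_min d0.
rewrite lt_min => /andP[/h h1 /h' h2].
rewrite (_ : _ - _ - _ = (F y - F x - l * (y - x)%:C) + (G y - G x - k * (y - x)%:C)); last by ring.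
by rewrite (le_trans (ler_normcD _ _))//; lra.
Qed.

Lemma has_rcderivM F x l c : has_rcderiv F x l ->
  has_rcderiv (fun t => c * F t) x (c * l).
Proof.
move=> hF e e0; have c0 : 0 < normc c + 1 by rewrite ltr_wpDl// normc_ge0.
have [d d0 h] := hF (e / (normc c + 1)) (ltac:(by rewrite divr_gt0)).
exists d => // y /h hy.
rewrite (_ : _ - _ - _ = c * (F y - F x - l * (y - x)%:C)); last by ring.
rewrite normcM (le_trans (ler_wpM2l (normc_ge0 c) hy))//.
rewrite mulrA ler_wpM2r// mulrCA -[leRHS]mulr1 ler_wpM2l ?ltW//.
by rewrite ltr_pdivrMr// mul1r ltrDl.
Qed.

(** A mean value inequality without Rolle, since the values are complex: near each point the
    increments have slope at most [M] plus a small error, and they are subadditive. *)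
Lemma has_rcderiv_bound F (f : R -> C) (a b M : R) : a <= b ->
  (forall x, a <= x <= b -> has_rcderiv F x (f x)) ->
  (forall x, a <= x <= b -> normc (f x) <= M) ->
  normc (F b - F a) <= M * (b - a).
Proof.
move=> ab dF fM; apply/ler_addgt0Pr => e e0.
have e1 : 0 < e / (b - a + 1) by rewrite divr_gt0//; lra.
apply: (@le_trans _ _ ((M + e / (b - a + 1)) * (b - a))); last first.
  rewrite mulrDl lerD2l mulrAC ler_pdivrMr; last by lra.
  by rewrite ler_wpM2l ?ltW//; lra.
apply: (@subadditive_local_bound (fun x y => normc (F y - F x))) => //.
  by move=> x y z; rewrite [leRHS]addrC (ler_distcD (F y)).
move=> t abt; have [d d0 h] := dF t abt _ e1; have ft := fM t abt.
have key s : `|s - t| < d -> normc (F s - F t) <= (M + e / (b - a + 1)) * `|s - t|.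
  move=> /h hs; rewrite mulrDl.
  have -> : F s - F t = (F s - F t - f t * (s - t)%:C) + f t * (s - t)%:C by rewrite subrK.
  rewrite (le_trans (ler_normcD _ _))// addrC lerD//.
  by rewrite normcM normc_real ler_wpM2r.
exists d => // s u /andP[_ st] /andP[tu _] sd ud; split.
  by rewrite normc_distC (le_trans (key s _))// distrC ger0_norm ?subr_ge0.
by rewrite (le_trans (key u _))// ger0_norm ?subr_ge0.
Qed.

Lemma has_rcderiv_Im_ge F (f : R -> C) (a b m : R) : a <= b ->
  (forall x, a <= x <= b -> has_rcderiv F x (f x)) ->
  (forall x, a <= x <= b -> m <= Im (f x)) ->
  m * (b - a) <= Im (F b - F a).
Proof.
move=> ab dF fM; rewrite -subr_le0; apply/ler_addgt0Pr => e e0; rewrite add0r.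
have e1 : 0 < e / (b - a + 1) by rewrite divr_gt0//; lra.
apply: (@le_trans _ _ (e / (b - a + 1) * (b - a))); last first.
  by rewrite mulrAC ler_pdivrMr ?ler_wpM2l ?ltW//; lra.
apply: (@subadditive_local_bound (fun x y => m * (y - x) - Im (F y - F x))) => //.
  by move=> x y z; rewrite !raddfB /=; lra.
move=> t abt; have [d d0 h] := dF t abt _ e1; have ft := fM t abt.
have key s : `|s - t| < d ->
    `|Im (F s - F t) - Im (f t) * (s - t)| <= e / (b - a + 1) * `|s - t|.
  move=> /h hs; rewrite (le_trans _ hs)// (le_trans _ (normr_Im _))//.
  rewrite (raddfB Im (F s - F t)) /=.
  by case: (f t) => p q /=; rewrite mulr0 add0r.
exists d => // s u /andP[_ st] /andP[tu _] sd ud; split.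
  have := key s (ltac:(by rewrite distrC ger0_norm ?subr_ge0)).
  rewrite [`|s - t|]distrC (ger0_norm (x := t - s)) ?subr_ge0// ler_norml => /andP[h1 h2].
  have st' : 0 <= t - s by rewrite subr_ge0.
  have := ler_wpM2r st' ft.
  by move: h1 h2; rewrite !raddfB /=; lra.
have := key u (ltac:(by rewrite ger0_norm ?subr_ge0)).
rewrite (ger0_norm (x := u - t)) ?subr_ge0// ler_norml => /andP[h1 h2].
have tu' : 0 <= u - t by rewrite subr_ge0.
have := ler_wpM2r tu' ft.
by move: h1 h2; rewrite !raddfB /=; lra.
Qed.

Lemma real_antiderivative (f : R -> R) (a b : R) : a <= b -> continuous f ->
  exists F : R -> R, forall x, a <= x <= b -> is_derive x 1 F (f x).
Proof.
move=> ab cf.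
(* Integration starts at [a - 1], and the fundamental theorem is applied up to [b + 1], so that the
   derivative is two-sided at [a] and [b] too. *)
pose F x := (\int[@lebesgue_measure R]_(t in [set` `[a - 1, x]]) (f t))%R.
exists F => x /andP[ax xb].
have [] := @continuous_FTC1_closed R f (a - 1) x (b + 1) _ _ _ (cf x).
- by lra.
- apply: continuous_compact_integrable; first exact: segment_compact.
  exact/continuous_subspaceT.
- by lra.
by move=> dF <-; rewrite derive1E; exact: derivableP.
Qed.

Lemma is_derive_eps (F : R -> R) (x l : R) : is_derive x 1 F l ->
  forall e, 0 < e -> exists2 d, 0 < d & forall y, `|y - x| < d ->
    `|F y - F x - l * (y - x)| <= e * `|y - x|.
Proof.
move=> [dF Fl] e e0; rewrite /derive in Fl.
have : h^-1 *: ((F \o shift x) (h *: 1) - F x) @[h --> (0:R)^'] --> l.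
  by rewrite -Fl; exact: dF.
move/cvgrPdist_le => /(_ e e0) [d /= d0 H].
exists d => // y yx; have [->|yx0] := eqVneq y x; first by rewrite !subrr mulr0 subrr normr0 mulr0.
have := H (y - x); rewrite /= sub0r normrN subr_eq0 => /(_ yx yx0).
rewrite /shift /= [_%:A]mulr1 subrK -(ler_pM2r (x := `|y - x|)) ?normr_gt0 ?subr_eq0//.
apply: le_trans; rewrite -normrM mulrBl [leRHS]distrC.
suff -> : (y - x)^-1 *: (F y - F x) * (y - x) = F y - F x by [].
by rewrite [LHS]mulrAC mulVf ?subr_eq0// mul1r.
Qed.

Lemma rc_antiderivative (f : R -> C) (a b : R) : a <= b -> continuous f ->
  exists F : R -> C, forall x, a <= x <= b -> has_rcderiv F x (f x).
Proof.
move=> ab cf.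
have cR : continuous (fun x => Re (f x)).
  move=> x; apply/cvgrPdist_lt => e e0.
  have /continuous_rcP/(_ e e0)[d d0 h] := cf x.
  apply/nbhs_ballP; exists d => // y; rewrite /ball /= distrC => /h.
  by apply: le_lt_trans; rewrite distrC (le_trans _ (normr_Re _))// raddfB.
have cI : continuous (fun x => Im (f x)).
  move=> x; apply/cvgrPdist_lt => e e0.
  have /continuous_rcP/(_ e e0)[d d0 h] := cf x.
  apply/nbhs_ballP; exists d => // y; rewrite /ball /= distrC => /h.
  by apply: le_lt_trans; rewrite distrC (le_trans _ (normr_Im _))// raddfB.
have [F hF] := real_antiderivative ab cR; have [G hG] := real_antiderivative ab cI.
exists (fun x => F x +i* G x) => x xab e e0.
have e2 : 0 < e / 2 by rewrite divr_gt0.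
have [d d0 h] := is_derive_eps (hF x xab) e2.
have [d' d'0 h'] := is_derive_eps (hG x xab) e2.
exists (Num.min d d') => [|y]; first by rewrite lt_min d0.
rewrite lt_min => /andP[/h h1 /h' h2].
rewrite (le_trans (normc_le_ReIm _))//=; case: (f x) h1 h2 => p q /=.
rewrite !(mulr0, subr0, add0r, addr0).
by lra.
Qed.

(** The integral of [f] as the increment of an antiderivative, so that linearity and additivity are
    read off from derivatives. The choice made by [get] does not matter ([cintE]): the difference of
    two antiderivatives has derivative 0 and is constant. *)
Definition cint (f : R -> C) (a b : R) : C :=
  let F := get [set F : R -> C | forall x, a <= x <= b -> has_rcderiv F x (f x)] in
  F b - F a.

Implicit Types (f g : R -> C) (a b m M : R).

Lemma cintE f F a b : a <= b ->
  (forall x, a <= x <= b -> has_rcderiv F x (f x)) -> cint f a b = F b - F a.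
Proof.
move=> ab hF; rewrite /cint; set P := (X in get X).
have hG : P (get P) by apply: (@getPex _ P); exists F.
set G := get P in hG *.
have h x : a <= x <= b -> has_rcderiv (fun t => G t + -1 * F t) x (f x + -1 * f x).
  by move=> xab; apply: has_rcderivD; [exact: hG|apply: has_rcderivM; exact: hF].
have /= := has_rcderiv_bound ab h (M := 0) _.
rewrite mul0r => H; have {H} : normc (G b + -1 * F b - (G a + -1 * F a)) <= 0.
  by apply: H => x _; rewrite mulN1r subrr normc0.
rewrite le_eqVlt ltNge normc_ge0 orbF normc_eq0 => /eqP H.
by apply/eqP; rewrite -subr_eq0 -H; apply/eqP; ring.
Qed.

Lemma cint_bound f a b M : a <= b -> continuous f ->
  (forall x, a <= x <= b -> normc (f x) <= M) -> normc (cint f a b) <= M * (b - a).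
Proof.
move=> ab cf; have [F hF] := rc_antiderivative ab cf.
by rewrite (cintE ab hF); exact: has_rcderiv_bound.
Qed.

Lemma cint_Im_ge f a b m : a <= b -> continuous f ->
  (forall x, a <= x <= b -> m <= Im (f x)) -> m * (b - a) <= Im (cint f a b).
Proof.
move=> ab cf; have [F hF] := rc_antiderivative ab cf.
by rewrite (cintE ab hF); exact: has_rcderiv_Im_ge.
Qed.

Lemma cint_split f a c b : a <= c -> c <= b -> continuous f ->
  cint f a b = cint f a c + cint f c b.
Proof.
move=> ac cb cf; have ab := le_trans ac cb.
have [F hF] := rc_antiderivative ab cf.
rewrite !(cintE (F := F))//; first by ring.
  by move=> x /andP[h ?]; apply: hF; rewrite (le_trans ac h).
by move=> x /andP[? h]; apply: hF; rewrite (le_trans h cb) andbT.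
Qed.

Lemma cintD f g a b : a <= b -> continuous f -> continuous g ->
  cint (fun x => f x + g x) a b = cint f a b + cint g a b.
Proof.
move=> ab cf cg; have [F hF] := rc_antiderivative ab cf.
have [G hG] := rc_antiderivative ab cg.
rewrite (cintE ab hF) (cintE ab hG) (cintE (F := fun x => F x + G x))//; first by ring.
by move=> x xab; apply: has_rcderivD; [exact: hF|exact: hG].
Qed.

Lemma cintM (c : C) f a b : a <= b -> continuous f ->
  cint (fun x => c * f x) a b = c * cint f a b.
Proof.
move=> ab cf; have [F hF] := rc_antiderivative ab cf.
rewrite (cintE ab hF) (cintE (F := fun x => c * F x))//; first by ring.
by move=> x xab; apply: has_rcderivM; exact: hF.
Qed.

End Integral.

(** * Goursat's theorem on rectangles *)

Section Goursat.
Context {R : realType}.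
Local Notation C := R[i].
Local Notation Re := (@complex.Re R).
Local Notation Im := (@complex.Im R).

Lemma nested_intervals (a b : nat -> R) : (forall n, a n <= a n.+1) ->
  (forall n, b n.+1 <= b n) -> (forall n, a n <= b n) ->
  exists x, forall n, a n <= x <= b n.
Proof.
move=> ha hb ab.
have ma : {homo a : m n / (m <= n)%N >-> m <= n} by exact: (homo_leq lexx le_trans).
have mb m n : (m <= n)%N -> b n <= b m.
  elim: n => [|n IH]; first by rewrite leqn0 => /eqP->.
  by rewrite leq_eqVlt => /predU1P[->//|/IH]; exact: le_trans.
have ub m n : a m <= b n.
  have [/ma h|/ltnW/mb h] := leqP m n; first exact: le_trans (ab n).
  by rewrite (le_trans (ab m)).
exists (sup [set a n | n in setT]) => n; apply/andP; split.
  apply: sup_upper_bound; last by exists n.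
  by split; [exists (a n); exists n | exists (b 0%N) => _ [m _ <-]].
by apply: ge_sup; [exists (a n); exists n|move=> _ [m _ <-]].
Qed.

(** Were the property false, repeated halving would give rectangles on which it fails, shrinking to
    a point; there the local hypothesis contradicts the failure. *)
Lemma bisection (P : R -> R -> R -> R -> Prop) x0 x1 y0 y1 : x0 <= x1 -> y0 <= y1 ->
  (forall a b c d, a <= b -> c <= d ->
    P a ((a + b) / 2) c ((c + d) / 2) -> P ((a + b) / 2) b c ((c + d) / 2) ->
    P a ((a + b) / 2) ((c + d) / 2) d -> P ((a + b) / 2) b ((c + d) / 2) d ->
    P a b c d) ->
  (forall x y, x0 <= x <= x1 -> y0 <= y <= y1 -> exists2 e, 0 < e &
    forall a b c d, x0 <= a <= x -> x <= b <= x1 -> y0 <= c <= y -> y <= d <= y1 ->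
      b - a < e -> d - c < e -> P a b c d) ->
  P x0 x1 y0 y1.
Proof.
move=> x01 y01 half loc; apply: contrapT => nP.
pose bad (q : R * R * R * R) := let: (a, b, c, d) := q in
  [/\ a <= b, c <= d & ~ P a b c d].
pose sub (q q' : R * R * R * R) := let: (a, b, c, d) := q in
  let: (a', b', c', d') := q' in
  [/\ a <= a', b' <= b, c <= c', d' <= d & b' - a' = (b - a) / 2 /\ d' - c' = (d - c) / 2].
have [F hF] : exists F, forall q, bad q -> bad (F q) /\ sub q (F q).
  suff /choice[F hF] : forall q, exists q', bad q -> bad q' /\ sub q q' by exists F.
  move=> [[[a b] c] d]; have [|nb] := pselect (bad (a, b, c, d)); last by exists (a, b, c, d).
  move=> /= [ab cd nPq]; have e1 : a <= (a + b) / 2 by lra.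
  have e2 : (a + b) / 2 <= b by lra.
  have e3 : c <= (c + d) / 2 by lra.
  have e4 : (c + d) / 2 <= d by lra.
  have [h1|h1] := pselect (P a ((a + b) / 2) c ((c + d) / 2)); last first.
    exists (a, (a + b) / 2, c, (c + d) / 2) => _ /=; split; first by split.
    by split => //; split; field.
  have [h2|h2] := pselect (P ((a + b) / 2) b c ((c + d) / 2)); last first.
    exists ((a + b) / 2, b, c, (c + d) / 2) => _ /=; split; first by split.
    by split => //; split; field.
  have [h3|h3] := pselect (P a ((a + b) / 2) ((c + d) / 2) d); last first.
    exists (a, (a + b) / 2, (c + d) / 2, d) => _ /=; split; first by split.
    by split => //; split; field.
  have [h4|h4] := pselect (P ((a + b) / 2) b ((c + d) / 2) d); last first.
    exists ((a + b) / 2, b, (c + d) / 2, d) => _ /=; split; first by split.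
    by split => //; split; field.
  by exfalso; apply: nPq; apply: half.
pose q n := iter n F (x0, x1, y0, y1).
have bq n : bad (q n) by elim: n => [|n /hF[]]; rewrite ?/q //=.
have sq n : sub (q n) (q n.+1) by have [] := hF _ (bq n).
pose a n := (q n).1.1.1; pose b n := (q n).1.1.2; pose c n := (q n).1.2; pose d n := (q n).2.
have qE n : q n = (a n, b n, c n, d n) by rewrite /a /b /c /d; case: (q n) => [[[? ?] ?] ?].
have [x hx] : exists x, forall n, a n <= x <= b n.
  apply: nested_intervals => n; [have := sq n|have := sq n|have := bq n].
  - by rewrite !qE => -[].
  - by rewrite !qE => -[].
  - by rewrite !qE => -[].
have [y hy] : exists y, forall n, c n <= y <= d n.
  apply: nested_intervals => n; [have := sq n|have := sq n|have := bq n].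
  - by rewrite !qE => -[].
  - by rewrite !qE => -[].
  - by rewrite !qE => -[].
have len n : b n - a n = (x1 - x0) / 2 ^+ n /\ d n - c n = (y1 - y0) / 2 ^+ n.
  elim: n => [|n [h1 h2]]; first by rewrite expr0 !divr1.
  have := sq n; rewrite !qE => -[_ _ _ _ [-> ->]]; rewrite h1 h2 exprS.
  have p2 : 2 ^+ n != 0 :> R by rewrite expf_neq0.
  by split; field; rewrite p2.
have nest n : [/\ x0 <= a n, b n <= x1, y0 <= c n & d n <= y1].
  elim: n => [|n [h1 h2 h3 h4]]; first by split.
  have := sq n; rewrite !qE => -[k1 k2 k3 k4 _].
  by split; [apply: le_trans k1|apply: (le_trans k2)|apply: le_trans k3|apply: (le_trans k4)].
have [e e0 he] := loc x y (hx 0%N) (hy 0%N).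
have [n [n1 n2]] : exists n, (x1 - x0) / 2 ^+ n < e /\ (y1 - y0) / 2 ^+ n < e.
  have hn := archi_boundP (_ : 0 <= (x1 - x0 + y1 - y0) / e).
  set n := Num.bound _ in hn; exists n.
  have {}hn : x1 - x0 + y1 - y0 < e * 2 ^+ n.
    rewrite mulrC -ltr_pdivrMr// (lt_trans (hn _))//; first by rewrite divr_ge0 ?(ltW e0)//; lra.
    by rewrite -natrX ltr_nat ltn_expl.
  by split; rewrite ltr_pdivrMr ?exprn_gt0//; lra.
have := bq n; rewrite qE => -[_ _]; apply.
have [h1 h2 h3 h4] := nest n; have [l1 l2] := len n.
have /andP[h5 h6] := hx n; have /andP[h7 h8] := hy n.
by apply: he; rewrite ?l1 ?l2 ?h1 ?h2 ?h3 ?h4 ?h5 ?h6 ?h7 ?h8.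
Qed.

Definition has_cderiv (f : C -> C) (z l : C) := forall e, 0 < e ->
  exists2 d, 0 < d & forall w, normc (w - z) < d ->
    normc (f w - f z - l * (w - z)) <= e * normc (w - z).

Definition cdiff f z := exists l, has_cderiv f z l.

(** The counterclockwise contour integral along the boundary of [[a, b] x [c, d]]; the factor ['i]
    is the derivative of [x +i* y] in [y]. *)
Definition rectint (f : C -> C) (a b c d : R) : C :=
  cint (fun x => f (x +i* c)) a b + 'i * cint (fun y => f (b +i* y)) c d
  - cint (fun x => f (x +i* d)) a b - 'i * cint (fun y => f (a +i* y)) c d.

Lemma continuous_hline (f : C -> C) y : continuous f -> continuous (fun x : R => f (x +i* y)).
Proof.
move=> cf x; apply/continuous_rcP => e e0.
have /continuous_normcP/(_ e e0)[d d0 h] := cf (x +i* y).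
exists d => // t xt; apply: h; rewrite (le_lt_trans (normc_le_ReIm _))//=.
by rewrite subrr normr0 addr0.
Qed.

Lemma continuous_vline (f : C -> C) x : continuous f -> continuous (fun y : R => f (x +i* y)).
Proof.
move=> cf y; apply/continuous_rcP => e e0.
have /continuous_normcP/(_ e e0)[d d0 h] := cf (x +i* y).
exists d => // t xt; apply: h; rewrite (le_lt_trans (normc_le_ReIm _))//=.
by rewrite subrr normr0 add0r.
Qed.

Lemma rectint_split_x f a m b c d : a <= m -> m <= b -> c <= d -> continuous f ->
  rectint f a b c d = rectint f a m c d + rectint f m b c d.
Proof.
move=> am mb cd cf; rewrite /rectint (cint_split am mb (continuous_hline (y:=c) cf)).
by rewrite (cint_split am mb (continuous_hline (y:=d) cf)); ring.
Qed.

Lemma rectint_split_y f a b c m d : a <= b -> c <= m -> m <= d -> continuous f ->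
  rectint f a b c d = rectint f a b c m + rectint f a b m d.
Proof.
move=> am mb cd cf; rewrite /rectint (cint_split mb cd (continuous_vline (x:=b) cf)).
by rewrite (cint_split mb cd (continuous_vline (x:=a) cf)); ring.
Qed.

Lemma rectintD f g a b c d : a <= b -> c <= d -> continuous f -> continuous g ->
  rectint (fun z => f z + g z) a b c d = rectint f a b c d + rectint g a b c d.
Proof.
move=> ab cd cf cg; rewrite /rectint.
rewrite (cintD ab (continuous_hline (y:=c) cf) (continuous_hline (y:=c) cg)).
rewrite (cintD ab (continuous_hline (y:=d) cf) (continuous_hline (y:=d) cg)).
rewrite (cintD cd (continuous_vline (x:=b) cf) (continuous_vline (x:=b) cg)).
by rewrite (cintD cd (continuous_vline (x:=a) cf) (continuous_vline (x:=a) cg)); ring.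
Qed.

Lemma rectintM (k : C) f a b c d : a <= b -> c <= d -> continuous f ->
  rectint (fun z => k * f z) a b c d = k * rectint f a b c d.
Proof.
move=> ab cd cf; rewrite /rectint.
rewrite (cintM k ab (continuous_hline (y:=c) cf)) (cintM k ab (continuous_hline (y:=d) cf)).
by rewrite (cintM k cd (continuous_vline (x:=b) cf)) (cintM k cd (continuous_vline (x:=a) cf)); ring.
Qed.

Lemma rectint_bound f a b c d M : a <= b -> c <= d -> continuous f ->
  (forall x, a <= x <= b -> normc (f (x +i* c)) <= M) ->
  (forall x, a <= x <= b -> normc (f (x +i* d)) <= M) ->
  (forall y, c <= y <= d -> normc (f (a +i* y)) <= M) ->
  (forall y, c <= y <= d -> normc (f (b +i* y)) <= M) ->
  normc (rectint f a b c d) <= 2 * M * ((b - a) + (d - c)).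
Proof.
move=> ab cd cf h1 h2 h3 h4; rewrite /rectint.
have k1 := cint_bound ab (continuous_hline (y:=c) cf) h1.
have k2 := cint_bound ab (continuous_hline (y:=d) cf) h2.
have k3 := cint_bound cd (continuous_vline (x:=a) cf) h3.
have k4 := cint_bound cd (continuous_vline (x:=b) cf) h4.
rewrite (le_trans (ler_normcB _ _))// normcM normc_i mul1r.
apply: (@le_trans _ _ (M * (b - a) + M * (d - c) + M * (b - a) + M * (d - c))); last by lra.
rewrite lerD// (le_trans (ler_normcB _ _))// lerD// (le_trans (ler_normcD _ _))//.
by rewrite normcM normc_i mul1r lerD.
Qed.

Lemma rectint_cst (k : C) a b c d : a <= b -> c <= d -> rectint (fun=> k) a b c d = 0.
Proof.
move=> ab cd; rewrite /rectint.
have h x : has_rcderiv (fun t => k * t%:C) x k.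
  move=> e e0; exists 1 => // y _; have -> : k * y%:C - k * x%:C - k * (y - x)%:C = 0 by ring.
  by rewrite normc0 mulr_ge0// ltW.
by rewrite !(cintE (F := fun t => k * t%:C))//; ring.
Qed.

Lemma has_rcderiv_sqr (p q : C) x : has_rcderiv (fun t => (p + q * t%:C) ^+ 2) x (2 * q * (p + q * x%:C)).
Proof.
move=> e e0; have q0 : 0 < normc q ^+ 2 + 1 by rewrite ltr_wpDl ?sqr_ge0.
exists (e / (normc q ^+ 2 + 1)); first by rewrite divr_gt0.
move=> y yx; have -> : (p + q * y%:C) ^+ 2 - (p + q * x%:C) ^+ 2 - 2 * q * (p + q * x%:C) * (y - x)%:C
  = q ^+ 2 * (y - x)%:C ^+ 2 by ring.
rewrite normcM !normcX normc_real expr2 [in leLHS]expr2 mulrA ler_wpM2r//.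
apply: ltW; apply: (@le_lt_trans _ _ ((normc q ^+ 2 + 1) * `|y - x|)).
  by rewrite ler_wpM2r// expr2 lerDl.
by rewrite mulrC -ltr_pdivlMr.
Qed.

Lemma rectint_id a b c d : a <= b -> c <= d -> rectint (fun z => z) a b c d = 0.
Proof.
move=> ab cd; rewrite /rectint.
have two : (2 : C) != 0 by rewrite pnatr_eq0.
have hh (y x : R) : @has_rcderiv R (fun t => 2^-1 * ('i * y%:C + 1 * t%:C) ^+ 2) x (x +i* y).
  have := has_rcderivM 2^-1 (has_rcderiv_sqr ('i * y%:C) 1 x); congr has_rcderiv.
  by rewrite !mulrA mulVf// !mul1r addrC [RHS]complexE.
have hv (y x : R) : @has_rcderiv R (fun t => (2 * 'i)^-1 * (x%:C + 'i * t%:C) ^+ 2) y (x +i* y).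
  have i0 : ('i : C) != 0 by rewrite -normc_eq0 normc_i oner_eq0.
  have := has_rcderivM (2 * 'i)^-1 (has_rcderiv_sqr x%:C 'i y); congr has_rcderiv.
  by rewrite mulrA mulVf ?mulf_neq0// !mul1r [RHS]complexE.
rewrite (cintE ab (F := fun t => 2^-1 * ('i * c%:C + 1 * t%:C) ^+ 2))//.
rewrite (cintE ab (F := fun t => 2^-1 * ('i * d%:C + 1 * t%:C) ^+ 2))//.
rewrite (cintE cd (F := fun t => (2 * 'i)^-1 * (b%:C + 'i * t%:C) ^+ 2))//.
rewrite (cintE cd (F := fun t => (2 * 'i)^-1 * (a%:C + 'i * t%:C) ^+ 2))//.
have i0 : ('i : C) != 0 by rewrite -normc_eq0 normc_i oner_eq0.
by field.
Qed.

Lemma continuous_id_c : continuous (fun z : C => z).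
Proof. by move=> z. Qed.

Lemma continuous_affine (p q r : C) : continuous (fun z : C => p + q * (z - r)).
Proof.
move=> z; apply/continuous_normcP => e e0.
have q0 : 0 < normc q + 1 by rewrite ltr_wpDl ?normc_ge0.
exists (e / (normc q + 1)); first by rewrite divr_gt0.
move=> w wz; rewrite (_ : _ - _ = q * (w - z)); last by ring.
rewrite normcM (@le_lt_trans _ _ ((normc q + 1) * normc (w - z)))//.
  by rewrite ler_wpM2r ?normc_ge0// lerDl.
by rewrite mulrC -ltr_pdivlMr.
Qed.

Lemma rectint_affine (p q r : C) a b c d : a <= b -> c <= d ->
  rectint (fun z => p + q * (z - r)) a b c d = 0.
Proof.
move=> ab cd.
have -> : (fun z : C => p + q * (z - r)) = (fun z : C => (p - q * r) + q * z).
  by apply/funext => z; ring.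
have eqc (f g : C -> C) : (forall z, f z = g z) -> continuous g -> continuous f.
  by move=> /funext ->.
have c1 : continuous (fun _ : C => p - q * r : C).
  by apply: (eqc _ (fun z : C => (p - q * r) + 0 * (z - 0))); [move=> z; ring|exact: continuous_affine].
have c2 : continuous (fun z : C => q * z).
  by apply: (eqc _ (fun z : C => 0 + q * (z - 0))); [move=> z; ring|exact: continuous_affine].
rewrite (rectintD ab cd c1 c2) (rectintM q ab cd continuous_id_c).
by rewrite rectint_cst// rectint_id// mulr0 addr0.
Qed.

Lemma normc_rect_bound a b c d x y x' y' : a <= x <= b -> a <= x' <= b ->
  c <= y <= d -> c <= y' <= d ->
  normc (x +i* y - (x' +i* y') : C) <= (b - a) + (d - c).
Proof.
move=> /andP[? ?] /andP[? ?] /andP[? ?] /andP[? ?].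
rewrite (le_trans (normc_le_ReIm _))//= lerD// ler_norml; apply/andP; split; lra.
Qed.

(** Quartering a rectangle halves its half-perimeter, so the bound [k * S ^+ 2] is exactly
    reproduced by summing over the four quarters. On a small rectangle around a point, [f] differs
    from its affine approximation there by at most [k / 2 * S], and the affine part has integral
    0. *)
Lemma goursat f a b c d : a <= b -> c <= d -> continuous f ->
  (forall x y, a <= x <= b -> c <= y <= d -> cdiff f (x +i* y)) ->
  rectint f a b c d = 0.
Proof.
move=> ab cd cf df; apply/eqP; rewrite -normc_eq0 eq_le normc_ge0 andbT.
apply/ler_addgt0Pr => e e0; rewrite add0r.
pose S := (b - a) + (d - c); have S0 : 0 <= S by rewrite /S; lra.
pose k := e / (S ^+ 2 + 1).
have S1 : 0 < S ^+ 2 + 1 by rewrite ltr_wpDl ?sqr_ge0.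
have k0 : 0 < k by rewrite divr_gt0.
suff : normc (rectint f a b c d) <= k * S ^+ 2.
  move/le_trans; apply; rewrite /k mulrAC ler_pdivrMr// ler_wpM2l ?ltW//; lra.
apply: (@bisection (fun a b c d => normc (rectint f a b c d) <= k * ((b - a) + (d - c)) ^+ 2)) => //.
  move=> p q r s pq rs.
  set m := (p + q) / 2; set n := (r + s) / 2 => h1 h2 h3 h4.
  have [pm mq rn ns] : [/\ p <= m, m <= q, r <= n & n <= s] by rewrite /m /n; split; lra.
  rewrite (rectint_split_x pm mq rs cf) !(rectint_split_y _ rn ns)//.
  apply: (le_trans (ler_normcD _ _)).
  have := lerD (ler_normcD (rectint f p m r n) (rectint f p m n s))
    (ler_normcD (rectint f m q r n) (rectint f m q n s)).
  move/le_trans; apply.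
  apply: le_trans (lerD (lerD h1 h3) (lerD h2 h4)) _.
  by rewrite le_eqVlt; apply/orP; left; apply/eqP; rewrite /m /n; field.
move=> x y hx hy; have [l hl] := df x y hx hy.
have [dl dl0 H] := hl (k / 2) (ltac:(by rewrite divr_gt0)).
exists (dl / 2) => [|p q r s /andP[ap px] /andP[xq qb] /andP[cr ry] /andP[ys sd] pq rs]; first by rewrite divr_gt0.
have [pq' rs'] : p <= q /\ r <= s by split; lra.
set z := x +i* y in H.
pose g w := f w + -1 * (f z + l * (w - z)).
have cg0 : continuous (fun w => -1 * (f z + l * (w - z))).
  have -> : (fun w => -1 * (f z + l * (w - z))) = (fun w => - f z + (- l) * (w - z)).
    by apply/funext => w; ring.
  exact: continuous_affine.
have -> : rectint f p q r s = rectint g p q r s.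
  have ca : continuous (fun w => f z + l * (w - z)) by exact: continuous_affine.
  rewrite /g (rectintD pq' rs' cf cg0) (rectintM (-1) pq' rs' ca).
  by rewrite rectint_affine// mulr0 addr0.
have cg : continuous g by move=> w; exact: (continuousD (cf w) (cg0 w)).
have -> : k * ((q - p) + (s - r)) ^+ 2 = 2 * (k / 2 * ((q - p) + (s - r))) * ((q - p) + (s - r)) by field.
have key x' y' : p <= x' <= q -> r <= y' <= s -> normc (g (x' +i* y')) <= k / 2 * ((q - p) + (s - r)).
  move=> hx' hy'; have nb : normc (x' +i* y' - z) <= (q - p) + (s - r).
    by apply: normc_rect_bound => //; apply/andP.
  rewrite /g mulN1r opprD addrA (le_trans (H _ _))//; first by lra.
  by rewrite ler_wpM2l// divr_ge0 ?ltW.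
by apply: rectint_bound => // t ht; apply: key; rewrite ?ht// lexx ?pq' ?rs'.
Qed.
End Goursat.

(** * Rules for complex derivatives *)

Section ComplexDerivative.
Context {R : realType}.
Local Notation C := R[i].
Implicit Types (f g : C -> C) (z w a b l k : C).

Lemma has_cderiv_lip f z l : has_cderiv f z l -> exists2 d, 0 < d &
  forall w, normc (w - z) < d -> normc (f w - f z) <= (normc l + 1) * normc (w - z).
Proof.
move=> /(_ 1 ltr01)[d d0 h]; exists d => // w /h; rewrite mul1r => hw.
have -> : f w - f z = l * (w - z) + (f w - f z - l * (w - z)) by ring.
by rewrite (le_trans (ler_normcD _ _))// mulrDl mul1r normcM lerD.
Qed.

Lemma has_cderiv_continuous f z l : has_cderiv f z l -> {for z, continuous f}.
Proof.
move=> /has_cderiv_lip[d d0 h]; apply/continuous_normcP => e e0.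
have l0 : 0 < normc l + 1 by rewrite ltr_wpDl// normc_ge0.
exists (Num.min d (e / (normc l + 1))) => [|w]; first by rewrite lt_min d0 divr_gt0.
rewrite lt_min => /andP[/h hw]; rewrite ltr_pdivlMr// mulrC.
exact: le_lt_trans.
Qed.

Lemma cdiff_continuous f z : cdiff f z -> {for z, continuous f}.
Proof. by move=> [l /has_cderiv_continuous]. Qed.

Lemma has_cderiv_local f g z l d : 0 < d ->
  (forall w, normc (w - z) < d -> f w = g w) -> has_cderiv f z l -> has_cderiv g z l.
Proof.
move=> d0 fg hf e e0; have [d' d'0 h] := hf e e0.
exists (Num.min d d') => [|w]; first by rewrite lt_min d0.
rewrite lt_min => /andP[h1 h2]; rewrite -!fg ?h//.
by rewrite subrr normc0.
Qed.

Lemma eq_has_cderiv f g z l : (forall w, f w = g w) -> has_cderiv f z l -> has_cderiv g z l.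
Proof. by move=> fg; apply: (has_cderiv_local ltr01) => w _. Qed.

Lemma has_cderiv_cst k z : has_cderiv (fun=> k) z 0.
Proof.
move=> e e0; exists 1 => // w _.
by rewrite subrr mul0r subrr normc0 mulr_ge0 ?normc_ge0// ltW.
Qed.

Lemma has_cderiv_id z : has_cderiv (fun w => w) z 1.
Proof.
move=> e e0; exists 1 => // w _.
by rewrite mul1r subrr normc0 mulr_ge0 ?normc_ge0// ltW.
Qed.

Lemma has_cderivD f g z l k : has_cderiv f z l -> has_cderiv g z k ->
  has_cderiv (fun w => f w + g w) z (l + k).
Proof.
move=> hF hG e e0; have e2 : 0 < e / 2 by rewrite divr_gt0.
have [d d0 h] := hF _ e2; have [d' d'0 h'] := hG _ e2.
exists (Num.min d d') => [|y]; first by rewrite lt_min d0.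
rewrite lt_min => /andP[/h h1 /h' h2].
have -> : f y + g y - (f z + g z) - (l + k) * (y - z) =
  (f y - f z - l * (y - z)) + (g y - g z - k * (y - z)) by ring.
by rewrite (le_trans (ler_normcD _ _))//; lra.
Qed.

(* [g (f w) - g (f z) - k l (w - z)] splits into the error of [g] at [f z] and
   [k] times the error of [f] at [z]. *)
Lemma has_cderiv_comp f g z l k : has_cderiv f z l -> has_cderiv g (f z) k ->
  has_cderiv (fun w => g (f w)) z (k * l).
Proof.
move=> hf hg e e0.
have [d1 d10 h1] := has_cderiv_lip hf.
have l0 : 0 < normc l + 1 by rewrite ltr_wpDl// normc_ge0.
have k0 : 0 < normc k + 1 by rewrite ltr_wpDl// normc_ge0.
have e2 : 0 < e / 2 by rewrite divr_gt0.
have [d2 d20 h2] := hg _ (divr_gt0 e2 l0).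
have [d3 d30 h3] := hf _ (divr_gt0 e2 k0).
exists (Num.min d1 (Num.min d3 (d2 / (normc l + 1)))) => [|w].
  by rewrite !lt_min d10 d30 divr_gt0.
rewrite !lt_min => /and3P[/h1 w1 /h3 w3]; rewrite ltr_pdivlMr// mulrC => w2.
have {}h2 := h2 _ (le_lt_trans w1 w2).
have -> : g (f w) - g (f z) - k * l * (w - z) =
  (g (f w) - g (f z) - k * (f w - f z)) + k * (f w - f z - l * (w - z)) by ring.
rewrite (le_trans (ler_normcD _ _))// normcM [leRHS](_ : _ = e / 2 * normc (w - z) + e / 2 * normc (w - z)); last by field.
apply: lerD.
  apply: (le_trans h2); apply: (le_trans (ler_wpM2l (ltW (divr_gt0 e2 l0)) w1)).
  by rewrite mulrA divfK ?gt_eqF.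
rewrite (le_trans (ler_wpM2l (normc_ge0 k) w3))//.
rewrite mulrA ler_wpM2r ?normc_ge0// mulrCA -[leRHS]mulr1 ler_wpM2l ?ltW//.
by rewrite ltr_pdivrMr// mul1r ltrDl.
Qed.

Lemma has_cderivZ k f z l : has_cderiv f z l -> has_cderiv (fun w => k * f w) z (k * l).
Proof.
move=> hf; apply: (@has_cderiv_comp f (fun w => k * w)) => // e e0.
exists 1 => // w _; have -> : k * w - k * f z - k * (w - f z) = 0 by ring.
by rewrite normc0 mulr_ge0 ?normc_ge0// ltW.
Qed.

Lemma has_cderiv_sqr z : has_cderiv (fun w => w ^+ 2) z (2 * z).
Proof.
move=> e e0; exists e => // w wz.
have -> : w ^+ 2 - z ^+ 2 - 2 * z * (w - z) = (w - z) * (w - z) by ring.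
by rewrite normcM ler_wpM2r ?normc_ge0// ltW.
Qed.

Lemma has_cderivM f g z l k : has_cderiv f z l -> has_cderiv g z k ->
  has_cderiv (fun w => f w * g w) z (l * g z + f z * k).
Proof.
move=> hf hg; have four : (4 : C) != 0 by rewrite pnatr_eq0.
have H u v (p q : C) : has_cderiv u z p -> has_cderiv v z q ->
    has_cderiv (fun w => (u w + v w) ^+ 2) z (2 * (u z + v z) * (p + q)).
  by move=> hu hv; exact: (has_cderiv_comp (has_cderivD hu hv) (has_cderiv_sqr _)).
have h1 := H _ _ _ _ hf hg; have h2 := H _ _ _ _ hf (has_cderivZ (-1) hg).
have h3 := has_cderivZ 4^-1 (has_cderivD h1 (has_cderivZ (-1) h2)).
have E : l * g z + f z * k =
  4^-1 * (2 * (f z + g z) * (l + k) + -1 * (2 * (f z + -1 * g z) * (l + -1 * k))) by field.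
by rewrite E; apply: eq_has_cderiv h3 => w; field.
Qed.

Lemma has_cderivV0 z : z != 0 -> has_cderiv (fun w => w^-1) z (- z ^- 2).
Proof.
move=> z0 e e0; have nz : 0 < normc z by rewrite normc_gt0.
exists (Num.min (normc z / 2) (e * normc z ^+ 3 / 2)) => [|w].
  by rewrite lt_min !divr_gt0// mulr_gt0// exprn_gt0.
rewrite lt_min => /andP[h1 h2].
have hw : normc z / 2 <= normc w.
  by have := lerB_normc z w; rewrite normc_distC; lra.
have w0 : w != 0 by rewrite -normc_gt0; lra.
have -> : w^-1 - z^-1 - (- z ^- 2) * (w - z) = (w - z) * ((w - z) / (z ^+ 2 * w)).
  by field; rewrite z0 w0.
rewrite normcM mulrC ler_wpM2r ?normc_ge0// normcM normcV normcM normcX.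
rewrite ler_pdivrMr; last by rewrite mulr_gt0 ?exprn_gt0 ?normc_gt0.
apply: (le_trans (ltW h2)).
rewrite -mulrA ler_wpM2l ?(ltW e0)// exprSr -mulrA ler_wpM2l// sqr_ge0//.
Qed.

Lemma has_cderivV f z l : f z != 0 -> has_cderiv f z l ->
  has_cderiv (fun w => (f w)^-1) z (- (f z) ^- 2 * l).
Proof. by move=> fz0 hf; exact: (has_cderiv_comp hf (has_cderivV0 fz0)). Qed.

Lemma has_cderivX f z l n : has_cderiv f z l ->
  has_cderiv (fun w => f w ^+ n.+1) z (n.+1%:R * f z ^+ n * l).
Proof.
move=> hf; elim: n => [|n IH].
  by rewrite expr0 !mul1r; apply: eq_has_cderiv hf => w; rewrite expr1.
have := has_cderivM hf IH; have -> : l * f z ^+ n.+1 + f z * (n.+1%:R * f z ^+ n * l) =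
  n.+2%:R * f z ^+ n.+1 * l by rewrite exprS -[n.+2]addn1 natrD; ring.
by apply: eq_has_cderiv => w; rewrite [RHS]exprS.
Qed.

Lemma has_cderiv_horner (p : {poly C}) z : has_cderiv (fun w => p.[w]) z (p^`()).[z].
Proof.
elim/poly_ind: p => [|p c IH].
  rewrite deriv0 horner0; have := has_cderiv_cst 0 z.
  by apply: eq_has_cderiv => w; rewrite horner0.
rewrite derivD derivC addr0 derivM derivX mulr1 hornerD hornerMX.
have := has_cderivD (has_cderivM IH (has_cderiv_id z)) (has_cderiv_cst c z).
rewrite addr0 mulr1.
by apply: eq_has_cderiv => w; rewrite hornerD hornerMX hornerC.
Qed.

Lemma has_cderiv_unique f z l k : has_cderiv f z l -> has_cderiv f z k -> l = k.
Proof.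
move=> hl hk; apply/eqP; rewrite -subr_eq0 -normc_eq0 eq_le normc_ge0 andbT.
apply/ler_addgt0Pr => e e0; rewrite add0r.
have e2 : 0 < e / 2 by rewrite divr_gt0.
have [d d0 h] := hl _ e2; have [d' d'0 h'] := hk _ e2.
pose t := Num.min d d' / 2; have m0 : 0 < Num.min d d' by rewrite lt_min d0.
have t0 : 0 < t by rewrite divr_gt0.
have nt : normc (z + t%:C - z) = t by rewrite addrAC subrr add0r normc_real gtr0_norm.
have td : t < Num.min d d' by rewrite /t; lra.
move: td; rewrite lt_min => /andP[td td'].
have := h (z + t%:C); have := h' (z + t%:C); rewrite nt => /(_ td') H1 /(_ td) H2.
rewrite -(ler_pM2r t0) -{1}nt -normcM.
have -> : (l - k) * (z + t%:C - z) = (f (z + t%:C) - f z - k * (z + t%:C - z))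
  - (f (z + t%:C) - f z - l * (z + t%:C - z)) by ring.
by rewrite (le_trans (ler_normcB _ _))//; lra.
Qed.

Lemma cdiffD f g z : cdiff f z -> cdiff g z -> cdiff (fun w => f w + g w) z.
Proof. by move=> [l hl] [k hk]; exists (l + k); exact: has_cderivD. Qed.

Lemma cdiffM f g z : cdiff f z -> cdiff g z -> cdiff (fun w => f w * g w) z.
Proof. by move=> [l hl] [k hk]; eexists; exact: has_cderivM hl hk. Qed.

Lemma cdiffB f g z : cdiff f z -> cdiff g z -> cdiff (fun w => f w - g w) z.
Proof.
move=> hf [k hk]; apply: cdiffD => //; exists (-1 * k).
by apply: eq_has_cderiv (has_cderivZ (-1) hk) => w; rewrite mulN1r.
Qed.

Lemma cdiffV f z : f z != 0 -> cdiff f z -> cdiff (fun w => (f w)^-1) z.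
Proof. by move=> f0 [k hk]; eexists; exact: has_cderivV hk. Qed.

Lemma cdiff_cst k z : cdiff (fun=> k) z.
Proof. by exists 0; exact: has_cderiv_cst. Qed.

Lemma cdiff_id z : cdiff (fun w => w) z.
Proof. by exists 1; exact: has_cderiv_id. Qed.

Lemma cdiffX f z n : cdiff f z -> cdiff (fun w => f w ^+ n) z.
Proof.
case: n => [|n] [l hl]; first exact: cdiff_cst.
by eexists; exact: has_cderivX hl.
Qed.

Lemma cdiff_comp f g z : cdiff f z -> cdiff g (f z) -> cdiff (fun w => g (f w)) z.
Proof. by move=> [l hl] [k hk]; eexists; exact: has_cderiv_comp hl hk. Qed.

Lemma cdiff_horner (p : {poly C}) z : cdiff (fun w => p.[w]) z.
Proof. by eexists; exact: has_cderiv_horner. Qed.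

Lemma cdiff_local f g z d : 0 < d ->
  (forall w, normc (w - z) < d -> f w = g w) -> cdiff f z -> cdiff g z.
Proof. by move=> d0 fg [l /(has_cderiv_local d0 fg)]; exists l. Qed.

Lemma ccontinuousB f g z : {for z, continuous f} -> {for z, continuous g} ->
  {for z, continuous (fun w => f w - g w)}.
Proof. by move=> cf cg; exact: (continuousB cf cg). Qed.

Lemma ccontinuousM f g z : {for z, continuous f} -> {for z, continuous g} ->
  {for z, continuous (fun w => f w * g w)}.
Proof. by move=> cf cg; exact: (continuousM cf cg). Qed.

Lemma ccontinuousV f z : f z != 0 -> {for z, continuous f} ->
  {for z, continuous (fun w => (f w)^-1)}.
Proof. by move=> f0 cf; exact: (continuousV f0 cf). Qed.

Lemma ccontinuous_cst k z : {for z, continuous (fun _ : C => k)}.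
Proof. exact: (has_cderiv_continuous (has_cderiv_cst k z)). Qed.
End ComplexDerivative.

(** * Contour integrals of difference quotients *)

Section DifferenceQuotient.
Context {R : realType}.
Local Notation C := R[i].
Local Notation Re := (@complex.Re R).
Local Notation Im := (@complex.Im R).
Implicit Types (f g : C -> C) (z w l k : C) (a b c d : R).

Definition clamp a b (x : R) := Num.max a (Num.min b x).

Lemma clamp_id a b x : a <= x <= b -> clamp a b x = x.
Proof. by move=> /andP[ax xb]; rewrite /clamp (min_r xb) max_r. Qed.

Lemma clamp_in a b x : a <= b -> a <= clamp a b x <= b.
Proof. by move=> ab; rewrite /clamp le_max lexx /= ge_max ab /= ge_min lexx. Qed.

Lemma clamp_lip a b x y : a <= b -> `|clamp a b x - clamp a b y| <= `|x - y|.
Proof.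
move=> ab; wlog xy : x y / x <= y.
  by move=> H; have [/H//|/ltW/H] := leP x y; rewrite distrC (distrC y).
rewrite [leRHS]distrC (@ger0_norm _ (y - x)) ?subr_ge0//.
have [h1|h1] := leP x a.
  have -> : clamp a b x = a by rewrite /clamp max_l// ge_min h1 orbT.
  have [h2|h2] := leP y a.
    have -> : clamp a b y = a by rewrite /clamp max_l// ge_min h2 orbT.
    by rewrite subrr normr0 subr_ge0.
  rewrite distrC ger0_norm; last by rewrite subr_ge0; case/andP: (clamp_in y ab).
  by rewrite lerB// /clamp ge_max ltW//= ge_min lexx orbT.
have [h2|h2] := leP b y.
  have -> : clamp a b y = b by rewrite /clamp (min_l h2) max_r.
  rewrite distrC ger0_norm; last by rewrite subr_ge0; case/andP: (clamp_in x ab).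
  have [h3|h3] := leP b x; last by rewrite clamp_id ?(ltW h1) ?(ltW h3)// lerB.
  by rewrite /clamp (min_l h3) (max_r ab) subrr subr_ge0.
have xb : x <= b by exact: le_trans (ltW h2).
have ay : a <= y by exact: le_trans (ltW h1) xy.
by rewrite !clamp_id ?(ltW h1) ?(ltW h2) ?xb ?ay// distrC ger0_norm ?subr_ge0.
Qed.

(** The nearest-point retraction onto a rectangle. The integrals above ask for continuity on the
    whole plane, which [f] composed with this retraction has, while it agrees with [f] on the
    rectangle. *)
Definition clampc a b c d z : C := clamp a b (Re z) +i* clamp c d (Im z).

Lemma continuous_clamped f a b c d : a <= b -> c <= d ->
  (forall x y, a <= x <= b -> c <= y <= d -> cdiff f (x +i* y)) ->
  continuous (fun z => f (clampc a b c d z)).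
Proof.
move=> ab cd df z; apply/continuous_normcP => e e0.
have := df _ _ (clamp_in (Re z) ab) (clamp_in (Im z) cd).
move=> /cdiff_continuous/continuous_normcP/(_ e e0)[del del0 h].
exists (del / 2) => [|w wz]; first by rewrite divr_gt0.
apply: h; rewrite (le_lt_trans (normc_le_ReIm _))//=.
have h1 := clamp_lip (Re w) (Re z) ab; have h2 := clamp_lip (Im w) (Im z) cd.
by have := normr_Re (w - z); have := normr_Im (w - z); rewrite !raddfB /=; lra.
Qed.

(* The difference quotient of [f] at [p], extended by [f' p], is continuous,
   and holomorphic off [p]. *)
Lemma rectint_quotient f x0 x1 y0 y1 px py : x0 < px < x1 -> y0 < py < y1 ->
  continuous f -> (forall x y, x0 < x < x1 -> y0 < y < y1 -> cdiff f (x +i* y)) ->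
  forall a b c d, x0 < a < px -> px < b < x1 -> y0 < c < py -> py < d < y1 ->
  exists k : C -> C, [/\ continuous k, rectint k a b c d = 0 &
    forall z, z != px +i* py -> k z = (f z - f (px +i* py)) / (z - (px +i* py))].
Proof.
move=> hbx hy cf df a b c d /andP[x0a abx] /andP[bxb bx1] /andP[y0c cy] /andP[yd dy1].
set p := px +i* py.
have [l hl] := df _ _ hbx hy.
pose k z := if z == p then l else (f z - f p) / (z - p).
have kE z : z != p -> k z = (f z - f p) / (z - p) by rewrite /k => /negbTE ->.
have dist_gt z : z != p -> 0 < normc (z - p) by rewrite normc_gt0 subr_eq0.
have off z w : normc (w - z) < normc (z - p) -> w != p.
  by move=> wz; apply: contraTneq wz => ->; rewrite -leNgt normc_distC.
have kt : continuous k.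
  move=> z; have [->|zp] := eqVneq z p.
    apply/continuous_normcP => e e0; have e2 : 0 < e / 2 by rewrite divr_gt0.
    have [del del0 h] := hl _ e2; exists del => // w /h hw.
    rewrite {2}/k eqxx /k; case: eqVneq => [_|wp]; first by rewrite subrr normc0.
    rewrite -(ltr_pM2r (dist_gt _ wp)) -normcM.
    rewrite mulrBl divfK ?subr_eq0// (le_lt_trans hw)//.
    by rewrite ltr_pM2r ?dist_gt//; lra.
  have hc : {for z, continuous (fun z => (f z - f p) / (z - p))}.
    apply: ccontinuousM; first by apply: ccontinuousB; [exact: cf|exact: ccontinuous_cst].
    apply: ccontinuousV; first by rewrite subr_eq0.
    exact: cdiff_continuous (cdiffB (cdiff_id z) (cdiff_cst p z)).
  move/continuous_normcP: hc => hc; apply/continuous_normcP => e e0.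
  have [del del0 h] := hc e e0; exists (Num.min del (normc (z - p))) => [|w].
    by rewrite lt_min del0 dist_gt.
  by rewrite lt_min => /andP[/h hw /off wz]; rewrite !kE.
have kdiff x' y' : x0 < x' < x1 -> y0 < y' < y1 -> x' +i* y' != p -> cdiff k (x' +i* y').
  move=> hx' hy' zp.
  have : cdiff (fun z => (f z - f p) / (z - p)) (x' +i* y').
    apply: cdiffM; first by apply: cdiffB; [exact: df|exact: cdiff_cst].
    apply: cdiffV; first by rewrite subr_eq0.
    by apply: cdiffB; [exact: cdiff_id|exact: cdiff_cst].
  by apply: (cdiff_local (dist_gt _ zp)) => w /off wz; rewrite kE.
exists k; split => [//||//]; apply/eqP; rewrite -normc_eq0 eq_le normc_ge0 andbT.
apply/ler_addgt0Pr => e e0; rewrite add0r.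
have [del del0 hdel] := (continuous_normcP k p).1 (kt p) 1 ltr01.
pose M := normc l + 1; have M0 : 0 < M by rewrite ltr_wpDl// normc_ge0.
(* A square of half-side [t] around [p] is cut out. Goursat's theorem disposes of the four
   rectangles around it, and on the square [|k| <= M], so that its integral is at most
   [8 * M * t]. *)
have [t [t0 [t1 t2 t3 t4] t5 t6]] : exists t, [/\ 0 < t,
    [/\ t <= px - a, t <= b - px, t <= py - c & t <= d - py], t <= del / 4 & t <= e / (8 * M)].
  exists (Num.min (Num.min (px - a) (b - px)) (Num.min (Num.min (py - c) (d - py)) (Num.min (del / 4) (e / (8 * M))))).
  split; first by rewrite !lt_min !subr_gt0 abx bxb cy yd !divr_gt0// mulr_gt0.
  by split; rewrite !ge_min lexx ?orbT.
  by rewrite !ge_min lexx ?orbT.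
  by rewrite !ge_min lexx ?orbT.
have [i1 i2 i3 i4] : [/\ a <= px - t, px - t <= px + t, px + t <= b & px - t <= b] by clear -t0 t1 t2; split; lra.
have [j1 j2 j3 j4] : [/\ c <= py - t, py - t <= py + t, py + t <= d & py - t <= d] by clear -t0 t3 t4; split; lra.
have cd : c <= d by exact: ltW (lt_trans cy yd).
rewrite (rectint_split_x i1 i4 cd kt) (rectint_split_x i2 i3 cd kt).
rewrite (rectint_split_y i2 j1 j4 kt) (rectint_split_y i2 j2 j3 kt).
have neq x' y' : x' != px \/ y' != py -> x' +i* y' != p.
  by rewrite /p eq_complex /= => -[/negbTE->|/negbTE->]; rewrite ?andbF.
have -> : rectint k a (px - t) c d = 0.
  apply: (goursat i1 cd kt) => x' y' /andP[h1 h2] /andP[h3 h4].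
  apply: kdiff.
  - by clear -x0a abx bxb bx1 t0 t1 t2 h1 h2; apply/andP; split; lra.
  - by clear -y0c cy yd dy1 t0 t3 t4 h3 h4; apply/andP; split; lra.
  - by apply: neq; left; rewrite lt_eqF//; clear -t0 h1 h2; lra.
have -> : rectint k (px + t) b c d = 0.
  apply: (goursat i3 cd kt) => x' y' /andP[h1 h2] /andP[h3 h4].
  apply: kdiff.
  - by clear -x0a abx bxb bx1 t0 t1 t2 h1 h2; apply/andP; split; lra.
  - by clear -y0c cy yd dy1 t0 t3 t4 h3 h4; apply/andP; split; lra.
  - by apply: neq; left; rewrite gt_eqF//; clear -t0 h1 h2; lra.
have -> : rectint k (px - t) (px + t) c (py - t) = 0.
  apply: (goursat i2 j1 kt) => x' y' /andP[h1 h2] /andP[h3 h4].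
  apply: kdiff.
  - by clear -x0a abx bxb bx1 t0 t1 t2 h1 h2; apply/andP; split; lra.
  - by clear -y0c cy yd dy1 t0 t3 t4 h3 h4; apply/andP; split; lra.
  - by apply: neq; right; rewrite lt_eqF//; clear -t0 h3 h4; lra.
have -> : rectint k (px - t) (px + t) (py + t) d = 0.
  apply: (goursat i2 j3 kt) => x' y' /andP[h1 h2] /andP[h3 h4].
  apply: kdiff.
  - by clear -x0a abx bxb bx1 t0 t1 t2 h1 h2; apply/andP; split; lra.
  - by clear -y0c cy yd dy1 t0 t3 t4 h3 h4; apply/andP; split; lra.
  - by apply: neq; right; rewrite gt_eqF//; clear -t0 h3 h4; lra.
rewrite !(add0r, addr0).
have kM x' y' : px - t <= x' <= px + t -> py - t <= y' <= py + t -> normc (k (x' +i* y')) <= M.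
  move=> /andP[h1 h2] /andP[h3 h4].
  have kp : k p = l by rewrite /k eqxx.
  have -> : k (x' +i* y') = l + (k (x' +i* y') - k p) by rewrite kp; ring.
  rewrite (le_trans (ler_normcD _ _))// /M lerD2l ltW// hdel//.
  rewrite (le_lt_trans (normc_le_ReIm _))//=.
  have k1 : `|x' - px| <= t by clear -h1 h2; rewrite ler_norml; apply/andP; split; lra.
  have k2 : `|y' - py| <= t by clear -h3 h4; rewrite ler_norml; apply/andP; split; lra.
  by clear -k1 k2 t0 t5; lra.
have bnd : normc (rectint k (px - t) (px + t) (py - t) (py + t)) <= 2 * M * (px + t - (px - t) + (py + t - (py - t))).
  by apply: (rectint_bound i2 j2 kt) => s hs; apply: kM; do ?[exact: hs]; clear -t0; apply/andP; split; lra.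
apply: (le_trans bnd); move: t6; rewrite ler_pdivlMr ?mulr_gt0// => t6.
by apply: le_trans t6; lra.
Qed.

(* For [k = 1 / (z - b)] the four sides all contribute positively to the
   imaginary part of the integral. *)
Lemma rectint_neq0 (k : C -> C) a b c d (m : R) : a < b -> c < d -> 0 < m -> continuous k ->
  (forall x, a <= x <= b -> m <= Im (k (x +i* c))) ->
  (forall x, a <= x <= b -> Im (k (x +i* d)) <= - m) ->
  (forall y, c <= y <= d -> m <= Re (k (b +i* y))) ->
  (forall y, c <= y <= d -> Re (k (a +i* y)) <= - m) ->
  rectint k a b c d <> 0.
Proof.
move=> ab cd m0 ck h1 h2 h3 h4.
have abl := ltW ab; have cdl := ltW cd.
have ch y : continuous (fun x : R => k (x +i* y)) by exact: continuous_hline.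
have cv x : continuous (fun y : R => k (x +i* y)) by exact: continuous_vline.
have ckm (q : C) : continuous (fun z => q * k z).
  by move=> z; apply: ccontinuousM; [exact: ccontinuous_cst|exact: ck].
have k1 := cint_Im_ge abl (ch c) h1.
have k2 : m * (b - a) <= Im (-1 * cint (fun x => k (x +i* d)) a b).
  rewrite -(cintM (-1) abl (ch d)); apply: (cint_Im_ge abl (continuous_hline (y:=d) (ckm (-1)))).
  by move=> x /h2; rewrite mulN1r raddfN /=; lra.
have k3 : m * (d - c) <= Im ('i * cint (fun y => k (b +i* y)) c d).
  rewrite -(cintM 'i cdl (cv b)); apply: (cint_Im_ge cdl (continuous_vline (x:=b) (ckm 'i))).
  move=> y /h3; case: (k _) => p q /=.
  by rewrite mul0r add0r mul1r.
have k4 : m * (d - c) <= Im (- 'i * cint (fun y => k (a +i* y)) c d).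
  rewrite -(cintM (- 'i) cdl (cv a)); apply: (cint_Im_ge cdl (continuous_vline (x:=a) (ckm (- 'i)))).
  move=> y /h4; case: (k _) => p q /=.
  by rewrite oppr0 mul0r add0r mulN1r; lra.
have pos1 : 0 < m * (b - a) by rewrite mulr_gt0// subr_gt0.
have pos2 : 0 < m * (d - c) by rewrite mulr_gt0// subr_gt0.
move=> /(congr1 Im); rewrite /rectint.
move: k1 k2 k3 k4.
move: (cint _ a b) (cint _ a b) (cint _ c d) (cint _ c d) => [p1 q1] [p2 q2] [p3 q3] [p4 q4] /=.
by lra.
Qed.

Lemma Re_invc z : Re z^-1 = Re z / normc z ^+ 2.
Proof. by case: z => x y /=; rewrite sqr_sqrtr ?addr_ge0 ?sqr_ge0 ?mulNr//. Qed.

Lemma Im_invc z : Im z^-1 = - Im z / normc z ^+ 2.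
Proof. by case: z => x y /=; rewrite sqr_sqrtr ?addr_ge0 ?sqr_ge0 ?mulNr//. Qed.
End DifferenceQuotient.

(** * Cauchy's estimate and the maximum principle *)

Section CauchyEstimates.
Context {R : realType}.
Local Notation C := R[i].
Local Notation Re := (@complex.Re R).
Local Notation Im := (@complex.Im R).
Implicit Types (f g : C -> C) (z w l k a b : C) (r s M : R).

Lemma ReD z w : Re (z + w) = Re z + Re w. Proof. by case: z w => ? ? []. Qed.
Lemma ImD z w : Im (z + w) = Im z + Im w. Proof. by case: z w => ? ? []. Qed.
Lemma ReB z w : Re (z - w) = Re z - Re w. Proof. by case: z w => ? ? []. Qed.
Lemma ImB z w : Im (z - w) = Im z - Im w. Proof. by case: z w => ? ? []. Qed.

(** The real part of 1 / (p + i q) on one side of a square: the denominator is at most 9/2 s^2 and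
    the numerator at least s / 2. *)
Lemma inv_side_bound (p q s : R) : 0 < s -> s / 2 <= p -> p <= 3 / 2 * s ->
  `|q| <= 3 / 2 * s -> (9 * s)^-1 <= p / (p ^+ 2 + q ^+ 2).
Proof.
move=> s0 p1 p2 q2; have p0 : 0 < p by lra.
have n0 : 0 < p ^+ 2 + q ^+ 2 by rewrite ltr_pwDl ?sqr_ge0 ?exprn_gt0.
have hp : p ^+ 2 <= (3 / 2 * s) ^+ 2 by rewrite ler_sqr ?nnegrE; lra.
have hq : q ^+ 2 <= (3 / 2 * s) ^+ 2.
  rewrite -real_normK ?num_real// ler_sqr ?nnegrE//; lra.
rewrite ler_pdivlMr// mulrC ler_pdivrMr ?mulr_gt0//.
have : s * (s / 2) <= s * p by rewrite ler_wpM2l// ltW.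
by move: hp hq; rewrite !expr2 /=; nra.
Qed.

(* A boundary perturbation of [1 / (z - b)] has a nonzero integral. *)
Lemma rectint_perturb (k : C -> C) (e : C -> C) a b s : 0 < s -> normc (b - a) <= s / 2 ->
  continuous k ->
  (forall z, s <= normc (z - a) -> normc (z - a) <= 3 / 2 * s ->
     s / 2 <= normc (z - b) -> k z = (z - b)^-1 + e z /\ normc (e z) <= (18 * s)^-1) ->
  rectint k (Re a - s) (Re a + s) (Im a - s) (Im a + s) <> 0.
Proof.
move=> s0 bs ck hk.
(* The error [e] is at most half of the lower bound given by [inv_side_bound]. *)
have s9 : (9 * s)^-1 = 2 * (18 * s)^-1 by field; rewrite gt_eqF.
have s18 : 0 < (18 * s)^-1 by rewrite invr_gt0 mulr_gt0.
have hR : `|Re (b - a)| <= s / 2 by exact: le_trans (normr_Re _) bs.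
have hI : `|Im (b - a)| <= s / 2 by exact: le_trans (normr_Im _) bs.
(* The corners lie at distance sqrt 2 s < 3/2 s from the centre. *)
have sq x y : `|x - Re a| <= s -> `|y - Im a| <= s -> normc (x +i* y - a) <= 3 / 2 * s.
  move=> hx hy; rewrite -ler_sqr ?nnegrE ?normc_ge0//; last by rewrite mulr_ge0 ?ltW.
  rewrite sqr_normcE ReB ImB /=.
  have h1 : (x - Re a) ^+ 2 <= s ^+ 2 by rewrite -real_normK ?num_real// ler_sqr ?nnegrE ?(ltW s0).
  have h2 : (y - Im a) ^+ 2 <= s ^+ 2 by rewrite -real_normK ?num_real// ler_sqr ?nnegrE ?(ltW s0).
  by have := sqr_ge0 s; rewrite exprMn; lra.
move: hR hI; rewrite ReB ImB !ler_norml => /andP[hR1 hR2] /andP[hI1 hI2].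
have key x y : `|x - Re a| <= s -> `|y - Im a| <= s ->
    (`|x - Re a| = s \/ `|y - Im a| = s) ->
    `|Re (k (x +i* y)) - (x - Re b) / ((x - Re b) ^+ 2 + (y - Im b) ^+ 2)| <= (18 * s)^-1
    /\ `|Im (k (x +i* y)) + (y - Im b) / ((x - Re b) ^+ 2 + (y - Im b) ^+ 2)| <= (18 * s)^-1.
  move=> hx hy xys.
  have ds : s <= normc (x +i* y - a).
    case: xys => <-.
      by apply: le_trans (normr_Re _); rewrite ?ReB ?ImB.
    by apply: le_trans (normr_Im _); rewrite ?ReB ?ImB.
  have [->  he] := hk _ ds (sq _ _ hx hy) (ltac:(have := ler_distcD b (x +i* y) a; lra)).
  rewrite !(ReD, ImD) Re_invc Im_invc sqr_normcE !(ReB, ImB) /= mulNr.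
  split.
    by rewrite addrAC subrr add0r (le_trans (normr_Re _)).
  by rewrite addrAC addNr add0r (le_trans (normr_Im _)).
have nrm t : - s <= t -> t <= s -> `|t| <= s by move=> *; rewrite ler_norml; apply/andP.
have nr32 t : - (3 / 2 * s) <= t -> t <= 3 / 2 * s -> `|t| <= 3 / 2 * s by move=> *; rewrite ler_norml; apply/andP.
have as1 : `|Re a - s - Re a| = s by rewrite addrAC subrr add0r normrN gtr0_norm.
have as2 : `|Re a + s - Re a| = s by rewrite addrAC subrr add0r gtr0_norm.
have as3 : `|Im a - s - Im a| = s by rewrite addrAC subrr add0r normrN gtr0_norm.
have as4 : `|Im a + s - Im a| = s by rewrite addrAC subrr add0r gtr0_norm.
apply: (@rectint_neq0 _ k _ _ _ _ (18 * s)^-1) => //; try by clear -s0; lra.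
- move=> x /andP[h1 h2].
  have [||| _] := key x (Im a - s); [by apply: nrm; clear -h1 h2; lra|by rewrite as3|by right|].
  rewrite ler_norml => /andP[h3 h4].
  have := @inv_side_bound (Im b - (Im a - s)) (x - Re b) s s0.
  move=> /(_ _ _ _) h5; have {}h5 : (9 * s)^-1 <= (Im b - (Im a - s)) / ((Im b - (Im a - s)) ^+ 2 + (x - Re b) ^+ 2).
    by apply: h5; [clear -hI1 hI2; lra|clear -hI1 hI2; lra|apply: nr32; clear -h1 h2 hR1 hR2; lra].
  move: h3 h4; rewrite -[Im a - s - Im b]opprB mulNr sqrrN addrC [(x - _) ^+ 2 + _]addrC.
  by move: h5; rewrite s9; clear; lra.
- move=> x /andP[h1 h2].
  have [||| _] := key x (Im a + s); [by apply: nrm; clear -h1 h2; lra|by rewrite as4|by right|].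
  rewrite ler_norml => /andP[h3 h4].
  have := @inv_side_bound (Im a + s - Im b) (x - Re b) s s0.
  move=> /(_ _ _ _) h5; have {}h5 : (9 * s)^-1 <= (Im a + s - Im b) / ((Im a + s - Im b) ^+ 2 + (x - Re b) ^+ 2).
    by apply: h5; [clear -hI1 hI2; lra|clear -hI1 hI2; lra|apply: nr32; clear -h1 h2 hR1 hR2; lra].
  move: h3 h4; rewrite [(x - _) ^+ 2 + _]addrC.
  by move: h5; rewrite s9; clear; lra.
- move=> y /andP[h1 h2].
  have [|||+ _] := key (Re a + s) y; [by rewrite as2|by apply: nrm; clear -h1 h2; lra|by left|].
  rewrite ler_norml => /andP[h3 h4].
  have := @inv_side_bound (Re a + s - Re b) (y - Im b) s s0.
  move=> /(_ _ _ _) h5; have {}h5 : (9 * s)^-1 <= (Re a + s - Re b) / ((Re a + s - Re b) ^+ 2 + (y - Im b) ^+ 2).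
    by apply: h5; [clear -hR1 hR2; lra|clear -hR1 hR2; lra|apply: nr32; clear -h1 h2 hI1 hI2; lra].
  by move: h3 h4 h5; rewrite s9; clear; lra.
- move=> y /andP[h1 h2].
  have [|||+ _] := key (Re a - s) y; [by rewrite as1|by apply: nrm; clear -h1 h2; lra|by left|].
  rewrite ler_norml => /andP[h3 h4].
  have := @inv_side_bound (Re b - (Re a - s)) (y - Im b) s s0.
  move=> /(_ _ _ _) h5; have {}h5 : (9 * s)^-1 <= (Re b - (Re a - s)) / ((Re b - (Re a - s)) ^+ 2 + (y - Im b) ^+ 2).
    by apply: h5; [clear -hR1 hR2; lra|clear -hR1 hR2; lra|apply: nr32; clear -h1 h2 hI1 hI2; lra].
  move: h3 h4; rewrite -[Re a - s - Re b]opprB mulNr sqrrN.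
  by move: h5; rewrite s9; clear; lra.
Qed.

Lemma continuous_scale (q : C) (k : C -> C) : continuous k -> continuous (fun z => q * k z).
Proof. by move=> ck z; apply: ccontinuousM; [exact: ccontinuous_cst|exact: ck]. Qed.

Lemma continuous_addc (k h : C -> C) : continuous k -> continuous h ->
  continuous (fun z => k z + h z).
Proof. by move=> ck ch z; exact: (continuousD (ck z) (ch z)). Qed.

(** [rectint_quotient] for the square of half-side [r] about [a], with [f] clamped to half-side 3/2
    r: the corners of this larger square are still within 3 r of [a], where [f] is
    differentiable. *)
Lemma quotient_exists f a b r : 0 < r -> (forall z, normc (z - a) < 3 * r -> cdiff f z) ->
  normc (b - a) <= r / 2 ->
  exists k : C -> C, [/\ continuous k,
    rectint k (Re a - r) (Re a + r) (Im a - r) (Im a + r) = 0 &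
    forall z, normc (z - a) <= 3 / 2 * r -> z != b -> k z = (f z - f b) / (z - b)].
Proof.
move=> r0 df br; pose t := 3 / 2 * r.
have [t1 t2] : Re a - t <= Re a + t /\ Im a - t <= Im a + t by rewrite /t; split; lra.
pose g z := f (clampc (Re a - t) (Re a + t) (Im a - t) (Im a + t) z).
have inD x y : Re a - t <= x <= Re a + t -> Im a - t <= y <= Im a + t -> cdiff f (x +i* y).
  move=> /andP[h1 h2] /andP[h3 h4]; apply: df.
  rewrite -ltr_sqr ?nnegrE ?normc_ge0 ?mulr_ge0 ?(ltW r0)// sqr_normcE ReB ImB /=.
  have h5 : (x - Re a) ^+ 2 <= t ^+ 2.
    by rewrite -real_normK ?num_real// ler_sqr ?nnegrE ?mulr_ge0 ?(ltW r0)// ler_norml; apply/andP; split; lra.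
  have h6 : (y - Im a) ^+ 2 <= t ^+ 2.
    by rewrite -real_normK ?num_real// ler_sqr ?nnegrE ?mulr_ge0 ?(ltW r0)// ler_norml; apply/andP; split; lra.
  have : 0 < r ^+ 2 by rewrite exprn_gt0.
  by move: h5 h6; rewrite /t !exprMn; clear; lra.
have cg : continuous g by exact: continuous_clamped.
have gE z : normc (z - a) <= t -> g z = f z.
  move=> h; have := normr_Re (z - a); have := normr_Im (z - a).
  rewrite ReB ImB => /le_trans/(_ h) hI /le_trans/(_ h); move: hI; rewrite !ler_norml.
  move=> /andP[h1 h2] /andP[h3 h4]; rewrite /g /clampc !clamp_id; first by case: (z).
    by clear -h1 h2; apply/andP; split; lra.
  by clear -h3 h4; apply/andP; split; lra.
have dg x y : Re a - t < x < Re a + t -> Im a - t < y < Im a + t -> cdiff g (x +i* y).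
  move=> /andP[h1 h2] /andP[h3 h4].
  pose d := Num.min (Num.min (x - (Re a - t)) (Re a + t - x)) (Num.min (y - (Im a - t)) (Im a + t - y)).
  have d0 : 0 < d by rewrite !lt_min !subr_gt0 h1 h2 h3 h4.
  apply: (@cdiff_local _ f _ _ d d0); last by apply: inD; rewrite !ltW.
  move=> w; rewrite !lt_min => /andP[/andP[k1 k2] /andP[k3 k4]].
  rewrite /g /clampc; have := normr_Re (w - (x +i* y)); have := normr_Im (w - (x +i* y)).
  rewrite ReB ImB /= !ler_norml => /andP[m1 m2] /andP[m3 m4].
  rewrite !clamp_id; first by case: (w).
    by clear -k3 k4 m1 m2; apply/andP; split; lra.
  by clear -k1 k2 m3 m4; apply/andP; split; lra.
have hR : `|Re b - Re a| <= r / 2 by rewrite -ReB (le_trans (normr_Re _)).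
have hI : `|Im b - Im a| <= r / 2 by rewrite -ImB (le_trans (normr_Im _)).
move: hR hI; rewrite !ler_norml => /andP[hR1 hR2] /andP[hI1 hI2].
have bE : b = Re b +i* Im b by case: (b).
have := @rectint_quotient _ g (Re a - t) (Re a + t) (Im a - t) (Im a + t) (Re b) (Im b) _ _ cg dg
  (Re a - r) (Re a + r) (Im a - r) (Im a + r) _ _ _ _.
have o1 : Re a - t < Re b < Re a + t by rewrite /t; clear -r0 hR1 hR2; apply/andP; split; lra.
have o2 : Im a - t < Im b < Im a + t by rewrite /t; clear -r0 hI1 hI2; apply/andP; split; lra.
have o3 : Re a - t < Re a - r < Re b by rewrite /t; clear -r0 hR1 hR2; apply/andP; split; lra.
have o4 : Re b < Re a + r < Re a + t by rewrite /t; clear -r0 hR1 hR2; apply/andP; split; lra.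
have o5 : Im a - t < Im a - r < Im b by rewrite /t; clear -r0 hI1 hI2; apply/andP; split; lra.
have o6 : Im b < Im a + r < Im a + t by rewrite /t; clear -r0 hI1 hI2; apply/andP; split; lra.
move=> /(_ o1 o2 o3 o4 o5 o6)[k [ck ik kE]]; exists k; split => // z za zb.
rewrite kE -?bE// gE// gE//; apply: (le_trans br); rewrite /t; clear -r0; lra.
Qed.

(** If the increment [D = f b - f a] were larger, the difference quotients [ka] and [kb] at [a] and
    [b] would give [(ka - kb) / D], with zero integral, yet equal to 1 / (z - b) up to an error of
    at most [(18 * r)^-1] on the contour. The error is bounded by 2 M |b - a| / (r^2 / 2) / |D|,
    whence 72 = 2 * 2 * 18. *)
Lemma cauchy_lip f a b r M : 0 < r -> (forall z, normc (z - a) < 3 * r -> cdiff f z) ->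
  (forall z, normc (z - a) < 2 * r -> normc (f z) <= M) -> normc (b - a) <= r / 2 ->
  normc (f b - f a) <= 72 * M / r * normc (b - a).
Proof.
move=> r0 df fM br; rewrite leNgt; apply/negP => H.
have [ka [cka ia kaE]] := quotient_exists r0 df (ltac:(by rewrite subrr normc0 divr_ge0// ltW) : normc (a - a) <= r / 2).
have [kb [ckb ib kbE]] := quotient_exists r0 df br.
have M0 : 0 <= M by apply: le_trans (fM a _); rewrite ?normc_ge0// subrr normc0 mulr_gt0.
set D := f b - f a in H.
have D0 : 0 < normc D by apply: le_lt_trans H; rewrite mulr_ge0 ?normc_ge0// divr_ge0 ?mulr_ge0// ltW.
have Dn0 : D != 0 by rewrite -normc_gt0.
pose k z := D^-1 * (ka z + -1 * kb z).
have c1 := continuous_scale (q:=-1) ckb; have c2 := continuous_addc cka c1.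
have ck : continuous k := continuous_scale (q:=D^-1) c2.
have [i1 i2] : Re a - r <= Re a + r /\ Im a - r <= Im a + r by clear -r0; lra.
have ik : rectint k (Re a - r) (Re a + r) (Im a - r) (Im a + r) = 0.
  rewrite /k (rectintM D^-1 i1 i2 c2) (rectintD i1 i2 cka c1) (rectintM (-1) i1 i2 ckb).
  by rewrite ia ib mulr0 addr0 mulr0.
apply: (@rectint_perturb k (fun z => - ((f z - f a) * (b - a) / ((z - a) * (z - b))) / D) a b r) => //.
move=> z z1 z2 z3; have za : z != a by rewrite -subr_eq0 -normc_gt0 (lt_le_trans r0).
have zb : z != b by rewrite -subr_eq0 -normc_gt0 (lt_le_trans _ z3)// divr_gt0.
split.
  rewrite /k kaE// kbE//; have -> : f b = f a + D by rewrite /D; ring.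
  by field; rewrite Dn0 !subr_eq0 za zb.
rewrite normcM normc_opp normcV ler_pdivrMr// normcM normcV !normcM.
have zr : normc (z - a) < 2 * r by clear -z2 r0; lra.
have f2 : normc (f z - f a) <= 2 * M.
  apply: (le_trans (ler_normcB _ _)); have := fM _ zr.
  by have := fM a (ltac:(by rewrite subrr normc0 mulr_gt0)); lra.
have den : r * (r / 2) <= normc (z - a) * normc (z - b) by rewrite ler_pM// ?divr_ge0 ?ltW.
have den0 : 0 < r * (r / 2) by rewrite mulr_gt0 ?divr_gt0.
rewrite ler_pdivrMr; last exact: lt_le_trans den.
apply: (@le_trans _ _ (2 * M * normc (b - a))); first by rewrite ler_wpM2r ?normc_ge0.
apply: (@le_trans _ _ ((18 * r)^-1 * normc D * (r * (r / 2)))); last first.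
  by rewrite ler_wpM2l// mulr_ge0 ?normc_ge0// invr_ge0 mulr_ge0// ltW.
have -> : (18 * r)^-1 * normc D * (r * (r / 2)) = normc D * (r / 36) by field; rewrite gt_eqF.
have := ltW H; rewrite -(ler_pM2r (_ : 0 < r / 36)); last by rewrite divr_gt0.
suff -> : 72 * M / r * normc (b - a) * (r / 36) = 2 * M * normc (b - a) by [].
by field; rewrite gt_eqF.
Qed.

(** If [|f a| > M], a high power of [f / f a] is 1 at [a] and at most 1/18 on the ring; minus its
    difference quotient at [a] is then 1 / (z - a) up to a small error, yet has zero integral. *)
Lemma max_principle f a r M : 0 < r -> (forall z, normc (z - a) < 3 * r -> cdiff f z) ->
  (forall z, r <= normc (z - a) -> normc (z - a) < 2 * r -> normc (f z) <= M) ->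
  normc (f a) <= M.
Proof.
move=> r0 df fM; rewrite leNgt; apply/negP => H.
have M0 : 0 <= M.
  apply: le_trans (fM (a + r%:C) _ _); rewrite ?normc_ge0 ?(addrC a) ?addrK ?normc_real ?gtr0_norm//.
  by rewrite mulr_natl mulr2n ltrDl.
have fa0 : 0 < normc (f a) by exact: le_lt_trans H.
have fan0 : f a != 0 by rewrite -normc_gt0.
pose q := M / normc (f a); have q0 : 0 <= q by rewrite divr_ge0// ltW.
have q1 : q < 1 by rewrite ltr_pdivrMr// mul1r.
have [n qn] : exists n, q ^+ n <= 18^-1.
  have := cvg_expr (_ : `|q| < 1); rewrite ger0_norm// => /(_ q1).
  move=> /cvgrPdist_le/(_ 18^-1 (ltac:(by rewrite invr_gt0)))[n _ /(_ n)].
  by rewrite /= leqnn sub0r normrN => /(_ isT) h; exists n; rewrite (le_trans _ h)// ler_norm.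
pose h z := (f z / f a) ^+ n.
have dh z : normc (z - a) < 3 * r -> cdiff h z.
  by move=> /df hz; apply: cdiffX; apply: cdiffM => //; exact: cdiff_cst.
have ha : h a = 1 by rewrite /h divff// expr1n.
have [k [ck ik kE]] := quotient_exists r0 dh (ltac:(by rewrite subrr normc0 divr_ge0// ltW) : normc (a - a) <= r / 2).
have [i1 i2] : Re a - r <= Re a + r /\ Im a - r <= Im a + r by clear -r0; lra.
have ckN := continuous_scale (q:=-1) ck.
have ikN : rectint (fun z => -1 * k z) (Re a - r) (Re a + r) (Im a - r) (Im a + r) = 0.
  by rewrite (rectintM (-1) i1 i2 ck) ik mulr0.
apply: (@rectint_perturb (fun z => -1 * k z) (fun z => - h z / (z - a)) a a r) => //.
  by rewrite subrr normc0 divr_ge0// ltW.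
move=> z z1 z2 _; have za : z != a by rewrite -subr_eq0 -normc_gt0 (lt_le_trans r0).
split.
  by rewrite kE// ha; field; rewrite subr_eq0.
rewrite normcM normc_opp normcV ler_pdivrMr ?(lt_le_trans r0)//.
apply: (@le_trans _ _ 18^-1); last first.
  by rewrite invfM -mulrA -[leLHS]mulr1 ler_wpM2l// mulrC ler_pdivlMr// mul1r.
rewrite /h normcX normcM normcV; apply: le_trans qn; rewrite lerXn2r ?nnegrE ?divr_ge0 ?normc_ge0//.
by rewrite /q ler_wpM2r ?invr_ge0 ?normc_ge0// fM//; clear -z2 r0; lra.
Qed.
End CauchyEstimates.

(** * Landau's theorem *)

Section SquareRoots.
Context {R : realType}.
Local Notation C := R[i].
Local Notation Re := (@complex.Re R).
Local Notation Im := (@complex.Im R).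
Implicit Types (f g s : C -> C) (z w l k a b : C) (r e M : R).

Lemma ccontinuousD f g z : {for z, continuous f} -> {for z, continuous g} ->
  {for z, continuous (fun w => f w + g w)}.
Proof. by move=> cf cg; exact: (continuousD cf cg). Qed.

Lemma uniform_continuity f (K : set C) e : 0 < e -> compact K ->
  (forall z, K z -> {for z, continuous f}) ->
  exists2 d, 0 < d & forall z w, K z -> normc (w - z) < d -> normc (f w - f z) < e.
Proof.
move=> e0 cK cf; have e2 : 0 < e / 2 by rewrite divr_gt0.
have /compact_near_coveringP H := cK.
have [z Kz|d /= d0 hd] := H R (0 : R)^'+ (fun d z => forall w, normc (w - z) < d -> normc (f w - f z) < e) _ _.
  have /continuous_normcP/(_ _ e2)[d d0 hd] := cf z Kz.
  have d2 : 0 < d / 2 by rewrite divr_gt0.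
  exists (cball z (d / 2), [set t | 0 < t < d / 2]).
    split; first exact: nbhs_cball.
    near=> t; rewrite /= ; apply/andP; split; near: t; [exact: nbhs_right_gt|exact: nbhs_right_lt].
  move=> [z' t] /= [zz' /andP[t0 td]] w wz'; rewrite /cball /= in zz'.
  have h1 := ler_distcD z' w z; have h2 := ler_distcD (f z) (f w) (f z').
  have h3 : normc (f w - f z) < e / 2 by apply: hd; clear -h1 zz' wz' td; lra.
  have h4 : normc (f z - f z') < e / 2.
    by rewrite normc_distC; apply: hd; clear -zz' d0; lra.
  by clear -h2 h3 h4; lra.
exists (d / 2); first by rewrite divr_gt0.
move=> z w Kz wz; apply: (hd (d / 2)) => //=; last by rewrite divr_gt0.
by rewrite sub0r normrN gtr0_norm ?divr_gt0//; clear -d0; lra.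
Unshelve. all: by end_near. Qed.

Definition psqrt (w : C) : C := sqrtc w.

Lemma psqrtK w : psqrt w ^+ 2 = w. Proof. exact: sqr_sqrtc. Qed.

Lemma Re_psqrt_ge0 w : 0 <= Re (psqrt w).
Proof. by case: w => x y; rewrite /psqrt /= sqrtr_ge0. Qed.

Lemma Re_psqrt_gt0 w : 0 < Re w -> 0 < Re (psqrt w).
Proof.
move=> w0; rewrite lt_def Re_psqrt_ge0 andbT; apply: contraTneq w0 => s0.
rewrite -(psqrtK w); case: (psqrt w) s0 => x y /= ->.
by rewrite -leNgt mul0r sub0r oppr_le0 -expr2 sqr_ge0.
Qed.

Lemma psqrt_continuous w : 0 < Re w -> {for w, continuous psqrt}.
Proof.
move=> w0; have s0 := Re_psqrt_gt0 w0; apply/continuous_normcP => e e0.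
exists (e * Re (psqrt w)); first by rewrite mulr_gt0.
move=> v vw; have : normc (psqrt v - psqrt w) * normc (psqrt v + psqrt w) < e * Re (psqrt w).
  by rewrite -normcM -subr_sqr !psqrtK.
apply: contraTT; rewrite -!leNgt => h; rewrite ler_pM// ?(ltW e0) ?(ltW s0)//.
rewrite (le_trans _ (normr_Re _))// ReD (le_trans _ (ler_norm _))// lerDr.
exact: Re_psqrt_ge0.
Qed.

Lemma psqrt_ratio_continuous (u v : C -> C) z : {for z, continuous u} -> {for z, continuous v} ->
  v z != 0 -> normc (u z / v z - 1) < 1 -> {for z, continuous (fun w => psqrt (u w / v w))}.
Proof.
move=> cu cv vz h.
have hR : 0 < Re (u z / v z).
  have := normr_Re (u z / v z - 1); rewrite ReB /= => /le_lt_trans/(_ h).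
  by rewrite ltr_norml => /andP[]; lra.
have c1 : {for z, continuous (fun w => u w / v w)}.
  exact: (ccontinuousM cu (ccontinuousV vz cv)).
exact: (@continuous_comp _ _ _ (fun w => u w / v w) psqrt z c1 (psqrt_continuous hR)).
Qed.

(* The square root is the telescoping product of principal square roots of
   ratios of values of [f] at consecutive points of the radius through [z]. *)
Lemma sqrt_on_disc f a r : 0 < r ->
  (forall z, normc (z - a) <= r -> {for z, continuous f} /\ f z != 0) ->
  exists s, forall z, normc (z - a) <= r -> {for z, continuous s} /\ s z ^+ 2 = f z.
Proof.
move=> r0 hf.
have cK : compact (cdisc a r).
  apply: (@bounded_closed_compact_c R _ (normc a + r)); first exact: closed_cdisc.
  move=> z; rewrite /cdisc /= subr0 => zr.
  by have := ler_normcD (z - a) a; rewrite subrK; lra.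
have [m m0 hm] : exists2 m, 0 < m & forall z, normc (z - a) <= r -> m <= normc (f z).
  have cn : {within cdisc a r, continuous (fun z => normc (f z))}.
    apply: continuous_in_subspaceT => z /set_mem /hf[cfz _].
    exact: (@continuous_comp _ _ _ f (fun w => normc w) z cfz (@continuous_normc R _)).
  have [|c /set_mem cD H] := compact_EVT_min _ cK cn.
    by exists a; rewrite /cdisc /= subrr normc0 ltW.
  exists (normc (f c)); first by rewrite normc_gt0 (hf c cD).2.
  by move=> z zr; apply: H; apply/mem_set.
have [d d0 hd] := uniform_continuity m0 cK (fun z zr => (hf z zr).1).
(* With [N] subdivisions, consecutive points of a radius are less than [d] apart, so the ratio of
   the values of [f] lies within 1 of 1, in the half-plane where [psqrt] is continuous. *)
pose N := (Num.bound (r / d)).+1.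
have N0 : 0 < N%:R :> R by rewrite ltr0n.
have rN : r / N%:R < d.
  rewrite ltr_pdivrMr// mulrC -ltr_pdivrMr//.
  apply: (lt_trans (archi_boundP _)); first by rewrite divr_ge0 ?ltW.
  by rewrite ltr_nat.
have NC : (N%:R : C) != 0 by rewrite pnatr_eq0.
pose pt (j : nat) z := a + (j%:R / N%:R) * (z - a).
have ptin j z : (j <= N)%N -> normc (z - a) <= r -> normc (pt j z - a) <= r.
  move=> jN zr; rewrite /pt addrAC subrr add0r normcM normcM normcV !normc_nat.
  apply: le_trans zr; rewrite -[leRHS]mul1r ler_wpM2r ?normc_ge0//.
  by rewrite ler_pdivrMr// mul1r ler_nat.
have ptc j z : {for z, continuous (pt j)}.
  apply: cdiff_continuous; apply: cdiffD; first exact: cdiff_cst.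
  apply: cdiffM; first exact: cdiff_cst.
  by apply: cdiffB; [exact: cdiff_id|exact: cdiff_cst].
have cfp j z : (j <= N)%N -> normc (z - a) <= r -> {for z, continuous (fun w => f (pt j w))}.
  move=> jN zr; have [cfz _] := hf _ (ptin j z jN zr).
  exact: (@continuous_comp _ _ _ (pt j) f z (ptc j z) cfz).
have close j z : (j < N)%N -> normc (z - a) <= r -> normc (f (pt j.+1 z) / f (pt j z) - 1) < 1.
  move=> jN zr; have pj := ptin j z (ltnW jN) zr; have [_ f0] := hf _ pj.
  have -> : f (pt j.+1 z) / f (pt j z) - 1 = (f (pt j.+1 z) - f (pt j z)) / f (pt j z) by field.
  rewrite normcM normcV ltr_pdivrMr ?normc_gt0// mul1r (lt_le_trans _ (hm _ pj))//.
  apply: hd => //; apply: le_lt_trans rN.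
  have -> : pt j.+1 z - pt j z = N%:R^-1 * (z - a).
    by rewrite /pt -[j.+1]addn1 natrD; field.
  by rewrite normcM normcV normc_nat mulrC ler_wpM2r// invr_ge0 ltW.
pose S := fix S (j : nat) (z : C) : C :=
  if j is j'.+1 then S j' z * psqrt (f (pt j z) / f (pt j' z)) else psqrt (f a).
have HS j : (j <= N)%N -> forall z, normc (z - a) <= r -> {for z, continuous (S j)} /\ S j z ^+ 2 = f (pt j z).
  elim: j => [_ z zr|j IH jN z zr].
    by split; [exact: ccontinuous_cst|rewrite psqrtK /pt mul0r mul0r addr0].
  have [c1 e1] := IH (ltnW jN) z zr.
  have [_ f0] := hf _ (ptin j z (ltnW jN) zr).
  split.
    apply: (@ccontinuousM _ (S j) (fun w => psqrt (f (pt j.+1 w) / f (pt j w))) z c1).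
    apply: (@psqrt_ratio_continuous (fun w => f (pt j.+1 w)) (fun w => f (pt j w))).
    - exact: cfp.
    - exact: cfp (ltnW jN) zr.
    - exact: f0.
    - exact: close.
  by rewrite /= exprMn e1 psqrtK mulrC divfK.
exists (S N) => z zr; have [c1 ->] := HS N (leqnn N) z zr; split => //.
by rewrite /pt divff// mul1r addrC subrK.
Qed.

Lemma has_cderiv_caratheodory f g (phi : C -> C) z l d : 0 < d -> has_cderiv f z l ->
  {for z, continuous phi} ->
  (forall w, normc (w - z) < d -> g w - g z = (f w - f z) * phi w) ->
  has_cderiv g z (l * phi z).
Proof.
move=> d0 hf /continuous_normcP cphi hg e e0.
have l0 : 0 < normc l + 1 by rewrite ltr_wpDl// normc_ge0.
have p0 : 0 < normc (phi z) + 1 by rewrite ltr_wpDl// normc_ge0.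
have e2 : 0 < e / 2 by rewrite divr_gt0.
have [d1 d10 h1] := has_cderiv_lip hf.
have [d2 d20 h2] := hf _ (divr_gt0 e2 p0).
have [d3 d30 h3] := cphi _ (divr_gt0 e2 l0).
exists (Num.min (Num.min d d1) (Num.min d2 d3)) => [|w]; first by rewrite !lt_min d0 d10 d20.
rewrite !lt_min => /andP[/andP[/hg -> /h1 w1] /andP[/h2 w2 /h3 w3]].
have -> : (f w - f z) * phi w - l * phi z * (w - z) =
  (f w - f z) * (phi w - phi z) + (f w - f z - l * (w - z)) * phi z by ring.
rewrite (le_trans (ler_normcD _ _))// !normcM.
have -> : e * normc (w - z) = e / 2 * normc (w - z) + e / 2 * normc (w - z) by field.
apply: lerD.
  apply: (le_trans (ler_pM (normc_ge0 _) (normc_ge0 _) w1 (ltW w3))).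
  by rewrite mulrAC mulrCA divff ?gt_eqF// mulr1 mulrC.
apply: (le_trans (ler_wpM2r (normc_ge0 _) w2)).
rewrite mulrAC ler_wpM2r ?normc_ge0// mulrAC ler_pdivrMr// ler_wpM2l ?(ltW e2)//.
by rewrite lerDl.
Qed.

(** [s w - s z = (f w - f z) / (s w + s z)], and [1 / (s w + s z)] is continuous at [z] because
    [s z] is nonzero. *)
Lemma sqrt_cdiff f s z d : 0 < d -> cdiff f z -> f z != 0 -> {for z, continuous s} ->
  (forall w, normc (w - z) < d -> s w ^+ 2 = f w) -> cdiff s z.
Proof.
move=> d0 [l hl] fz0 cs hs.
have sz0 : s z != 0.
  by apply: contraNneq fz0 => sz0; rewrite -hs ?sz0 ?expr0n// subrr normc0.
have two : (2 : C) != 0 by rewrite pnatr_eq0.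
have cphi : {for z, continuous (fun w => (s w + s z)^-1)}.
  apply: (@ccontinuousV _ (fun w => s w + s z) z); first by rewrite -mulr2n -mulr_natl mulf_neq0.
  exact: (ccontinuousD cs (@ccontinuous_cst R (s z) z)).
have [d' d'0 hd'] := (continuous_normcP s z).1 cs (normc (s z)) (ltac:(by rewrite normc_gt0)).
exists (l * (s z + s z)^-1).
apply: (@has_cderiv_caratheodory f s _ z l (Num.min d d') _ hl cphi).
  by rewrite lt_min d0.
move=> w; rewrite lt_min => /andP[/hs fw /hd' sw].
have h0 : s w + s z != 0.
  apply: contraTneq sw => /eqP; rewrite addr_eq0 => /eqP ->.
  rewrite -leNgt -opprD normc_opp -mulr2n -mulr_natl normcM normc_nat.
  by rewrite ler_peMl ?normc_ge0// ler1n.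
by rewrite -fw -hs ?subrr ?normc0// subr_sqr mulfK.
Qed.

Lemma pow2_root f a r r' j : 0 < r' -> r' < r ->
  (forall z, normc (z - a) < r -> cdiff f z /\ f z != 0) ->
  exists s, forall z, normc (z - a) < r' -> cdiff s z /\ s z ^+ (2 ^ j) = f z.
Proof.
elim: j r' => [|j IH] r' r'0 r'r hf.
  by exists f => z zr; rewrite expn0 expr1; split=> //; apply: (hf z _).1; exact: lt_trans zr r'r.
pose m := (r' + r) / 2.
have [m1 m2] : r' < m /\ m < r by rewrite /m; split; lra.
have [s hs] := IH m (lt_trans r'0 m1) m2 hf.
have s0 z : normc (z - a) < m -> s z != 0.
  move=> zm; have [_ e] := hs z zm; have [_] := hf z (lt_trans zm m2).
  by rewrite -e expf_eq0 expn_gt0 /=.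
have [|t ht] := @sqrt_on_disc s a r' r'0.
  move=> z zr; have zm : normc (z - a) < m by exact: le_lt_trans zr m1.
  by split; [exact: cdiff_continuous (hs z zm).1|exact: s0].
exists t => z zr; have zm := lt_trans zr m1; have [ct et] := ht z (ltW zr); split.
  apply: (@sqrt_cdiff s t z (r' - normc (z - a))).
  - by rewrite subr_gt0.
  - exact: (hs z zm).1.
  - exact: s0.
  - exact: ct.
  move=> w wz; apply: (ht w _).2; have := ler_distcD z w a; clear -wz; lra.
by rewrite expnS exprM et (hs z zm).2.
Qed.
End SquareRoots.

(** * The chordal metric and spherical derivatives *)

Section Chordal.
Context {R : realType}.
Local Notation C := R[i].
Local Notation Re := (@complex.Re R).
Local Notation Im := (@complex.Im R).
Implicit Types (f g s : C -> C) (z w l k a b : C) (r e M c : R) (x y : sphere R).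

(** As the spherical derivative of [f] is 2 |f'| / (1 + |f|^2), a bound [|f'| <= c * jap f ^+ 2]
    says that it is at most 2 c. *)
Definition jap z : R := Num.sqrt (1 + normc z ^+ 2).

Lemma jap_ge1 z : 1 <= jap z.
Proof. by rewrite /jap -{1}sqrtr1 ler_wsqrtr// lerDl sqr_ge0. Qed.

Lemma jap_gt0 z : 0 < jap z. Proof. exact: lt_le_trans ltr01 (jap_ge1 z). Qed.

Lemma sqr_jap z : jap z ^+ 2 = 1 + normc z ^+ 2.
Proof. by rewrite sqr_sqrtr// addr_ge0 ?sqr_ge0. Qed.

Lemma jap_normc z : jap z = normc (1 +i* normc z : C).
Proof. by rewrite /jap /= expr1n. Qed.

Lemma jap_le z : jap z <= 1 + normc z.
Proof. by rewrite jap_normc (le_trans (normc_le_ReIm _))//= normr1 ger0_norm ?normc_ge0. Qed.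

Lemma normc_le_jap z : normc z <= jap z.
Proof. by rewrite -ler_sqr ?nnegrE ?normc_ge0 ?(ltW (jap_gt0 z))// sqr_jap lerDr. Qed.

Lemma jap_lip z w : `|jap z - jap w| <= normc (z - w).
Proof.
have key a b : jap a - jap b <= normc (a - b).
  rewrite !jap_normc; apply: (le_trans (lerB_normc _ _)).
  have -> : 1 +i* normc a - (1 +i* normc b) = 0 +i* (normc a - normc b) :> C.
    by rewrite -[LHS]/((1 - 1) +i* (normc a - normc b)) subrr.
  rewrite (le_trans (normc_le_ReIm _))//= normr0 add0r ler_norml.
  by rewrite lerB_normc andbT lerNl opprB normc_distC lerB_normc.
by rewrite ler_norml key andbT lerNl opprB normc_distC key.
Qed.

Lemma chordal_fin z w : chordal (fin z) (fin w) = 2 * normc (z - w) / (jap z * jap w).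
Proof. by []. Qed.

(* Stereographic projection onto the unit sphere of [C * R]. *)
Definition stereo (x : sphere R) : C * R :=
  if x is Some z then ((2 / (1 + normc z ^+ 2))%:C * z, (normc z ^+ 2 - 1) / (1 + normc z ^+ 2))
  else (0, 1).

Definition dist3 (u v : C * R) : R := normc (normc (u.1 - v.1) +i* (u.2 - v.2) : C).

Lemma dist3_sqr u v : dist3 u v ^+ 2 = normc (u.1 - v.1) ^+ 2 + (u.2 - v.2) ^+ 2.
Proof. by rewrite /dist3 [LHS]sqr_normcE. Qed.

Lemma dist3_triangle (v u w : C * R) : dist3 u w <= dist3 u v + dist3 v w.
Proof.
rewrite {1}/dist3.
apply: (@le_trans _ _ (normc ((normc (u.1 - v.1) +i* `|u.2 - v.2|) + (normc (v.1 - w.1) +i* `|v.2 - w.2|) : C))).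
  rewrite -ler_sqr ?nnegrE ?normc_ge0// [leLHS]sqr_normcE [leRHS]sqr_normcE ReD ImD /=.
  apply: lerD; first by rewrite ler_sqr ?nnegrE ?addr_ge0 ?normc_ge0// ler_distcD.
  rewrite -real_normK ?num_real// ler_sqr ?nnegrE ?addr_ge0//.
  by rewrite (le_trans _ (ler_normD _ _))// addrA subrK.
apply: (le_trans (ler_normcD _ _)).
by rewrite /dist3 /= !real_normK ?num_real.
Qed.

Lemma dist3C u v : dist3 u v = dist3 v u.
Proof.
apply/eqP; rewrite -(eqrXn2 (n := 2))// ?normc_ge0// !dist3_sqr normc_distC.
by rewrite -[(v.2 - _) ^+ 2]sqrrN opprB.
Qed.

Lemma chordal_ge0 x y : 0 <= chordal x y.
Proof.
by case: x y => [z|] [w|] //=; rewrite divr_ge0 ?mulr_ge0 ?normc_ge0 ?sqrtr_ge0.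
Qed.

Lemma chordal_stereo x y : chordal x y = dist3 (stereo x) (stereo y).
Proof.
apply/eqP; rewrite -(eqrXn2 (n := 2)) ?normc_ge0 ?chordal_ge0// dist3_sqr.
have pos z : 1 + normc z ^+ 2 != 0 by rewrite -sqr_jap expf_neq0// gt_eqF// jap_gt0.
case: x y => [z|] [w|] /=; apply/eqP; last by rewrite !subrr expr0n /= !addr0 sqrtr0 expr0n.
- rewrite -!/(jap _) !exprMn exprVn exprMn !sqr_jap.
  move: (pos z) (pos w); rewrite !sqr_normcE !ReB !ImB.
  case: z => p q; case: w => u v /=; rewrite !mul0r !subr0 !addr0 => h1 h2.
  by field; rewrite h1 h2.
- rewrite -/(jap _) exprMn exprVn sqr_jap subr0 normcM normc_real exprMn.
  rewrite real_normK ?num_real//; have := pos z; set n := normc z ^+ 2 => h.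
  by field.
- rewrite -/(jap _) exprMn exprVn sqr_jap sub0r normc_opp normcM normc_real exprMn.
  rewrite real_normK ?num_real//; have := pos w; set n := normc w ^+ 2 => h.
  by field.
Qed.

Lemma chordalC x y : chordal x y = chordal y x.
Proof. by rewrite !chordal_stereo dist3C. Qed.

Lemma chordal_triangle y x (z : sphere R) : chordal x z <= chordal x y + chordal y z.
Proof. by rewrite !chordal_stereo dist3_triangle. Qed.

Lemma chordal_xx x : chordal x x = 0.
Proof. by case: x => [z|]//=; rewrite subrr normc0 mulr0 mul0r. Qed.

Lemma chordal_le_normc z w : chordal (fin z) (fin w) <= 2 * normc (z - w).
Proof.
rewrite chordal_fin ler_pdivrMr ?mulr_gt0 ?jap_gt0//.
rewrite -[leLHS]mulr1 ler_wpM2l ?mulr_ge0 ?normc_ge0//.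
by rewrite -[leLHS]mulr1 ler_pM ?jap_ge1.
Qed.

Lemma chordal_inftyE z : chordal (fin z) infty = 2 / jap z. Proof. by []. Qed.

(** The spherical derivative is summed along the segment from [z] to [w]. Locally the linear error
    turns [c] into 3/2 c, and [jap] may drop to 3/4 of its value, so that the factor 2 c becomes 4
    c. *)
Lemma chordal_lip f a r c : 0 < c ->
  (forall z, normc (z - a) < r -> exists2 l, has_cderiv f z l & normc l <= c * jap (f z) ^+ 2) ->
  forall z w, normc (z - a) < r -> normc (w - a) < r ->
  chordal (fin (f z)) (fin (f w)) <= 4 * c * normc (z - w).
Proof.
move=> c0 hf z w zr wr.
pose p (t : R) := z + t%:C * (w - z).
have pin t : 0 <= t <= 1 -> normc (p t - a) < r.
  move=> /andP[t0 t1]; have -> : p t - a = (1 - t)%:C * (z - a) + t%:C * (w - a).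
    by rewrite /p rmorphB /= rmorph1; ring.
  apply: (le_lt_trans (ler_normcD _ _)); rewrite !normcM !normc_real.
  rewrite (ger0_norm t0) ger0_norm ?subr_ge0//.
  have [->|t0'] := eqVneq t 0; first by rewrite subr0 mul1r mul0r addr0.
  have h1 : (1 - t) * normc (z - a) <= (1 - t) * r by rewrite ler_wpM2l ?subr_ge0// ltW.
  have h2 : t * normc (w - a) < t * r by rewrite ltr_pM2l// lt_def t0'.
  by clear -h1 h2; lra.
have dp (s t : R) : p s - p t = (s - t)%:C * (w - z) by rewrite /p rmorphB /=; ring.
have := @subadditive_local_bound _ (fun s t : R => chordal (fin (f (p s))) (fin (f (p t)))) 0 1
  (4 * c * normc (z - w)) ler01.
have -> : p 0 = z by rewrite /p rmorph0 mul0r addr0.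
have -> : p 1 = w by rewrite /p rmorph1 mul1r addrC subrK.
rewrite subr0 mulr1; apply; first by move=> *; exact: chordal_triangle.
move=> t t01; have [l hl lc] := hf _ (pin t t01).
set A := jap (f (p t)) in lc.
have A1 : 1 <= A by exact: jap_ge1.
have A0 : 0 < A := lt_le_trans ltr01 A1.
have c2 : 0 < c / 2 by rewrite divr_gt0.
have [d1 d10 h1] := hl _ c2.
have [d2 d20 h2] := has_cderiv_lip hl.
have l0 : 0 < normc l + 1 by rewrite ltr_wpDl// normc_ge0.
pose d := Num.min d1 (Num.min d2 ((4 * (normc l + 1))^-1)).
have d0 : 0 < d by rewrite !lt_min d10 d20 invr_gt0 mulr_gt0.
have key v : normc (v - p t) < d ->
    chordal (fin (f v)) (fin (f (p t))) <= 4 * c * normc (v - p t).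
  rewrite !lt_min => /and3P[v1 v2 v3].
  have {}h1 := h1 _ v1; have {}h2 := h2 _ v2.
  have B1 : normc (f v - f (p t)) <= 3 / 2 * c * A ^+ 2 * normc (v - p t).
    have -> : f v - f (p t) = (f v - f (p t) - l * (v - p t)) + l * (v - p t) by ring.
    apply: (le_trans (ler_normcD _ _)); rewrite normcM.
    have e1 : normc l * normc (v - p t) <= c * A ^+ 2 * normc (v - p t) by rewrite ler_wpM2r ?normc_ge0.
    have e2 : c / 2 * normc (v - p t) <= c / 2 * A ^+ 2 * normc (v - p t).
      by rewrite ler_wpM2r ?normc_ge0// ler_peMr ?(ltW c2)// expr_ge1// ltW.
    by clear -h1 e1 e2; lra.
  have B2 : 3 / 4 * A <= jap (f v).
    have := jap_lip (f v) (f (p t)); rewrite -/A ler_norml => /andP[b1 _].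
    have b2 : normc (f v - f (p t)) <= 4^-1.
      apply: (le_trans h2); rewrite mulrC -ler_pdivlMr// -invfM; exact: ltW.
    by clear -b1 b2 A1; lra.
  rewrite chordal_fin -/A ler_pdivrMr ?mulr_gt0 ?jap_gt0//.
  apply: (@le_trans _ _ (4 * c * normc (v - p t) * (3 / 4 * A * A))); last first.
    by rewrite ler_wpM2l ?mulr_ge0 ?normc_ge0 ?(ltW c0)// ler_wpM2r ?(ltW A0).
  by clear -B1; lra.
have wz0 : 0 < normc (w - z) + 1 by rewrite ltr_wpDl// normc_ge0.
exists (d / (normc (w - z) + 1)); first by rewrite divr_gt0.
have small q : `|q - t| < d / (normc (w - z) + 1) -> normc (p q - p t) < d.
  rewrite ltr_pdivlMr// => h; rewrite dp normcM normc_real; apply: le_lt_trans h.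
  by rewrite ler_wpM2l// lerDl.
move=> s u /andP[_ st] /andP[tu _] sd ud; split.
  apply: (le_trans (key _ (small _ _))).
    by rewrite distrC ger0_norm ?subr_ge0.
  by rewrite dp normcM normc_real distrC ger0_norm ?subr_ge0// normc_distC mulrCA mulrC.
rewrite chordalC; apply: (le_trans (key _ (small _ _))).
  by rewrite ger0_norm ?subr_ge0.
by rewrite dp normcM normc_real ger0_norm ?subr_ge0// normc_distC mulrCA mulrC.
Qed.
End Chordal.

(** * Rescaling and the proof of Landau's theorem *)

Section Landau.
Context {R : realType}.
Local Notation C := R[i].
Local Notation Re := (@complex.Re R).
Local Notation Im := (@complex.Im R).
Implicit Types (f g s : C -> C) (z w l k a b : C) (r e M c : R).

(** [cauchy_lip] with radius [r / 3], whence 216 = 3 * 72. *)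
Lemma cderiv_bound f a l r M : 0 < r -> (forall z, normc (z - a) < r -> cdiff f z) ->
  (forall z, normc (z - a) < r -> normc (f z) <= M) -> has_cderiv f a l ->
  normc l <= 216 * M / r.
Proof.
move=> r0 df fM hl; have r3 : 0 < r / 3 by rewrite divr_gt0.
have M0 : 0 <= M by apply: le_trans (fM a _); rewrite ?normc_ge0 ?subrr ?normc0.
have lip b : normc (b - a) <= r / 3 / 2 -> normc (f b - f a) <= 216 * M / r * normc (b - a).
  move=> br; have -> : 216 * M / r = 72 * M / (r / 3) by field; rewrite gt_eqF.
  apply: cauchy_lip => // z zr; first by apply: df; rewrite (lt_le_trans zr)//; clear -r0; lra.
  by apply: fM; rewrite (lt_le_trans zr)//; clear -r0; lra.
apply/ler_addgt0Pr => e e0; have [d d0 hd] := hl e e0.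
pose t := Num.min d (r / 6) / 2; have t1 : 0 < Num.min d (r / 6) by rewrite lt_min d0 divr_gt0.
have t0 : 0 < t by rewrite divr_gt0.
have [td tr] : t < d /\ t < r / 6.
  by have : t < Num.min d (r / 6); [rewrite /t; clear -t1; lra|rewrite lt_min => /andP].
have nt : normc (a + t%:C - a) = t by rewrite addrAC subrr add0r normc_real gtr0_norm.
have := hd (a + t%:C); have := lip (a + t%:C); rewrite nt => h1 /(_ td) h2.
have {}h1 := h1 (ltac:(clear -tr; lra)).
rewrite -(ler_pM2r t0) -{1}nt -normcM.
have -> : l * (a + t%:C - a) = (f (a + t%:C) - f a) - (f (a + t%:C) - f a - l * (a + t%:C - a)) by ring.
by apply: (le_trans (ler_normcB _ _)); rewrite mulrDl lerD.
Qed.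

(** A [2 ^ j]-th root of [f] is bounded by 1 and at most 1/2 at [a]; Cauchy's estimate with radius
    [r / 6] bounds its increments by [432 / r] times the distance, hence by 1/4 within
    [r / 1728]. *)
Lemma nonvanishing_small f a r j : 0 < r ->
  (forall z, normc (z - a) < r -> cdiff f z /\ f z != 0) ->
  (forall z, normc (z - a) < r -> normc (f z) <= 1) ->
  normc (f a) <= 2^-1 ^+ (2 ^ j) ->
  forall z, normc (z - a) <= r / 1728 -> normc (f z) <= (3 / 4) ^+ (2 ^ j).
Proof.
move=> r0 hf f1 fa z za; have r2 : 0 < r / 2 by rewrite divr_gt0.
have [s hs] := pow2_root j r2 (ltac:(clear -r0; lra) : r / 2 < r) hf.
have pj : (0 < 2 ^ j)%N by rewrite expn_gt0.
have sE w : normc (w - a) < r / 2 -> normc (s w) ^+ (2 ^ j) = normc (f w).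
  by move=> /hs[_ <-]; rewrite normcX.
have s1 w : normc (w - a) < r / 2 -> normc (s w) <= 1.
  move=> wr; rewrite -(ler_pXn2r pj) ?nnegrE ?normc_ge0// expr1n sE// f1//.
  by clear -wr r0; lra.
have aa : normc (a - a) < r / 2 by rewrite subrr normc0.
have sa : normc (s a) <= 2^-1 by rewrite -(ler_pXn2r pj) ?nnegrE ?normc_ge0 ?invr_ge0// sE.
have r6 : 0 < r / 6 by rewrite divr_gt0.
have := @cauchy_lip _ s a z (r / 6) 1 r6 _ _ _.
move=> /(_ _ _ _) H; have {}H : normc (s z - s a) <= 72 * 1 / (r / 6) * normc (z - a).
  apply: H; [|by move=> w wr; apply: s1; clear -wr r0; lra|by clear -za r0; lra].
  by move=> w wr; apply: (hs w _).1; clear -wr; lra.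
have h4 : normc (s z - s a) <= 4^-1.
  apply: (le_trans H); have -> : 72 * 1 / (r / 6) = 432 / r by field; rewrite gt_eqF.
  by rewrite mulrAC ler_pdivrMr//; clear -za; lra.
have sz : normc (s z) <= 3 / 4.
  by have := ler_normcD (s z - s a) (s a); rewrite subrK; clear -h4 sa; lra.
rewrite -sE; last by clear -za r0; lra.
by rewrite lerXn2r ?nnegrE ?normc_ge0.
Qed.

(** Since (3/4)^4 = 81/256 < 1/2, going back from base 3/4 to base 1/2 costs two units of [j]. *)
Lemma pow34_le j : (3 / 4) ^+ (2 ^ j.+2) <= (2^-1 : R) ^+ (2 ^ j).
Proof.
rewrite (_ : 2 ^ j.+2 = 4 * 2 ^ j)%N; last by rewrite !expnS mulnA.
rewrite exprM lerXn2r ?nnegrE ?exprn_ge0// !exprS expr0; lra.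
Qed.

(** Closeness to an omitted value spreads: the bound on the spherical derivative keeps [|g - omega|]
    below 1 on a disc of radius 1/100, and there [nonvanishing_small] applies to [g - omega]. *)
Lemma landau_step g zeta omega j : normc omega = 1 ->
  (forall z, normc (z - zeta) < 1 -> g z != omega /\
     exists2 l, has_cderiv g z l & normc l <= 4 * jap (g z) ^+ 2) ->
  normc (g zeta - omega) <= 2^-1 ^+ (2 ^ j.+2) ->
  forall z, normc (z - zeta) <= 100^-1 / 1728 -> normc (g z - omega) <= 2^-1 ^+ (2 ^ j).
Proof.
move=> o1 hg gz.
have gz4 : normc (g zeta - omega) <= 4^-1.
  apply: (le_trans gz); apply: (@le_trans _ _ (2^-1 ^+ 2)); last by rewrite expr2; lra.
  by apply: ler_wiXn2l; rewrite ?invf_le1 ?ler1n ?invr_ge0// -{1}(expn1 2) leq_exp2l.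
have gn : normc (g zeta) <= 5 / 4.
  by have := ler_normcD (g zeta - omega) omega; rewrite subrK o1; clear -gz4; lra.
have small z : normc (z - zeta) < 100^-1 -> normc (g z - omega) <= 1.
  move=> zz; have z1 : normc (z - zeta) < 1 by clear -zz; lra.
  have := @chordal_lip _ g zeta 1 4 (ltac:(by [])) (fun z zr => (hg z zr).2) z zeta z1.
  rewrite subrr normc0 => /(_ ltr01); rewrite chordal_fin ler_pdivrMr ?mulr_gt0 ?jap_gt0// => H.
  have j1 := jap_le (g z); have j2 := jap_le (g zeta).
  have j3 := ler_normcD (g z - g zeta) (g zeta); rewrite subrK in j3.
  have jj : jap (g z) * jap (g zeta) <= (9 / 4 + normc (g z - g zeta)) * (9 / 4).
    by apply: ler_pM; rewrite ?(ltW (jap_gt0 _))//; clear -j1 j2 j3 gn; lra.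
  have H2 : 2 * normc (g z - g zeta) <= 16 / 100 * ((9 / 4 + normc (g z - g zeta)) * (9 / 4)).
    apply: (le_trans H); apply: ler_pM => //; rewrite ?mulr_ge0 ?normc_ge0 ?(ltW (jap_gt0 _))//.
    by clear -zz; lra.
  have := ler_normcD (g z - g zeta) (g zeta - omega); rewrite addrA subrK.
  by clear -H2 gz4; lra.
move=> z zz; apply: le_trans (pow34_le j).
have r0 : 0 < 100^-1 :> R by rewrite invr_gt0.
apply: (@nonvanishing_small (fun w => g w - omega) zeta 100^-1 j.+2 r0).
- move=> w wz; have [gw [l hl _]] := hg w (ltac:(clear -wz; lra)).
  by split; [apply: cdiffB; [exists l|exact: cdiff_cst]|rewrite subr_eq0].
- exact: small.
- exact: gz.
- exact: zz.
Qed.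

Lemma landau_chain g omega T j n : normc omega = 1 ->
  (forall z, normc z < T + 1 -> g z != omega /\
     exists2 l, has_cderiv g z l & normc l <= 4 * jap (g z) ^+ 2) ->
  forall z zeta, normc z <= T -> normc zeta <= T ->
  normc (z - zeta) <= n%:R * (100^-1 / 1728) ->
  normc (g zeta - omega) <= 2^-1 ^+ (2 ^ (j + n.*2)) -> normc (g z - omega) <= 2^-1 ^+ (2 ^ j).
Proof.
move=> o1 hg; elim: n => [|n IH] z zeta zT zetaT.
  by rewrite mul0r le_eqVlt ltNge normc_ge0 orbF normc_eq0 subr_eq0 => /eqP ->; rewrite addn0.
move=> zz h.
pose t : R := n.+1%:R^-1.
have t0 : 0 <= t by rewrite invr_ge0.
have t1 : t <= 1 by rewrite invf_le1 ?ler1n.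
pose v := zeta + t%:C * (z - zeta).
have vT : normc v <= T.
  have -> : v = (1 - t)%:C * zeta + t%:C * z by rewrite /v rmorphB /= rmorph1; ring.
  apply: (le_trans (ler_normcD _ _)); rewrite !normcM !normc_real !ger0_norm ?subr_ge0//.
  have h1 := ler_wpM2l t0 zT; have h2 : (1 - t) * normc zeta <= (1 - t) * T by rewrite ler_wpM2l ?subr_ge0.
  by clear -h1 h2; lra.
have n0 : 0 < n.+1%:R :> R by rewrite ltr0n.
apply: (IH z v zT vT).
  have -> : z - v = (1 - t)%:C * (z - zeta) by rewrite /v rmorphB /= rmorph1; ring.
  rewrite normcM normc_real ger0_norm ?subr_ge0//.
  have -> : n%:R * (100^-1 / 1728) = (1 - t) * (n.+1%:R * (100^-1 / 1728)) :> R.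
    by rewrite /t -[n.+1]addn1 natrD in n0 *; field; rewrite gt_eqF.
  by rewrite ler_wpM2l ?subr_ge0.
apply: (@landau_step g zeta omega) => //.
- move=> w wz; apply: hg; have := ler_normcD (w - zeta) zeta; rewrite subrK.
  by clear -wz zetaT; lra.
- by move: h; rewrite doubleS !addnS.
have -> : v - zeta = t%:C * (z - zeta) by rewrite /v; ring.
rewrite normcM normc_real ger0_norm// /t mulrC ler_pdivrMr//.
by rewrite mulrC.
Qed.

(* Every unimodular number is close to a [2 ^ k]-th root of unity: divide it
   by an iterated principal square root of its [2 ^ k]-th power. *)
Lemma near_root_of_unity (k0 : nat) (u : C) : normc u = 1 ->
  exists omega : C, [/\ omega ^+ (2 ^ k0) = 1, normc omega = 1 & normc (u - omega) <= 2 * (4 / 5) ^+ k0].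
Proof.
move=> u1; pose sq n := iter n (@psqrt R).
have key n (v : C) : normc v = 1 -> [/\ sq n v ^+ (2 ^ n) = v, normc (sq n v) = 1 & normc (sq n v - 1) <= 2 * (4 / 5) ^+ n].
  move=> v1; elim: n => [|n [h1 h2 h3]].
    have -> : sq 0%N v = v by [].
    rewrite expn0 expr1 expr0 mulr1; split => //.
    by apply: (le_trans (ler_normcB _ _)); rewrite v1 normc1; lra.
  have e1 : psqrt (sq n v) ^+ 2 = sq n v by exact: psqrtK.
  have n1 : normc (psqrt (sq n v)) = 1.
    by apply/eqP; rewrite -(eqrXn2 (n := 2)) ?normc_ge0// -normcX e1 h2 expr1n.
  split => //; first by rewrite expnS exprM /= e1.
  rewrite /=; set t := psqrt _ in e1 n1 *.
  (* [Re t >= 0] and [|t| = 1] give |t + 1|^2 >= 2, so each square root reduces the distance to 1 by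
     a factor 4/5. *)
  have t5 : 5 / 4 <= normc (t + 1).
    rewrite -ler_sqr ?nnegrE ?normc_ge0// sqr_normcE ReD ImD /= addr0.
    have := sqr_normcE t; rewrite n1 expr1n; have := @Re_psqrt_ge0 R (sq n v); rewrite -/t.
    move: (Re t) (Im t) => p q p0 E; rewrite sqrrD expr1n mulr1 mulr2n; clear -p0 E; lra.
  have : normc (t - 1) * normc (t + 1) <= 2 * (4 / 5) ^+ n.
    by rewrite -normcM -subr_sqr_1 e1.
  have h5 : normc (t - 1) * (5 / 4) <= normc (t - 1) * normc (t + 1) by rewrite ler_wpM2l ?normc_ge0.
  by rewrite exprS; clear -h5; lra.
have uu : normc (u ^+ (2 ^ k0)) = 1 by rewrite normcX u1 expr1n.
have [h1 h2 h3] := key k0 _ uu; set s := sq k0 _ in h1 h2 h3.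
have s0 : s != 0 by rewrite -normc_gt0 h2.
exists (u / s); split.
- by rewrite expr_div_n h1 divff// -normc_gt0 uu.
- by rewrite normcM normcV u1 h2 invr1 mulr1.
have -> : u - u / s = u * s^-1 * (s - 1) by field.
by rewrite !normcM normcV u1 h2 invr1 !mul1r.
Qed.

(* Zalcman's rescaling: a function on the disc of radius [T + 1] whose spherical
   derivative is at most [4], and is [1] at the origin, cannot omit all the
   [2 ^ k]-th roots of unity when [k] and [T] are large. *)
Lemma rescaled_omits_roots : exists k0 : nat, forall g,
  ~ [/\ forall z, normc z < 301 -> [/\ g z != 0, g z ^+ (2 ^ k0) != 1 &
          exists2 l, has_cderiv g z l & normc l <= 4 * jap (g z) ^+ 2]
     & exists2 l, has_cderiv g 0 l & normc l = jap (g 0) ^+ 2].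
Proof.
have [c c0 cE] : exists2 c : R, 0 < c & c = 100^-1 / 1728.
  by exists (100^-1 / 1728); rewrite ?divr_gt0 ?invr_gt0 ?ltr0n.
(* 600 is the diameter of the disc of radius 300 and [c] the length of one step of [landau_chain].
   The order [2 ^ k0] is then taken so large that every unimodular number is within the tolerance of
   an [n]-step chain of some root of unity. *)
have [n hn] : exists n : nat, 600 <= n%:R * c.
  exists (Num.bound (600 / c)); rewrite -ler_pdivrMr// ltW//.
  by apply: archi_boundP; rewrite divr_ge0 ?(ltW c0) ?ler0n.
have [k0 hk] : exists k0 : nat, 2 * (4 / 5) ^+ k0 <= 2^-1 ^+ (2 ^ (3 + n.*2)) :> R.
  have := @cvg_expr R (4 / 5) (ltac:(rewrite ger0_norm//; lra)).
  move=> /cvgrPdist_le/(_ (2^-1 ^+ (2 ^ (3 + n.*2)) / 2))[|m _ /(_ m)].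
    by rewrite divr_gt0// exprn_gt0// invr_gt0.
  rewrite /= leqnn sub0r normrN => /(_ isT); rewrite ger0_norm ?exprn_ge0// => h.
  by exists m; clear -h; lra.
exists k0 => g [hg [l0 hl0 l01]].
have g0 : 1 <= normc l0 by rewrite l01 sqr_jap lerDl sqr_ge0.
have gder z : normc z < 301 -> cdiff g z by move=> /hg[_ _ [l hl _]]; exists l.
(* If [|g| = 1] somewhere, [g] is close there to an omitted root of unity, hence within 1/256 of it
   on the unit disc, and its derivative at 0 is at most 216/256. Otherwise [g] or [1 / g] is bounded
   by 1 on radius 300 and has derivative at most 216/300 at 0. Both contradict the normalisation at
   0. *)
have [[zeta [zT zeta1]]|no] := pselect (exists zeta, normc zeta < 301 - 1 /\ normc (g zeta) = 1).
  have [omega [om1 om2 om3]] := near_root_of_unity k0 zeta1.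
  have hg' z : normc z < 300 + 1 -> g z != omega /\
      exists2 l, has_cderiv g z l & normc l <= 4 * jap (g z) ^+ 2.
    move=> zr; have [|_ gz hl] := hg z; first by clear -zr; lra.
    by split => //; apply: contraNneq gz => ->; rewrite om1.
  have small z : normc z < 1 -> normc (g z - omega) <= 2^-1 ^+ (2 ^ 3).
    move=> z1; apply: (@landau_chain g omega 300 3 n om2 hg' z zeta).
    - by clear -z1; lra.
    - by clear -zT; lra.
    - by rewrite -cE; apply: le_trans hn; have := ler_normcB z zeta; clear -z1 zT; lra.
    - exact: le_trans om3 hk.
  have hd : has_cderiv (fun w => g w + - omega) 0 (l0 + 0) := has_cderivD hl0 (has_cderiv_cst _ _).
  have := @cderiv_bound _ 0 _ 1 (2^-1 ^+ (2 ^ 3)) ltr01 _ _ hd.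
  rewrite addr0 => H; have {}H : normc l0 <= 216 * 2^-1 ^+ (2 ^ 3) / 1.
    apply: H => z; rewrite subr0 => z1; last exact: small.
    by apply: cdiffB; [apply: gder; clear -z1; lra|exact: cdiff_cst].
  have E : 2^-1 ^+ (2 ^ 3) = 256^-1 :> R by rewrite (_ : (2 ^ 3 = 8)%N)// !exprS expr0; field.
  by rewrite E in H; clear -H g0; lra.
have p300 : 0 < 300 :> R by rewrite ltr0n.
have p0 : normc (0 : C) < 300 by rewrite normc0.
have p1 : normc (0 : C) < 301 by rewrite normc0 ltr0n.
have bound h : (forall z, normc z < 300 -> cdiff h z) -> (forall z, normc z < 300 -> normc (h z) <= 1) ->
    forall l, has_cderiv h 0 l -> normc l < 1.
  move=> dh h1 l hl; have H := @cderiv_bound h 0 l 300 1 p300 _ _ hl.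
  have {}H : normc l <= 216 * 1 / 300 by apply: H => z; rewrite subr0; [exact: dh|exact: h1].
  by clear -H; lra.
have side z : normc z < 300 -> (normc (g z) < 1) = (normc (g 0) < 1).
  move=> zr; have cg v : cball 0 300 v -> {for v, continuous (fun w => normc (g w))}.
    rewrite /cball /= subr0 => vr; have := cdiff_continuous (gder v (ltac:(clear -vr; lra))).
    by move=> cgv; exact: (@continuous_comp _ _ _ g (fun w => normc w) v cgv (@continuous_normc R _)).
  have Bz : cball 0 300 z by rewrite /cball /= subr0.
  have B0 : cball (0 : C) 300 0 by rewrite /cball /= subrr.
  have cross u v : cball 0 300 u -> cball 0 300 v -> normc (g u) < 1 -> ~~ (normc (g v) < 1) -> False.
    move=> Bu Bv u1; rewrite -leNgt le_eqVlt => /predU1P[v1|v1].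
      by apply: no; exists v; move: Bv; rewrite /cball /= subr0; split => //; clear -Bv; lra.
    have [c' Bc' c1] := connected_ivt (@cball_connected R 0 300) cg Bu Bv u1 v1.
    by apply: no; exists c'; move: Bc'; rewrite /cball /= subr0; split => //; clear -Bc'; lra.
  by apply/idP/idP => h; apply: contraT => h'; exfalso; [apply: (cross z 0)|apply: (cross 0 z)].
have zlt z : normc z < 300 -> normc z < 301 by clear; lra.
have [small|big] := boolP (normc (g 0) < 1).
  have := bound g (fun z zr => gder z (zlt z zr)) _ _ hl0.
  rewrite ltNge g0 => H; suff : false by []; apply: H => z zr.
  by apply: ltW; rewrite side.
have g00 : g 0 != 0 by have [] := hg 0 p1.
have hinv := has_cderivV g00 hl0.
have := bound (fun w => (g w)^-1) _ _ _ hinv.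
rewrite normcM normc_opp normcV normcX l01 => H.
have {}H : (normc (g 0) ^+ 2)^-1 * jap (g 0) ^+ 2 < 1.
  apply: H => z zr; have [gz0 _ [l hl _]] := hg z (zlt z zr).
    by apply: cdiffV => //; exists l.
  rewrite normcV invf_le1 ?normc_gt0// leNgt side//.
move: H; rewrite mulrC ltr_pdivrMr ?exprn_gt0 ?normc_gt0// mul1r sqr_jap.
by rewrite ltNge lerDr ler01.
Qed.

(** A [2 ^ k0]-th root [s] of [f] omits 0 and all [2 ^ k0]-th roots of unity. Its spherical
    derivative, weighted by the distance to the circle of radius 1/2, is bounded: rescaling about a
    point that almost attains a large supremum would give a function excluded by
    [rescaled_omits_roots]. *)
Theorem landau : exists2 K, 0 < K & forall f a r l, 0 < r ->
  (forall z, normc (z - a) < r -> cdiff f z /\ f z != 0 /\ f z != 1) ->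
  has_cderiv f a l -> normc l <= K / r * jap (f a) ^+ 2.
Proof.
have [k0 no] := rescaled_omits_roots.
set N := (2 ^ k0)%N in no; have N0 : (0 < N)%N by rewrite expn_gt0.
(* If the supremum exceeds [4 * 301], the rescaled disc of radius 301 fits into half the distance
   from [z0] to the circle, where the weight drops by at most a factor 2; together with the factor 2
   lost in the choice of [z0] this gives the bound 4. *)
have [m0 m00 m0E] : exists2 m0 : R, 0 < m0 & m0 = 4 * 301.
  by exists (4 * 301); rewrite ?mulr_gt0 ?ltr0n.
suff H : forall f l, (forall z, normc z < 1 -> cdiff f z /\ f z != 0 /\ f z != 1) ->
    has_cderiv f 0 l -> normc l <= N%:R * 4 * m0 * jap (f 0) ^+ 2.
  exists (N%:R * 4 * m0); first by rewrite !mulr_gt0 ?ltr0n.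
  move=> f a r l r0 hf hl; have rC : normc r%:C = r by rewrite normc_real gtr0_norm.
  pose h z := f (a + r%:C * z).
  have dlin z : has_cderiv (fun z => a + r%:C * z) z (0 + r%:C * 1).
    exact: has_cderivD (has_cderiv_cst a z) (has_cderivZ r%:C (has_cderiv_id z)).
  have hh : has_cderiv h 0 (l * r%:C).
    have := dlin 0; rewrite add0r mulr1 => d1.
    by apply: (has_cderiv_comp d1); rewrite mulr0 addr0.
  have := H h _ _ hh; rewrite /h mulr0 addr0 normcM rC => {}H.
  rewrite -(ler_pM2r r0).
  have -> : N%:R * 4 * m0 / r * jap (f a) ^+ 2 * r = N%:R * 4 * m0 * jap (f a) ^+ 2.
    by move: (N%:R * 4 * m0) => q; field; rewrite gt_eqF.
  apply: H => z z1.
  have zr : normc (a + r%:C * z - a) < r.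
    by rewrite addrAC subrr add0r normcM rC -[ltRHS]mulr1 ltr_pM2l.
  have [[k hk] fz] := hf _ zr; split => //; eexists; exact: has_cderiv_comp (dlin z) hk.
move=> f l hf hl.
have p34 : 0 < 3 / 4 :> R by rewrite divr_gt0.
have [|s hs] := @pow2_root R f 0 1 (3 / 4) k0 p34 (ltac:(lra)).
  by move=> z; rewrite subr0 => /hf[dz [z0 _]].
rewrite -/N in hs.
have {}hs z : normc z < 3 / 4 -> cdiff s z /\ s z ^+ N = f z by move=> h; apply: hs; rewrite subr0.
pose ds z : C := xget 0 [set k | has_cderiv s z k].
have dsP z : normc z < 3 / 4 -> has_cderiv s z (ds z) by move=> /hs[h _]; exact: (xgetPex 0 h).
have s0 z : normc z < 3 / 4 -> s z != 0.
  move=> zr; have [_ e] := hs z zr; have [_ [+ _]] := hf z (ltac:(clear -zr; lra)).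
  by rewrite -e expf_eq0 N0.
have [M sM] : exists M, forall z, normc z <= 2 / 3 -> normc (s z) <= M.
  have cK : compact (cdisc (0 : C) (2 / 3)).
    by apply: (@bounded_closed_compact_c R _ (2 / 3)); [exact: closed_cdisc|exact: subset_refl].
  have cn : {within cdisc 0 (2 / 3), continuous (fun z => normc (s z))}.
    apply: continuous_in_subspaceT => z /set_mem; rewrite /cdisc /= subr0 => zr.
    have csz := cdiff_continuous (hs z (ltac:(clear -zr; lra))).1.
    exact: (@continuous_comp _ _ _ s (fun w => normc w) z csz (@continuous_normc R _)).
  have [|c _ H] := compact_EVT_max _ cK cn.
    by exists 0; apply/cball_cdisc/cball_center; rewrite divr_gt0.
  by exists (normc (s c)) => z zr; apply: H; apply/mem_set; rewrite /cdisc /= subr0.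
pose sd z := normc (ds z) / jap (s z) ^+ 2.
have sd0 z : 0 <= sd z by rewrite divr_ge0 ?normc_ge0 ?sqr_ge0.
pose E := [set t | exists2 z, normc z < 2^-1 & t = (2^-1 - normc z) * sd z].
have h0 : normc (0 : C) < 2^-1 by rewrite normc0 invr_gt0.
have E0 : E (2^-1 * sd 0) by exists 0; rewrite // normc0 subr0.
have hE : has_sup E.
  split; first by exists (2^-1 * sd 0).
  exists (216 * M * 6) => t [z zr ->].
  have dz : normc (ds z) <= 216 * M / (6^-1).
    apply: (@cderiv_bound s z (ds z) 6^-1 M); rewrite ?invr_gt0//.
    - move=> w wz; apply: (hs w _).1; have := ler_normcD (w - z) z; rewrite subrK.
      by clear -wz zr; lra.
    - move=> w wz; apply: sM; have := ler_normcD (w - z) z; rewrite subrK.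
      by clear -wz zr; lra.
    - by apply: dsP; clear -zr; lra.
  rewrite invrK in dz; apply: le_trans dz.
  have sdz : sd z <= normc (ds z).
    rewrite /sd ler_pdivrMr ?exprn_gt0 ?jap_gt0// ler_peMr ?normc_ge0//.
    by rewrite expr_ge1 ?jap_ge1// (ltW (jap_gt0 _)).
  apply: le_trans sdz; rewrite -[leRHS]mul1r ler_wpM2r//.
  by have := normc_ge0 z; lra.
set m := sup E.
have Em z : normc z < 2^-1 -> (2^-1 - normc z) * sd z <= m.
  by move=> zr; apply: sup_upper_bound => //; exists z.
have mm0 : m <= m0.
  rewrite leNgt; apply/negP => mm.
  have m2 : 0 < m / 2 by rewrite divr_gt0// (lt_trans m00).
  have [_ [z0 z0r ->] z0m] := sup_adherent m2 hE; rewrite -/m in z0m.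
  have {}z0m : m / 2 < (2^-1 - normc z0) * sd z0 by clear -z0m; lra.
  set q := 2^-1 - normc z0 in z0m; have q0 : 0 < q by rewrite subr_gt0.
  have sdp : 0 < sd z0.
    by rewrite -(pmulr_rgt0 _ q0); exact: lt_trans m2 z0m.
  pose d := (sd z0)^-1; have d0 : 0 < d by rewrite invr_gt0.
  have dq : d * 301 <= q / 2.
    rewrite /d mulrC ler_pdivrMr//.
    have -> : q / 2 * sd z0 = (q * sd z0) / 2 by rewrite mulrAC.
    by move: mm z0m; rewrite m0E; clear; lra.
  pose g z := s (z0 + d%:C * z).
  have nd : normc d%:C = d by rewrite normc_real gtr0_norm.
  have dlin z : has_cderiv (fun z => z0 + d%:C * z) z (d%:C).
    have := has_cderivD (has_cderiv_cst z0 z) (has_cderivZ d%:C (has_cderiv_id z)).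
    by rewrite add0r mulr1.
  have inn z : normc z < 301 -> normc (z0 + d%:C * z) <= normc z0 + q / 2.
    move=> zr; apply: (le_trans (ler_normcD _ _)); rewrite lerD2l normcM nd.
    by apply: le_trans dq; rewrite ler_wpM2l ?(ltW d0) ?(ltW zr).
  have qE : normc z0 = 2^-1 - q by rewrite /q; ring.
  have gd z : normc z < 301 -> has_cderiv g z (ds (z0 + d%:C * z) * d%:C).
    move=> zr; apply: (has_cderiv_comp (dlin z)); apply: dsP.
    by have := inn z zr; rewrite qE; clear -q0; lra.
  have dj z w : normc w * d = sd z * d * jap (s z) ^+ 2 -> normc w = sd z * jap (s z) ^+ 2.
    by move=> h; apply: (mulIf (lt0r_neq0 d0)); rewrite h mulrAC.
  apply: (no g); split.
    move=> z zr; have iz := inn z zr; have z34 : normc (z0 + d%:C * z) < 3 / 4 by move: iz; rewrite qE; clear -q0; lra.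
    split; first exact: s0.
      rewrite /g (hs _ z34).2; have [_ [_ //]] := hf (z0 + d%:C * z) (ltac:(clear -z34; lra)).
    exists (ds (z0 + d%:C * z) * d%:C); first exact: gd.
    rewrite normcM nd -/(g z); have sv := Em (z0 + d%:C * z).
    have hz : normc (z0 + d%:C * z) < 2^-1 by move: iz; rewrite qE; clear -q0; lra.
    have {}sv := sv hz.
    have b1 : q / 2 * sd (z0 + d%:C * z) <= m.
      apply: le_trans sv; rewrite ler_wpM2r//; move: iz; rewrite qE; clear; lra.
    have b2 : sd (z0 + d%:C * z) * d <= 4.
      rewrite /d ler_pdivrMr// -(ler_pM2l q0); move: b1 z0m; clear; lra.
    have -> : normc (ds (z0 + d%:C * z)) = sd (z0 + d%:C * z) * jap (g z) ^+ 2.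
      by rewrite /sd divfK// expf_neq0// gt_eqF// jap_gt0.
    by rewrite mulrAC ler_wpM2r ?sqr_ge0.
  exists (ds z0 * d%:C).
    by have := gd 0; rewrite normc0 mulr0 addr0; apply; rewrite ltr0n.
  rewrite normcM nd /g mulr0 addr0 /d /sd invf_div mulrCA divff ?mulr1//.
  by apply: contraTneq sdp => h; rewrite /sd h mul0r ltxx.
have sd00 : sd 0 <= 2 * m0.
  by have := Em 0 h0; rewrite normc0 subr0; clear -mm0; lra.
have z34 : normc (0 : C) < 3 / 4 by rewrite normc0.
have E1 : l = N%:R * s 0 ^+ N.-1 * ds 0.
  apply: (has_cderiv_unique hl).
  have := has_cderivX N.-1 (dsP 0 z34); rewrite prednK// => h.
  apply: (has_cderiv_local (d := 3 / 4) _ _ h) => // w; rewrite subr0 => wr.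
  exact: (hs w wr).2.
rewrite E1 !normcM normc_nat normcX -!mulrA ler_wpM2l ?ler0n//.
have -> : normc (ds 0) = sd 0 * jap (s 0) ^+ 2.
  by rewrite /sd divfK// expf_neq0// gt_eqF// jap_gt0.
rewrite -(hs 0 z34).2 !sqr_jap !normcX.
set x := normc (s 0); have x0 : 0 <= x by exact: normc_ge0.
(* This passes from [s] back to [f = s ^+ N], whose derivative is [N * s ^+ N.-1] times that of [s]:
   for [x <= 1] the left side is bounded, for [x > 1] the power [x ^+ N] dominates. *)
have key : x ^+ N.-1 * (1 + x ^+ 2) <= 2 * (1 + (x ^+ N) ^+ 2).
  have N1 : N = N.-1.+1 by rewrite prednK.
  have [x1|x1] := leP x 1.
    have h1 : x ^+ N.-1 <= 1 by rewrite exprn_ile1.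
    have h2 : x ^+ 2 <= 1 by rewrite exprn_ile1.
    have h3 : x ^+ N.-1 * (1 + x ^+ 2) <= 1 * 2 by apply: ler_pM; rewrite ?addr_ge0 ?exprn_ge0//; lra.
    by have := sqr_ge0 (x ^+ N); lra.
  have h1 : x ^+ N.-1 <= x ^+ N by rewrite ler_weXn2l ?(ltW x1)// leq_pred.
  have h2 : x ^+ N.-1 * x ^+ 2 = x ^+ N * x by rewrite expr2 mulrA [in RHS]N1 exprSr.
  have h3 : x <= x ^+ N by rewrite -{1}(expr1 x) ler_weXn2l ?(ltW x1).
  have xN : 1 <= x ^+ N by rewrite (le_trans (ltW x1)).
  rewrite mulrDr mulr1 h2 expr2.
  have h4 : x ^+ N * x <= x ^+ N * x ^+ N by rewrite ler_wpM2l// exprn_ge0.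
  have h5 : x ^+ N <= x ^+ N * x ^+ N by rewrite ler_peMr// exprn_ge0.
  by clear -h1 h4 h5; lra.
have := ler_pM (sd0 0) (_ : 0 <= x ^+ N.-1 * (1 + x ^+ 2)) sd00 key.
rewrite mulr_ge0 ?exprn_ge0 ?addr_ge0 ?exprn_ge0// => /(_ isT).
move: (x ^+ N.-1) (x ^+ 2) ((x ^+ N) ^+ 2) (sd 0) (m0) => u1 u2 u3 u4 u5 h.
have -> : u1 * (u4 * (1 + u2)) = u4 * (u1 * (1 + u2)) by ring.
by apply: (le_trans h); rewrite le_eqVlt; apply/orP; left; apply/eqP; ring.
Qed.
End Landau.

(** * Plane topology *)

Section PlaneTopology.
Context {R : realType}.
Local Notation C := R[i].
Local Notation Re := (@complex.Re R).
Local Notation Im := (@complex.Im R).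
Implicit Types (f g s : C -> C) (z w l k a b : C) (A B X Y : set C) (r e M c : R).

Lemma closure_normcP A z : closure A z <-> forall e, 0 < e -> exists2 w, A w & normc (w - z) < e.
Proof.
split=> [cA e e0|H U /nbhs_normcP[e e0 eU]].
  by have [w [Aw wz]] := cA _ (nbhs_cball z e0); exists w.
by have [w Aw wz] := H e e0; exists w; split => //; exact: eU.
Qed.

Lemma closed_notin A z : closed A -> ~ A z -> exists2 e, 0 < e & forall w, normc (w - z) < e -> ~ A w.
Proof.
move=> cA Az; have oA : open (~` A) by exact: closed_openC.
by have [e e0 h] := (open_normcP (~` A)).1 oA z Az; exists e.
Qed.

Lemma cderiv_lip f a r c : 0 < c ->
  (forall z, normc (z - a) < r -> exists2 l, has_cderiv f z l & normc l <= c) ->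
  forall z w, normc (z - a) < r -> normc (w - a) < r ->
  normc (f z - f w) <= 2 * c * normc (z - w).
Proof.
move=> c0 hf z w zr wr.
pose p (t : R) := z + t%:C * (w - z).
have pin t : 0 <= t <= 1 -> normc (p t - a) < r.
  by move=> t01; apply: (segc_cball zr wr); exists t.
have dp (s t : R) : p s - p t = (s - t)%:C * (w - z) by rewrite /p rmorphB /=; ring.
have := @subadditive_local_bound _ (fun s t : R => normc (f (p s) - f (p t))) 0 1
  (2 * c * normc (z - w)) ler01.
have -> : p 0 = z by rewrite /p rmorph0 mul0r addr0.
have -> : p 1 = w by rewrite /p rmorph1 mul1r addrC subrK.
rewrite subr0 mulr1; apply; first by move=> x y t; exact: ler_distcD.
move=> t t01; have [l hl lc] := hf _ (pin t t01).
have [d d0 h1] := hl _ c0.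
have key v : normc (v - p t) < d -> normc (f v - f (p t)) <= 2 * c * normc (v - p t).
  move=> /h1 hv; have -> : f v - f (p t) = (f v - f (p t) - l * (v - p t)) + l * (v - p t) by ring.
  apply: (le_trans (ler_normcD _ _)); rewrite normcM.
  have e1 : normc l * normc (v - p t) <= c * normc (v - p t) by rewrite ler_wpM2r ?normc_ge0.
  by clear -hv e1; lra.
have wz0 : 0 < normc (w - z) + 1 by rewrite ltr_wpDl// normc_ge0.
exists (d / (normc (w - z) + 1)); first by rewrite divr_gt0.
have small q : `|q - t| < d / (normc (w - z) + 1) -> normc (p q - p t) < d.
  rewrite ltr_pdivlMr// => h; rewrite dp normcM normc_real; apply: le_lt_trans h.
  by rewrite ler_wpM2l// lerDl.
move=> s u /andP[_ st] /andP[tu _] sd ud; split.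
  apply: (le_trans (key _ (small _ _))).
    by rewrite distrC ger0_norm ?subr_ge0.
  by rewrite dp normcM normc_real distrC ger0_norm ?subr_ge0// normc_distC mulrCA mulrC.
rewrite normc_distC; apply: (le_trans (key _ (small _ _))).
  by rewrite ger0_norm ?subr_ge0.
by rewrite dp normcM normc_real ger0_norm ?subr_ge0// normc_distC mulrCA mulrC.
Qed.

Definition dset A z : R := inf [set normc (z - a) | a in A].

Lemma has_inf_dset A z : A !=set0 -> has_inf [set normc (z - a) | a in A].
Proof.
move=> [a Aa]; split; first by exists (normc (z - a)), a.
by exists 0 => _ [b _ <-]; exact: normc_ge0.
Qed.

Lemma dset_ge0 A z : A !=set0 -> 0 <= dset A z.
Proof.
move=> A0; apply: lb_le_inf; first by case: (has_inf_dset z A0).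
by move=> _ [b _ <-]; exact: normc_ge0.
Qed.

Lemma dset_le A z a : A a -> dset A z <= normc (z - a).
Proof.
move=> Aa; apply: inf_lbound; last by exists a.
by apply: (has_inf_dset z _).2; exists a.
Qed.

Lemma dset_lip A z w : A !=set0 -> `|dset A z - dset A w| <= normc (z - w).
Proof.
move=> A0; have key u v : dset A u - dset A v <= normc (u - v).
  rewrite lerBlDr -lerBlDl; apply: lb_le_inf; first by case: (has_inf_dset v A0).
  move=> _ [b Ab <-]; have := dset_le u Ab; have := ler_distcD v u b; lra.
by rewrite ler_norml key andbT lerNl opprB normc_distC key.
Qed.

Lemma dset_in A z : A z -> dset A z = 0.
Proof.
move=> Az; apply/eqP; rewrite eq_le dset_ge0 ?andbT; last by exists z.
by have := dset_le z Az; rewrite subrr normc0.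
Qed.

Lemma dset_out A z : closed A -> A !=set0 -> ~ A z -> 0 < dset A z.
Proof.
move=> cA A0 Az; have [e e0 h] := closed_notin cA Az.
apply: (lt_le_trans e0); apply: lb_le_inf; first by case: (has_inf_dset z A0).
by move=> _ [b Ab <-]; rewrite leNgt normc_distC; apply/negP => /h.
Qed.

Lemma dset_continuous A : A !=set0 -> continuous (dset A).
Proof.
move=> A0 z; apply/continuous_normcRP => e e0; exists e => // w wz.
exact: le_lt_trans (dset_lip w z A0) wz.
Qed.

Lemma plane_urysohn A B : closed A -> closed B -> A !=set0 -> B !=set0 -> A `&` B = set0 ->
  exists u : C -> R, [/\ continuous u, forall z, 0 <= u z <= 1, forall z, A z -> u z = 0 & forall z, B z -> u z = 1].
Proof.
move=> cA cB A0 B0 AB.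
have pos z : 0 < dset A z + dset B z.
  have [Az|Az] := pselect (A z); last by rewrite ltr_pwDl ?dset_out// dset_ge0.
  rewrite ltr_wpDl ?dset_ge0// dset_out// => Bz.
  by have : (A `&` B) z by []; rewrite AB.
exists (fun z => dset A z / (dset A z + dset B z)); split.
- move=> z; apply: (@continuousM _ _ (dset A) (fun z => (dset A z + dset B z)^-1)); first exact: dset_continuous.
  apply: (@continuousV _ _ (fun z => dset A z + dset B z)); first by rewrite gt_eqF.
  by apply: (@continuousD _ _ _ (dset A) (dset B)); exact: dset_continuous.
- move=> z; rewrite divr_ge0 ?dset_ge0 ?(ltW (pos z))//= ler_pdivrMr// mul1r lerDl.
  exact: dset_ge0.
- by move=> z Az; rewrite dset_in// mul0r.
- by move=> z Bz; rewrite (dset_in Bz) addr0 divff// -[dset A z]addr0 -{1}(dset_in Bz) gt_eqF.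
Qed.

Lemma plane_separation A B : closed A -> closed B -> A !=set0 -> B !=set0 -> A `&` B = set0 ->
  exists U V : set C, [/\ open U, open V, A `<=` U, B `<=` V & U `&` V = set0].
Proof.
move=> cA cB A0 B0 AB; have [u [cu _ uA uB]] := plane_urysohn cA cB A0 B0 AB.
exists (u @^-1` [set x | x < 2^-1]), (u @^-1` [set x | 2^-1 < x]); split.
- by apply: open_comp; [move=> z _; exact: cu|exact: open_lt].
- by apply: open_comp; [move=> z _; exact: cu|exact: open_gt].
- by move=> z /uA /= ->; rewrite invr_gt0.
- by move=> z /uB /= ->; rewrite invf_lt1 ?ltr1n.
- by apply/seteqP; split=> // z [/= h1 h2]; have := lt_trans h1 h2; rewrite ltxx.
Qed.

Lemma closed_in_separation X : closed X -> ~ connected X ->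
  exists A B, [/\ closed A, closed B, A !=set0, B !=set0 & X = A `|` B /\ A `&` B = set0].
Proof.
move=> cX /connectedPn[E [E0 EU [sE1 sE2]]].
exists (E false), (E true); split => //.
- suff -> : E false = closure (E false) by exact: closed_closure.
  apply/seteqP; split; first exact: subset_closure.
  move=> z cz; have : X z by rewrite (closure_id X).1//; apply: closureS cz => w Ew; rewrite EU; left.
  rewrite EU => -[//|Ez]; exfalso.
  by have : (closure (E false) `&` E true) z by []; rewrite sE1.
- suff -> : E true = closure (E true) by exact: closed_closure.
  apply/seteqP; split; first exact: subset_closure.
  move=> z cz; have : X z by rewrite (closure_id X).1//; apply: closureS cz => w Ew; rewrite EU; right.
  rewrite EU => -[Ez|//]; exfalso.
  by have : (E false `&` closure (E true)) z by []; rewrite sE2.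
split => //; apply/seteqP; split=> // z [Ez Fz].
by have : (closure (E false) `&` E true) z by [split => //; exact: subset_closure]; rewrite sE1.
Qed.

Lemma connected_open_cover X U V : connected X -> open U -> open V -> X `<=` U `|` V ->
  U `&` V = set0 -> X `&` U !=set0 -> X `&` V !=set0 -> False.
Proof.
move=> cX oU oV XUV UV [a [Xa Ua]] [b [Xb Vb]].
have : U b; last by move=> Ub; have : (U `&` V) b by []; rewrite UV.
apply: (@connected_locally_constant C X U cX _ a b) => // x Xx.
have [Ux|Vx] := XUV x Xx.
  by have := open_nbhs_nbhs (conj oU Ux); apply: filterS => y Uy _.
have Ux : ~ U x by move=> Ux; have : (U `&` V) x by []; rewrite UV.
have := open_nbhs_nbhs (conj oV Vx); apply: filterS => y Vy _; split => // Uy.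
by have : (U `&` V) y by []; rewrite UV.
Qed.

Lemma nested_compact_meet (F : nat -> set C) (O : set C) : (forall n, compact (F n)) ->
  (forall n, F n.+1 `<=` F n) -> open O -> \bigcap_n F n `<=` O -> exists n, F n `<=` O.
Proof.
move=> cF dF oO FO; apply: contrapT => no.
have dec m n : (m <= n)%N -> F n `<=` F m.
  elim: n => [|n IH]; first by rewrite leqn0 => /eqP->.
  by rewrite leq_eqVlt => /predU1P[->//|/IH h] z /dF /h.
have ex n : exists z, F n z /\ ~ O z.
  by apply: contrapT => h; apply: no; exists n => z Fz; apply: contrapT => Oz; apply: h; exists z.
have [x hx] := choice ex.
have F0 : (x @ \oo) (F 0%N) by exists 0%N => // n _; exact: (dec 0%N n (leq0n n)) _ (hx n).1.
have [z [F0z cz]] := cF 0%N (x @ \oo) _ F0.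
have Oz : O z.
  apply: FO => n _; have cl : closed (F n) by exact: compact_closed_c.
  rewrite (closure_id (F n)).1// => U nU.
  have [w [Fw Uw]] := cz (F n) U (ltac:(by exists n => // m /= nm; exact: (dec n m nm) _ (hx m).1)) nU.
  by exists w.
have [w [Ow nw]] := cz (~` O) O (ltac:(by exists 0%N => // m _; exact: (hx m).2)) (open_nbhs_nbhs (conj oO Oz)).
exact: Ow nw.
Qed.

(** The tangent half-angle parametrisation, which misses only -1; with its negative it covers the
    unit circle, and connectedness needs no trigonometry. *)
Definition circ (t : R) : C := (1 - t ^+ 2) / (1 + t ^+ 2) +i* (2 * t / (1 + t ^+ 2)).

Lemma circ_continuous : continuous circ.
Proof.
move=> t; have d0 (x : R) : 1 + x ^+ 2 != 0 by rewrite gt_eqF// ltr_pwDl ?sqr_ge0.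
have cs : {for t, continuous (fun x : R => x ^+ 2)} by exact: exprn_continuous.
have cd : {for t, continuous (fun x : R => (1 + x ^+ 2)^-1)}.
  apply: (@continuousV _ _ (fun x : R => 1 + x ^+ 2)) => //.
  by apply: cvgD; [exact: cvg_cst|exact: cs].
have c1 : {for t, continuous (fun x : R => (1 - x ^+ 2) / (1 + x ^+ 2))}.
  by apply: (cvgM _ cd); apply: cvgB; [exact: cvg_cst|exact: cs].
have c2 : {for t, continuous (fun x : R => 2 * x / (1 + x ^+ 2))}.
  by apply: (cvgM _ cd); apply: cvgM; [exact: cvg_cst|exact: cvg_id].
have := @continuous_Complex R (((1 - t ^+ 2) / (1 + t ^+ 2)), (2 * t / (1 + t ^+ 2))).
by apply: continuous_comp (cvg_pair c1 c2).
Qed.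

Lemma circ_normc t : normc (circ t) = 1.
Proof.
apply/eqP; rewrite -(eqrXn2 (n := 2)) ?normc_ge0// sqr_normcE /= expr1n; apply/eqP.
have d0 : 1 + t ^+ 2 != 0 by rewrite gt_eqF// ltr_pwDl ?sqr_ge0.
by field.
Qed.

Lemma circ_surj (u : C) : normc u = 1 -> exists t, u = circ t \/ u = - circ t.
Proof.
have pos (w : C) : normc w = 1 -> 0 <= Re w -> exists t, w = circ t.
  move=> w1 w0; have := sqr_normcE w; rewrite w1 expr1n; case: w w0 {w1} => x y /= x0 E.
  exists (y / (1 + x)); have x1 : 1 + x != 0 by rewrite gt_eqF// ltr_pwDl.
  have y2 : y ^+ 2 = (1 - x) * (1 + x) by rewrite (_ : y ^+ 2 = 1 - x ^+ 2); [ring|rewrite E; ring].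
  have e1 : (y / (1 + x)) ^+ 2 = (1 - x) / (1 + x) by rewrite exprMn exprVn y2; field.
  rewrite /circ e1; have e2 : 1 + (1 - x) / (1 + x) = 2 / (1 + x) by field.
  by rewrite e2; congr (_ +i* _); field; rewrite x1.
move=> u1; have [u0|u0] := leP 0 (Re u); first by have [t ->] := pos u u1 u0; exists t; left.
have u0' : 0 <= Re (- u).
  have -> : Re (- u) = - Re u by case: (u).
  by rewrite oppr_ge0 ltW.
have [t E] := pos (- u) (etrans (normc_opp u) u1) u0'.
by exists t; right; rewrite -E opprK.
Qed.

Lemma unit_circle_connected : connected [set u : C | normc u = 1].
Proof.
pose A := circ @` [set: R]; pose B := (fun t => - circ t) @` [set: R].
have -> : [set u : C | normc u = 1] = A `|` B.
  apply/seteqP; split=> [u /circ_surj[t [->|->]]|_ [[t _ <-]|[t _ <-]]].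
  - by left; exists t.
  - by right; exists t.
  - exact: circ_normc.
  - exact: etrans (normc_opp _) (circ_normc t).
have cR : connected [set: R].
  by apply/connected_intervalP.
apply: connectedU.
- exists 'i; split.
    exists 1 => //; rewrite /circ expr1n subrr mul0r mulr1; congr (_ +i* _).
    by rewrite divff// gt_eqF// addr_gt0.
  exists (-1) => //; rewrite -[RHS]opprK; congr (- _).
  rewrite /circ sqrrN expr1n subrr mul0r mulrN1 mulNr divff; last by rewrite gt_eqF// addr_gt0.
  by apply/eqP; rewrite eq_complex /= oppr0 !eqxx.
- by apply: (image_connected cR) => t _; exact: circ_continuous.
apply: (image_connected cR) => t _; apply: cvgN; exact: circ_continuous.
Qed.

Lemma exterior_connected a r : 0 <= r -> connected [set z | r < normc (z - a)].
Proof.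
move=> r0; pose f (u : C) := a + (r + 1)%:C * u.
have r1 : 0 < r + 1 by lra.
have cf u : {for u, continuous f}.
  by apply: cdiff_continuous; apply: cdiffD; [exact: cdiff_cst|apply: cdiffM; [exact: cdiff_cst|exact: cdiff_id]].
have nr : normc (r + 1)%:C = r + 1 by rewrite normc_real gtr0_norm.
pose S := f @` [set u : C | normc u = 1].
have cS : connected S by apply: image_connected; [exact: unit_circle_connected|move=> u _; exact: cf].
pose P z := S `|` segc z (a + ((r + 1) / normc (z - a))%:C * (z - a)).
have -> : [set z | r < normc (z - a)] = \bigcup_(z in [set z | r < normc (z - a)]) P z.
  apply/seteqP; split=> [z zr|z [w /= wr]]; first by exists z => //; right; exact: segc_left.
  have w0 : 0 < normc (w - a) by exact: le_lt_trans wr.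
  move=> [[u /= u1 <-]|[t]] /=; first by rewrite /f addrAC subrr add0r normcM nr u1 mulr1; lra.
  rewrite in_itv /= => /andP[t0 t1] <-.
  have -> : w + t%:C * (a + ((r + 1) / normc (w - a))%:C * (w - a) - w) - a =
    (1 - t + t * ((r + 1) / normc (w - a)))%:C * (w - a).
    by rewrite rmorphD rmorphM rmorphB /= rmorph1; ring.
  rewrite normcM normc_real ger0_norm; last first.
    by rewrite addr_ge0 ?subr_ge0// mulr_ge0// divr_ge0 ?normc_ge0// ltW.
  rewrite mulrDl -mulrA divfK ?gt_eqF//.
  have [->|t0'] := eqVneq t 0; first by rewrite subr0 mul1r mul0r addr0.
  have h1 : (1 - t) * r <= (1 - t) * normc (w - a) by rewrite ler_wpM2l ?subr_ge0// ltW.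
  have h2 : t * r < t * (r + 1) by rewrite ltr_pM2l ?ltrDl// lt_def t0'.
  by clear -h1 h2; lra.
apply: bigcup_connected.
  exists (f 1) => z zr; left; exists 1 => //; exact: normc1.
move=> z /= zr; have z0 : 0 < normc (z - a) by exact: le_lt_trans zr.
apply: connectedU => //; last exact: segc_connected.
exists (a + ((r + 1) / normc (z - a))%:C * (z - a)); split; last exact: segc_right.
exists ((normc (z - a))^-1%:C * (z - a)).
  by rewrite /= normcM normc_real ger0_norm ?invr_ge0 ?normc_ge0// mulVf// gt_eqF.
by rewrite /f mulrA -rmorphM.
Qed.
End PlaneTopology.

(** * Polynomials and filled Julia sets *)

Section Polynomials.
Context {R : realType}.
Local Notation C := R[i].
Local Notation Re := (@complex.Re R).
Local Notation Im := (@complex.Im R).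
Implicit Types (p q : {poly C}) (z w u a : C) (A B X : set C) (r e M s t : R).

Lemma pred_size_gt0 p : (1 < size p)%N -> (0 < (size p).-1)%N.
Proof. by case: (size p) => [|[]]. Qed.

Lemma pred_size_gt1 p : (2 < size p)%N -> (1 < (size p).-1)%N.
Proof. by case: (size p) => [|[|[]]]. Qed.

Lemma prod_ge (rs : seq C) (f : C -> R) r : 0 <= r -> (forall x, x \in rs -> r <= f x) ->
  r ^+ size rs <= \prod_(x <- rs) f x.
Proof.
move=> r0; elim: rs => [|x rs IH] h; first by rewrite big_nil expr0.
rewrite big_cons /= exprS ler_pM ?exprn_ge0//; first by apply: h; rewrite mem_head.
by apply: IH => y yr; apply: h; rewrite in_cons yr orbT.
Qed.

Lemma prod_le (rs : seq C) (f : C -> R) r : (forall x, x \in rs -> 0 <= f x <= r) ->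
  0 <= \prod_(x <- rs) f x <= r ^+ size rs.
Proof.
elim: rs => [|x rs IH] h; first by rewrite big_nil expr0 ler01 lexx.
have /andP[x0 xr] := h x (mem_head _ _).
have /andP[i0 i1] : 0 <= \prod_(x <- rs) f x <= r ^+ size rs.
  by apply: IH => y yr; apply: h; rewrite in_cons yr orbT.
by rewrite big_cons /= exprS mulr_ge0//= ler_pM.
Qed.

Lemma prod_lt (rs : seq C) (f g : C -> R) : (0 < size rs)%N ->
  (forall x, x \in rs -> 0 <= f x < g x) -> \prod_(x <- rs) f x < \prod_(x <- rs) g x.
Proof.
elim: rs => [//|x rs IH] _ h.
have /andP[x0 xr] := h x (mem_head _ _).
have h' y : y \in rs -> 0 <= f y < g y by move=> yr; apply: h; rewrite in_cons yr orbT.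
rewrite !big_cons; case: rs IH h' {h} => [_ _|y rs IH h']; first by rewrite !big_nil !mulr1.
apply: ltr_pM => //; last exact: IH.
rewrite big_seq_cond; apply: prodr_ge0 => i /andP[/h' /andP[]] //.
Qed.

Lemma normc_prod (rs : seq C) (f : C -> C) :
  normc (\prod_(x <- rs) f x) = \prod_(x <- rs) normc (f x).
Proof. by elim: rs => [|x rs IH]; rewrite ?big_nil ?normc1// !big_cons normcM IH. Qed.

(** Over the algebraically closed field [R[i]], [|p z - w|] is a product of distances to the
    preimages of [w]. Most estimates for polynomials below are read off from this product. *)
Lemma poly_factor p w : (1 < size p)%N -> exists rs : seq C,
  [/\ size rs = (size p).-1, forall x, (x \in rs) = (p.[x] == w)
    & forall z, normc (p.[z] - w) = normc (lead_coef p) * \prod_(x <- rs) normc (z - x)].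
Proof.
move=> p1; have sw : (size (- w%:P) < size p)%N.
  by rewrite size_polyN (leq_ltn_trans (size_polyC_leq1 _)).
have [rs E] := closed_field_poly_normal (p - w%:P).
have lc : lead_coef (p - w%:P) = lead_coef p by rewrite lead_coefDl.
have sz : size (p - w%:P) = size p by rewrite size_polyDl.
have l0 : lead_coef p != 0 by rewrite lead_coef_eq0 -size_poly_gt0 (ltn_trans _ p1).
rewrite lc in E; exists rs; split.
- by move: sz; rewrite E size_scale// size_prod_XsubC => <-.
- move=> x; rewrite -root_prod_XsubC -(rootZ _ _ l0) -E rootE.
  by rewrite hornerD hornerN hornerC subr_eq0.
move=> z; have -> : p.[z] - w = (p - w%:P).[z] by rewrite hornerD hornerN hornerC.
rewrite E hornerZ normcM horner_prod normc_prod; congr (_ * _).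
by apply: eq_bigr => x _; rewrite hornerXsubC.
Qed.

Lemma lead_gt0 p : (1 < size p)%N -> 0 < normc (lead_coef p).
Proof. by move=> p1; rewrite normc_gt0 lead_coef_eq0 -size_poly_gt0 (ltn_trans _ p1). Qed.

(** Quantitative openness: if every preimage of [w] were at distance at least [r] from [z], each
    factor of [|p z - w|] would be at least [r]. *)
Lemma poly_open p r : (1 < size p)%N -> 0 < r -> forall z w,
  normc (w - p.[z]) < normc (lead_coef p) * r ^+ (size p).-1 ->
  exists2 x, normc (x - z) < r & p.[x] = w.
Proof.
move=> p1 r0 z w; have [rs [sz mem E]] := poly_factor w p1.
rewrite normc_distC E -sz ltNge => /negP h.
have [x xr xz] : exists2 x, x \in rs & normc (x - z) < r.
  apply: contrapT => no; apply: h; rewrite ler_wpM2l ?normc_ge0// prod_ge ?(ltW r0)// => x xr.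
  by rewrite leNgt normc_distC; apply/negP => xz; apply: no; exists x.
by exists x => //; apply/eqP; rewrite -mem.
Qed.

Lemma roots_bound (rs : seq C) : exists2 r, 0 < r & forall x, x \in rs -> normc x <= r.
Proof.
elim: rs => [|y rs [r r0 h]]; first by exists 1.
exists (r + normc y) => [|x]; first by rewrite ltr_pwDl ?normc_ge0.
rewrite in_cons => /predU1P[->|/h hx]; first by rewrite lerDr ltW.
by rewrite (le_trans hx)// lerDl normc_ge0.
Qed.

Lemma poly_lower p : (1 < size p)%N -> exists2 r, 0 < r & forall z, r <= normc z ->
  normc (lead_coef p) * (normc z - r) ^+ (size p).-1 <= normc p.[z].
Proof.
move=> p1; have [rs [sz mem E]] := poly_factor 0 p1.
have [r r0 h] := roots_bound rs; exists r => // z rz.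
rewrite -[p.[z]]subr0 E -sz ler_wpM2l ?normc_ge0// prod_ge ?subr_ge0// => x /h xr.
by have := lerB_normc z x; lra.
Qed.

Lemma poly_growth p M : (1 < size p)%N -> exists2 r, 0 < r & forall z, r <= normc z -> M < normc p.[z].
Proof.
move=> p1; have [r r0 h] := poly_lower p1; have l0 := lead_gt0 p1.
pose c := 1 + `|M| / normc (lead_coef p); have c1 : 1 <= c by rewrite lerDl divr_ge0 ?normc_ge0.
exists (r + c) => [|z zr]; first by lra.
have rz : r <= normc z by lra.
apply: lt_le_trans (h z rz); apply: le_lt_trans (ler_norm M) _.
rewrite mulrC -ltr_pdivrMr//; apply: (@lt_le_trans _ _ c); first by rewrite /c; lra.
apply: (@le_trans _ _ (c ^+ (size p).-1)).
  by rewrite -[leLHS]expr1 ler_weXn2l// pred_size_gt0.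
by rewrite lerXn2r ?nnegrE; lra.
Qed.

Lemma poly_escape p : (2 < size p)%N -> exists2 r, 1 <= r & forall z, r <= normc z ->
  2 * normc z <= normc p.[z].
Proof.
move=> p2; have p1 : (1 < size p)%N by exact: ltn_trans p2.
have [r r0 h] := poly_lower p1; have l0 := lead_gt0 p1; set l := normc _ in l0 h.
pose c := 1 + 4 / l; have c1 : 1 <= c by rewrite lerDl divr_ge0// ltW.
exists (2 * r + 2 * c) => [|z zr]; first by lra.
have rz : r <= normc z by lra.
apply: le_trans (h z rz).
have z2 : normc z / 2 <= normc z - r by lra.
have z1 : 1 <= normc z - r by lra.
apply: (@le_trans _ _ (l * (normc z - r) ^+ 2)); last first.
  by rewrite ler_wpM2l ?(ltW l0)// ler_weXn2l// pred_size_gt1.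
have lc : 4 <= l * (normc z - r).
  apply: (@le_trans _ _ (l * c)); last by rewrite ler_wpM2l ?(ltW l0)//; lra.
  by rewrite /c mulrDr mulr1 mulrCA divff ?gt_eqF// mulr1 lerDr ltW.
rewrite expr2 mulrA; apply: (@le_trans _ _ (4 * (normc z - r))); first by lra.
by rewrite ler_wpM2r//; lra.
Qed.

Lemma poly_continuous p z : {for z, continuous (fun w => p.[w])}.
Proof. exact: cdiff_continuous (cdiff_horner p z). Qed.

Lemma normc_poly_continuous p : continuous (fun w => normc p.[w]).
Proof.
move=> z.
exact: (@continuous_comp _ _ _ (fun w => p.[w]) (fun w => normc w) z (@poly_continuous p z) (@continuous_normc R _)).
Qed.

Lemma sublevel_closed p M : closed [set z | normc p.[z] <= M].
Proof.
have -> : [set z | normc p.[z] <= M] = (fun z => normc p.[z]) @^-1` [set x | x <= M] by [].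
apply: closed_comp; last exact: closed_le.
by move=> z _; exact: normc_poly_continuous.
Qed.

Lemma sublevel_compact p M : (1 < size p)%N -> compact [set z | normc p.[z] <= M].
Proof.
move=> p1; have [r r0 h] := poly_growth M p1.
apply: (@bounded_closed_compact_c R _ r); first exact: sublevel_closed.
move=> z /= zM; rewrite /cdisc /= subr0 leNgt; apply/negP => /ltW /h.
by rewrite ltNge zM.
Qed.

Definition lev p s : set C := [set z | normc p.[z] = s].

Lemma lev_closed p s : closed (lev p s).
Proof.
have -> : lev p s = (fun z => normc p.[z]) @^-1` [set x | x = s] by [].
apply: closed_comp; last exact: closed_eq.
by move=> z _; exact: normc_poly_continuous.
Qed.

Lemma lev_compact p s : (1 < size p)%N -> compact (lev p s).
Proof.
move=> p1; apply: (subclosed_compact (@lev_closed p s) (sublevel_compact (M := s) p1)).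
by move=> z /= ->.
Qed.

Definition unitc z : C := (normc z)^-1%:C * z.

Lemma normc_unitc z : z != 0 -> normc (unitc z) = 1.
Proof.
rewrite -normc_gt0 => z0; rewrite normcM normc_real ger0_norm ?invr_ge0 ?normc_ge0//.
by rewrite mulVf// gt_eqF.
Qed.

Lemma unitcK z : z != 0 -> z = (normc z)%:C * unitc z.
Proof. by rewrite -normc_eq0 => z0; rewrite mulrA -rmorphM divff// mul1r. Qed.

Lemma unitc_lip z w : z != 0 -> w != 0 ->
  normc (unitc w - unitc z) <= 2 * normc (w - z) / normc z.
Proof.
move=> z0 w0; have nz : 0 < normc z by rewrite normc_gt0.
have nw : 0 < normc w by rewrite normc_gt0.
have -> : unitc w - unitc z = (normc z)^-1%:C * (w - z) + ((normc w)^-1 - (normc z)^-1)%:C * w.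
  by rewrite /unitc rmorphB /=; ring.
apply: (le_trans (ler_normcD _ _)); rewrite !normcM !normc_real.
have -> : `|(normc w)^-1 - (normc z)^-1| * normc w = `|normc z - normc w| / normc z.
  have -> : (normc w)^-1 - (normc z)^-1 = (normc z - normc w) / (normc z * normc w).
    by field; rewrite !gt_eqF.
  rewrite normrM (ger0_norm (x := (_ * _)^-1)) ?invr_ge0 ?mulr_ge0 ?normc_ge0//.
  by field; rewrite !gt_eqF.
rewrite ger0_norm ?invr_ge0 ?normc_ge0//.
have h : `|normc z - normc w| <= normc (w - z).
  rewrite ler_norml lerNl opprB lerB_normc/= normc_distC; exact: lerB_normc.
rewrite mulrC -mulrDl ler_pM2r ?invr_gt0//; lra.
Qed.

Lemma unitc_continuous z : z != 0 -> {for z, continuous unitc}.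
Proof.
move=> z0; have nz : 0 < normc z by rewrite normc_gt0.
apply/continuous_normcP => e e0; exists (Num.min (normc z) (e * normc z / 3)).
  by rewrite lt_min nz !mulr_gt0// invr_gt0.
move=> w; rewrite lt_min => /andP[w1 w2].
have w0 : w != 0 by apply: contraTneq w1 => ->; rewrite sub0r normc_opp ltxx.
apply: le_lt_trans (unitc_lip z0 w0) _; rewrite ltr_pdivrMr//.
by have : 0 < e * normc z; [rewrite mulr_gt0|move: w2; rewrite ltr_pdivlMr//; lra].
Qed.

Lemma circle_arc w1 w2 s : 0 < s -> normc w1 = s -> normc w2 = s -> normc (w2 - w1) < s ->
  exists X, [/\ connected X, X w1, X w2 &
    forall w, X w -> normc w = s /\ normc (w - w1) <= 2 * normc (w2 - w1)].
Proof.
move=> s0 e1 e2 d12.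
have seg w : segc w1 w2 w -> w != 0 /\ normc (w - w1) <= normc (w2 - w1).
  move=> [t /=]; rewrite in_itv /= => /andP[t0 t1] E.
  have le : normc (w - w1) <= normc (w2 - w1).
    rewrite -E addrAC subrr add0r normcM normc_real ger0_norm// -[leRHS]mul1r.
    by rewrite ler_wpM2r// normc_ge0.
  split=> //; apply: contraTneq le => ->; rewrite sub0r normc_opp -ltNge.
  by rewrite e1.
have E1 w : normc w = s -> s%:C * unitc w = w.
  by move=> ws; rewrite -{1}ws -unitcK// -normc_gt0 ws.
exists ((fun w => s%:C * unitc w) @` segc w1 w2); split.
- apply: (image_connected (@segc_connected R w1 w2)) => w /seg[w0 _].
  by apply: ccontinuousM; [exact: (@ccontinuous_cst R)|exact: unitc_continuous].
- by exists w1; [exact: segc_left|exact: E1].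
- by exists w2; [exact: segc_right|exact: E1].
move=> _ [w /seg[w0 wd] <-]; split.
  by rewrite normcM normc_unitc// mulr1 normc_real gtr0_norm.
have w10 : w1 != 0 by rewrite -normc_gt0 e1.
have -> : s%:C * unitc w - w1 = s%:C * (unitc w - unitc w1) by rewrite mulrBr (E1 w1).
rewrite normcM normc_real gtr0_norm//.
apply: (@le_trans _ _ (s * (2 * normc (w - w1) / normc w1))).
  by rewrite ler_pM2l// unitc_lip.
by rewrite e1 mulrC divfK ?gt_eqF// ler_pM2l.
Qed.

Lemma connected_closed_cover X A B : connected X -> closed A -> closed B -> X `<=` A `|` B ->
  A `&` B = set0 -> X `&` A !=set0 -> X `&` B !=set0 -> False.
Proof.
move=> cX cA cB XAB AB [a [Xa Aa]] [b [Xb Bb]].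
have disj z : A z -> B z -> False by move=> Az Bz; have : (A `&` B) z by []; rewrite AB.
have : A b; last by move=> Ab; exact: (disj b).
apply: (@connected_locally_constant C X A cX _ a b) => // x Xx.
have [Ax|Bx] := XAB x Xx.
  have : nbhs x (~` B) by apply: open_nbhs_nbhs; split; [exact: closed_openC|move=> /(disj x Ax)].
  by apply: filterS => y By Xy; split=> // _; have [//|/By] := XAB y Xy.
have : nbhs x (~` A) by apply: open_nbhs_nbhs; split; [exact: closed_openC|move=> /disj; exact].
apply: filterS => y By Xy; split; first by move=> /By.
by move=> /disj /(_ Bx).
Qed.

Lemma ray_monotone u x (r r1 r2 : R) : 0 < r -> normc u = 1 -> normc x <= r -> r <= r1 -> r1 < r2 ->
  normc (r1%:C * u - x) < normc (r2%:C * u - x).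
Proof.
move=> r0 u1 xr rr1 r12; rewrite -(ltr_pXn2r (n := 2)) ?nnegrE ?normc_ge0//.
have e1 : Re u ^+ 2 + Im u ^+ 2 = 1 by rewrite -sqr_normcE u1 expr1n.
have e2 : Re x ^+ 2 + Im x ^+ 2 <= r ^+ 2.
  by rewrite -sqr_normcE lerXn2r ?nnegrE ?normc_ge0// ltW.
rewrite !sqr_normcE; case: u x e1 e2 {u1 xr} => [a b] [c d] /= e1 e2.
have h0 : 0 <= (r * a - c) ^+ 2 + (r * b - d) ^+ 2 by rewrite addr_ge0 ?sqr_ge0.
have h : r * (a * c + b * d) <= r * r by move: h0 e2; rewrite -[X in _ -> _ <= X -> _]mulr1 -e1; nra.
have {}h : a * c + b * d <= r by rewrite -(ler_pM2l r0).
have -> : (r2 * a - 0 * b - c) ^+ 2 + (r2 * b + 0 * a - d) ^+ 2 =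
  (r1 * a - 0 * b - c) ^+ 2 + (r1 * b + 0 * a - d) ^+ 2 +
  (r2 - r1) * ((r2 + r1) * (a ^+ 2 + b ^+ 2) - 2 * (a * c + b * d)) by ring.
rewrite e1 ltrDl mulr_gt0 ?subr_gt0//; lra.
Qed.

(** Outside a disc that contains the roots, [|p|] increases strictly along rays, so each ray meets
    the level exactly once. Thus [unitc] is a continuous bijection from the compact level to the
    unit circle, and a separation of the level would separate the circle. *)
Lemma large_level_connected p : (1 < size p)%N ->
  exists T, forall t, T < t -> connected (lev p t).
Proof.
move=> p1; have [rs [sz mem E0]] := poly_factor 0 p1.
have E z : normc p.[z] = normc (lead_coef p) * \prod_(x <- rs) normc (z - x).
  by rewrite -E0 subr0.
have [r r0 hr] := roots_bound rs.
have l0 := lead_gt0 p1.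
exists (normc (lead_coef p) * (r + r + r) ^+ size rs) => t Tt.
have out z : lev p t z -> r + r < normc z.
  move=> zt; rewrite ltNge; apply/negP => zr; move: Tt; rewrite -zt E ltNge => /negP; apply.
  rewrite ler_wpM2l ?normc_ge0//.
  apply: (andP (prod_le (rs := rs) (f := fun x => normc (z - x)) (r := r + r + r) _)).2 => x /hr xr.
  by rewrite normc_ge0/= (le_trans (ler_normcB _ _))// lerD.
have mono u r1 r2 : normc u = 1 -> r <= r1 -> r1 < r2 -> normc p.[r1%:C * u] < normc p.[r2%:C * u].
  move=> u1 rr1 r12; rewrite !E ltr_pM2l//; apply: prod_lt.
    by rewrite sz pred_size_gt0.
  by move=> x /hr xr; rewrite normc_ge0/=; exact: ray_monotone xr rr1 r12.
have uniq z w : lev p t z -> lev p t w -> unitc z = unitc w -> z = w.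
  move=> zt wt uzw; have := out z zt; have := out w wt => wr zr.
  have z0 : z != 0 by rewrite -normc_gt0; lra.
  have w0 : w != 0 by rewrite -normc_gt0; lra.
  have uz := normc_unitc z0; rewrite (unitcK z0) (unitcK w0) -uzw.
  have [h|h|->//] := ltgtP (normc z) (normc w).
    have := mono _ _ _ uz (ltac:(lra) : r <= normc z) h.
    by rewrite {2}uzw -!unitcK// zt wt ltxx.
  have := mono _ _ _ uz (ltac:(lra) : r <= normc w) h.
  by rewrite {1}uzw -!unitcK// zt wt ltxx.
have [g g0 hg] := poly_growth t p1.
have ex u : normc u = 1 -> exists2 z, lev p t z & unitc z = u.
  move=> u1; have nr (c : R) : 0 < c -> normc (c%:C * u) = c.
    by move=> c0; rewrite normcM u1 mulr1 normc_real gtr0_norm.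
  have cu : continuous (fun c : R => normc p.[c%:C * u]).
    move=> c; apply: (@continuous_comp _ _ _ (fun c : R => c%:C * u) (fun z => normc p.[z])).
      have := @continuous_line R 0 u c.
      by rewrite (_ : (fun t => 0 + t%:C * (u - 0)) = (fun c : R => c%:C * u)) // funeqE => x; rewrite add0r subr0.
    exact: normc_poly_continuous.
  pose c1 := r + r; pose c2 := r + r + g.
  have [c /=] : exists2 c, `[c1, c2]%classic c & normc p.[c%:C * u] = t.
    apply: (@connected_ivt _ _ `[c1, c2]%classic (fun c : R => normc p.[c%:C * u]) t _ (fun c _ => cu c) c1 c2).
    - exact: segment_connected.
    - by rewrite /= in_itv /= lexx /c1 /c2; lra.
    - by rewrite /= in_itv /= lexx andbT /c1 /c2; lra.
    - apply: le_lt_trans Tt; rewrite E ler_wpM2l ?normc_ge0//.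
      apply: (andP (prod_le (rs := rs) (f := fun x => normc (c1%:C * u - x)) (r := r + r + r) _)).2 => x /hr xr.
      by rewrite normc_ge0/= (le_trans (ler_normcB _ _))// lerD// nr// /c1; lra.
    - by apply: hg; rewrite nr /c2; lra.
  rewrite in_itv /= => /andP[cc _] ct; have c0 : 0 < c by rewrite /c1 in cc; lra.
  exists (c%:C * u) => //; rewrite /unitc nr// mulrA -rmorphM mulVf ?mul1r//.
  by rewrite gt_eqF.
apply: contrapT => nc.
have [A [B [cA cB A0 B0 [EAB AB]]]] := closed_in_separation (@lev_closed p t) nc.
have ne0 z : lev p t z -> z != 0 by move=> /out zr; rewrite -normc_gt0; lra.
have im (Y : set C) : closed Y -> Y `<=` lev p t -> closed (unitc @` Y).
  move=> cY Yl; apply: compact_closed_c; apply: continuous_compact.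
    by apply: continuous_in_subspaceT => z /set_mem Yz; apply: unitc_continuous; exact/ne0/Yl.
  exact: subclosed_compact cY (@lev_compact p t p1) Yl.
have Al : A `<=` lev p t by rewrite EAB; left.
have Bl : B `<=` lev p t by rewrite EAB; right.
apply: (@connected_closed_cover [set u : C | normc u = 1] (unitc @` A) (unitc @` B)).
- exact: unit_circle_connected.
- exact: im.
- exact: im.
- move=> u /ex[z]; rewrite EAB => -[Az|Bz] <-; [left|right]; by exists z.
- apply/seteqP; split=> // u [[z Az <-] [w Bw wz]].
  have zw := uniq _ _ (Bl _ Bw) (Al _ Az) wz.
  have : (A `&` B) z by split=> //; rewrite -zw.
  by rewrite AB.
- by case: A0 => z Az; exists (unitc z); split; [exact/normc_unitc/ne0/Al|exists z].
- by case: B0 => z Bz; exists (unitc z); split; [exact/normc_unitc/ne0/Bl|exists z].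
Qed.

(** On small discs around [x] in [K], [p] minus its linear part at [x] has Lipschitz constant at
    most half of a lower bound for [|p'|] on [K], so [p] is injective there. *)
Lemma poly_inj_uniform p (K : set C) : compact K -> (forall z, K z -> p^`().[z] != 0) ->
  exists2 d, 0 < d & forall x, K x -> forall u v, normc (u - x) < d -> normc (v - x) < d ->
    p.[u] = p.[v] -> u = v.
Proof.
move=> cK hK; have : compact ((fun z => (p^`().[z])^-1) @` K).
  apply: continuous_compact => //; apply: continuous_in_subspaceT => z /set_mem /hK pz.
  exact: ccontinuousV pz (@poly_continuous _ z).
move=> /compact_bounded_c[m0 m00 hm]; pose m := m0^-1.
have m_gt0 : 0 < m by rewrite invr_gt0.
have pm z : K z -> m <= normc p^`().[z].
  move=> Kz; have := hm _ (ex_intro2 _ _ z Kz erefl); rewrite /cdisc /= subr0 normcV.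
  by rewrite -[leRHS]invrK lef_pV2 ?posrE ?invr_gt0 ?normc_gt0 ?hK.
have m4 : 0 < m / 4 by rewrite divr_gt0.
have [d d0 hd] := uniform_continuity m4 cK (fun z _ => @poly_continuous p^`() z).
exists d => // x Kx u v ux vx puv.
pose f w := p.[w] - p^`().[x] * w.
have fl w : normc (w - x) < d -> exists2 l, has_cderiv f w l & normc l <= m / 4.
  move=> wx; exists (p^`().[w] - p^`().[x]); last exact/ltW/hd.
  have h := has_cderivD (has_cderiv_horner p w) (has_cderivZ (- p^`().[x]) (has_cderiv_id w)).
  move: h; rewrite mulr1; apply: eq_has_cderiv => y; rewrite /f; ring.
have := cderiv_lip m4 fl ux vx.
have -> : f u - f v = p^`().[x] * (v - u) by rewrite /f puv; ring.
rewrite normcM (normc_distC v u) => h; apply/eqP; rewrite -subr_eq0 -normc_eq0.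
have h1 : m * normc (u - v) <= normc p^`().[x] * normc (u - v) by rewrite ler_wpM2r ?normc_ge0 ?pm.
have h2 : m * normc (u - v) <= 0.
  have h3 : 2 * (m / 4) * normc (u - v) = m * normc (u - v) / 2 by field.
  move: h; rewrite h3 => h; clear -h h1; set y := normc p^`().[x] * _ in h h1; lra.
by rewrite eq_le normc_ge0 andbT; move: h2; rewrite pmulr_rle0.
Qed.

(** The arc of the circle of radius [s] from [p a] to [p b] is lifted near [a], uniquely because [p]
    is injective there. The values with a lift in [A] form a relatively clopen set, so the lift [b]
    of [p b] would be in [A]. Hence the two halves of a separated level cannot come close to each
    other. *)
Lemma level_separation p A B s d : (1 < size p)%N -> 0 < s -> 0 < d -> closed A -> closed B ->
  lev p s = A `|` B -> A `&` B = set0 ->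
  forall a b, A a -> B b -> normc (b - a) < d -> 
  (forall u v, normc (u - a) < d -> normc (v - a) < d -> p.[u] = p.[v] -> u = v) ->
  normc (p.[b] - p.[a]) < s -> 2 * normc (p.[b] - p.[a]) < normc (lead_coef p) * d ^+ (size p).-1 -> False.
Proof.
move=> p1 s0 d0 cA cB E AB a b Aa Bb ab inj ps pl.
have disj z : A z -> B z -> False by move=> Az Bz; have : (A `&` B) z by []; rewrite AB.
have pa : normc p.[a] = s by have : lev p s a by rewrite E; left.
have pb : normc p.[b] = s by have : lev p s b by rewrite E; right.
have [X [cX Xa Xb hX]] := circle_arc s0 pa pb ps.
have l0 := lead_gt0 p1.
suff : exists a', [/\ A a', normc (a' - a) < d & p.[a'] = p.[b]].
  by move=> [a' [Aa' a'd /inj]] => /(_ a'd ab) E'; apply: (disj b) => //; rewrite -E'.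
apply: (@connected_locally_constant C X (fun w => exists a', [/\ A a', normc (a' - a) < d & p.[a'] = w]) cX _ p.[a]) => //; last first.
  by exists a; split => //; rewrite subrr normc0.
move=> w0 Xw0; have [ws wd] := hX _ Xw0.
have [y0 y0a py0] := poly_open p1 d0 (le_lt_trans wd pl).
have [AB0|AB0] : (A `|` B) y0 by rewrite -E /lev /= py0.
- have [r1 r10 h1] := closed_notin cB (fun By => disj y0 AB0 By).
  pose r := Num.min r1 (d - normc (y0 - a)).
  have r0 : 0 < r by rewrite lt_min r10 subr_gt0.
  apply/nbhs_normcP; exists (normc (lead_coef p) * r ^+ (size p).-1).
    by rewrite mulr_gt0// exprn_gt0.
  move=> w /= ww Xw; rewrite -py0 in ww.
  have [y yy0 py] := poly_open p1 r0 ww; move: yy0; rewrite lt_min => /andP[yr yd].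
  split=> _; first by exists y0.
  exists y; split => //; last by have := ler_distcD y0 y a; lra.
  have [ws' _] := hX _ Xw.
  have [//|/(h1 _ yr)//] : (A `|` B) y by rewrite -E /lev /= py.
- have [r1 r10 h1] := closed_notin cA (fun Ay => disj y0 Ay AB0).
  pose r := Num.min r1 (d - normc (y0 - a)).
  have r0 : 0 < r by rewrite lt_min r10 subr_gt0.
  apply/nbhs_normcP; exists (normc (lead_coef p) * r ^+ (size p).-1).
    by rewrite mulr_gt0// exprn_gt0.
  move=> w /= ww Xw; rewrite -py0 in ww.
  have [y yy0 py] := poly_open p1 r0 ww; move: yy0; rewrite lt_min => /andP[yr yd].
  split; move=> [a' [Aa' a'd pa']]; exfalso.
    have ya : normc (y - a) < d by have := ler_distcD y0 y a; lra.
    have ya' : a' = y by apply: inj => //; rewrite pa' py.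
    by apply: (h1 _ yr); rewrite -ya'.
  have ya' : a' = y0 by apply: inj => //; rewrite pa' py0.
  by apply: (disj y0) => //; rewrite -ya'.
Qed.

(** Without critical points between the levels, two halves [A], [B] of [lev p t] are at least [dl]
    apart by [level_separation]. Each level lies within [dl / 3] of the other, so being within
    [dl / 3] of [A] is a locally constant property on the connected [lev p s], and it spreads to
    points near [B]. *)
Lemma level_step p s1 s2 : (1 < size p)%N -> 0 < s1 ->
  (forall c, s1 <= normc p.[c] <= s2 -> p^`().[c] != 0) ->
  exists2 e, 0 < e & forall s t, s1 <= s <= s2 -> s1 <= t <= s2 -> `|t - s| < e ->
    connected (lev p s) -> connected (lev p t).
Proof.
move=> p1 s10 crit; have l0 := lead_gt0 p1.
pose K := [set z | s1 <= normc p.[z] <= s2].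
have cK : compact K.
  apply: (subclosed_compact _ (sublevel_compact (M := s2) p1)); last by move=> z /andP[].
  have -> : K = [set z | normc p.[z] <= s2] `&` ((fun z => normc p.[z]) @^-1` [set x | s1 <= x]).
    by apply/seteqP; split=> z /= => [/andP[]|[h1 h2]]; [|apply/andP].
  apply: closedI; first exact: sublevel_closed.
  apply: closed_comp; last exact: closed_ge.
  by move=> z _; exact: normc_poly_continuous.
have [d d0 inj] := poly_inj_uniform cK crit.
pose k := Num.min s1 (normc (lead_coef p) * d ^+ (size p).-1 / 2).
have k0 : 0 < k by rewrite lt_min s10 divr_gt0// mulr_gt0// exprn_gt0.
have [d1 d10 hd1] := uniform_continuity k0 cK (fun z _ => @poly_continuous p z).
pose dl := Num.min d d1; have dl0 : 0 < dl by rewrite lt_min d0.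
have dl3 : 0 < dl / 3 by rewrite divr_gt0.
exists (normc (lead_coef p) * (dl / 3) ^+ (size p).-1).
  by rewrite mulr_gt0// exprn_gt0.
move=> s t s12 t12 st cs; apply: contrapT => nc.
have s0 : 0 < s by lra.
have t0 : 0 < t by lra.
have [A [B [cA cB [a0 Aa0] [b0 Bb0] [E AB]]]] := closed_in_separation (@lev_closed p t) nc.
have far a b : A a -> B b -> normc (b - a) < dl -> False.
  move=> Aa Bb; rewrite lt_min => /andP[ad ad1].
  have pa : lev p t a by rewrite E; left.
  have Ka : K a by rewrite /K /= pa.
  have := hd1 _ _ Ka ad1; rewrite lt_min => /andP[h1 h2].
  apply: (level_separation p1 t0 d0 cA cB E AB Aa Bb ad (inj _ Ka)); lra.
have near_lev s' t' z : 0 < s' -> 0 < t' -> `|t' - s'| < normc (lead_coef p) * (dl / 3) ^+ (size p).-1 ->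
    lev p s' z -> exists2 x, lev p t' x & normc (x - z) < dl / 3.
  move=> s0' t0' st' zs; have := @poly_open p (dl / 3) p1 dl3 z ((t' / s')%:C * p.[z]).
  case.
    have -> : (t' / s')%:C * p.[z] - p.[z] = ((t' - s') / s')%:C * p.[z].
      by rewrite mulrBl divff ?gt_eqF// rmorphB rmorph1; ring.
    by rewrite normcM zs normc_real normrM normfV (gtr0_norm s0') divfK ?gt_eqF.
  move=> x xz px; exists x => //; rewrite /lev /= px normcM zs normc_real gtr0_norm ?divr_gt0//.
  by rewrite divfK ?gt_eqF.
have [za zas zaa] := near_lev t s a0 t0 s0 (ltac:(by rewrite distrC)) (ltac:(by rewrite E; left)).
have [zb zbs zbb] := near_lev t s b0 t0 s0 (ltac:(by rewrite distrC)) (ltac:(by rewrite E; right)).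
pose Q z := exists2 a, A a & normc (a - z) < dl / 3.
have step y z : lev p s y -> lev p s z -> normc (z - y) < dl / 3 -> Q y -> Q z.
  move=> ys zs yz [a Aa ay].
  have [x xt xz] := near_lev s t z s0 t0 st zs.
  have [Ax|Bx] : (A `|` B) x by rewrite -E.
    by exists x.
  exfalso; apply: (far a x Aa Bx).
  by have := ler_distcD z x a; have := ler_distcD y z a; rewrite (normc_distC y a); lra.
have : Q zb.
  apply: (@connected_locally_constant C (lev p s) Q cs _ za) => //; last first.
    by exists a0; rewrite // normc_distC.
  move=> z zs; apply/nbhs_normcP; exists (dl / 3) => // y /= yz ys.
  by split; apply: step => //; rewrite // normc_distC.
move=> [a Aa azb]; apply: (far a b0 Aa Bb0).
by have := ler_distcD zb b0 a; rewrite (normc_distC b0 zb) (normc_distC zb a); lra.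
Qed.

(** Large levels are connected, and connectedness is carried down to [t] in finitely many uses of
    [level_step], since no critical point has a level above [M]. This stands in for a covering
    argument outside the critical values. *)
Lemma level_connected p M t : (1 < size p)%N -> 0 <= M ->
  (forall c, p^`().[c] = 0 -> normc p.[c] <= M) -> M < t -> connected (lev p t).
Proof.
move=> p1 M0 crit Mt; have [T hT] := large_level_connected p1.
have t0 : 0 < t by exact: le_lt_trans Mt.
pose s2 := `|T| + 1 + t; have T2 : T < s2 by rewrite /s2; have := ler_norm T; lra.
have ts : t < s2 by rewrite /s2; have := normr_ge0 T; lra.
have [e e0 he] : exists2 e, 0 < e & forall s s', t <= s <= s2 -> t <= s' <= s2 -> `|s' - s| < e ->
    connected (lev p s) -> connected (lev p s').
  apply: level_step => // c /andP[tc _]; apply/eqP => /crit; lra.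
pose N := (Num.truncn ((s2 - t) / e)).+1.
have N0 : 0 < N%:R :> R by rewrite ltr0n.
have Ne : (s2 - t) / N%:R < e.
  rewrite ltr_pdivrMr// mulrC -ltr_pdivrMr//; exact: truncnS_gt.
have st : 0 < (s2 - t) / N%:R by rewrite divr_gt0// subr_gt0.
have NE : N%:R * ((s2 - t) / N%:R) = s2 - t by rewrite mulrC divfK// gt_eqF.
have H k0 : (k0 <= N)%N -> connected (lev p (s2 - k0%:R * ((s2 - t) / N%:R))).
  have bd j : (j <= N)%N -> t <= s2 - j%:R * ((s2 - t) / N%:R) <= s2.
    move=> jN; have h : j%:R * ((s2 - t) / N%:R) <= N%:R * ((s2 - t) / N%:R).
      by rewrite ler_wpM2r ?ler_nat// ltW.
    have h' : 0 <= j%:R * ((s2 - t) / N%:R) by rewrite mulr_ge0 ?ler0n// ltW.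
    by rewrite NE in h; clear -h h' ts; lra.
  elim: k0 => [_|j IH jN]; first by rewrite mul0r subr0; exact: hT.
  apply: he (IH (ltnW jN)); [exact/bd/ltnW|exact: bd|].
  have -> : s2 - j.+1%:R * ((s2 - t) / N%:R) - (s2 - j%:R * ((s2 - t) / N%:R)) = - ((s2 - t) / N%:R).
    by rewrite -natr1; ring.
  by rewrite normrN gtr0_norm.
have := H N (leqnn N); rewrite NE.
by rewrite opprB addrCA subrr addr0.
Qed.
End Polynomials.

(** * Iteration, filled Julia sets and their boundaries *)

Section PolynomialDynamics.
Context {R : realType}.
Local Notation C := R[i].
Implicit Types (p q g h : {poly C}) (z w v a c : C) (A B X : set C) (r e M t : R) (m n : nat).

Lemma poly_increase p c e : (1 < size p)%N -> 0 < e ->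
  exists2 x, normc (x - c) < e & normc p.[c] < normc p.[x].
Proof.
move=> p1 e0; pose k := normc (lead_coef p) * e ^+ (size p).-1.
have k0 : 0 < k by rewrite mulr_gt0 ?lead_gt0// exprn_gt0.
have [u u1 E] : exists2 u, normc u = 1 & p.[c] = (normc p.[c])%:C * u.
  have [->|pc] := eqVneq p.[c] 0; first by exists 1; rewrite ?normc1// normc0 rmorph0 mul0r.
  by exists (unitc p.[c]); [exact: normc_unitc|exact: unitcK].
have [|x xc px] := @poly_open R p e p1 e0 c ((normc p.[c] + k / 2)%:C * u).
  rewrite [X in _ - X]E -mulrBl -rmorphB /= addrAC subrr add0r normcM u1 mulr1 normc_real.
  by rewrite gtr0_norm ?divr_gt0// -/k; clear -k0; lra.
exists x => //; rewrite px normcM u1 mulr1 normc_real ger0_norm.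
  by rewrite ltrDl divr_gt0.
by rewrite addr_ge0 ?normc_ge0// divr_ge0// ltW.
Qed.

Definition it p n z : C := iter n (fun w => p.[w]) z.
Definition piter p n : {poly C} := iter n (fun q => p \Po q) 'X.

Lemma horner_piter p n z : (piter p n).[z] = it p n z.
Proof. by elim: n => [|n IH] /=; rewrite ?hornerX// horner_comp IH. Qed.

Lemma itD p m n z : it p (m + n) z = it p m (it p n z).
Proof. exact: iterD. Qed.

Lemma size_comp_gt1 p q : (1 < size p)%N -> (1 < size q)%N -> (1 < size (p \Po q))%N.
Proof.
move=> p1 q1; have : (0 < (size (p \Po q)).-1)%N.
  by rewrite size_comp_poly muln_gt0 !pred_size_gt0.
by case: (size _) => [|[]].
Qed.

Lemma size_piter p n : (1 < size p)%N -> (1 < size (piter p n))%N.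
Proof. by move=> p1; elim: n => [|n IH] /=; rewrite ?size_polyX// size_comp_gt1. Qed.

Lemma it_continuous p n z : {for z, continuous (it p n)}.
Proof.
have -> : it p n = (fun w => (piter p n).[w]) by rewrite funeqE => w; rewrite horner_piter.
exact: poly_continuous.
Qed.

Definition Kf p : set C := [set z | exists M, forall n, normc (it p n z) <= M].

Definition jul p : set C := Kf p `&` closure (~` Kf p).

Lemma Kf_it p n z : Kf p (it p n z) <-> Kf p z.
Proof.
split=> [[M hM]|[M hM]]; last by exists M => m; rewrite -itD.
elim: n M hM => [|n IH] M hM; first by exists M.
apply: (IH (Num.max M (normc (it p n z)))) => -[|m]; first by rewrite /= le_max lexx orbT.
by rewrite le_max -itD addSnnS itD hM.
Qed.

Lemma Kf_horner p z : Kf p p.[z] <-> Kf p z.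
Proof. exact: (Kf_it p 1 z). Qed.

Section EscapeRadius.
Variables (p : {poly C}) (r : R).
Hypotheses (r1 : 1 <= r) (hr : forall z, r <= normc z -> 2 * normc z <= normc p.[z]).

Lemma it_growth z n : r <= normc z -> 2 ^+ n * normc z <= normc (it p n z) /\ r <= normc (it p n z).
Proof.
move=> rz; elim: n => [|n [IH1 IH2]] /=; first by rewrite expr0 mul1r.
have h := hr IH2; split.
  by rewrite exprS -mulrA; apply: le_trans h; rewrite ler_pM2l.
by apply: le_trans h; have := normc_ge0 (it p n z); lra.
Qed.

Lemma it_ge z n : r <= normc z -> normc z <= normc (it p n z).
Proof.
move=> rz; have [h _] := it_growth n rz; apply: le_trans h.
by rewrite ler_peMl ?normc_ge0// exprn_ege1// ler1n.
Qed.

Lemma it_unbounded z M : r <= normc z -> exists n0, forall n, (n0 <= n)%N -> M < normc (it p n z).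
Proof.
move=> rz; exists (Num.truncn `|M|).+1 => n hn; have [h _] := it_growth n rz.
apply: lt_le_trans h; apply: le_lt_trans (ler_norm M) _.
apply: (@lt_le_trans _ _ n%:R).
  by apply: lt_le_trans (truncnS_gt _) _; rewrite ler_nat.
apply: (@le_trans _ _ (2 ^+ n)); first by rewrite -natrX ler_nat ltnW// ltn_expl.
by rewrite ler_peMr ?(le_trans r1 rz)// exprn_ge0.
Qed.

Lemma KfP z : Kf p z <-> forall n, normc (it p n z) <= r.
Proof.
split=> [Kz n|h]; last by exists r.
rewrite leNgt; apply/negP => /ltW rz.
have [M hM] : Kf p (it p n z) by apply/Kf_it.
have [n0 hn] := it_unbounded M rz.
by have := hn n0 (leqnn _); rewrite ltNge hM.
Qed.

Lemma notKfP z : ~ Kf p z -> forall M, exists n0, forall n, (n0 <= n)%N -> M < normc (it p n z).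
Proof.
move=> nK M; have [n rn] : exists n, r <= normc (it p n z).
  apply: contrapT => no; apply: nK; apply/KfP => n; rewrite leNgt; apply/negP => /ltW h.
  by apply: no; exists n.
have [n0 hn] := it_unbounded M rn; exists (n0 + n)%N => k nk.
have nk' : (n <= k)%N by apply: leq_trans nk; exact: leq_addl.
by rewrite -(subnK nk') itD; apply: hn; rewrite leq_subRL// addnC.
Qed.

Lemma far_notKf z : r < normc z -> ~ Kf p z.
Proof. by move=> rz /KfP /(_ 0%N); rewrite leNgt rz. Qed.

Lemma closed_Kf : closed (Kf p).
Proof.
have -> : Kf p = \bigcap_n [set z | normc (piter p n).[z] <= r].
  apply/seteqP; split=> [z /KfP h n _ /=|z h]; first by rewrite horner_piter.
  by apply/KfP => n; have := h n I; rewrite /= horner_piter.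
by apply: closed_bigI => n _; exact: sublevel_closed.
Qed.

End EscapeRadius.

Lemma Kf_closed p : (2 < size p)%N -> closed (Kf p).
Proof. by move=> /poly_escape[r r1 hr]; exact: closed_Kf hr. Qed.

Lemma jul_closed p : (2 < size p)%N -> closed (jul p).
Proof. by move=> p2; apply: closedI; [exact: Kf_closed|exact: closed_closure]. Qed.

Lemma Kf_interior p z : Kf p z -> ~ jul p z -> exists2 e, 0 < e & forall w, normc (w - z) < e -> Kf p w.
Proof.
move=> Kz nj; have [|e e0 he] := @closed_notin R (closure (~` Kf p)) z (@closed_closure _ _).
  by move=> cz; apply: nj.
by exists e => // w /he h; apply: contrapT => nK; apply: h; exact: subset_closure.
Qed.

Lemma conn_meets_jul p X a c : (2 < size p)%N -> connected X -> X a -> X c -> Kf p a -> ~ Kf p c ->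
  exists2 x, X x & jul p x.
Proof.
move=> p2 cX Xa Xc Ka nKc; apply: contrapT => no; apply: nKc.
apply: (@connected_locally_constant C X (Kf p) cX _ a c) => // x Xx.
have [Kx|nKx] := pselect (Kf p x).
  have [|e e0 he] := Kf_interior Kx; first by move=> jx; apply: no; exists x.
  by apply/nbhs_normcP; exists e => // y /he Ky _.
have [e e0 he] := closed_notin (Kf_closed p2) nKx.
by apply/nbhs_normcP; exists e => // y /he Ky _; split.
Qed.

Lemma exists_far (a z : C) M : exists2 w : C, M < normc w & M < normc (w - a).
Proof.
exists ((`|M| + normc a + 1)%:C).
  by rewrite normc_real ger0_norm; have := ler_norm M; have := normc_ge0 a; have := normr_ge0 M; lra.
have h : normc (`|M| + normc a + 1)%:C = `|M| + normc a + 1.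
  by rewrite normc_real ger0_norm; have := normc_ge0 a; have := normr_ge0 M; lra.
by have := lerB_normc (`|M| + normc a + 1)%:C a; rewrite h; have := ler_norm M; lra.
Qed.

(** An interior point of [Kf p] can be moved away from [a] inside [Kf p]; the exterior of the circle
    through [z] is connected and contains escaping points, so it meets the boundary. In this way
    facts about [jul p] control all of [Kf p]. *)
Lemma jul_far p z a : (2 < size p)%N -> Kf p z -> exists2 c, jul p c & normc (z - a) <= normc (c - a).
Proof.
move=> p2 Kz; have [jz|jz] := pselect (jul p z); first by exists z.
have [e e0 he] := Kf_interior Kz jz.
have [r r1 hr] := poly_escape p2.
have X1 : (1 < size ('X : {poly C}))%N by rewrite size_polyX.
have [x xz] := poly_increase (p := 'X - a%:P) z (ltac:(by rewrite size_XsubC)) e0.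
rewrite !hornerXsubC => zx.
have [w w1 w2] := exists_far a 0 (Num.max r (normc (z - a))).
have [c /= ca jc] : exists2 c, [set c | normc (z - a) < normc (c - a)] c & jul p c.
  apply: (@conn_meets_jul p _ x w p2) => //.
  - exact: exterior_connected (normc_ge0 _).
  - by rewrite /=; apply: le_lt_trans w2; rewrite le_max lexx orbT.
  - exact: he.
  by apply: (far_notKf r1 hr); apply: le_lt_trans w1; rewrite le_max lexx.
by exists c; [exact: jc|exact: ltW ca].
Qed.

Lemma jul_subset p a r : (2 < size p)%N -> (forall c, jul p c -> normc (c - a) < r) ->
  forall z, Kf p z -> normc (z - a) < r.
Proof. by move=> p2 h z /(jul_far a p2)[c /h + zc]; exact: le_lt_trans. Qed.

(** The level curves of the iterates at [t] are connected, as [t] exceeds all their critical values,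
    and accumulate exactly at [jul p]: they lie in decreasing compact sets [H n] with intersection
    inside [jul p], and all late ones meet a given neighbourhood of a point of [jul p]. A separation
    of [jul p] would thus separate a late curve. *)
Lemma jul_connected p M : (2 < size p)%N ->
  (forall n c, (piter p n)^`().[c] = 0 -> normc (piter p n).[c] <= M) -> connected (jul p).
Proof.
move=> p2 crit; have p1 : (1 < size p)%N by exact: ltn_trans p2.
have [r r1 hr] := poly_escape p2.
pose t := `|M| + r + 1; have tM : `|M| < t by rewrite /t; lra.
have rt : r < t by rewrite /t; have := normr_ge0 M; lra.
have levc n : connected (lev (piter p n) t).
  apply: (@level_connected _ _ `|M|) => //; first exact: size_piter.
  by move=> c /crit h; exact: le_trans (ler_norm M).
pose H n := [set z | normc (piter p n).[z] <= t] `&` closure (~` Kf p).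
have cH n : compact (H n).
  apply: (subclosed_compact _ (sublevel_compact (M := t) (size_piter n p1))); last by move=> z [].
  by apply: closedI; [exact: sublevel_closed|exact: closed_closure].
have Hd n : H n.+1 `<=` H n.
  move=> z [] /=; rewrite !horner_comp horner_piter => h cz; split=> //=; rewrite horner_piter leNgt.
  apply/negP => h'; have := hr (it p n z) (ltac:(lra)); lra.
have Hle m n : (m <= n)%N -> H n `<=` H m.
  elim: n => [|n IH]; first by rewrite leqn0 => /eqP->.
  by rewrite leq_eqVlt => /predU1P[->//|/IH h] z /Hd /h.
have HJ : \bigcap_n H n `<=` jul p.
  move=> z hz; split; last by have [] := hz 0%N I.
  by exists t => n; have [] := hz n I; rewrite /= horner_piter.
have levH n : lev (piter p n) t `<=` H n.
  move=> z zt; split; first by rewrite /= zt.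
  apply: subset_closure => /(KfP r1 hr) /(_ n); rewrite -horner_piter zt; lra.
apply: contrapT => nc.
have [A [B [cA cB A0 B0 [E AB]]]] := closed_in_separation (jul_closed p2) nc.
have [U [V [oU oV AU BV UV]]] := plane_separation cA cB A0 B0 AB.
have [N hN] : exists n, H n `<=` U `|` V.
  apply: nested_compact_meet => //; first exact: openU.
  by move=> z /HJ; rewrite E => -[/AU|/BV]; [left|right].
have meet (O : set C) z : open O -> O z -> jul p z ->
    exists n0, forall n, (n0 <= n)%N -> lev (piter p n) t `&` O !=set0.
  move=> oO Oz [Kz cz]; have [e e0 he] := (open_normcP O).1 oO z Oz.
  have [w nKw wz] := (closure_normcP _ _).1 cz e e0.
  have [n0 hn0] := notKfP r1 hr nKw t; exists n0 => n /hn0 tn.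
  have [x xe xt] : exists2 x, cball z e x & normc (piter p n).[x] = t.
    apply: (@connected_ivt _ _ (cball z e) (fun x => normc (piter p n).[x]) t _ _ z w) => //.
    - exact: cball_connected.
    - by move=> x _; exact: normc_poly_continuous.
    - exact: cball_center.
    - by rewrite horner_piter; apply: le_lt_trans rt; exact: (KfP r1 hr z).1.
    by rewrite horner_piter.
  by exists x; split=> //; exact: he.
have [a Aa] := A0; have [b Bb] := B0.
have [na hna] := meet U a oU (AU _ Aa) (ltac:(by rewrite E; left)).
have [nb hnb] := meet V b oV (BV _ Bb) (ltac:(by rewrite E; right)).
pose n := maxn N (maxn na nb).
apply: (@connected_open_cover R (lev (piter p n) t) U V) => //.
- by move=> z /levH /(Hle N n (leq_maxl _ _)); exact: hN.
- by apply: hna; rewrite /n !leq_max leqnn !orbT.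
- by apply: hnb; rewrite /n !leq_max leqnn !orbT.
Qed.

Lemma open_in_separation X : open X -> ~ connected X ->
  exists A B, [/\ open A, open B, A !=set0, B !=set0 & X = A `|` B /\ A `&` B = set0].
Proof.
move=> oX /connectedPn[E [E0 EU [sE1 sE2]]].
have sep b : X `&` ~` closure (E (~~ b)) = E b.
  apply/seteqP; split=> [z []|z Ez].
    rewrite EU => -[Ez|Ez] nz; case: b nz => // nz; exfalso; apply: nz; exact: subset_closure.
  split; first by rewrite EU; case: b Ez; [right|left].
  move=> cz; case: b Ez cz => /= Ez cz.
    by have : (closure (E false) `&` E true) z by []; rewrite sE1.
  by have : (E false `&` closure (E true)) z by []; rewrite sE2.
have oE b : open (E b) by rewrite -sep; apply: openI => //; apply: closed_openC; exact: closed_closure.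
exists (E false), (E true); split => //; split => //.
apply/seteqP; split=> // z [Ez Fz].
by have : (closure (E false) `&` E true) z by [split => //; exact: subset_closure]; rewrite sE1.
Qed.

(** A piece of the basin away from infinity is bounded, and some iterate exceeds the escape radius
    in it. The maximum of that iterate over the closure lies in the piece itself, since boundary
    points belong to [Kf p], against [poly_increase]. *)
Lemma basin_connected p : (2 < size p)%N -> connected (~` Kf p).
Proof.
move=> p2; have p1 : (1 < size p)%N by exact: ltn_trans p2.
have [r r1 hr] := poly_escape p2; apply: contrapT => nc.
have oX : open (~` Kf p) by apply: closed_openC; exact: Kf_closed.
have ext : [set z | r < normc (z - 0)] `<=` ~` Kf p by move=> z /=; rewrite subr0; exact: (far_notKf r1 hr).
have key A B : open A -> open B -> B !=set0 -> ~` Kf p = A `|` B -> A `&` B = set0 ->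
    [set z | r < normc (z - 0)] `<=` A -> False.
  move=> oA oB [b Bb] E AB hA.
  have disj z : A z -> B z -> False by move=> Az Bz; have : (A `&` B) z by []; rewrite AB.
  have nKb : ~ Kf p b by have : (~` Kf p) b by rewrite E; right.
  have [n0 /(_ n0 (leqnn _)) rb] := notKfP r1 hr nKb r; rewrite -horner_piter in rb.
  have clB : closure B `<=` cdisc 0 r.
    move=> z cz; rewrite /cdisc /= leNgt; apply/negP => zr.
    have [w [Bw Aw]] := cz A (open_nbhs_nbhs (conj oA (hA z zr))); exact: disj Bw.
  have cc : compact (closure B) by apply: (bounded_closed_compact_c (r := r)) => //; exact: closed_closure.
  have [c /set_mem cB hc] : exists2 c, c \in closure B & forall z, z \in closure B ->
      normc (piter p n0).[z] <= normc (piter p n0).[c].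
    apply: compact_EVT_max => //; first by exists b; exact: subset_closure.
    by apply: continuous_in_subspaceT => z _; exact: normc_poly_continuous.
  have bc := hc b (mem_set (subset_closure Bb)).
  have nKc : ~ Kf p c.
    by move=> /(KfP r1 hr) /(_ n0); rewrite -horner_piter; lra.
  have Bc : B c.
    have : (~` Kf p) c by []; rewrite E => -[Ac|//].
    by have [w [Bw Aw]] := cB A (open_nbhs_nbhs (conj oA Ac)); exfalso; exact: disj Bw.
  have [e e0 he] := (open_normcP B).1 oB c Bc.
  have [x /he Bx] := poly_increase c (size_piter n0 p1) e0.
  by rewrite ltNge hc//; apply/mem_set/subset_closure.
have [A [B [oA oB A0 B0 [E AB]]]] := open_in_separation oX nc.
have cext : connected [set z : C | r < normc (z - 0)] by apply: exterior_connected; lra.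
have [[z0 [z0r Az0]]|no] := pselect ([set z | r < normc (z - 0)] `&` A !=set0).
  apply: (key A B) => // z zr; have := ext z zr; rewrite E => -[//|Bz]; exfalso.
  apply: (@connected_open_cover R _ A B cext) => //; last by exists z.
    by rewrite -E.
  by exists z0.
apply: (key B A) => //; [by rewrite E setUC|by rewrite setIC|].
move=> z zr; have := ext z zr; rewrite E => -[Az|//]; exfalso.
by apply: no; exists z.
Qed.

Lemma Kf_piter p m : (2 < size p)%N -> Kf (piter p m.+1) = Kf p.
Proof.
move=> p2; have [r r1 hr] := poly_escape p2.
have itE n z : it (piter p m.+1) n z = it p (n * m.+1) z.
  by elim: n => [//|n IH]; rewrite mulSn itD -IH -(horner_piter p m.+1).
apply/seteqP; split=> z; last by move=> [M hM]; exists M => n; rewrite itE.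
move=> [M hM]; apply: contrapT => /(notKfP r1 hr) /(_ M)[n0 hn].
have := hn (n0 * m.+1)%N (leq_pmulr _ (ltn0Sn m)).
by rewrite -itE ltNge hM.
Qed.

Lemma jul_piter p m : (2 < size p)%N -> jul (piter p m.+1) = jul p.
Proof. by move=> p2; rewrite /jul Kf_piter. Qed.
End PolynomialDynamics.

(** * Normality on the sphere *)

Section SphereTopology.
Context {R : realType}.
Local Notation C := R[i].
Local Notation S := (sphere R).
Implicit Types (z w c : C) (x y : S) (A U : set S) (e r d : R) (p g : {poly C}) (G : set {poly C}).

Lemma nbhs_fin z A : nbhs (fin z) A <-> exists2 e, 0 < e & forall w, normc (w - z) < e -> A (fin w).
Proof.
have -> : nbhs (fin z) A = nbhs z (@fin R @^-1` A) by [].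
exact: nbhs_normcP.
Qed.

Lemma nbhs_infty A : nbhs (infty : S) A <-> A infty /\ exists r, forall w, r < normc w -> A (fin w).
Proof.
split=> [[K [cK _] KA]|[Ai [r hr]]].
  split; first by apply: KA; right.
  have [r r0 hr] := compact_bounded_c cK; exists r => w rw; apply: KA; left; exists w => // Kw.
  by have := hr w Kw; rewrite /cdisc /= subr0 leNgt rw.
exists (cdisc 0 r).
  split; last exact: closed_cdisc.
  by apply: (bounded_closed_compact_c (r := r)) => //; exact: closed_cdisc.
move=> x [[w nw <-]|/= ->//]; apply: hr; rewrite ltNge; apply/negP => wr; apply: nw.
by rewrite /cdisc /= subr0.
Qed.

Lemma nbhs_chordal x A : nbhs x A <-> exists2 e, 0 < e & forall y, chordal x y < e -> A y.
Proof.
have l1 z : 0 < jap z by exact: jap_gt0.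
case: x => [z|].
  rewrite -/(fin z) nbhs_fin; split=> [[e e0 h]|[e e0 h]]; last first.
    exists (e / 2); first by rewrite divr_gt0.
    move=> w wz; apply: h; apply: le_lt_trans (chordal_le_normc z w) _.
    by rewrite normc_distC mulrC -ltr_pdivlMr.
  exists (Num.min (jap z)^-1 (e / jap z ^+ 2)).
    by rewrite lt_min invr_gt0 l1 divr_gt0// exprn_gt0.
  move=> [w|]; last first.
    rewrite -/(fin z) -/infty chordal_inftyE lt_min => /andP[+ _].
    rewrite ltr_pdivrMr// mulVf ?gt_eqF//; lra.
  rewrite -/(fin z) -/(fin w) chordal_fin lt_min !ltr_pdivrMr ?mulr_gt0// => /andP[].
  rewrite mulrA mulVf ?gt_eqF// mul1r => h1 h2; apply: h.
  have jwz : jap w <= jap z + normc (w - z).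
    by have := jap_lip w z; rewrite ler_norml => /andP[_]; lra.
  have zw : normc (z - w) = normc (w - z) by exact: normc_distC.
  have d1 : normc (w - z) < jap z by rewrite zw in h1; lra.
  have e2 : e / jap z ^+ 2 * (jap z * jap w) = e * jap w / jap z by field; rewrite gt_eqF.
  move: h2; rewrite e2 zw ltr_pdivlMr// => h2.
  have h3 : e * jap w <= e * (2 * jap z) by rewrite ler_pM2l//; lra.
  have h4 : 2 * (normc (w - z) * jap z) < 2 * (e * jap z) by lra.
  by move: h4; rewrite ltr_pM2l// ltr_pM2r.
rewrite -/infty nbhs_infty; split=> [[Ai [r h]]|[e e0 h]].
  exists (2 / (`|r| + 2)); first by rewrite divr_gt0//; have := normr_ge0 r; lra.
  move=> [w|//]; rewrite -/(fin w) chordalC chordal_inftyE => hw; apply: h.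
  have r2 : 0 < `|r| + 2 by have := normr_ge0 r; lra.
  move: hw; rewrite ltr_pM2l// ltf_pV2 ?posrE// => hw.
  by have := jap_le w; have := ler_norm r; lra.
split; first by apply: h; rewrite chordal_xx.
exists (2 / e) => w hw; apply: h; rewrite chordalC chordal_inftyE ltr_pdivrMr//.
rewrite mulrC -ltr_pdivrMr//; exact: lt_le_trans hw (normc_le_jap w).
Qed.

Lemma sphere_compact : compact [set: S].
Proof. exact: one_point_compactification_compact. Qed.

Lemma sphere_hausdorff : hausdorff_space S.
Proof.
move=> x y cxy; apply: contrapT => xy.
have d0 : 0 < chordal x y.
  rewrite lt_def chordal_ge0 andbT; apply/eqP; move: xy {cxy}; case: x y => [z|] [w|] // xy; last first.
  - by rewrite -/infty -/(fin w) chordalC chordal_inftyE => /eqP; rewrite gt_eqF ?divr_gt0 ?jap_gt0.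
  - by rewrite -/infty -/(fin z) chordal_inftyE => /eqP; rewrite gt_eqF ?divr_gt0 ?jap_gt0.
  rewrite -/(fin z) -/(fin w) chordal_fin => /eqP; rewrite gt_eqF// divr_gt0 ?mulr_gt0 ?jap_gt0//.
  by rewrite normc_gt0 subr_eq0; apply/eqP => zw; apply: xy; rewrite zw.
have d2 : 0 < chordal x y / 2 by rewrite divr_gt0.
have [] := cxy [set u | chordal x u < chordal x y / 2] [set u | chordal y u < chordal x y / 2].
- by apply/nbhs_chordal; exists (chordal x y / 2).
- by apply/nbhs_chordal; exists (chordal x y / 2).
by move=> u /= [h1 h2]; have := chordal_triangle u x y; rewrite (chordalC u y); lra.
Qed.

Lemma fin_continuous : continuous (@fin R).
Proof. exact: one_point_compactification_some_continuous. Qed.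

Definition equi G x := forall e, 0 < e ->
  \forall y \near x, forall g, G g -> chordal (poly_map g x) (poly_map g y) < e.

Lemma closed_chordal_ball x r : closed [set y : S | chordal x y <= r].
Proof.
rewrite -[X in closed X]setCK; apply: open_closedC; rewrite openE => y /= h.
have {}h : r < chordal x y by rewrite ltNge; apply/negP.
apply/nbhs_chordal; exists (chordal x y - r); first by rewrite subr_gt0.
move=> u yu /=; have := chordal_triangle u x y; rewrite (chordalC u y); lra.
Qed.

Lemma compact_chordal_ball x r : compact [set y : S | chordal x y <= r].
Proof. exact: subclosed_compact (@closed_chordal_ball x r) sphere_compact _. Qed.

Lemma uniform_equi G U : compact U -> (forall x, U x -> equi G x) -> forall e, 0 < e ->
  exists2 d, 0 < d & forall x y, U x -> chordal x y < d ->
    forall g, G g -> chordal (poly_map g x) (poly_map g y) < e.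
Proof.
move=> cU eU e e0; have e2 : 0 < e / 2 by rewrite divr_gt0.
pose P d x := forall y, chordal x y < d -> forall g, G g -> chordal (poly_map g x) (poly_map g y) < e.
have : \forall d \near 0^'+, U `<=` P d.
  apply: (compact_near_coveringP U).1 => // x Ux.
  have [d d0 hd] := (nbhs_chordal _ _).1 (eU x Ux _ e2).
  exists ([set y | chordal x y < d / 2], [set t | t < d / 2]) => /=.
    split; first by apply/nbhs_chordal; exists (d / 2); rewrite ?divr_gt0.
    by apply: nbhs_right_lt; rewrite divr_gt0.
  move=> [y t] /= [xy td] u yu g Gg; have h1 := hd y (ltac:(lra)) g Gg.
  have h2 := hd u (ltac:(have := chordal_triangle y x u; lra)) g Gg.
  by have := chordal_triangle (poly_map g x) (poly_map g y) (poly_map g u); rewrite (chordalC (poly_map g y) (poly_map g x)); lra.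
move=> H; have [d [d0 hd]] : exists d, 0 < d /\ U `<=` P d.
  have H0 : \forall d \near (0 : R)^'+, 0 < d by exact: nbhs_right_gt.
  by have := filter_ex (filterI H0 H) => -[d [h1 h2]]; exists d.
by exists d => // x y Ux xy g Gg; exact: hd.
Qed.

Lemma finite_net U d : compact U -> 0 < d -> exists s : seq S, (forall x, x \in s -> U x) /\
  forall y, U y -> exists2 x, x \in s & chordal x y < d.
Proof.
rewrite compact_cover => cU d0.
have [|y Uy|D DU cD] := cU S U (fun x => interior [set y | chordal x y < d]).
- by move=> x _; exact: open_interior.
- exists y => //; apply/nbhs_chordal; exists d => //.
exists (finmap.enum_fset D); split; first by move=> x xD; have := DU x xD; rewrite inE.
by move=> y /cD[x xD /interior_subset xy]; exists x.
Qed.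

(** A pointwise cluster point [g] of the sequence exists because a product of spheres is compact;
    equicontinuity turns its approximation on a finite net into a uniform one. The subsequence is
    then chosen term by term. *)
Lemma arzela_ascoli G U : compact U -> (forall x, U x -> equi G x) ->
  normal_on ((@poly_map R) @` G) U.
Proof.
move=> cU eU f fG.
have unif := uniform_equi cU eU.
have [g gcl] : exists g : S -> S, forall (s : seq S) e n0, 0 < e -> exists2 n, (n0 <= n)%N &
    forall x, x \in s -> chordal (g x) (f n x) < e.
  have := @tychonoff S (fun=> S) (fun=> setT) (fun=> sphere_compact).
  move=> /(_ (f @ \oo) _)[|g [_ clg]]; first by exists 0%N.
  exists g => s e n0 e0.
  have near_s : nbhs (g : {ptws S -> S}) [set h : {ptws S -> S} | forall x, x \in s -> chordal (g x) (h x) < e].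
    elim: s => [|x s IH]; first by apply: filterS filterT => h _ x.
    have hx : nbhs (g : {ptws S -> S}) [set h : {ptws S -> S} | chordal (g x) (h x) < e].
      apply: (@proj_continuous S (fun=> S) x g [set y | chordal (g x) y < e]).
      by apply/nbhs_chordal; exists e.
    by apply: filterS (filterI hx IH) => h [h1 h2] y; rewrite in_cons => /predU1P[->|/h2].
  have tail : (f @ \oo) (f @` [set n | (n0 <= n)%N]).
    by exists n0 => // n /= n0n; exists n.
  have [_ [[n n0n <-] h]] := clg _ _ tail near_s.
  by exists n.
have chG n e d : 0 < e -> (forall x y, U x -> chordal x y < d ->
    forall g, G g -> chordal (poly_map g x) (poly_map g y) < e) ->
    forall x y, U x -> chordal x y < d -> chordal (f n x) (f n y) < e.
  by move=> e0 h x y Ux xy; have [q Gq <-] := fG n; exact: h.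
have step e n0 : 0 < e -> exists2 n, (n0 <= n)%N & forall x, U x -> chordal (f n x) (g x) < e.
  move=> e0; have e5 : 0 < e / 6 by rewrite divr_gt0.
  have [d d0 hd] := unif _ e5.
  have [s [sU hs]] := finite_net cU d0.
  have [n n0n hn] := gcl s _ n0 e5.
  exists n => // y Uy; have [x xs xy] := hs y Uy; have Ux := sU x xs.
  have h1 := chG n _ _ e5 hd x y Ux xy; have h2 := hn x xs.
  have [m _ hm] := gcl [:: x; y] _ 0%N e5.
  have h3 := hm x (mem_head _ _); have h4 := hm y (ltac:(by rewrite !inE eqxx orbT)).
  have h5 := chG m _ _ e5 hd x y Ux xy.
  have t1 := chordal_triangle (f n x) (f n y) (g y); have t2 := chordal_triangle (g x) (f n x) (g y).
  have t3 := chordal_triangle (f m x) (g x) (g y); have t4 := chordal_triangle (f m y) (f m x) (g y).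
  move: t1 t2 t3 t4; rewrite (chordalC (f n y) (f n x)) (chordalC (f n x) (g x)) (chordalC (f m y) (g y)); lra.
have ex k0 : exists N : nat -> nat, forall n0, (n0 <= N n0)%N /\ forall x, U x -> chordal (f (N n0) x) (g x) < k0.+1%:R^-1.
  have /choice[N hN] : forall n0, exists n, (n0 <= n)%N /\ forall x, U x -> chordal (f n x) (g x) < k0.+1%:R^-1.
    by move=> n0; have [|n h1 h2] := step k0.+1%:R^-1 n0; [rewrite invr_gt0 ltr0n|exists n].
  by exists N.
have [N hN] := choice ex.
pose fix phi n : nat := if n is n'.+1 then N n (phi n').+1 else N 0%N 0%N.
have phiS n : (phi n < phi n.+1)%N by exact: (hN n.+1 (phi n).+1).1.
exists phi; split; first by apply: homo_ltn => // a b c; exact: ltn_trans.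
exists g => K cK KU e e0; exists (Num.truncn e^-1) => // n /= en x Kx.
have : chordal (f (phi n) x) (g x) < n.+1%:R^-1.
  by case: n en => [|n] _; [exact: (hN 0%N 0%N).2 (KU _ Kx)|exact: (hN n.+1 (phi n).+1).2 (KU _ Kx)].
move=> h; apply: lt_le_trans h _; rewrite -[leRHS]invrK lef_pV2 ?posrE ?invr_gt0 ?ltr0n//.
by apply: ltW; apply: lt_le_trans (truncnS_gt _) _; rewrite ler_nat.
Qed.

Lemma fatou_intro G x : (\forall y \near x, equi G y) -> fatou G x.
Proof.
move=> /nbhs_chordal[e e0 he]; have e2 : 0 < e / 2 by rewrite divr_gt0.
exists [set y | chordal x y <= e / 2].
  by apply/nbhs_chordal; exists (e / 2) => // y /ltW.
apply: arzela_ascoli; first exact: compact_chordal_ball.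
by move=> y /= xy; apply: he; lra.
Qed.

Lemma poly_map_continuous p : (1 < size p)%N -> continuous (poly_map p).
Proof.
move=> p1 [z|] A.
  rewrite -/(fin z) /= -/(fin p.[z]) => /nbhs_fin[e e0 h].
  have [d d0 hd] := (continuous_normcP _ _).1 (@poly_continuous R p z) e e0.
  by apply/nbhs_fin; exists d => // w /hd; exact: h.
rewrite -/infty => /nbhs_infty[Ai [r h]]; apply/nbhs_infty; split=> //.
have [r' r0' hr'] := poly_growth r p1; exists r' => w /ltW /hr'; exact: h.
Qed.

(** The limit is not assumed continuous, so the values at [x] and at a bad point are compared
    through one fixed member of the convergent subsequence, which is continuous: five errors below
    [e / 8] stay below [e]. *)
Lemma normal_equi G U x : (forall g, G g -> (1 < size g)%N) -> nbhs x U ->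
  normal_on ((@poly_map R) @` G) U -> equi G x.
Proof.
move=> G1 nU nG e e0; apply: contrapT => no.
have [r r0 hr] := (nbhs_chordal _ _).1 nU.
have ex n : exists gy : {poly C} * S, [/\ G gy.1, chordal x gy.2 < n.+1%:R^-1 &
    e <= chordal (poly_map gy.1 x) (poly_map gy.1 gy.2)].
  apply: contrapT => h; apply: no; apply/nbhs_chordal; exists n.+1%:R^-1; first by rewrite invr_gt0 ltr0n.
  move=> y xy g Gg; rewrite ltNge; apply/negP => eg; apply: h; by exists (g, y).
have [gy hgy] := choice ex.
have [phi [phi_incr [lim hlim]]] := nG (fun n => poly_map (gy n).1) (fun n => ex_intro2 _ _ _ (let: And3 a _ _ := hgy n in a) erefl).
have r2 : 0 < r / 2 by rewrite divr_gt0.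
have e8 : 0 < e / 8 by rewrite divr_gt0.
have [n0 _ hn0] := hlim [set y | chordal x y <= r / 2] (@compact_chordal_ball _ _)
  (ltac:(by move=> y /= h; apply: hr; lra)) _ e8.
have [gm1 _ _] := hgy (phi n0).
have [d d0 hd] : exists2 d, 0 < d & forall y, chordal x y < d ->
    chordal (poly_map (gy (phi n0)).1 x) (poly_map (gy (phi n0)).1 y) < e / 8.
  apply/(nbhs_chordal x [set y | chordal (poly_map (gy (phi n0)).1 x) (poly_map (gy (phi n0)).1 y) < e / 8]).
  apply: (@poly_map_continuous _ (G1 _ gm1) x [set y | chordal (poly_map (gy (phi n0)).1 x) y < e / 8]).
  by apply/nbhs_chordal; exists (e / 8).
have phin n : (n <= phi n)%N.
  by elim: n => [//|n IH]; apply: leq_ltn_trans IH _; exact: phi_incr.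
pose m := Num.min d (r / 2); have m0 : 0 < m by rewrite lt_min d0.
pose n := maxn n0 (Num.truncn m^-1).
have xn : chordal x (gy (phi n)).2 < m.
  have [_ h _] := hgy (phi n); apply: lt_le_trans h _.
  rewrite -[leRHS]invrK lef_pV2 ?posrE ?invr_gt0 ?ltr0n//.
  apply: ltW; apply: lt_le_trans (truncnS_gt _) _; rewrite ler_nat ltnS.
  by apply: leq_trans (phin n); exact: leq_maxr.
move: xn; rewrite lt_min => /andP[xd xr].
have [_ _ eg] := hgy (phi n); set y := (gy (phi n)).2 in xd xr eg.
have ex' : chordal x x <= r / 2 by rewrite chordal_xx ltW.
have a1 := hn0 n0 (leqnn _) x ex'; have a2 := hn0 n0 (leqnn _) y (ltW xr).
have a3 := hn0 n (leq_maxl _ _) x ex'; have a4 := hn0 n (leq_maxl _ _) y (ltW xr).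
have a5 := hd y xd.
set F := poly_map (gy (phi n)).1 in eg a3 a4; set H := poly_map (gy (phi n0)).1 in a1 a2 a5.
have t1 := chordal_triangle (lim x) (F x) (F y); have t2 := chordal_triangle (lim y) (lim x) (F y).
have t3 := chordal_triangle (H x) (lim x) (lim y); have t4 := chordal_triangle (H y) (H x) (lim y).
rewrite (chordalC (lim y) (F y)) in t2; rewrite (chordalC (lim x) (H x)) in t3.
lra.
Qed.

Lemma open_fatou G : open (fatou G).
Proof.
rewrite openE => x [U nU nG]; move/nbhs_interior: (nU).
by apply: filterS => y yU; exists U.
Qed.

Lemma fatouP G x : (forall g, G g -> (1 < size g)%N) ->
  fatou G x <-> \forall y \near x, equi G y.
Proof.
move=> G1; split; last exact: fatou_intro.
have := @open_fatou G; rewrite openE => o /o; apply: filterS => y [U nU nG].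
exact: normal_equi nG.
Qed.

Lemma closed_julia G : closed (julia G).
Proof. exact: open_closedC (@open_fatou G). Qed.

Lemma equi_finP G z : equi G (fin z) <-> forall e, 0 < e -> exists2 d, 0 < d &
  forall w, normc (w - z) < d -> forall g, G g -> chordal (fin g.[z]) (fin g.[w]) < e.
Proof.
split=> h e e0; first by have [d d0 hd] := (nbhs_fin _ _).1 (h e e0); exists d.
by apply/nbhs_fin; have [d d0 hd] := h e e0; exists d.
Qed.

Lemma equi_inftyP G : equi G infty <-> forall e, 0 < e -> exists r,
  forall w, r < normc w -> forall g, G g -> chordal infty (fin g.[w]) < e.
Proof.
split=> h e e0; first by have [_ [r hr]] := (nbhs_infty _).1 (h e e0); exists r.
apply/nbhs_infty; have [r hr] := h e e0; split; last by exists r.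
by move=> g Gg /=.
Qed.

(** By [poly_open], points near [h z] are images of points near [z], and every [g] in [G] followed
    back through [h] is again in [G]; equicontinuity at [z] thus passes to [h z]. *)
Lemma fatou_forward G h z : (forall g, G g -> (1 < size g)%N) ->
  (forall p q, G p -> G q -> G (p \Po q)) -> G h -> fatou G (fin z) -> fatou G (fin h.[z]).
Proof.
move=> G1 Gc Gh /(fatouP _ G1) /nbhs_fin[r r0 hr]; apply/(fatouP _ G1)/nbhs_fin.
exists (normc (lead_coef h) * r ^+ (size h).-1).
  by rewrite mulr_gt0 ?lead_gt0 ?G1// exprn_gt0.
move=> w /(poly_open (G1 _ Gh) r0)[x xz <-]; have /equi_finP ex := hr x xz.
apply/equi_finP => e /ex[d d0 hd].
exists (normc (lead_coef h) * d ^+ (size h).-1).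
  by rewrite mulr_gt0 ?lead_gt0 ?G1// exprn_gt0.
move=> y /(poly_open (G1 _ Gh) d0)[u ux <-] g Gg.
by have := hd u ux _ (Gc _ _ Gg Gh); rewrite !horner_comp.
Qed.
End SphereTopology.

(** * Translation of the definitions to finite coordinates *)

Section Unpacking.
Context {R : realType}.
Local Notation C := R[i].
Implicit Types (z w c l : C) (p g h : {poly C}) (G : set {poly C}) (M : R).

Lemma has_cderivP (f : C -> C) z l : has_cderiv f z l <-> is_derive z 1 f l.
Proof.
have E : has_cderiv f z l <->
    (fun u : C => u^-1 *: ((f \o shift z) (u *: (1 : C)) - f z)) @ 0^' --> l.
  split=> [h|h].
    apply/cvgrPdist_lt => e' e'0; have [e e0 eE] : exists2 e : R, 0 < e & e' = e%:C.
      move: e'0; rewrite ltcE /= => /andP[/eqP e2 e1]; exists (complex.Re e') => //.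
      by case: e' e2 e1 => a b /= -> .
    have e2 : 0 < e / 2 by rewrite divr_gt0.
    have [d d0 hd] := h _ e2.
    apply/nbhs_normcP; exists d => // w wd w0 /=.
    rewrite [X in `|X|](_ : _ = - (w^-1 * (f (w + z) - f z - l * (w + z - z)))); last first.
      by rewrite /GRing.scale /= mulr1; field.
    rewrite eE normcE ltcR normc_opp normcM normcV.
    have wp : 0 < normc w by rewrite normc_gt0.
    rewrite mulrC ltr_pdivrMr//; apply: le_lt_trans (hd (w + z) _) _.
      by rewrite addrK -[w]subr0.
    by rewrite addrK ltr_pM2r//; lra.
  move=> e e0; have ec : 0 < e%:C :> C by rewrite ltcR.
  move/cvgrPdist_lt : h => /(_ _ ec) /nbhs_normcP[d d0 hd]; exists d => // w wd.
  have [->|wz] := eqVneq w z; first by rewrite !subrr mulr0 subrr normc0 mulr0.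
  have w0 : w - z != 0 by rewrite subr_eq0.
  have := hd (w - z) (ltac:(by rewrite subr0)) w0.
  rewrite [X in `|X|](_ : _ = - ((w - z)^-1 * (f w - f z - l * (w - z)))); last first.
    by rewrite /GRing.scale /= mulr1 subrK; field.
  rewrite normcE ltcR normc_opp normcM normcV => h.
  have wp : 0 < normc (w - z) by rewrite normc_gt0.
  by move: h; rewrite mulrC ltr_pdivrMr// => /ltW.
rewrite E; split=> [h|[h1 <-]].
  by apply: DeriveDef; [apply/cvg_ex; exists l|exact: cvg_lim].
exact: h1.
Qed.

Lemma local_expr_fin p c : local_expr (poly_map p) (fin c) = (fun w => p.[w]).
Proof. by []. Qed.

Lemma critical_pointP p c : critical_point (poly_map p) (fin c) <-> p^`().[c] = 0.
Proof.
rewrite /critical_point local_expr_fin -has_cderivP; split=> [h|<-].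
  exact: has_cderiv_unique (has_cderiv_horner p c) h.
exact: has_cderiv_horner.
Qed.

Lemma superattractingP p c : superattracting_fixed (poly_map p) (fin c) <-> p.[c] = c /\ p^`().[c] = 0.
Proof.
by split=> -[h1 h2]; split; [case: h1|apply/critical_pointP|rewrite /= h1|apply/critical_pointP].
Qed.

Definition crit_values G : set C := [set v | exists g c, [/\ G g, g^`().[c] = 0 & v = g.[c]]].

(** The properties of [calG] in finite coordinates, phrased by closure under composition instead of
    generators so that they pass to subsemigroups. *)
Definition pcb G := [/\ G !=set0, forall p q, G p -> G q -> G (p \Po q),
  forall g, G g -> (2 < size g)%N & exists M, forall v, crit_values G v -> normc v <= M].

Lemma generated_comp (T : set {poly C}) p q :
  generated_semigroup T p -> generated_semigroup T q -> generated_semigroup T (p \Po q).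
Proof. by move=> hp hq H HT; apply: HT.1; [exact: hp|exact: hq]. Qed.

Lemma calG_pcb G : calG G -> pcb G.
Proof.
move=> [[T [[t Tt] T1 GE]] G2 bG]; split.
- by exists t; rewrite GE; exact: sub_gen_smallest.
- by rewrite GE; exact: generated_comp.
- exact: G2.
have [M M0 hM] := ex_strict_bound_gt0 bG; exists (complex.Re M) => v [g [c [Gg gc ->]]].
have : `|g.[c]| < M.
  apply: hM; split=> //; apply: subset_closure; exists g => //.
  by exists (fin c) => //; exact/critical_pointP.
by rewrite normcE ltcE /= => /andP[_ /ltW].
Qed.

Lemma pcb_sub G G' : pcb G -> G' !=set0 -> G' `<=` G -> (forall p q, G' p -> G' q -> G' (p \Po q)) -> pcb G'.
Proof.
move=> [_ _ G2 [M hM]] G0 sG Gc; split=> //; first by move=> g /sG /G2.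
by exists M => v [g [c [/sG Gg h1 h2]]]; apply: hM; exists g, c.
Qed.

Lemma generated1_piter g q : generated_semigroup [set g] q -> exists n, q = piter g n.+1.
Proof.
move=> /(_ [set q | exists n, q = piter g n.+1]); apply; split=> [p q' [m ->] [n ->]|p ->]; last first.
  by exists 0%N; rewrite /= comp_polyXr.
exists (m + n.+1)%N; elim: m => [|m IH]; first by rewrite /= comp_polyXr.
by rewrite [in LHS]/= -comp_polyA IH.
Qed.

Lemma pcb_generated1 G g : pcb G -> G g -> pcb (generated_semigroup [set g]).
Proof.
move=> pG Gg; have [_ Gc _ _] := pG; apply: (pcb_sub pG).
- by exists g; apply: sub_gen_smallest.
- by apply: smallest_sub => // p ->.
exact: generated_comp.
Qed.
End Unpacking.

(** * Density of the Julia sets of the elements *)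

Section Density.
Context {R : realType}.
Local Notation C := R[i].
Implicit Types (z w c v u a b : C) (p q f g h : {poly C}) (G : set {poly C}) (M r d B e : R).

(** Landau's theorem for [(f - b1) / (b2 - b1)]. The constant depends only on [d] and [B], so that
    the omitted pair may vary with the map. *)
Lemma landau_omit d B : 0 < d -> 0 < B -> exists2 K : R, 0 < K &
  forall b1 b2 (f : C -> C) a r l, normc b1 <= B -> normc b2 <= B -> d <= normc (b2 - b1) -> 0 < r ->
  (forall z, normc (z - a) < r -> cdiff f z /\ f z != b1 /\ f z != b2) ->
  has_cderiv f a l -> normc l <= K / r * jap (f a) ^+ 2.
Proof.
move=> d0 B0; have [K0 K00 hK] := @landau R.
pose c : R := 1 + 2 * (1 + B ^+ 2) / d ^+ 2.
have c0 : 0 < c by rewrite ltr_pwDl// divr_ge0 ?sqr_ge0// mulr_ge0// addr_ge0 ?sqr_ge0.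
exists (2 * B * K0 * c); first by rewrite !mulr_gt0.
move=> b1 b2 f a r l b1B b2B db r0 hf hl.
have b0 : b2 - b1 != 0 by rewrite -normc_gt0; exact: lt_le_trans db.
pose psi w := (b2 - b1)^-1 * (f w + - b1).
have dpsi : has_cderiv psi a ((b2 - b1)^-1 * l).
  by rewrite -[l]addr0; apply: has_cderivZ; apply: has_cderivD hl (has_cderiv_cst _ _).
have psif z : psi z = (f z - b1) / (b2 - b1) by rewrite /psi mulrC.
have := hK psi a r _ r0 _ dpsi; rewrite normcM normcV; move=> /(_ _) H.
have {}H : (normc (b2 - b1))^-1 * normc l <= K0 / r * jap (psi a) ^+ 2.
  apply: H => z /hf[dz [z1 z2]]; split.
    by apply: cdiffM; [exact: cdiff_cst|apply: cdiffD => //; exact: cdiff_cst].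
  rewrite psif; split; first by rewrite mulf_neq0 ?invr_eq0// subr_eq0.
  apply: contra z2 => /eqP E; rewrite -subr_eq0; apply/eqP.
  have : f z - b1 = b2 - b1 by rewrite -[RHS]mul1r -E divfK.
  by move=> /addIr ->; rewrite subrr.
have nb : 0 < normc (b2 - b1) by rewrite normc_gt0.
move: H; rewrite mulrC ler_pdivrMr// => H; apply: (le_trans H).
have nb2 : normc (b2 - b1) <= 2 * B by have := ler_normcB b2 b1; lra.
have h1 : jap (psi a) ^+ 2 <= c * jap (f a) ^+ 2.
  rewrite !sqr_jap psif normcM normcV; set x := normc (f a).
  have xb : normc (f a - b1) <= x + B by have := ler_normcB (f a) b1; rewrite -/x; lra.
  have x0 : 0 <= x by exact: normc_ge0.
  have h2 : (normc (f a - b1) / normc (b2 - b1)) ^+ 2 <= (x + B) ^+ 2 / d ^+ 2.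
    rewrite -[leRHS]expr_div_n lerXn2r ?nnegrE ?divr_ge0 ?normc_ge0 ?(ltW d0)//; first by lra.
    by rewrite ler_pM ?invr_ge0 ?normc_ge0// lef_pV2 ?posrE.
  have i0 : 0 <= d ^- 2 by rewrite invr_ge0 sqr_ge0.
  have h3 : (x + B) ^+ 2 / d ^+ 2 <= 2 * (x ^+ 2 + B ^+ 2) / d ^+ 2.
    by rewrite ler_wpM2r//; have := sqr_ge0 (x - B); rewrite sqrrB sqrrD; lra.
  have h4 : 2 * (x ^+ 2 + B ^+ 2) / d ^+ 2 <= 2 * (1 + B ^+ 2) * (1 + x ^+ 2) / d ^+ 2.
    have h0 : 0 <= B ^+ 2 * x ^+ 2 by rewrite mulr_ge0 ?sqr_ge0.
    by rewrite ler_wpM2r//; clear -h0; lra.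
  have E : c * (1 + x ^+ 2) = 1 + x ^+ 2 + 2 * (1 + B ^+ 2) * (1 + x ^+ 2) / d ^+ 2.
    by rewrite /c; ring.
  by rewrite E; have := sqr_ge0 x; lra.
have k0 : 0 <= K0 / r by rewrite divr_ge0 ?(ltW K00) ?(ltW r0).
apply: (@le_trans _ _ (K0 / r * (c * jap (f a) ^+ 2) * (2 * B))).
  apply: ler_pM => //; first by rewrite mulr_ge0// sqr_ge0.
    exact: normc_ge0.
  by rewrite ler_wpM2l.
have -> // : K0 / r * (c * jap (f a) ^+ 2) * (2 * B) = 2 * B * K0 * c / r * jap (f a) ^+ 2.
by ring.
Qed.

Lemma omit_lip d B : 0 < d -> 0 < B -> exists2 K : R, 0 < K &
  forall b1 b2 (f : C -> C) a r, normc b1 <= B -> normc b2 <= B -> d <= normc (b2 - b1) -> 0 < r ->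
  (forall z, normc (z - a) < r -> cdiff f z /\ f z != b1 /\ f z != b2) ->
  forall z w, normc (z - a) < r / 2 -> normc (w - a) < r / 2 ->
  chordal (fin (f z)) (fin (f w)) <= K / r * normc (z - w).
Proof.
move=> d0 B0; have [K K0 hK] := landau_omit d0 B0.
exists (8 * K) => [|b1 b2 f a r b1B b2B db r0 hf z w za wa]; first by rewrite mulr_gt0.
have r2 : 0 < r / 2 by rewrite divr_gt0.
have c0 : 0 < K / (r / 2) by rewrite divr_gt0.
have E : 8 * K / r = 4 * (K / (r / 2)) by field; rewrite gt_eqF.
rewrite E; apply: chordal_lip c0 _ _ _ za wa => y ya.
have [[l hl] _] := hf y (ltac:(lra)); exists l => //.
apply: (hK b1 b2 f y (r / 2)) => // x xy; apply: hf.
by have := ler_distcD y x a; lra.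
Qed.

(** Compare the distances to infinity: at least [2 / (1 + r)] for [z], less than [1 / (1 + r)] for
    [w]. Bounded and escaping orbits are told apart by this amount. *)
Lemma chordal_far z w r : normc z <= r -> 2 * (1 + r) < normc w ->
  (1 + r)^-1 < chordal (fin z) (fin w).
Proof.
move=> zr wr; have r0 : 0 <= r by exact: le_trans (normc_ge0 z) zr.
have r1 : 0 < 1 + r by lra.
have := chordal_triangle (fin w) (fin z) infty; rewrite !chordal_inftyE.
have h1 : 2 * (1 + r)^-1 <= 2 / jap z.
  rewrite ler_pM2l// lef_pV2 ?posrE ?jap_gt0//; have := jap_le z; lra.
have h2 : 2 / jap w < (1 + r)^-1.
  rewrite ltr_pdivrMr ?jap_gt0// mulrC ltr_pdivlMr//.
  by have := normc_le_jap w; lra.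
lra.
Qed.

Section Semigroup.
Variable G : set {poly C}.
Hypothesis pG : pcb G.

Let Gc p q : G p -> G q -> G (p \Po q). Proof. by case: pG => _ h _ _; exact: h. Qed.
Lemma pcb_size g : G g -> (2 < size g)%N. Proof. by case: pG => _ _ h _; exact: h. Qed.
Lemma pcb_size1 g : G g -> (1 < size g)%N. Proof. by move=> /pcb_size; exact: ltn_trans. Qed.

Lemma pcb_piter h n : G h -> G (piter h n.+1).
Proof. by move=> Gh; elim: n => [|n IH]; [rewrite /= comp_polyXr|exact: Gc]. Qed.

Lemma crit_forward h v : G h -> crit_values G v -> crit_values G h.[v].
Proof.
move=> Gh [g [c [Gg gc ->]]]; exists (h \Po g), c; split; first exact: Gc.
  by rewrite deriv_comp hornerM gc mulr0.
by rewrite horner_comp.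
Qed.

Lemma crit_Kf h v : G h -> crit_values G v -> Kf h v.
Proof.
move=> Gh cv; case: pG => _ _ _ [M hM]; exists M => n; apply: hM.
by elim: n => [//|n IH]; exact: crit_forward.
Qed.

Lemma size_deriv_gt1 g : (2 < size g)%N -> (1 < size g^`())%N.
Proof.
move=> g2; rewrite ltnNge; apply/negP => s1.
have : (g^`())`_((size g).-2) = 0.
  by apply: nth_default; apply: leq_trans s1 _; case: (size g) g2 => [|[|[]]].
rewrite coef_deriv; have -> : (size g).-2.+1 = (size g).-1 by case: (size g) g2 => [|[|[]]].
move/eqP; rewrite mulrn_eq0 -lead_coefE lead_coef_eq0 -size_poly_eq0.
by case: (size g) g2 => [|[|[]]].
Qed.

Lemma crit_ex : exists v, crit_values G v.
Proof.
have [[g Gg] _ _ _] := pG.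
have s1 := size_deriv_gt1 (pcb_size Gg); have [rs [sz mem _]] := poly_factor 0 s1.
case: rs sz mem => [|c rs] sz mem; first by have := pred_size_gt0 s1; rewrite -sz.
exists g.[c], g, c; split=> //; apply/eqP; rewrite -mem; exact: mem_head.
Qed.

Lemma pcb_jul_connected h : G h -> connected (jul h).
Proof.
move=> Gh; have [_ _ _ [M hM]] := pG; have h2 := pcb_size Gh.
apply: (@jul_connected R h `|M|) => // -[|n] c hc.
  by move: hc; rewrite /= derivX hornerC => /eqP; rewrite oner_eq0.
apply: le_trans (hM _ _) (ler_norm M); exists (piter h n.+1), c; split=> //; exact: pcb_piter.
Qed.

Lemma min_gap (rs : seq C) z : exists2 e, 0 < e & forall y, y \in rs -> normc (y - z) < e -> y = z.
Proof.
elim: rs => [|x rs [e e0 he]]; first by exists 1.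
have [->|xz] := eqVneq x z.
  by exists e => // y; rewrite in_cons => /predU1P[->//|/he].
have xz0 : 0 < normc (x - z) by rewrite normc_gt0 subr_eq0.
exists (Num.min e (normc (x - z))); first by rewrite lt_min e0.
move=> y; rewrite in_cons lt_min => /predU1P[->|/he h] /andP[h1 h2]; last exact: h.
by rewrite ltxx in h2.
Qed.

(** By [level_connected] with [M = 0] all levels are connected; a level close to 0 lies in small
    discs around the roots and meets each of them, so there is only one root. *)
Lemma single_critical_value_root p : (1 < size p)%N -> (forall c, p^`().[c] = 0 -> p.[c] = 0) ->
  forall x y, p.[x] = 0 -> p.[y] = 0 -> x = y.
Proof.
move=> p1 crit x y px py; apply: contrapT => xy.
have [rs [sz mem E]] := poly_factor 0 p1; have l0 := lead_gt0 p1.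
have [e e0 he] := min_gap rs x; have e2 : 0 < e / 2 by rewrite divr_gt0.
pose k := normc (lead_coef p) * (e / 2) ^+ (size p).-1.
have k0 : 0 < k by rewrite mulr_gt0// exprn_gt0.
have k2 : 0 < k / 2 by rewrite divr_gt0.
have cl : connected (lev p (k / 2)).
  by apply: (level_connected (M := 0)) => // c /crit ->; rewrite normc0.
pose V := \bigcup_(z in [set z | p.[z] = 0 /\ z <> x]) cball z (e / 2).
have meet z : p.[z] = 0 -> lev p (k / 2) `&` cball z (e / 2) !=set0.
  move=> pz; have [|u uz pu] := @poly_open R p (e / 2) p1 e2 z (k / 2)%:C.
    by rewrite pz subr0 normc_real gtr0_norm// -/k; clear -k0; lra.
  by exists u; split=> //; rewrite /lev /= pu normc_real gtr0_norm.
apply: (@connected_open_cover R (lev p (k / 2)) (cball x (e / 2)) V cl).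
- exact: open_cball.
- by apply: bigcup_open => z _; exact: open_cball.
- move=> z zk; apply: contrapT => no.
  have : k <= normc p.[z].
    rewrite -[p.[z]]subr0 E /k -sz ler_wpM2l ?normc_ge0// prod_ge ?(ltW e2)// => r rr.
    rewrite leNgt; apply/negP => zr; apply: no.
    have [rx|rx] := eqVneq r x; first by left; rewrite /cball /= -rx.
    by right; exists r => //; split; [apply/eqP; rewrite -mem|apply/eqP].
  by rewrite zk; clear -k0; lra.
- apply/seteqP; split=> // z [zx [r [pr rx] zr]]; apply: rx; apply: he; first by rewrite mem pr.
  by have := ler_distcD z r x; move: zx zr; rewrite /cball /= (normc_distC z r); clear; lra.
- exact: meet.
have [u [uk uy]] := meet y py; exists u; split=> //; exists y => //; split=> // yx.
by apply: xy.
Qed.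

(** The only critical value [v] is fixed by [h], and [h - v] has at most 0 as critical value, hence
    [v] as its only root. *)
Lemma crit_monomial v : crit_values G `<=` [set v] -> forall h, G h ->
  forall z, h.[z] = v + lead_coef h * (z - v) ^+ (size h).-1.
Proof.
move=> hv h Gh; have h1 := pcb_size1 Gh.
have cv : crit_values G v by have [v' cv'] := crit_ex; have := hv v' cv' => /= <-.
have hvv : h.[v] = v by exact: hv (crit_forward Gh cv).
pose q := h - v%:P.
have qE z : q.[z] = h.[z] - v by rewrite hornerD hornerN hornerC.
have sw : (size (- v%:P) < size h)%N by rewrite size_polyN (leq_ltn_trans (size_polyC_leq1 _)).
have sq : size q = size h by rewrite size_polyDl.
have lq : lead_coef q = lead_coef h by rewrite lead_coefDl.
have uniq : forall x y, q.[x] = 0 -> q.[y] = 0 -> x = y.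
  apply: single_critical_value_root; first by rewrite sq.
  move=> c; rewrite derivB derivC subr0 => hc; rewrite qE.
  by have -> : h.[c] = v; [apply: hv; exists h, c|rewrite subrr].
have [rs E] := closed_field_poly_normal q.
have l0 : lead_coef q != 0 by rewrite lq -normc_gt0 lead_gt0.
have rsv x : x \in rs -> x = v.
  rewrite -root_prod_XsubC -(rootZ _ _ l0) -E => /rootP qx.
  by apply: uniq => //; rewrite qE hvv subrr.
have ssz : size rs = (size h).-1.
  by move: sq; rewrite E size_scale// size_prod_XsubC => <-.
have E2 : \prod_(x <- rs) ('X - x%:P) = ('X - v%:P) ^+ size rs.
  rewrite big_seq (eq_bigr (fun=> 'X - v%:P)) => [|x /rsv ->//].
  by rewrite -big_seq big_const_seq count_predT iter_mulr_1.
move=> z; have -> : h.[z] = v + q.[z] by rewrite qE addrC subrK.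
by rewrite E E2 lq hornerZ horner_exp hornerXsubC ssz.
Qed.

(** Two distinct critical values will do. With a single one, [f] and [h] are monomials about [v] of
    degree at least two, and both map a small disc about [v] into itself. The pair is independent of
    [n], so that it can serve as omitted values for a whole sequence of maps. *)
Lemma common_pair f h : G f -> G h -> exists a b, [/\ a != b & forall n,
  Kf (piter h n.+1 \Po f) a /\ Kf (piter h n.+1 \Po f) b].
Proof.
move=> Gf Gh; have [v cv] := crit_ex.
have GF n : G (piter h n.+1 \Po f) by apply: Gc => //; exact: pcb_piter.
have [[u [cu uv]]|no] := pselect (exists u, crit_values G u /\ u <> v).
  by exists u, v; split; [exact/eqP|move=> n; split; exact: crit_Kf].
have hv : crit_values G `<=` [set v].
  by move=> u cu; apply: contrapT => uv; apply: no; exists u.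
have small g : G g -> exists2 e, 0 < e <= 1 & forall d, d <= e -> forall z, normc (z - v) <= d -> normc (g.[z] - v) <= d.
  move=> Gg; have l0 := lead_gt0 (pcb_size1 Gg).
  exists (Num.min 1 (normc (lead_coef g))^-1).
    by rewrite lt_min ltr01 invr_gt0 l0 ge_min lexx.
  move=> d; rewrite le_min => /andP[d1 dl] z zd; apply: le_trans (zd).
  rewrite (crit_monomial hv Gg) addrC addKr normcM normcX.
  have z1 : normc (z - v) <= 1 by exact: le_trans d1.
  have zl : normc (lead_coef g) * normc (z - v) <= 1.
    by rewrite -ler_pdivlMl// mulr1; exact: le_trans dl.
  have := pred_size_gt1 (pcb_size Gg); case: (size g).-1 => [|[|n]] // _.
  rewrite exprS mulrA -[leRHS]mul1r ler_pM ?mulr_ge0 ?exprn_ge0 ?normc_ge0//.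
  by rewrite exprS ler_piMr ?normc_ge0// exprn_ile1 ?normc_ge0.
have [ef /andP[ef0 ef1] hf] := small f Gf; have [eh /andP[eh0 eh1] hh] := small h Gh.
pose e := Num.min ef eh; have e0 : 0 < e by rewrite lt_min ef0.
have hi n z : normc (z - v) <= e -> normc (it h n z - v) <= e.
  by move=> ze; elim: n => [//|n IH] /=; apply: hh => //; rewrite ge_min lexx orbT.
exists (v + e%:C), v; split.
  by rewrite -subr_eq0 addrC addKr -normc_gt0 normc_real gtr0_norm.
move=> n; split; last exact: crit_Kf.
exists (normc v + e) => m.
suff : normc (it (piter h n.+1 \Po f) m (v + e%:C) - v) <= e.
  by have := lerB_normc (it (piter h n.+1 \Po f) m (v + e%:C)) v; clear; lra.
elim: m => [|m IH]; first by rewrite /= addrC addKr normc_real gtr0_norm.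
have -> : it (piter h n.+1 \Po f) m.+1 (v + e%:C) =
  (piter h n.+1 \Po f).[it (piter h n.+1 \Po f) m (v + e%:C)] by [].
rewrite horner_comp horner_piter; apply: hi; apply: hf => //.
by rewrite ge_min lexx.
Qed.

Lemma equi_jul h z : G h -> jul h z -> ~ equi G (fin z).
Proof.
move=> Gh [Kz cz] /equi_finP ez; have [r r1 hr] := poly_escape (pcb_size Gh).
have [d d0 hd] := ez (1 + r)^-1 (ltac:(rewrite invr_gt0; lra)).
have [w nKw wz] := (closure_normcP _ _).1 cz d d0.
have [n0 hn] := notKfP r1 hr nKw (2 * (1 + r)).
have := hd w wz _ (pcb_piter n0 Gh); rewrite !horner_piter.
apply/negP; rewrite -leNgt; apply: ltW; apply: chordal_far; first exact: (KfP r1 hr z).1.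
exact: hn.
Qed.

Lemma jul_julia h z : G h -> jul h z -> julia G (fin z).
Proof.
move=> Gh jz /(fatouP _ pcb_size1) H; apply: (equi_jul Gh jz).
exact: nbhs_singleton H.
Qed.

Lemma jul_two h : G h -> exists a b, [/\ a != b, jul h a & jul h b].
Proof.
move=> Gh; have [a [b [ab hab]]] := common_pair Gh Gh; have h2 := pcb_size Gh.
have [Ka Kb] := hab 0%N.
have E : piter h 1 \Po h = piter h 2 by rewrite /= !comp_polyXr.
rewrite E Kf_piter// in Ka Kb.
have [c jc _] := jul_far 0 h2 Ka.
have [u [Ku uc]] : exists u, Kf h u /\ u <> c.
  have [ac|/eqP ac] := eqVneq a c; last by exists a.
  by exists b; split=> // bc; move: ab; rewrite ac bc eqxx.
have [c' jc' cc'] := jul_far c h2 Ku; exists c, c'; split=> //.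
apply/eqP => E'; move: cc'; rewrite -E' subrr normc0 leNgt normc_gt0 subr_eq0.
by move/eqP: uc => ->.
Qed.

(** If [f u] were in [jul h], the maps [F n], iterates of [h] after [f], would keep [u] bounded but
    send a point near [u] far out. A disc around [u] misses [jul (F n)] and contains an escaping
    point, so it lies outside [Kf (F n)], and [F n] omits there the pair of [common_pair]; the
    Lipschitz bound of [omit_lip] contradicts the spreading. Hence every element of [G] omits all of
    [jul h] on the disc about [a]. *)
Lemma density_fwd a r f h : 0 < r -> G f -> G h ->
  (forall g z, G g -> normc (z - a) < r -> ~ jul g z) ->
  forall z, normc (z - a) < r -> ~ jul h f.[z].
Proof.
move=> r0 Gf Gh miss u ua [Kfu cfu].
have h2 := pcb_size Gh; have [rh rh1 hrh] := poly_escape h2.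
have [rf rf1 hrf] := poly_escape (pcb_size Gf).
pose R1 := Num.max rf rh; have R11 : 1 <= R1 by rewrite le_max rf1.
pose F n := piter h n.+1 \Po f.
have FE n z : (F n).[z] = it h n.+1 f.[z] by rewrite horner_comp horner_piter.
have GF n : G (F n) by apply: Gc => //; exact: pcb_piter.
have escF n z : R1 <= normc z -> 2 * normc z <= normc (F n).[z].
  rewrite ge_max => /andP[z1 z2]; have h1 := hrf z z1; rewrite FE; apply: le_trans (h1) _.
  by apply: (it_ge hrh); lra.
have [p [q [pq KF]]] := common_pair Gf Gh.
pose rho := r - normc (u - a); have rho0 : 0 < rho by rewrite subr_gt0.
have sub z : normc (z - u) < rho -> normc (z - a) < r.
  by rewrite /rho; have := ler_distcD u z a; clear; lra.
have pq0 : 0 < normc (q - p) by rewrite normc_gt0 subr_eq0 eq_sym.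
have B0 : 0 < normc p + normc q + 1 by have := normc_ge0 p; have := normc_ge0 q; clear; lra.
have [K K0 hK] := omit_lip pq0 B0.
have rh0 : 0 < (1 + rh)^-1 by rewrite invr_gt0; clear -rh1; lra.
have kr : 0 < K / rho by rewrite divr_gt0.
pose eps := Num.min (rho / 2) ((1 + rh)^-1 / (K / rho)).
have eps0 : 0 < eps by rewrite lt_min !divr_gt0.
have f1 := pcb_size1 Gf.
have [w nKw wf] := (closure_normcP _ _).1 cfu (normc (lead_coef f) * eps ^+ (size f).-1)
  (ltac:(by rewrite mulr_gt0 ?lead_gt0// exprn_gt0)).
have [u' u'u fu'] := poly_open f1 eps0 wf.
have [n0 hn0] := notKfP rh1 hrh nKw (Num.max R1 (2 * (1 + rh))).
have := hn0 n0.+1 (leqnSn _); rewrite gt_max => /andP[far1 far2].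
have nKu' : ~ Kf (F n0) u'.
  by move=> /Kf_horner; rewrite FE fu'; exact: (far_notKf R11 (escF n0)).
have F2 := pcb_size (GF n0).
move: (u'u); rewrite lt_min => /andP[u'1 u'2].
have nK z : normc (z - u) < rho -> ~ Kf (F n0) z.
  move=> zu Kz; have [x ux jx] := @conn_meets_jul R (F n0) (cball u rho) z u' F2 (@cball_connected R u rho) zu (ltac:(rewrite /cball /=; clear -u'1 rho0; lra)) Kz nKu'.
  exact: (miss _ _ (GF n0) (sub x ux)).
have om z : normc (z - u) < rho -> cdiff (fun z => (F n0).[z]) z /\ (F n0).[z] != p /\ (F n0).[z] != q.
  move=> zu; split; first exact: cdiff_horner.
  have n1 : ~ Kf (F n0) (F n0).[z] by move=> /Kf_horner; exact: nK.
  split; apply/eqP => E; apply: n1; rewrite E; have [] := KF n0; by [].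
have := hK p q _ u rho _ _ (lexx _) rho0 om u' u; rewrite !FE fu'.
move=> /(_ _ _ u'1 _) H.
have : chordal (fin (it h n0.+1 f.[u])) (fin (it h n0.+1 w)) < (1 + rh)^-1.
  rewrite chordalC; apply: le_lt_trans (H _ _ _) _.
  - by have := normc_ge0 q; clear; lra.
  - by have := normc_ge0 p; clear; lra.
  - by rewrite subrr normc0 divr_gt0.
  by rewrite mulrC -ltr_pdivlMr.
apply/negP; rewrite -leNgt; apply: ltW; apply: chordal_far => //.
exact: (KfP rh1 hrh _).1.
Qed.

Lemma density_fin a r : 0 < r -> (forall h z, G h -> normc (z - a) < r -> ~ jul h z) -> fatou G (fin a).
Proof.
move=> r0 miss; have [[h Gh] _ _ _] := pG.
have [b1 [b2 [b12 j1 j2]]] := jul_two Gh.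
have b0 : 0 < normc (b2 - b1) by rewrite normc_gt0 subr_eq0 eq_sym.
have B0 : 0 < normc b1 + normc b2 + 1 by have := normc_ge0 b1; have := normc_ge0 b2; clear; lra.
have [K K0 hK] := omit_lip b0 B0.
have kr : 0 < K / r by rewrite divr_gt0.
apply/(fatouP _ pcb_size1)/nbhs_fin; exists (r / 2); first by rewrite divr_gt0.
move=> z za; apply/equi_finP => e e0.
exists (Num.min (r / 2 - normc (z - a)) (e / (K / r))); first by rewrite lt_min subr_gt0 za divr_gt0.
move=> w; rewrite lt_min => /andP[w1 w2] g Gg.
have om x : normc (x - a) < r -> cdiff (fun z => g.[z]) x /\ g.[x] != b1 /\ g.[x] != b2.
  move=> xa; split; first exact: cdiff_horner.
  by split; apply/eqP => E; apply: (density_fwd r0 Gg Gh miss xa); rewrite E.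
have wa : normc (w - a) < r / 2 by have := ler_distcD z w a; clear -w1; lra.
apply: le_lt_trans (hK b1 b2 _ a r _ _ (lexx _) r0 om z w za wa) _.
- by have := normc_ge0 b2; clear; lra.
- by have := normc_ge0 b1; clear; lra.
by rewrite mulrC -ltr_pdivlMr// normc_distC.
Qed.

(** All filled Julia sets lie in the disc of radius [B0]. Then [|lead_coef g| * (2 * B1) ^+ N >= 1]
    for every [g], as otherwise [g] would map the disc of radius [B1] into itself and [B1] would lie
    in [Kf g]. The resulting lower bound for [|g z|] is the same for all elements and gives
    equicontinuity at infinity. *)
Lemma density_infty r : (forall h z, G h -> r < normc z -> ~ jul h z) -> fatou G infty.
Proof.
move=> miss; pose B0 := `|r| + 1; have B00 : 1 <= B0 by rewrite /B0; have := normr_ge0 r; lra.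
have rB : r < B0 by rewrite /B0; have := ler_norm r; lra.
have KB g z : G g -> Kf g z -> normc z <= B0.
  move=> Gg Kz; have [c jc zc] := jul_far 0 (pcb_size Gg) Kz; rewrite !subr0 in zc.
  apply: (le_trans zc); rewrite leNgt; apply/negP => h; apply: (miss g c Gg _ jc); clear -h rB; lra.
have [p cp] := crit_ex.
have pB : normc p <= B0 by have [[h Gh] _ _ _] := pG; exact: (KB h p Gh (crit_Kf Gh cp)).
pose B1 := B0 + 1.
have low g z : G g -> B0 + 2 * B1 <= normc z -> (normc z - B0) / (2 * B1) - B0 <= normc g.[z].
  move=> Gg zB; have g1 := pcb_size1 Gg; have [rs [sz mem E]] := poly_factor p g1.
  have rsB x : x \in rs -> normc x <= B0.
    by rewrite mem => /eqP gx; apply: (KB g) => //; apply/Kf_horner; rewrite gx; exact: crit_Kf.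
  have l0 := lead_gt0 g1; set N := (size g).-1 in sz.
  have aB : 1 <= normc (lead_coef g) * (2 * B1) ^+ N.
    rewrite leNgt; apply/negP => small.
    have inv x : normc x <= B1 -> normc g.[x] <= B1.
      move=> xB; have : normc (g.[x] - p) <= 1.
        apply: ltW; apply: le_lt_trans small; rewrite E -sz ler_wpM2l ?normc_ge0//.
        apply: (andP (prod_le (rs := rs) (f := fun y => normc (x - y)) (r := 2 * B1) _)).2 => y /rsB yB.
        by rewrite normc_ge0/=; have := ler_normcB x y; rewrite /B1 in xB *; clear -yB xB; lra.
      by have := lerB_normc g.[x] p; rewrite /B1; clear -pB; lra.
    have : Kf g B1%:C.
      exists B1 => n; elim: n => [|n IH]; last exact: inv.
      have -> : it g 0 B1%:C = B1%:C by [].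
      by rewrite normc_real ger0_norm// /B1; clear -B00; lra.
    by move=> /(KB g _ Gg); rewrite normc_real ger0_norm /B1; clear -B00; lra.
  have B1p : 0 < 2 * B1 by rewrite /B1; clear -B00; lra.
  pose t := (normc z - B0) / (2 * B1).
  have t1 : 1 <= t by rewrite ler_pdivlMr// mul1r; clear -zB; lra.
  have : t <= normc (g.[z] - p).
    apply: (@le_trans _ _ (t ^+ N)).
      by rewrite -[leLHS]expr1 ler_weXn2l// /N pred_size_gt0.
    rewrite E; apply: (@le_trans _ _ (normc (lead_coef g) * (normc z - B0) ^+ size rs)).
      rewrite sz /t expr_div_n ler_pdivrMr ?exprn_gt0//.
      by rewrite mulrAC -[leLHS]mul1r ler_wpM2r ?exprn_ge0//; clear -zB B1p; lra.
    rewrite ler_wpM2l ?normc_ge0// prod_ge// => [|y /rsB yB]; first by clear -zB B1p; lra.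
    by have := lerB_normc z y; clear -yB; lra.
  by have := ler_normcB g.[z] p; rewrite -/t; clear -pB; lra.
have B1p : 0 < 2 * B1 by rewrite /B1; clear -B00; lra.
apply: fatou_intro; apply/nbhs_infty; split; last first.
  exists (B0 + 1) => w wB; have : fatou G (fin w).
    apply: (@density_fin w 1) => // h z Gh zw; apply: miss => //.
    by have := lerB_normc w z; rewrite normc_distC; clear -wB zw rB; lra.
  by move=> /(fatouP _ pcb_size1) H; exact: nbhs_singleton H.
apply/equi_inftyP => e e0; exists (B0 + 2 * B1 + (2 / e + B0) * (2 * B1)) => w wB g Gg.
have pos : 0 < (2 / e + B0) * (2 * B1).
  by rewrite mulr_gt0// addr_gt0 ?divr_gt0//; clear -B00; lra.
rewrite chordalC chordal_inftyE ltr_pdivrMr ?jap_gt0// mulrC -ltr_pdivrMr//.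
apply: lt_le_trans (normc_le_jap _); apply: lt_le_trans (low g w Gg _); last by clear -wB pos; lra.
by rewrite ltrBrDr ltr_pdivlMr//; clear -wB B1p; lra.
Qed.

Lemma julia_finP z : julia G (fin z) <-> forall e, 0 < e -> exists h w, [/\ G h, jul h w & normc (w - z) < e].
Proof.
split=> [jz e e0|H].
  apply: contrapT => no; apply: jz; apply: (density_fin e0) => h w Gh we jw.
  by apply: no; exists h, w.
have [[W]|] := pselect (fatou G (fin z)); last by [].
move=> nW nW'; exfalso; have : fatou G (fin z) by exists W.
move=> F; have := @open_fatou R G; rewrite openE => /(_ _ F) /nbhs_fin[e e0 he].
by have [h [w [Gh jw wz]]] := H e e0; apply: (jul_julia Gh jw); exact: he.
Qed.

Lemma julia_inftyP : julia G infty -> forall r, exists h w, [/\ G h, jul h w & r < normc w].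
Proof.
move=> ji r; apply: contrapT => no; apply: ji; apply: (density_infty (r := r)) => h z Gh rz jz.
by apply: no; exists h, z.
Qed.
End Semigroup.

Lemma julia1_sub G g x : pcb G -> G g -> julia1 g x -> exists2 z, jul g z & x = fin z.
Proof.
move=> pG Gg jx; have pg := pcb_generated1 pG Gg; have g2 := pcb_size pG Gg.
have jE h : generated_semigroup [set g] h -> jul h = jul g.
  by move=> /generated1_piter[n ->]; exact: jul_piter.
case: x jx => [z|] jx; last first.
  have [r r1 hr] := poly_escape g2.
  have [h [w [Gh]]] := julia_inftyP pg jx r; rewrite jE// => -[Kw _] rw.
  by have := far_notKf r1 hr rw.
exists z => //; have cj := jul_closed g2; rewrite (closure_id (jul g)).1//.
apply/closure_normcP => e /((julia_finP pg z).1 jx)[h [w [Gh jw wz]]].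
by exists w => //; rewrite -(jE h).
Qed.
End Density.

(** * Superattracting fixed points *)

Section Superattracting.
Context {R : realType}.
Local Notation C := R[i].
Implicit Types (z w c v u a b : C) (p q f g h : {poly C}) (G : set {poly C}) (M r d B e : R) (A : set C).

(** If [c] were omitted, [(f - b) / (c - b)] would omit 0 and 1 and have modulus 1 at [v], where
    Landau's bound is [2 * K0 / r]. *)
Lemma landau_circle : exists2 K : R, 0 < K & forall (f : C -> C) v r l b, 0 < r ->
  (forall z, normc (z - v) < r -> cdiff f z /\ f z != b) -> has_cderiv f v l ->
  K / r * normc (f v - b) < normc l ->
  forall c, normc (c - b) = normc (f v - b) -> exists2 x, normc (x - v) < r & f x = c.
Proof.
have [K0 K00 hK] := @landau R; exists (2 * K0) => [|f v r l b r0 hf hl big c cE].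
  by rewrite mulr_gt0.
apply: contrapT => no.
have [_ fvb] := hf v (ltac:(by rewrite subrr normc0)).
have cb0 : 0 < normc (c - b) by rewrite cE normc_gt0 subr_eq0.
have cb : c - b != 0 by rewrite -normc_gt0.
pose psi w := (c - b)^-1 * (f w + - b).
have dpsi : has_cderiv psi v ((c - b)^-1 * l).
  by rewrite -[l]addr0; apply: has_cderivZ; apply: has_cderivD hl (has_cderiv_cst _ _).
have H : normc ((c - b)^-1 * l) <= K0 / r * jap (psi v) ^+ 2.
  apply: (hK psi v r _ r0) => // z zv; have [dz zb] := hf z zv; split.
    by apply: cdiffM; [exact: cdiff_cst|apply: cdiffD => //; exact: cdiff_cst].
  split; first by rewrite mulf_neq0 ?invr_eq0// subr_eq0.
  apply/eqP => E; apply: no; exists z => //; apply/eqP; rewrite -subr_eq0; apply/eqP.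
  have : f z - b = c - b by rewrite -[RHS]mulr1 -E /psi mulrA divff// mul1r.
  by move=> /addIr ->; rewrite subrr.
move: H; rewrite sqr_jap /psi !normcM normcV -cE mulVf ?gt_eqF// expr1n mulrC ler_pdivrMr//.
rewrite leNgt => /negP; apply; apply: le_lt_trans big; rewrite -cE.
by have -> : K0 / r * (1 + 1) * normc (c - b) = 2 * K0 / r * normc (c - b) by ring.
Qed.

Section Expanding.
Variables (G : set {poly C}) (g : {poly C}) (A : set C) (b : C).
Hypotheses (pG : pcb G) (Gg : G g) (Ag : forall z, A z -> A g.[z]) (Ab : ~ A b).
Hypothesis Aexp : forall z, A z -> 3 / 2 * normc (g.[z] - b) <= normc g^`().[z] * normc (z - b).

Lemma it_forward n z : fatou G (fin z) -> fatou G (fin (it g n z)).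
Proof.
move=> Fz; elim: n => [//|n IH]; apply: (fatou_forward (pcb_size1 pG)) => //.
by case: pG => _ h _ _; exact: h.
Qed.

Lemma it_inv n z : A z -> A (it g n z).
Proof. by move=> Az; elim: n => [//|n IH]; exact: Ag. Qed.

(** In the coordinate log (z - b), [Aexp] says that [g] expands by at least 3/2, and the chain rule
    multiplies these factors. The section serves both a finite superattracting point [b] and
    infinity, for which [b = 0]. *)
Lemma deriv_growth n z : A z ->
  (3 / 2) ^+ n * normc (it g n z - b) <= normc (piter g n)^`().[z] * normc (z - b).
Proof.
move=> Az; elim: n => [|n IH]; first by rewrite expr0 mul1r derivX hornerC normc1 mul1r.
have -> : piter g n.+1 = g \Po piter g n by [].
rewrite deriv_comp hornerM horner_comp horner_piter normcM.
have := Aexp (it_inv n Az); have -> : it g n.+1 z = g.[it g n z] by [].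
set x := normc g^`().[_]; set y := normc (piter _ _)^`().[_] in IH *.
set Y := normc (g.[_] - b); set Z := normc (_ - b) in IH *; set W := normc (z - b) in IH *.
move=> h; have x0 : 0 <= x by exact: normc_ge0.
have e0 : 0 <= (3 / 2 : R) ^+ n by rewrite exprn_ge0// divr_ge0.
have h1 : (3 / 2) ^+ n * (3 / 2 * Y) <= (3 / 2) ^+ n * (x * Z) by rewrite ler_wpM2l.
have h2 : x * ((3 / 2) ^+ n * Z) <= x * (y * W) by rewrite ler_wpM2l.
rewrite exprS; have -> : 3 / 2 * (3 / 2) ^+ n * Y = (3 / 2) ^+ n * (3 / 2 * Y) by ring.
apply: le_trans h1 _; have -> : (3 / 2) ^+ n * (x * Z) = x * ((3 / 2) ^+ n * Z) by ring.
by apply: le_trans h2 _; rewrite mulrA.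
Qed.

Lemma three_halves_unbounded M : exists n0, forall n, (n0 <= n)%N -> M < (3 / 2) ^+ n.
Proof.
exists (Num.truncn (2 * `|M|)).+1 => n hn.
have h : forall n, 1 + n%:R / 2 <= (3 / 2 : R) ^+ n.
  elim=> [|k IH]; first by rewrite expr0 mul0r addr0.
  by rewrite exprS -natr1; have : 0 <= k%:R :> R by []; lra.
apply: lt_le_trans (h n); have h1 := truncnS_gt (2 * `|M|).
have h2 : (Num.truncn (2 * `|M|)).+1%:R <= n%:R :> R by rewrite ler_nat.
by have := ler_norm M; lra.
Qed.

(** The relative derivative of the [n]-th iterate outgrows the constant of [landau_circle], so the
    image of the disc of radius [r / 2] about [v'] contains the whole circle about [b] through the
    image of [v']. The index [n0] is common to all these centres, so that circles fill whole annuli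
    later. *)
Lemma circles_expanding v r : 0 < r -> (forall z, normc (z - v) < r -> A z /\ fatou G (fin z)) ->
  exists n0, forall n v' c, (n0 <= n)%N -> normc (v' - v) < r / 2 ->
    normc (c - b) = normc (it g n v' - b) -> fatou G (fin c).
Proof.
move=> r0 hV; have [K K0 hK] := landau_circle; have r2 : 0 < r / 2 by rewrite divr_gt0.
have [n0 hn0] := three_halves_unbounded (K / (r / 2) * (normc (v - b) + r)).
exists n0 => n v' c nn v'v cE.
have sub z : normc (z - v') < r / 2 -> normc (z - v) < r.
  by have := ler_distcD v' z v; lra.
have Av' : A v' by apply: (hV v' _).1; lra.
have om z : normc (z - v') < r / 2 -> cdiff (fun z => (piter g n).[z]) z /\ (piter g n).[z] != b.
  move=> /sub /hV[Az _]; split; first exact: cdiff_horner.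
  by apply/eqP => E; apply: Ab; rewrite -E horner_piter; exact: it_inv.
have big : K / (r / 2) * normc ((piter g n).[v'] - b) < normc (piter g n)^`().[v'].
  have h := deriv_growth n Av'; rewrite horner_piter.
  have vb : 0 < normc (v' - b) by rewrite normc_gt0 subr_eq0; apply/eqP => E; apply: Ab; rewrite -E.
  have v'b : normc (v' - b) <= normc (v - b) + r by have := ler_distcD v v' b; lra.
  rewrite -(ltr_pM2r vb); apply: lt_le_trans h.
  have itb : 0 < normc (it g n v' - b).
    by rewrite normc_gt0 subr_eq0; apply/eqP => E; apply: Ab; rewrite -E; exact: it_inv.
  rewrite mulrAC ltr_pM2r//; apply: le_lt_trans (hn0 n nn).
  by rewrite ler_wpM2l// divr_ge0 ?(ltW K0) ?(ltW r2).
have [|x xv' fx] := hK _ v' (r / 2) _ b r2 om (has_cderiv_horner _ _) big c.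
  by rewrite horner_piter.
rewrite -fx horner_piter; apply: it_forward.
by case: (hV x (sub x xv')).
Qed.
End Expanding.

(** With [g - b = q * (z - b) ^+ m] and [q b] nonzero, the two conditions at [b] force [m >= 2]; the
    ratio g'(z) (z - b) / (g(z) - b) tends to [m], hence its modulus exceeds 3/2 near [b]. *)
Lemma superattracting_nbhd g b : (1 < size g)%N -> g.[b] = b -> g^`().[b] = 0 ->
  exists2 r, 0 < r & forall z, normc (z - b) < r -> z <> b ->
    [/\ g.[z] <> b, normc (g.[z] - b) <= normc (z - b) / 2 &
      3 / 2 * normc (g.[z] - b) <= normc g^`().[z] * normc (z - b)].
Proof.
move=> g1 gb g'b.
have p0 : g - b%:P != 0.
  have sw : (size (- b%:P) < size g)%N by rewrite size_polyN (leq_ltn_trans (size_polyC_leq1 _)).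
  by rewrite -size_poly_gt0 size_polyDl// (ltn_trans _ g1).
have [m [q]] := multiplicity_XsubC (g - b%:P) b; rewrite p0 /= => qb E.
have gE z : g.[z] - b = q.[z] * (z - b) ^+ m.
  have -> : g.[z] - b = (g - b%:P).[z] by rewrite hornerD hornerN hornerC.
  by rewrite E hornerM horner_exp hornerXsubC.
have dE : g^`() = q^`() * ('X - b%:P) ^+ m + q * (('X - b%:P) ^+ m.-1 *+ m).
  have -> : g^`() = (g - b%:P)^`() by rewrite derivB derivC subr0.
  rewrite E derivM; congr (_ + _ * _).
  by rewrite deriv_exp derivXsubC mul1r.
have q0 : q.[b] != 0 by exact: qb.
have m2 : exists k0, m = k0.+2.
  case: m E gE dE => [|[|m]] E gE dE; last by exists m.
    by have := gE b; rewrite gb subrr expr0 mulr1 => q1; move/eqP: q0; rewrite -q1.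
  move: g'b; rewrite dE hornerD hornerM horner_exp hornerXsubC subrr expr1 mulr0 add0r.
  by rewrite hornerM expr0 mulr1n hornerC mulr1 => /eqP; rewrite (negbTE q0).
have [m' mE] := m2; pose c := normc q.[b]; have c0 : 0 < c by rewrite normc_gt0.
have c2 : 0 < c / 2 by rewrite divr_gt0.
have [r1 r10 h1] := (continuous_normcP _ _).1 (@poly_continuous R q b) (c / 2) c2.
have [r2 r20 h2] := (continuous_normcP _ _).1 (@poly_continuous R q^`() b) 1 ltr01.
pose Q := normc q^`().[b] + 1; have Q0 : 0 < Q by rewrite ltr_pwDr// normc_ge0.
exists (Num.min (Num.min r1 r2) (Num.min (c / (4 * Q)) (Num.min 1 (4 * c)^-1))).
  by rewrite !lt_min r10 r20 ltr01 divr_gt0 ?mulr_gt0// invr_gt0 mulr_gt0.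
move=> z; rewrite !lt_min => /andP[/andP[z1 z2] /andP[z3 /andP[z4 z5]]] zb.
have zb0 : 0 < normc (z - b) by rewrite normc_gt0 subr_eq0; apply/eqP.
have qz := h1 z z1; have q'z := h2 z z2.
have qlo : c / 2 < normc q.[z].
  by have := lerB_normc q.[b] q.[z]; rewrite normc_distC -/c; clear -qz; lra.
have qhi : normc q.[z] <= 2 * c.
  by have := lerB_normc q.[z] q.[b]; rewrite -/c; clear -qz c0; lra.
have q'hi : normc q^`().[z] <= Q.
  by have := lerB_normc q^`().[z] q^`().[b]; rewrite /Q; clear -q'z; lra.
have zm : normc (z - b) ^+ m <= normc (z - b) * normc (z - b).
  by rewrite mE !exprS mulrA ler_piMr ?mulr_ge0 ?normc_ge0// exprn_ile1 ?normc_ge0// ltW.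
split.
- apply/eqP; rewrite -subr_eq0 gE mulf_neq0 ?expf_neq0 ?subr_eq0//; last exact/eqP.
  by rewrite -normc_gt0; exact: lt_trans qlo.
- rewrite gE normcM normcX; apply: (@le_trans _ _ (2 * c * (normc (z - b) * normc (z - b)))).
    by rewrite ler_pM ?normc_ge0// exprn_ge0 ?normc_ge0.
  rewrite mulrA mulrC ler_pM2l//.
  have := z5; rewrite -[X in X < _]mul1r -ltr_pdivlMr// ?invr_gt0// => h.
  have c4 : 0 < 4 * c by rewrite mulr_gt0.
  have : normc (z - b) * (4 * c) < 1 by rewrite -ltr_pdivlMr// div1r.
  by clear; lra.
rewrite gE dE !normcM normcX hornerD !hornerM hornerMn !horner_exp hornerXsubC.
have -> : q^`().[z] * (z - b) ^+ m + q.[z] * ((z - b) ^+ m.-1 *+ m) =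
  (z - b) ^+ m.-1 * (q.[z] * m%:R + q^`().[z] * (z - b)).
  by rewrite mE -mulr_natr /= exprS; ring.
have key : 3 / 2 * normc q.[z] <= normc (q.[z] * m%:R + q^`().[z] * (z - b)).
  have h3 := lerB_normcD (q.[z] * m%:R) (q^`().[z] * (z - b)).
  rewrite !normcM normc_nat in h3; apply: le_trans h3.
  have h4 : normc q.[z] * 2 <= normc q.[z] * m%:R by rewrite ler_wpM2l ?normc_ge0// ler_nat mE.
  have h5 : normc q^`().[z] * normc (z - b) <= Q * (c / (4 * Q)).
    by apply: ler_pM; rewrite ?normc_ge0// ltW.
  have h6 : Q * (c / (4 * Q)) = c / 4 by field; rewrite gt_eqF.
  by rewrite h6 in h5; clear -h4 h5 qlo; lra.
set X := q.[z] * m%:R + _ in key *.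
have -> : normc ((z - b) ^+ m.-1 * X) * normc (z - b) = normc X * normc (z - b) ^+ m.
  by rewrite normcM normcX mE /= [in RHS]exprSr; ring.
by rewrite mulrA ler_wpM2r ?exprn_ge0 ?normc_ge0.
Qed.

Lemma poly_upper q n : (size q <= n.+1)%N -> exists2 M, 0 <= M & forall z, 1 <= normc z -> normc q.[z] <= M * normc z ^+ n.
Proof.
move=> qn; exists (\sum_(i < size q) normc q`_i).
  by apply: sumr_ge0 => i _; exact: normc_ge0.
move=> z z1; rewrite horner_coef mulr_suml.
elim/big_ind2: _ => [|x1 x2 y1 y2 h1 h2|i _]; first by rewrite normc0.
  by apply: le_trans (ler_normcD _ _) _; exact: lerD.
rewrite normcM normcX ler_wpM2l ?normc_ge0// ler_weXn2l//.
by rewrite -ltnS (leq_trans _ qn).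
Qed.

(** The polynomial [q = X g' - N g] has degree below [N], so it is at most [|g| / 2] far out; as
    [N >= 2], this leaves [|z g'| >= 3/2 |g|]. *)
Lemma infinity_nbhd g : (2 < size g)%N -> exists2 r, 1 <= r & forall z, r < normc z ->
  [/\ 2 * normc z <= normc g.[z] & 3 / 2 * normc (g.[z] - 0) <= normc g^`().[z] * normc (z - 0)].
Proof.
move=> g2; have g1 : (1 < size g)%N by exact: ltn_trans g2.
have [r1 r11 h1] := poly_escape g2; have [r2 r20 h2] := poly_lower g1.
set N := (size g).-1 in h2; have N0 : (0 < N)%N by exact: pred_size_gt0.
pose q := 'X * g^`() - N%:R *: g.
have sq : (size q <= N)%N.
  apply/leq_sizeP => j Nj; rewrite coefB coefZ coefXM.
  case: j Nj => [|j Nj]; first by rewrite leqNgt N0.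
  rewrite coef_deriv /= -[g`_j.+1 *+ _](mulr_natl g`_j.+1).
  move: Nj; rewrite leq_eqVlt => /predU1P[->|Nj].
    by rewrite subrr.
  have -> : g`_j.+1 = 0 by apply: nth_default; rewrite -(prednK (ltn_trans _ g1)).
  by rewrite !mulr0 subrr.
have [M M0 hM] := @poly_upper q N.-1 (ltac:(by rewrite prednK)).
have l0 := lead_gt0 g1; set l := normc (lead_coef g) in h2 l0.
pose r3 := 2 ^+ N * M * 2 / l.
have r30 : 0 <= r3 by rewrite divr_ge0 ?(ltW l0)// !mulr_ge0// exprn_ge0.
exists (r1 + 2 * r2 + r3) => [|z zr]; first by lra.
have zr1 : r1 <= normc z by lra.
have z1 : 1 <= normc z by lra.
split; first exact: h1.
rewrite !subr0.
have gz : l * (normc z / 2) ^+ N <= normc g.[z].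
  apply: le_trans (h2 z _); last by lra.
  by rewrite ler_pM2l// lerXn2r ?nnegrE; lra.
have qz : normc q.[z] <= normc g.[z] / 2.
  apply: le_trans (hM z z1) _; apply: (@le_trans _ _ (l * (normc z / 2) ^+ N / 2)); last by lra.
  have -> : normc z ^+ N.-1 = normc z ^+ N / normc z.
    by rewrite -[in RHS](prednK N0) exprSr mulfK// gt_eqF//; lra.
  have zp : 0 < normc z by lra.
  have p2 : 0 < (2 : R) ^+ N by rewrite exprn_gt0.
  have ML : M <= l * normc z / (2 ^+ N * 2).
    rewrite ler_pdivlMr ?mulr_gt0//; have -> : M * (2 ^+ N * 2) = l * r3 by rewrite /r3; field; rewrite gt_eqF.
    by rewrite ler_pM2l//; lra.
  apply: (@le_trans _ _ (l * normc z / (2 ^+ N * 2) * (normc z ^+ N / normc z))).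
    by rewrite ler_wpM2r// divr_ge0 ?exprn_ge0 ?normc_ge0.
  by rewrite expr_div_n le_eqVlt; apply/orP; left; apply/eqP; field; rewrite !gt_eqF.
have E : q.[z] = z * g^`().[z] - N%:R * g.[z].
  by rewrite hornerD hornerN hornerM hornerX hornerZ.
have := lerB_normc (N%:R * g.[z]) (- q.[z]).
have -> : N%:R * g.[z] - - q.[z] = z * g^`().[z] by rewrite E; ring.
rewrite normc_opp !normcM normc_nat mulrC => h.
have h3 : normc g.[z] * 2 <= normc g.[z] * N%:R.
  by rewrite ler_wpM2l ?normc_ge0// ler_nat pred_size_gt1.
by rewrite [leRHS]mulrC; lra.
Qed.

Section Semigroup.
Variable G : set {poly C}.
Hypothesis pG : pcb G.

Lemma open_fatou_fin z : fatou G (fin z) -> exists2 e, 0 < e & forall w, normc (w - z) < e -> fatou G (fin w).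
Proof. by move=> Fz; have := @open_fatou R G; rewrite openE => /(_ _ Fz) /nbhs_fin. Qed.

Lemma jul_dichotomy h z0 r : G h -> (forall c, normc (c - z0) = r -> fatou G (fin c)) ->
  forall a, jul h a -> normc (a - z0) < r -> forall c, jul h c -> normc (c - z0) < r.
Proof.
move=> Gh circ a ja ar c jc; rewrite ltNge le_eqVlt; apply/negP => /orP[/eqP E|cr].
  by apply: (jul_julia pG Gh jc); apply: circ.
have [x jx xr] := @connected_ivt _ _ (jul h) (fun x => normc (x - z0)) r (pcb_jul_connected pG Gh)
  (fun x _ => @continuous_normc_sub R z0 x) a c ja jc ar cr.
by apply: (jul_julia pG Gh jx); exact: circ.
Qed.

Lemma small_circle_contra z0 r (q : C) : crit_values G q -> r <= normc (q - z0) -> 0 < r ->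
  julia G (fin z0) -> (forall c, normc (c - z0) = r -> fatou G (fin c)) -> False.
Proof.
move=> cq qr r0 jz circ; have [h [w [Gh jw wz]]] := (julia_finP pG z0).1 jz r r0.
have := jul_subset (pcb_size pG Gh) (jul_dichotomy Gh circ jw wz) (crit_Kf pG Gh cq).
by rewrite ltNge qr.
Qed.

Lemma not_interior_fin z0 : ~ interior (julia G) (fin z0) ->
  forall e, 0 < e -> exists2 v, normc (v - z0) < e & fatou G (fin v).
Proof.
move=> ni e e0; apply: contrapT => no; apply: ni; apply/nbhs_fin; exists e => // w we.
by move=> Fw; apply: no; exists w.
Qed.

Lemma interior_superattracting_two g z0 (q : C) : G g -> g.[z0] = z0 -> g^`().[z0] = 0 ->
  crit_values G q -> q <> z0 -> julia G (fin z0) -> interior (julia G) (fin z0).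
Proof.
move=> Gg gz g'z cq qz jz; apply: contrapT => ni; have g1 := pcb_size1 pG Gg.
have [r r0 hr] := superattracting_nbhd g1 gz g'z.
have [v vr Fv] := not_interior_fin ni r0.
have vz : v <> z0 by move=> E; apply: jz; rewrite -E.
have vz0 : 0 < normc (v - z0) by rewrite normc_gt0 subr_eq0; exact/eqP.
have [e e0 he] := open_fatou_fin Fv.
pose A z := normc (z - z0) < r /\ z <> z0.
have Ag z : A z -> A g.[z].
  move=> [zr zz]; have [h1 h2 _] := hr z zr zz; split; last exact: h1.
  by have := normc_ge0 (z - z0); lra.
pose d := Num.min e (Num.min (normc (v - z0)) (r - normc (v - z0))).
have d0 : 0 < d by rewrite !lt_min e0 vz0 subr_gt0.
have hV z : normc (z - v) < d -> A z /\ fatou G (fin z).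
  rewrite !lt_min => /andP[z1 /andP[z2 z3]]; split; last exact: he.
  split; first by have := ler_distcD v z z0; lra.
  by move=> E; rewrite E normc_distC ltxx in z2.
have [n0 hn0] := circles_expanding pG Gg Ag (fun Az0 : A z0 => Az0.2 erefl)
  (fun z Az => let: And3 _ _ hz := hr z Az.1 Az.2 in hz) d0 hV.
have Av : A v := conj vr vz.
have small n : normc (it g n v - z0) * 2 ^+ n <= normc (v - z0).
  elim: n => [|n IH]; first by rewrite expr0 mulr1.
  have [a1 a2] := it_inv Ag n Av; have [_ h _] := hr _ a1 a2.
  apply: le_trans IH; rewrite exprS mulrA.
  apply: ler_wpM2r; first by rewrite exprn_ge0.
  have two : 0 < 2 :> R by rewrite ltr0n.
  by rewrite -(ler_pdivlMr _ _ two); exact: h.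
have qz0 : 0 < normc (q - z0) by rewrite normc_gt0 subr_eq0; exact/eqP.
(* [n] is also so large that the circle through [it g n v] about [z0] has radius at most the
   distance from [z0] to the critical value [q], so that it does not enclose [q]. *)
pose n := maxn n0 (Num.truncn (normc (v - z0) / normc (q - z0))).+1.
have rn : normc (it g n v - z0) <= normc (q - z0).
  have h1 := small n; have h2 : normc (v - z0) / normc (q - z0) <= 2 ^+ n.
    apply: ltW; apply: lt_le_trans (truncnS_gt _) _.
    rewrite -natrX ler_nat; apply: leq_trans (leq_maxr n0 _) _.
    by apply: ltnW; rewrite ltn_expl.
  have h3 := le_trans h1 (ltac:(rewrite -(ler_pdivrMl _ _ qz0) mulrC; exact: h2) : _ <= normc (q - z0) * 2 ^+ n).
  have two : 0 < (2 : R) ^+ n by rewrite exprn_gt0.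
  by rewrite -(ler_pM2r two); exact: h3.
apply: (small_circle_contra cq rn _ jz).
  by rewrite normc_gt0 subr_eq0; apply/eqP; have [] := it_inv Ag n Av.
move=> c; apply: (hn0 n v c (leq_maxl _ _)); rewrite subrr normc0 divr_gt0//.
Qed.
End Semigroup.
End Superattracting.

(** * Semigroups with a single finite critical value *)

Section Monomials.
Context {R : realType}.
Local Notation C := R[i].
Implicit Types (z w c u x : C) (f g h : {poly C}) (s t e : R) (n : nat).

(* In the logarithmic coordinate [ln |z - v|] a map [v + a (z - v)^d] is affine with
   slope [d], and its Julia set is the repelling fixed point [- ln |a| / (d - 1)]. *)
Definition logd v z : R := ln (normc (z - v)).
Definition deg h : R := (size h).-1%:R.
Definition yy h : R := - ln (normc (lead_coef h)) / (deg h - 1).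

Lemma escape_absurd (P Q X Y V Z N : R) : N + V + Z < X -> 1 + (Y + X) <= Q -> P <= N -> Q <= P + V ->
  - Y <= Z -> False.
Proof. lra. Qed.

Lemma pow_unbounded (d M : R) : 2 <= d -> exists n, M < d ^+ n.
Proof.
move=> d2; exists (Num.truncn `|M|).+1; apply: le_lt_trans (ler_norm M) _.
apply: lt_le_trans (truncnS_gt _) _; apply: (@le_trans _ _ (2 ^+ (Num.truncn `|M|).+1)).
  by rewrite -natrX ler_nat ltnW// ltn_expl.
by apply: lerXn2r; rewrite ?nnegrE//; apply: le_trans d2.
Qed.

(* The images of [[t, be[] under the [j]-th iterate of [s |-> yg + Dg (s - yg)] followed by
   all iterates of [s |-> yf + df (s - yf)] overlap and cover a half-line. *)
Lemma affine_cover (df Dg t be yf yg : R) : 2 <= df -> 2 <= Dg -> t < be -> be <= yf -> be <= yg ->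
  yg < be + (be - t) / (2 * df) -> exists (j : nat) (a : R), forall r : R, a < r -> exists (i : nat) (s : R),
  [/\ t <= s, s < be & yf + df ^+ i * (yg + Dg ^+ j * (s - yg) - yf) = yf - r].
Proof.
move=> d2 D2 tb bf bg gb; have dp : 0 < df by apply: lt_le_trans d2.
have l0 : 0 < be - t by rewrite subr_gt0.
have l2 : 0 < (be - t) / 2 by rewrite divr_gt0.
have [c cE] : exists c : R, c = yf - yg by exists (yf - yg).
have [j jD] := pow_unbounded ((df - 1) * c / ((be - t) / 2)) D2.
rewrite ltr_pdivrMr// in jD.
have D1 : 1 <= Dg ^+ j by rewrite exprn_ege1//; clear -D2; lra.
have [D DE] : exists D : R, D = Dg ^+ j by exists (Dg ^+ j).
rewrite -DE in jD D1.
(* Measured downwards from [yf], the interval [[t, be[] is sent to []b, a]], and the second map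
   multiplies by [df]. The inequality [df * b < a] makes consecutive multiples overlap, so that they
   cover everything beyond [a]. *)
have [a aE] : exists a : R, a = c + D * (yg - t) by exists (c + D * (yg - t)).
have [b bE] : exists b : R, b = c + D * (yg - be) by exists (c + D * (yg - be)).
have b0 : 0 <= b.
  have : 1 * (yg - be) <= D * (yg - be) by rewrite ler_wpM2r// subr_ge0.
  by rewrite bE cE; clear -bf; lra.
have ab : df * b < a.
  have h1 : df * (yg - be) <= (be - t) / 2.
    have h : yg - be <= (be - t) / (2 * df) by clear -gb; lra.
    have E : (be - t) / (2 * df) = (be - t) / 2 / df by field; rewrite gt_eqF.
    by rewrite mulrC -ler_pdivlMr// -E.
  have h2 : D * (df * (yg - be)) <= D * ((be - t) / 2) by rewrite ler_wpM2l//; clear -D1; lra.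
  have h3 : D * (be - t) <= D * (yg - t).
    by rewrite ler_wpM2l//; [clear -D1; lra|clear -bg; lra].
  have E : df * b = df * c + D * (df * (yg - be)) by rewrite bE; ring.
  have E2 : D * (be - t) = D * ((be - t) / 2) + D * ((be - t) / 2) by field.
  by rewrite E aE; clear -jD h2 h3 E2; lra.
have a0 : 0 < a by apply: le_lt_trans ab; rewrite mulr_ge0// ltW.
exists j, a => r ra.
have ex : exists i, r < a * df ^+ i.
  have [i hi] := pow_unbounded (r / a) d2; exists i.
  by rewrite mulrC -ltr_pdivrMr.
case: (ex_minnP ex) => -[|i] hi hmin; first by move: hi; rewrite expr0 mulr1; clear -ra; lra.
have hi' : a * df ^+ i <= r by rewrite leNgt; apply/negP => /hmin; rewrite ltnn.
have pi0 : 0 < df ^+ i.+1 by rewrite exprn_gt0.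
have [sg sgE] : exists sg : R, sg = r / df ^+ i.+1 by exists (r / df ^+ i.+1).
have sa : sg < a by rewrite sgE ltr_pdivrMr.
have sb : b < sg.
  rewrite sgE ltr_pdivlMr// exprS mulrA; apply: lt_le_trans hi'.
  by rewrite ltr_pM2r ?exprn_gt0// mulrC.
have D0 : 0 < D by clear -D1; lra.
exists i.+1, (yg - (sg - c) / D); split.
- have : (sg - c) / D <= yg - t by rewrite ler_pdivrMr// mulrC; clear -sa aE; lra.
  by clear; lra.
- have : yg - be < (sg - c) / D by rewrite ltr_pdivlMr// mulrC; clear -sb bE; lra.
  by clear; lra.
rewrite -DE sgE cE; field.
by rewrite !gt_eqF.
Qed.

Variables (G : set {poly C}) (v : C).
Hypotheses (pG : pcb G) (hv : crit_values G `<=` [set v]).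

Local Notation Ln := (logd v).

Let dist_gt0 z : z != v -> 0 < normc (z - v).
Proof. by rewrite normc_gt0 subr_eq0. Qed.

Let deg_ge2 h : G h -> 2 <= deg h.
Proof. by move=> Gh; rewrite ler_nat pred_size_gt1// (pcb_size pG). Qed.

Let crit_v : crit_values G v.
Proof. by have [u cu] := crit_ex pG; have := hv cu => /= <-. Qed.

Lemma log_horner h z : G h -> z != v -> h.[z] != v /\ Ln h.[z] = yy h + deg h * (Ln z - yy h).
Proof.
move=> Gh zv; have z0 := dist_gt0 zv; have l0 := lead_gt0 (pcb_size1 pG Gh).
have E : h.[z] - v = lead_coef h * (z - v) ^+ (size h).-1.
  by rewrite (crit_monomial pG hv Gh) addrC addKr.
split; first by rewrite -subr_eq0 E mulf_neq0 ?expf_neq0 ?subr_eq0// -normc_gt0.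
have d1 : deg h - 1 != 0 by rewrite gt_eqF//; have := deg_ge2 Gh; lra.
rewrite /logd E normcM normcX lnM ?posrE ?exprn_gt0// lnXn// -mulr_natl -/(deg h) /yy.
by field.
Qed.

Lemma log_it h n z : G h -> z != v -> it h n z != v /\ Ln (it h n z) = yy h + deg h ^+ n * (Ln z - yy h).
Proof.
move=> Gh zv; elim: n => [|n [IH1 IH2]]; first by rewrite expr0 mul1r addrC subrK.
have -> : it h n.+1 z = h.[it h n z] by [].
have [h1 h2] := log_horner Gh IH1; split; first exact: h1.
by rewrite h2 IH2 exprS; ring.
Qed.

Lemma dist_exp z : z != v -> normc (z - v) = expR (Ln z).
Proof. by move=> zv; rewrite lnK// posrE dist_gt0. Qed.

Let deg_pow h n : G h -> n%:R <= deg h ^+ n.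
Proof.
move=> Gh; apply: (@le_trans _ _ (2 ^+ n)); first by rewrite -natrX ler_nat ltnW// ltn_expl.
have d2 := deg_ge2 Gh; have d0 : 0 <= deg h by lra.
by apply: lerXn2r; rewrite ?nnegrE.
Qed.

Lemma Kf_log h z : G h -> z != v -> Kf h z <-> Ln z <= yy h.
Proof.
move=> Gh zv; split=> [[M hM]|le].
  rewrite leNgt; apply/negP => lt; have d0 : 0 < Ln z - yy h by rewrite subr_gt0.
  pose A := (M + normc v + `|yy h|) / (Ln z - yy h).
  pose n := (Num.truncn `|A|).+1.
  have nA : A < n%:R by apply: le_lt_trans (ler_norm A) _; exact: truncnS_gt.
  have [nv E] := log_it n Gh zv.
  have h1 : M + normc v + `|yy h| < deg h ^+ n * (Ln z - yy h).
    by rewrite -ltr_pdivrMr//; apply: lt_le_trans nA _; exact: deg_pow.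
  have h2 := expR_ge1Dx (Ln (it h n z)); rewrite -dist_exp// E in h2.
  have h3 := hM n; have h4 := ler_normcB (it h n z) v; have h5 := ler_norm (- yy h).
  rewrite normrN in h5.
  exact: escape_absurd h1 h2 h3 h4 h5.
exists (expR (yy h) + normc v) => n; have [nv E] := log_it n Gh zv.
have h1 : normc (it h n z - v) <= expR (yy h).
  rewrite dist_exp// ler_expR E gerDl mulr_ge0_le0//; last by rewrite subr_le0.
  by rewrite exprn_ge0//; have := deg_ge2 Gh; lra.
by have := lerB_normc (it h n z) v; lra.
Qed.

Lemma near_in_Kf h z : G h -> normc (z - v) < expR (yy h) -> Kf h z.
Proof.
move=> Gh zr; have [->|zv] := eqVneq z v; first exact: crit_Kf crit_v.
by apply/(Kf_log Gh zv); rewrite -ler_expR -dist_exp// ltW.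
Qed.

Lemma not_jul_inside h z : G h -> normc (z - v) < expR (yy h) -> ~ jul h z.
Proof.
move=> Gh zr [_ cz].
have [w nK wz] := (closure_normcP _ _).1 cz (expR (yy h) - normc (z - v)) (ltac:(by rewrite subr_gt0)).
by apply: nK; apply: near_in_Kf => //; have := ler_distcD z w v; lra.
Qed.

Lemma jul_log h z : G h -> jul h z -> z != v /\ Ln z = yy h.
Proof.
move=> Gh jz; have zv : z != v.
  apply/eqP => E; apply: (@not_jul_inside h z Gh) => //.
  by rewrite E subrr normc0 expR_gt0.
split=> //; apply/eqP; rewrite eq_le; have [Kz _] := jz.
rewrite ((Kf_log Gh zv).1 Kz)/= leNgt; apply/negP => lt.
by apply: (@not_jul_inside h z Gh) => //; rewrite dist_exp// ltr_expR.
Qed.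

Lemma log_jul h z : G h -> z != v -> Ln z = yy h -> jul h z.
Proof.
move=> Gh zv Lz; split; first by apply/Kf_log => //; rewrite Lz.
have z0 := dist_gt0 zv.
apply/closure_normcP => e e0; pose k : R := e / (2 * normc (z - v)).
have k0 : 0 < k by rewrite divr_gt0// mulr_gt0.
have E : v + (1 + k)%:C * (z - v) - v = (1 + k)%:C * (z - v) by ring.
have nE : normc (v + (1 + k)%:C * (z - v) - v) = (1 + k) * normc (z - v).
  by rewrite E normcM normc_real ger0_norm//; lra.
have wv : v + (1 + k)%:C * (z - v) != v.
  by rewrite -subr_eq0 -normc_gt0 nE mulr_gt0//; lra.
exists (v + (1 + k)%:C * (z - v)).
  move=> /(Kf_log Gh wv); apply/negP; rewrite -ltNge -Lz /logd ltr_ln ?posrE//; last first.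
    by rewrite nE mulr_gt0//; lra.
  by rewrite nE ltr_pMl//; lra.
have -> : v + (1 + k)%:C * (z - v) - z = k%:C * (z - v) by rewrite rmorphD rmorph1; ring.
rewrite normcM normc_real gtr0_norm//.
have -> : k * normc (z - v) = e / 2 by rewrite /k; field; rewrite gt_eqF.
by lra.
Qed.

(** The closure of the set of all [yy h], that is, of the logarithmic radii of the circles
    [jul h]. *)
Let JL t := forall e, 0 < e -> exists2 h, G h & `|yy h - t| < e.

Lemma julia_JL z : z != v -> julia G (fin z) <-> JL (Ln z).
Proof.
move=> zv; have z0 := dist_gt0 zv; rewrite (julia_finP pG); split=> H e e0.
  have cL : {for z, continuous (fun w => ln (normc (w - v)))}.
    apply: (@continuous_comp _ _ _ (fun w => normc (w - v)) (@ln R)).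
      exact: continuous_normc_sub.
    exact: continuous_ln.
  have [d d0 hd] := (continuous_normcRP _ _).1 cL e e0.
  have m0 : 0 < Num.min d (normc (z - v)) by rewrite lt_min d0.
  have [h [w [Gh jw]]] := H _ m0; rewrite lt_min => /andP[w1 w2].
  by exists h => //; have [_ <-] := jul_log Gh jw; exact: hd.
have ez : 0 < e / normc (z - v) by rewrite divr_gt0.
have /cvgrPdist_lt /(_ _ ez) /nbhs_ballP[d /= d0 hd] := @continuous_expR R 0.
have [h Gh hz] := H d d0; exists h, (v + (expR (yy h - Ln z))%:C * (z - v)).
have E : v + (expR (yy h - Ln z))%:C * (z - v) - v = (expR (yy h - Ln z))%:C * (z - v) by ring.
have nE : normc (v + (expR (yy h - Ln z))%:C * (z - v) - v) = expR (yy h).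
  rewrite E normcM normc_real ger0_norm ?expR_ge0// dist_exp// -expRD.
  by congr expR; ring.
have wv : v + (expR (yy h - Ln z))%:C * (z - v) != v.
  by rewrite -subr_eq0 -normc_gt0 nE expR_gt0.
split=> //; first by apply: log_jul => //; rewrite /logd nE expRK.
have -> : v + (expR (yy h - Ln z))%:C * (z - v) - z = (expR (yy h - Ln z) - 1)%:C * (z - v).
  by rewrite rmorphB rmorph1; ring.
rewrite normcM normc_real -ltr_pdivlMr//.
have hb : ball (0 : R) d (yy h - Ln z) by rewrite /ball /= sub0r normrN.
by have := hd _ hb; rewrite expR0 distrC.
Qed.

Lemma JL_yy h : G h -> JL (yy h).
Proof. by move=> Gh e e0; exists h => //; rewrite subrr normr0. Qed.

Lemma JL_forward h n t : G h -> ~ JL t -> ~ JL (yy h + deg h ^+ n * (t - yy h)).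
Proof.
move=> Gh; elim: n => [|n IH] nt; first by rewrite expr0 mul1r addrC subrK.
have := IH nt; set s := yy h + _ => ns.
have -> : yy h + deg h ^+ n.+1 * (t - yy h) = yy h + deg h * (s - yy h).
  by rewrite /s exprS; ring.
pose z := v + (expR s)%:C.
have nz : normc (z - v) = expR s by rewrite /z addrC addKr normc_real ger0_norm ?expR_ge0.
have zv : z != v by rewrite -subr_eq0 -normc_gt0 nz expR_gt0.
have Lz : Ln z = s by rewrite /logd nz expRK.
have Fz : fatou G (fin z).
  by apply: contrapT => /(julia_JL zv); rewrite Lz.
have [hzv E] := log_horner Gh zv; rewrite -Lz -E => /(julia_JL hzv); apply.
by apply: (fatou_forward (pcb_size1 pG)) => //; case: pG.
Qed.

Lemma JL_gap s t : ~ JL t -> t <= s -> JL s ->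
  exists be, [/\ t < be, JL be & forall r : R, t <= r -> r < be -> ~ JL r].
Proof.
move=> njt ts Js; pose B := [set r | JL r /\ t <= r].
have Bs : B s := conj Js ts.
have hB : has_inf B by split; [exists s|exists t => r []].
have glb r : B r -> inf B <= r by move=> Br; apply: inf_lbound; [exact: hB.2|exact: Br].
have adh e : 0 < e -> exists2 r, B r & r < inf B + e by move=> e0; exact: inf_adherent e0 hB.
have lb : t <= inf B by apply: lb_le_inf; [exists s|move=> r []].
move: (inf B) glb adh lb => be glb adh lb; exists be.
have JLb : JL be.
  move=> e e0; have e2 : 0 < e / 2 by rewrite divr_gt0.
  have [r Br rb] := adh _ e2; have br := glb r Br; have [h Gh hs] := Br.1 _ e2.
  exists h; first exact: Gh.
  have h1 : `|r - be| < e / 2 by rewrite ger0_norm ?subr_ge0// ltrBlDl.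
  by rewrite (splitr e); apply: le_lt_trans (ler_distD r _ _) _; exact: ltrD.
split; [|exact: JLb|].
  by rewrite lt_def lb andbT; apply/eqP => E; apply: njt; rewrite -E.
move=> r tr rb Jr; have br := glb r (conj Jr tr).
by move: rb; rewrite ltNge br.
Qed.

(** A point [z] outside the Julia set gives a gap [[t, be[] of [JL], with [f] and [g] in [G] whose
    fixed points lie just above [be] or at it. Forward images of the gap are free of [JL] and, by
    [affine_cover], reach every sufficiently negative number; but [v] in the Julia set means that
    some [yy h] is as negative as desired. *)
Lemma monomial_julia z x : julia G (fin v) -> julia G (fin x) ->
  normc (z - v) <= normc (x - v) -> julia G (fin z).
Proof.
move=> jv jx zx; apply: contrapT => njz.
have zv : z != v by apply/eqP => E; apply: njz; rewrite E.
have z0 := dist_gt0 zv.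
have xv : x != v by rewrite -subr_eq0 -normc_gt0; exact: lt_le_trans zx.
have x0 := dist_gt0 xv.
have tx : Ln z <= Ln x by rewrite /logd ler_ln ?posrE ?z0 ?x0 ?zx.
have njt : ~ JL (Ln z) by move=> /(julia_JL zv).
have [be [tb JLb free]] := JL_gap njt tx ((julia_JL xv).1 jx).
move: (Ln z) tb free => t tb free {njt tx z0 x0 zx njz}.
have near e : 0 < e -> exists h, [/\ G h, be <= yy h & yy h < be + e].
  move=> e0; have m0 : 0 < Num.min e (be - t) by rewrite lt_min e0 subr_gt0.
  have [h Gh] := JLb _ m0; rewrite lt_min => /andP[h1 h2]; exists h.
  move: h1 h2; rewrite !ltr_norml => /andP[h1 h1'] /andP[h2 h2'].
  have th : t <= yy h by move: h2; rewrite opprB ltrBrDr subrK => /ltW.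
  split; [exact: Gh| |by rewrite -ltrBlDl].
  rewrite leNgt; apply/negP => hb; exact: (free _ th hb (JL_yy Gh)).
have l0 : 0 < be - t by rewrite subr_gt0.
have [f [Gf f1 _]] := near _ l0; have d2 := deg_ge2 Gf.
have e0 : 0 < (be - t) / (2 * deg f).
  by rewrite divr_gt0 ?mulr_gt0//; apply: lt_le_trans d2; rewrite ltr0n.
have [g [Gg g1 g2]] := near _ e0; have D2 := deg_ge2 Gg.
have [j [a cover]] := affine_cover d2 D2 tb f1 g1 g2.
have [h [w [Gh jw wv]]] := (julia_finP pG v).1 jv (expR (yy f - a)) (expR_gt0 _).
have [wv' Lw] := jul_log Gh jw.
have ha : a < yy f - yy h.
  by move: wv; rewrite dist_exp// Lw ltr_expR !ltrBrDr addrC.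
have [i [s [ts sb E]]] := cover _ ha.
have n2 := @JL_forward f i _ Gf (@JL_forward g j _ Gg (free s ts sb)).
by apply: n2; rewrite E opprB addrCA subrr addr0; exact: JL_yy.
Qed.
End Monomials.

Section InteriorFinite.
Context {R : realType}.
Local Notation C := R[i].
Variable G : set {poly C}.
Hypothesis pG : pcb G.

Lemma interior_superattracting (g : {poly C}) (z0 : C) : G g -> g.[z0] = z0 -> g^`().[z0] = 0 ->
  julia G (fin z0) -> interior (julia G) (fin z0).
Proof.
move=> Gg gz g'z jz.
have [[q [cq qz]]|no] := pselect (exists q, crit_values G q /\ q <> z0).
  exact: (interior_superattracting_two pG Gg gz g'z cq qz jz).
have hv : crit_values G `<=` [set z0].
  by move=> u cu; apply: contrapT => uv; apply: no; exists u.
have [a [b [ab ja jb]]] := jul_two pG Gg.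
have [x jx xz] : exists2 x, jul g x & x != z0.
  have [az|az] := eqVneq a z0; last by exists a.
  by exists b => //; rewrite -az eq_sym.
apply: contrapT => ni.
have [w wx Fw] := not_interior_fin ni (ltac:(by rewrite normc_gt0 subr_eq0) : 0 < normc (x - z0)).
by apply: (monomial_julia pG hv jz (jul_julia pG Gg jx) (ltW wx)).
Qed.
End InteriorFinite.

(** * The point at infinity *)

Section LeadingCoefficient.
Context {R : realType}.
Local Notation C := R[i].
Implicit Types (z w y : C) (F p q : {poly C}) (s B r : R) (n k : nat).

Lemma binom_le_pow n k : ('C(n, k) <= 2 ^ n)%N.
Proof.
elim: n k => [|n IH] [|k] //; first by rewrite bin0 expn_gt0.
by rewrite binS expnS mul2n -addnn leq_add.
Qed.

Lemma pow_le_ffact n k : (n ^ k <= (n + k) ^_ k)%N.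
Proof.
elim: k => [|k IH]; first by rewrite ffactn0.
by rewrite addnS ffactSS expnS leq_mul// -addnS leq_addr.
Qed.

(** The left side is at most the falling factorial of [2 n] with [n] factors, that is, [n!] times a
    binomial coefficient of at most [4 ^ n]. *)
Lemma pow_le_fact n : (n ^ n <= 4 ^ n * n`!)%N.
Proof.
apply: leq_trans (pow_le_ffact n n) _; rewrite -bin_ffact leq_mul2r; apply/orP; right.
by rewrite addnn -mul2n (_ : 4 = 2 ^ 2)%N// -expnM binom_le_pow.
Qed.

(** In truncated subtraction [(k - i) + (i - k)] is the distance of [k] and [i]; the indices below
    and above [k] give the two factorials. *)
Lemma prod_dist n k : (k <= n)%N ->
  (\prod_(i < n.+1 | i != k :> nat) ((k - i) + (i - k)) = k`! * (n - k)`!)%N.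
Proof.
move=> kn; rewrite -(subnKC kn); elim: (n - k)%N => [|m IH].
  rewrite addn0 subnn fact0 muln1 big_mkcond big_ord_recr /= eqxx muln1 -ffactnn ffact_prod.
  by apply: eq_bigr => i _; rewrite neq_ltn ltn_ord /= (eqP (ltnW (ltn_ord i))) addn0.
rewrite addnS big_mkcond big_ord_recr /= -big_mkcond /= IH.
have -> : ((k + m).+1 != k)%N by rewrite gtn_eqF// ltnS leq_addr.
have -> : (k - (k + m).+1 = 0)%N by apply/eqP; rewrite subn_eq0 -addnS leq_addr.
by rewrite add0n -addnS !addKn factS -mulnA; congr muln; rewrite mulnC.
Qed.

Lemma prod_dist_ge n k : (k <= n)%N ->
  (n`! <= 2 ^ n * \prod_(i < n.+1 | i != k :> nat) ((k - i) + (i - k)))%N.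
Proof. by move=> kn; rewrite prod_dist// -(bin_fact kn) leq_mul2r binom_le_pow orbT. Qed.

Lemma lagrange_lead F n (x : 'I_n.+1 -> C) : (size F <= n.+1)%N -> injective x ->
  F`_n = \sum_l F.[x l] / \prod_(i | i != l) (x l - x i).
Proof.
move=> sF inj; pose L l := \prod_(i | i != l) ('X - (x i)%:P).
have Lseq l : L l = \prod_(i <- [seq i <- enum 'I_n.+1 | i != l]) ('X - (x i)%:P).
  by rewrite big_filter big_enum_cond.
have szL l : size (L l) = n.+1.
  rewrite Lseq size_prod_XsubC size_filter; congr _.+1.
  have := count_predC (pred1 l) (enum 'I_n.+1).
  by rewrite count_uniq_mem ?enum_uniq// mem_enum size_enum_ord add1n => -[].
have Ln l : (L l)`_n = 1.
  have m : L l \is monic by rewrite Lseq monic_prod_XsubC.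
  by move/monicP: m; rewrite lead_coefE szL.
have Lx l j : (L l).[x j] = if j == l then \prod_(i | i != l) (x l - x i) else 0.
  rewrite horner_prod; case: eqP => [->|/eqP jk].
    by apply: eq_bigr => i _; rewrite hornerXsubC.
  by rewrite (bigD1 j)//= hornerXsubC subrr mul0r.
pose Q := \sum_l (F.[x l] / \prod_(i | i != l) (x l - x i)) *: L l.
have prod0 l : \prod_(i | i != l) (x l - x i) != 0.
  apply/prodf_neq0 => i ik; rewrite subr_eq0; apply: contra ik => /eqP /inj ->; exact: eqxx.
suff -> : F`_n = Q`_n.
  by rewrite coef_sum; apply: eq_bigr => l _; rewrite coefZ Ln mulr1.
congr (_`_ _); congr polyseq.
apply/eqP; rewrite -subr_eq0; apply/negPn/negP => nz.
have := @max_poly_roots _ (F - Q) [seq x l | l <- enum 'I_n.+1] nz.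
rewrite size_map size_enum_ord ltnNge.
have -> : (size (F - Q)%R <= n.+1)%N.
  apply: leq_trans (size_polyD _ _) _; rewrite geq_max sF size_polyN.
  apply: leq_trans (size_sum _ _ _) _; apply/bigmax_leqP => l _.
  by apply: leq_trans (size_scale_leq _ _) _; rewrite szL.
move=> h; suff : false by []; apply: h; last by rewrite map_inj_uniq ?enum_uniq.
apply/allP => _ /mapP[j _ ->]; apply/rootP; rewrite hornerD hornerN /Q horner_sum.
rewrite (bigD1 j)//= hornerZ Lx eqxx divfK// big1 ?addr0 ?subrr// => l kj.
by rewrite hornerZ Lx eq_sym (negbTE kj) mulr0.
Qed.

(** Nodes at distances [k * s / n] from [y] are at least [|k - l| * s / n] apart, whatever their
    directions. The denominators in Lagrange's formula are thus at least
    [(s / n) ^+ n * n! / 2 ^+ n]; with [n + 1 <= 2 ^+ n] and [n ^+ n <= 4 ^+ n * n!] the constant is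
    2 * 2 * 4 = 16. *)
Lemma lead_bound F n s B y : size F = n.+1 -> (0 < n)%N -> 0 < s -> 0 <= B ->
  (forall k, (k <= n)%N -> exists2 z, normc (z - y) = k%:R * (s / n%:R) & normc F.[z] <= B) ->
  normc (lead_coef F) <= B * (16 / s) ^+ n.
Proof.
move=> sF n0 s0 B0 hz; have nR : 0 < n%:R :> R by rewrite ltr0n.
have d0 : 0 < s / n%:R by rewrite divr_gt0.
have ex (k : 'I_n.+1) : exists z, normc (z - y) = k%:R * (s / n%:R) /\ normc F.[z] <= B.
  by have [z h1 h2] := hz k (ltn_ord k); exists z.
have [x hx] := choice ex.
pose D (k i : nat) := ((k - i) + (i - k))%N.
have dist (k i : 'I_n.+1) : (D k i)%:R * (s / n%:R) <= normc (x k - x i).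
  have [hk _] := hx k; have [hi _] := hx i; rewrite /D; case: (leqP i k) => ik.
    have -> : (i - k = 0)%N by apply/eqP; rewrite subn_eq0.
    rewrite addn0 natrB// mulrBl -hk -hi.
    by have := ler_distcD (x i) (x k) y; clear; lra.
  have -> : (k - i = 0)%N by apply/eqP; rewrite subn_eq0 ltnW.
  rewrite add0n natrB ?(ltnW ik)// mulrBl -hk -hi.
  by have := ler_distcD (x k) (x i) y; rewrite (normc_distC (x i) (x k)); clear; lra.
have Dpos (k i : 'I_n.+1) : i != k -> 0 < (D k i)%:R * (s / n%:R).
  move=> ik; rewrite mulr_gt0// ltr0n /D; case: (ltngtP i k) ik => [h _|h _|/val_inj ->].
  - by rewrite addn_gt0 subn_gt0 h.
  - by rewrite addn_gt0 !subn_gt0 h orbT.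
  - by rewrite eqxx.
have inj : injective x.
  move=> i k E; apply/eqP/negPn/negP => ik.
  by have := lt_le_trans (Dpos k i ik) (dist k i); rewrite E subrr normc0 ltxx.
pose bound : R := (s / n%:R) ^+ n * (n`!%:R / 2 ^+ n).
have bound0 : 0 < bound.
  by rewrite mulr_gt0 ?exprn_gt0// divr_gt0 ?exprn_gt0// ltr0n fact_gt0.
have prodge (k : 'I_n.+1) : bound <= normc (\prod_(i | i != k) (x k - x i)).
  rewrite (big_morph (fun z : C => normc z) (id1 := 1) (op1 := *%R)) ?normc1//; last exact: normcM.
  apply: (@le_trans _ _ (\prod_(i < n.+1 | i != k) ((D k i)%:R * (s / n%:R)))); last first.
    by apply: ler_prod => i ik; rewrite (ltW (Dpos k i ik)) dist.
  rewrite big_split /= mulrC prodr_const.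
  have -> : #|[pred i : 'I_n.+1 | i != k]| = n.
    have E := cardC1 k; rewrite card_ord /= in E; apply: etrans E.
    exact: eq_card.
  rewrite /bound ler_pM2l ?exprn_gt0// -natr_prod ler_pdivrMr ?exprn_gt0// mulrC -natrX -natrM ler_nat.
  have := @prod_dist_ge n k (ltn_ord k); exact.
have l0 : lead_coef F = F`_n by rewrite lead_coefE sF.
rewrite l0 (lagrange_lead (x := x)) ?sF//.
apply: (@le_trans _ _ (\sum_(k < n.+1) (B / bound))).
  elim/big_ind2: _ => [|z1 r1 z2 r2 h1 h2|k _]; first by rewrite normc0.
    by apply: le_trans (ler_normcD _ _) _; exact: lerD.
  rewrite normcM normcV; apply: ler_pM; rewrite ?invr_ge0 ?normc_ge0//; first by case: (hx k).
  by rewrite lef_pV2 ?posrE// (lt_le_trans bound0).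
rewrite sumr_const card_ord -[leLHS]mulr_natr.
rewrite -mulrA ler_wpM2l// /bound.
have fp : 0 < n`!%:R :> R by rewrite ltr0n fact_gt0.
have h2 : n.+1%:R <= 2 ^+ n :> R by rewrite -natrX ler_nat ltn_expl.
have h3 : (n%:R) ^+ n <= 4 ^+ n * n`!%:R :> R by rewrite -!natrX -natrM ler_nat pow_le_fact.
have -> : ((s / n%:R) ^+ n * (n`!%:R / 2 ^+ n))^-1 * n.+1%:R = n%:R ^+ n * 2 ^+ n * n.+1%:R / (s ^+ n * n`!%:R).
  by rewrite expr_div_n; field; rewrite !gt_eqF ?exprn_gt0.
have -> : (16 / s) ^+ n = 4 ^+ n * n`!%:R * 2 ^+ n * 2 ^+ n / (s ^+ n * n`!%:R).
  rewrite expr_div_n (_ : 16 = 4 * 2 * 2 :> R); last by ring.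
  by rewrite !exprMn; field; rewrite !gt_eqF ?exprn_gt0.
rewrite ler_pM2r ?invr_gt0 ?mulr_gt0 ?exprn_gt0//.
have e2 : 0 <= (2 : R) ^+ n by rewrite exprn_ge0.
apply: ler_pM; [|exact: ler0n| |exact: h2].
  by apply: mulr_ge0; [exact: exprn_ge0|exact: e2].
exact: ler_wpM2r.
Qed.

Lemma size_piter_ge p n : (2 < size p)%N -> (n <= (size (piter p n)).-1)%N.
Proof.
move=> p2; suff : (n < (size (piter p n)).-1.+1)%N by [].
elim: n => [//|n IH]; rewrite ltnS in IH; rewrite ltnS.
have p1 : (1 < size p)%N by exact: ltn_trans p2.
have q1 := pred_size_gt0 (size_piter n p1).
have -> : piter p n.+1 = p \Po piter p n by [].
rewrite size_comp_poly; apply: (@leq_trans (2 * (size (piter p n)).-1)).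
  by have := leq_add IH q1; rewrite addn1 addnn mul2n; exact.
by rewrite leq_mul2r pred_size_gt1// orbT.
Qed.

Lemma poly_upper_disc q n : (size q <= n.+1)%N -> exists2 M, 0 <= M &
  forall r z, 1 <= r -> normc z <= r -> normc q.[z] <= M * r ^+ n.
Proof.
move=> qn; exists (\sum_(i < size q) normc q`_i).
  by apply: sumr_ge0 => i _; exact: normc_ge0.
move=> r z r1 zr; rewrite horner_coef mulr_suml.
elim/big_ind2: _ => [|x1 x2 y1 y2 h1 h2|i _]; first by rewrite normc0.
  by apply: le_trans (ler_normcD _ _) _; exact: lerD.
rewrite normcM normcX ler_wpM2l ?normc_ge0//; apply: (@le_trans _ _ (r ^+ i)).
  by apply: lerXn2r; rewrite ?nnegrE ?normc_ge0// (le_trans _ r1).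
by rewrite ler_weXn2l// -ltnS (leq_trans _ qn).
Qed.
End LeadingCoefficient.

(** * Interior of the Julia set at infinity *)

Section InteriorInfinity.
Context {R : realType}.
Local Notation C := R[i].
Implicit Types (z w c : C) (f g h : {poly C}) (r e T M : R).
Variable G : set {poly C}.
Hypothesis pG : pcb G.

Lemma lead_lower g (p : C) r : G g -> 1 <= r -> (forall z, Kf g z -> normc z <= r) -> crit_values G p ->
  1 <= normc (lead_coef g) * (2 * (r + 1)) ^+ (size g).-1.
Proof.
move=> Gg r1 Kr cp; have g1 := pcb_size1 pG Gg; have [rs [sz mem E]] := poly_factor p g1.
have pr : normc p <= r := Kr p (crit_Kf pG Gg cp).
have rsr x : x \in rs -> normc x <= r.
  by rewrite mem => /eqP gx; apply: Kr; apply/Kf_horner; rewrite gx; exact: (crit_Kf pG Gg cp).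
rewrite leNgt; apply/negP => small.
have inv x : normc x <= r + 1 -> normc g.[x] <= r + 1.
  move=> xr; have : normc (g.[x] - p) <= 1.
    apply: ltW; apply: le_lt_trans small; rewrite E -sz ler_wpM2l ?normc_ge0//.
    apply: (andP (prod_le (rs := rs) (f := fun y => normc (x - y)) (r := 2 * (r + 1)) _)).2 => y /rsr yr.
    by rewrite normc_ge0/=; have := ler_normcB x y; clear -yr xr; lra.
  by have := lerB_normc g.[x] p; clear -pr; lra.
have r10 : 0 <= r + 1 by rewrite addr_ge0// (le_trans _ r1).
have : Kf g (r + 1)%:C.
  exists (r + 1) => n; elim: n => [|n IH]; last exact: inv.
  have -> : it g 0 (r + 1)%:C = (r + 1)%:C by [].
  by rewrite normc_real ger0_norm.
by move=> /Kr; rewrite normc_real ger0_norm// gerDl ler10.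
Qed.

Lemma poly_root_ex g w : (1 < size g)%N -> exists x, g.[x] = w.
Proof.
move=> g1; have [rs [sz mem _]] := poly_factor w g1.
case: rs sz mem => [|c rs] sz mem; first by have := pred_size_gt0 g1; rewrite -sz.
by exists c; apply/eqP; rewrite -mem; exact: mem_head.
Qed.

(** A point [w] beyond the annulus has a preimage under [h], which lies outside radius [X] because
    [h] maps that disc into radius [W < Z], and has at most half the modulus of [w]. Descending in
    this way ends in the annulus, and the Fatou set is forward invariant. *)
Lemma fatou_chain h X W Z : G h -> (forall z, X <= normc z -> 2 * normc z <= normc h.[z]) ->
  (forall z, normc z <= X -> normc h.[z] <= W) -> W < Z -> 0 < Z ->
  (forall w, X < normc w -> normc w < Z -> fatou G (fin w)) ->
  forall w, X < normc w -> fatou G (fin w).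
Proof.
move=> Gh esc hW WZ Z0 hF.
have H k0 w : X < normc w -> normc w < 2 ^+ k0 * Z -> fatou G (fin w).
  elim: k0 w => [|k0 IH] w Xw; first by rewrite expr0 mul1r; exact: hF.
  have [/IH h1 _|wk wk1] := ltP (normc w) (2 ^+ k0 * Z); first exact: h1.
  have Zk : Z <= 2 ^+ k0 * Z by rewrite ler_peMl ?(ltW Z0)// exprn_ege1// ler1n.
  have [x hx] := poly_root_ex w (pcb_size1 pG Gh).
  have Xx : X < normc x.
    rewrite ltNge; apply/negP => /hW; rewrite hx leNgt => /negP; apply.
    by apply: lt_le_trans wk; apply: lt_le_trans Zk.
  rewrite -hx; apply: (fatou_forward (pcb_size1 pG)) => //; first by case: pG.
  apply: IH => //; have := esc x (ltW Xx); rewrite hx => h2.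
  by move: wk1; rewrite exprS -mulrA => h3; have := le_lt_trans h2 h3; rewrite ltr_pM2l.
move=> w Xw; apply: (H (Num.truncn (normc w / Z)).+1 w Xw).
rewrite -ltr_pdivrMr//; apply: lt_le_trans (truncnS_gt _) _.
by rewrite -natrX ler_nat ltnW// ltn_expl.
Qed.

(** [circles_expanding] gives circles through all [it g n v'] with [v'] near [v]. Their radii fill
    an interval by connectedness, and its ratio exceeds [T] for large [n]: otherwise Cauchy's
    estimate would bound the derivative at [v], against [deriv_growth]. *)
Lemma large_annuli T M : julia G infty -> ~ interior (julia G) infty -> 0 < T ->
  exists2 r, M < r & forall z, r <= normc z -> normc z <= T * r -> fatou G (fin z).
Proof.
move=> ji ni T0; have [[g Gg] _ _ _] := pG.
have [rho rho1 hrho] := infinity_nbhd (pcb_size pG Gg).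
have [v [vr Fv]] : exists v, rho < normc v /\ fatou G (fin v).
  apply: contrapT => no; apply: ni; apply/nbhs_infty; split=> //.
  by exists rho => w rw Fw; apply: no; exists w.
have [e e0 he] := open_fatou_fin Fv.
pose A := [set z | rho < normc z].
have rho0 : 0 < rho by apply: lt_le_trans rho1.
have Ag z : A z -> A g.[z].
  rewrite /A /= => Az; have [h1 _] := hrho z Az; apply: lt_le_trans h1.
  by apply: lt_trans (Az) _; rewrite ltr_pMl ?ltr1n//; exact: lt_trans Az.
have Ab : ~ A 0.
  by move=> A0; have := lt_trans rho0 A0; rewrite normc0 ltxx.
have Aexp z : A z -> 3 / 2 * normc (g.[z] - 0) <= normc g^`().[z] * normc (z - 0).
  by move=> Az; case: (hrho z Az).
pose d := Num.min e (normc v - rho).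
have d0 : 0 < d by rewrite lt_min e0 subr_gt0.
have hV z : normc (z - v) < d -> A z /\ fatou G (fin z).
  rewrite lt_min => /andP[z1 z2]; split; last exact: he.
  by rewrite /A /=; have := lerB_normc v z; rewrite (normc_distC v z); clear -z2; lra.
have [n0 hn0] := circles_expanding pG Gg Ag Ab Aexp d0 hV.
have d2 : 0 < d / 2 by rewrite divr_gt0.
have Av : A v by exact: vr.
have grow n : 2 ^+ n <= normc (it g n v).
  elim: n => [|n IH]; first by rewrite expr0; apply: le_trans rho1 _; exact: ltW.
  have [h1 _] := hrho _ (it_inv Ag n Av); apply: le_trans h1.
  by rewrite exprS ler_wpM2l.
have [n1 hn1] := @three_halves_unbounded R (216 * (T / (d / 2) * normc v)).
pose n := maxn n0 (maxn n1 (Num.truncn `|M|).+1).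
have nM : M < normc (it g n v).
  apply: le_lt_trans (ler_norm M) _; apply: lt_le_trans (truncnS_gt _) _.
  apply: le_trans (grow n); rewrite -natrX ler_nat; apply: (@leq_trans n).
    by rewrite /n !leq_max leqnn !orbT.
  by apply: ltnW; rewrite ltn_expl.
have itp : 0 < normc (it g n v) by apply: lt_le_trans (grow n); rewrite exprn_gt0.
exists (normc (it g n v)); first exact: nM.
have v0 : 0 < normc v by apply: lt_trans vr.
have [x xv xT] : exists2 x, normc (x - v) < d / 2 & T * normc (it g n v) < normc (it g n x).
  apply: contrapT => no.
  have bd z : normc (z - v) < d / 2 -> normc (piter g n).[z] <= T * normc (it g n v).
    move=> zv; rewrite horner_piter leNgt; apply/negP => h; apply: no; exists z => //.
  have := cderiv_bound d2 (fun z _ => cdiff_horner (piter g n) z) bd (has_cderiv_horner _ _).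
  have := deriv_growth Ag Aexp n Av; rewrite !subr0 => h1 h2.
  have h3 : (3 / 2) ^+ n * normc (it g n v) <= 216 * (T * normc (it g n v)) / (d / 2) * normc v.
    by apply: le_trans h1 _; rewrite ler_wpM2r ?normc_ge0.
  have h4 : (3 / 2 : R) ^+ n <= 216 * (T / (d / 2) * normc v).
    rewrite -(ler_pM2r itp); apply: le_trans h3 _; rewrite le_eqVlt; apply/orP; left; apply/eqP.
    by ring.
  by have := hn1 n (ltac:(by rewrite /n !leq_max leqnn !orbT)); rewrite ltNge h4.
move=> z zr zT.
have [v' v'v vz] : exists2 v', normc (v' - v) < d / 2 & normc (it g n v') = normc z.
  move: zr; rewrite le_eqVlt => /predU1P[zr|zr]; first by exists v => //; rewrite subrr normc0.
  apply: (@connected_ivt _ _ (cball v (d / 2)) (fun x => normc (it g n x)) (normc z) _ _ v x) => //.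
  - exact: cball_connected.
  - move=> y _; exact: (@continuous_comp _ _ _ (it g n) (fun w => normc w) y (@it_continuous R g n y) (@continuous_normc R _)).
  - exact: cball_center.
  - exact: le_lt_trans xT.
apply: (hn0 n v' z) => //; first by rewrite /n leq_maxl.
by rewrite !subr0 vz.
Qed.

Lemma interior_infty : julia G infty -> interior (julia G) infty.
Proof.
move=> ji; apply: contrapT => ni; have [[h Gh] _ _ _] := pG.
have h2 := pcb_size pG Gh; have [rh rh1 hrh] := poly_escape h2.
set d0 := (size h).-1; have [Ch Ch0 hCh] := @poly_upper_disc R h d0 (ltac:(by rewrite /d0 prednK// (ltn_trans _ h2))).
have [p cp] := crit_ex pG; have [P PE] : exists P, P = normc p by exists (normc p).
have P0 : 0 <= P by rewrite PE normc_ge0.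
have pP : normc p <= P by rewrite PE.
(* 192 is [16 / (rho / 4) * (3 * rho)], from [lead_bound] with [s = rho / 4] and the disc of radius
   [2 * rho], whose points are within [3 * rho] of the roots. The power [Q] absorbs the degree [d0]
   of [h] below. *)
have [q qE] : exists q : R, q = 192 by exists 192.
have q1 : 1 <= q by rewrite qE ler1n.
have [Q QE] : exists Q : R, Q = q ^+ d0 by exists (q ^+ d0).
have Q1 : 1 <= Q by rewrite QE exprn_ege1.
(* Points beyond [T * rho] are then at distance at least [8 * Q * rho] from the roots, which is at
   least [2 * Q] times the radius [2 * (rho + 1)] in [lead_lower]. *)
pose T := 1 + 8 * Q; have T9 : 9 <= T by rewrite /T; lra.
have [h1 [w1 [Gh1 jw1 w1R]]] := julia_inftyP pG ji (4 * (P + 1) + rh).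
have T0 : 0 < T by lra.
have [R1 R1w ann] := large_annuli (normc w1) ji ni T0.
pose S := [set z | julia G (fin z) /\ normc z <= R1].
have cS : compact S.
  apply: (bounded_closed_compact_c (r := R1)); last by move=> z [_]; rewrite /cdisc /= subr0.
  apply: closedI.
    apply: (@closed_comp _ _ (@fin R) (julia G)); last exact: closed_julia.
    by move=> z _; exact: fin_continuous.
  by have := @closed_cdisc R 0 R1; congr closed; apply/seteqP; split=> z; rewrite /cdisc /= subr0.
have Sw1 : S w1 by split; [exact: jul_julia jw1|exact: ltW].
(* The outermost Julia point of modulus at most [R1]: beyond its modulus [rho], the ring up to
   [T * rho] lies in the Fatou set. *)
have [x /set_mem [jx xR1] xmax] : exists2 x, x \in S & forall z, z \in S -> normc z <= normc x.
  apply: compact_EVT_max => //; first by exists w1.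
  by apply: continuous_in_subspaceT => z _; exact: continuous_normc.
have [rho rhoE] : exists rho, rho = normc x by exists (normc x).
have rhow : 4 * (P + 1) + rh < rho by rewrite rhoE; apply: lt_le_trans w1R _; apply: xmax; exact: mem_set.
have rhoR : rho <= R1 by rewrite rhoE.
have annF z : rho < normc z -> normc z <= T * rho -> fatou G (fin z).
  move=> z1 z2; have [zR|zR] := leP (normc z) R1.
    apply: contrapT => jz; move: z1; rewrite ltNge rhoE => /negP; apply; apply: xmax.
    by apply/mem_set; split.
  by apply: ann; [exact: ltW|apply: le_trans z2 _; rewrite ler_pM2l].
have [g [y [Gg jy yx]]] := (julia_finP pG x).1 jx 1 ltr01.
have rho1 : 1 <= rho by lra.
have y1 : rho - 1 < normc y by rewrite rhoE; have := lerB_normc x y; rewrite normc_distC; lra.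
have y2 : normc y < rho + 1 by rewrite rhoE; have := lerB_normc y x; lra.
have Trho : 9 * rho <= T * rho by rewrite ler_wpM2r//; lra.
have jin c : jul g c -> normc c <= rho.
  move=> jc; rewrite leNgt; apply/negP => cr.
  have cT : normc (c - 0) < T * rho.
    apply: (jul_dichotomy pG Gg _ jy) => //; last by rewrite subr0; clear -y2 rho1 Trho; lra.
    by move=> u; rewrite subr0 => uT; apply: annF; rewrite uT; clear -rho1 Trho; lra.
  by apply: (jul_julia pG Gg jc); apply: annF => //; rewrite subr0 in cT; exact: ltW.
have g2 := pcb_size pG Gg.
have Kin z : Kf g z -> normc z <= rho.
  move=> Kz; have [c jc zc] := jul_far 0 g2 Kz; rewrite !subr0 in zc.
  exact: le_trans zc (jin c jc).
have [c0 jc0 c0y] := jul_far y g2 (crit_Kf pG Gg cp).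
have s0 : 0 < rho / 4 by clear -rho1; lra.
have c0s : rho / 4 < normc (c0 - y).
  by apply: lt_le_trans c0y; have := lerB_normc y p; rewrite normc_distC; clear -pP y1 rhow P0 rh1; lra.
(* The connected set [jul g] has points at every distance up to [rho / 4] from [y]; these are the
   interpolation nodes for [lead_bound]. *)
have nodes t : 0 <= t -> t <= rho / 4 -> exists2 z, jul g z & normc (z - y) = t.
  rewrite le_eqVlt => /predU1P[<- _|t0 ts]; first by exists y; rewrite // subrr normc0.
  apply: (@connected_ivt _ _ (jul g) (fun z => normc (z - y)) t (pcb_jul_connected pG Gg) _ y c0) => //.
  - by move=> z _; exact: continuous_normc_sub.
  - by rewrite subrr normc0.
  - exact: le_lt_trans ts c0s.
(* Replacing [g] by an iterate [F] keeps the filled Julia set and makes the degree [n] large enough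
   for [2 ^+ n] to beat the constants that come with [h]. *)
have [j hj] := @pow_unbounded R 2 (Ch * (P + rho) ^+ d0 + P) (lexx _).
have [F FE] : exists F, F = piter g j.+1 by exists (piter g j.+1).
have GF : G F by rewrite FE; exact: pcb_piter.
have F1 := pcb_size1 pG GF; have [n nE] : exists n, n = (size F).-1 by exists (size F).-1.
have n0 : (0 < n)%N by rewrite nE; exact: pred_size_gt0.
have sF : size F = n.+1 by rewrite nE prednK// (ltn_trans _ F1).
have jn : (j <= n)%N by rewrite nE FE; apply: leq_trans (size_piter_ge j.+1 g2); exact: leqnSn.
have KF : Kf F = Kf g by rewrite FE; exact: Kf_piter.
move: F GF F1 nE sF KF {FE} => F GF F1 nE sF KF.
have up : normc (lead_coef F) <= rho * (16 / (rho / 4)) ^+ n.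
  apply: (@lead_bound R F n (rho / 4) rho y) => //; first by clear -rho1; lra.
  move=> k kn; have nR : 0 < n%:R :> R by rewrite ltr0n.
  have k1 : k%:R * (rho / 4 / n%:R) <= rho / 4.
    rewrite mulrA ler_pdivrMr// mulrC ler_pM2l// ler_nat//.
  have [|z jz zE] := nodes (k%:R * (rho / 4 / n%:R)) _ k1.
    by rewrite mulr_ge0// divr_ge0//; exact: ltW.
  exists z => //; apply: Kin; rewrite -KF; apply/Kf_horner; rewrite KF; by case: jz.
have lo := lead_lower GF rho1 (ltac:(by rewrite KF; exact: Kin)) cp; rewrite -nE in lo.
have [rs [sz mem E]] := poly_factor p F1; rewrite -nE in sz.
have rsr u : u \in rs -> normc u <= rho.
  by rewrite mem => /eqP Fu; apply: Kin; rewrite -KF; apply/Kf_horner; rewrite Fu; exact: (crit_Kf pG GF cp).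
have a0 := normc_ge0 (lead_coef F); move: (normc (lead_coef F)) up lo E a0 => a up lo E a0.
have rp : 0 < rho by exact: lt_le_trans ltr01 rho1.
have inner z : normc z <= 2 * rho -> normc F.[z] <= P + rho * q ^+ n.
  move=> zr; have : normc (F.[z] - p) <= rho * q ^+ n.
    rewrite E; apply: (@le_trans _ _ (a * (3 * rho) ^+ n)).
      rewrite ler_wpM2l// -sz.
      apply: (andP (prod_le (rs := rs) (f := fun u => normc (z - u)) (r := 3 * rho) _)).2 => u /rsr ur.
      by rewrite normc_ge0/=; have := ler_normcB z u; clear -zr ur; lra.
    apply: (@le_trans _ _ (rho * (16 / (rho / 4)) ^+ n * (3 * rho) ^+ n)).
      by rewrite ler_wpM2r// exprn_ge0//; clear -rp; lra.
    rewrite -mulrA -exprMn; have -> : 16 / (rho / 4) * (3 * rho) = q by rewrite qE; field; rewrite gt_eqF.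
    exact: lexx.
  by have := lerB_normc F.[z] p; clear -pP; lra.
have outer z : T * rho <= normc z -> (2 * Q) ^+ n - P <= normc F.[z].
  move=> zr; have : (2 * Q) ^+ n <= normc (F.[z] - p).
    rewrite E; apply: (@le_trans _ _ (a * (8 * Q * rho) ^+ n)); last first.
      have Q8 : 0 <= 8 * Q * rho by apply: mulr_ge0; clear -Q1 rp; lra.
      rewrite ler_wpM2l// -sz; apply: prod_ge => // u /rsr ur.
      by have := lerB_normc z u; rewrite /T in zr; clear -zr ur; lra.
    apply: (@le_trans _ _ (a * (2 * (rho + 1)) ^+ n * (2 * Q) ^+ n)).
      by rewrite ler_peMl// exprn_ge0//; clear -Q1; lra.
    have Q0 : 0 <= Q by clear -Q1; lra.
    have Qr : Q * 1 <= Q * rho by rewrite ler_wpM2l.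
    rewrite -mulrA -exprMn ler_wpM2l//; apply: lerXn2r; rewrite ?nnegrE.
    - by apply: mulr_ge0; clear -Q0 rp; lra.
    - by apply: mulr_ge0; clear -Q0 rp; lra.
    by clear -Qr; lra.
  by have := ler_normcB F.[z] p; clear -pP; lra.
(* [F] maps radius [2 * rho] into radius [X], and the outside of [T * rho] beyond [Z], so points
   strictly between [X] and [Z] have their preimages in the Fatou ring. The image of radius [X]
   under [h] grows at most like [Q ^+ n], and [Z] like [(2 * Q) ^+ n], which gives the overlap
   [W < Z]. *)
pose X := P + rho * q ^+ n; pose Z := (2 * Q) ^+ n - P; pose W := Ch * X ^+ d0.
have qn1 : 1 <= q ^+ n by rewrite exprn_ege1.
have rX : rho <= X.
  have : rho * 1 <= rho * q ^+ n by rewrite ler_wpM2l//; exact: ltW.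
  by rewrite /X; move: P0; clear; lra.
have WZ : W < Z.
  have Xup : X <= (P + rho) * q ^+ n.
    by rewrite /X mulrDl lerD2r ler_peMr.
  have X0 : 0 <= X by apply: le_trans rX; exact: ltW.
  have Qn1 : 1 <= Q ^+ n by rewrite exprn_ege1.
  have w1' : W <= Ch * (P + rho) ^+ d0 * Q ^+ n.
    rewrite /W -mulrA ler_wpM2l//.
    have -> : (P + rho) ^+ d0 * Q ^+ n = ((P + rho) * q ^+ n) ^+ d0.
      by rewrite exprMn QE -!exprM mulnC.
    by apply: lerXn2r; rewrite ?nnegrE//; apply: le_trans Xup.
  have hj' : Ch * (P + rho) ^+ d0 + P < 2 ^+ n.
    by apply: lt_le_trans hj _; rewrite ler_weXn2l// ler1n.
  have w2 : (Ch * (P + rho) ^+ d0 + P) * Q ^+ n < 2 ^+ n * Q ^+ n.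
    by rewrite ltr_pM2r//; exact: lt_le_trans Qn1.
  have w3 : P * 1 <= P * Q ^+ n by rewrite ler_wpM2l.
  by rewrite /Z exprMn; move: w2; rewrite mulrDl; clear -w1' w3; lra.
have Z0 : 0 < Z.
  by apply: le_lt_trans WZ; rewrite /W mulr_ge0// exprn_ge0// (le_trans _ rX)// ltW.
have core w : X < normc w -> normc w < Z -> fatou G (fin w).
  move=> wX wZ; have [u Fu] := poly_root_ex w F1.
  rewrite -Fu; apply: (fatou_forward (pcb_size1 pG)) => //; first by case: pG.
  apply: annF.
    rewrite ltNge; apply/negP => ur; have := inner u (ltac:(clear -ur rp; lra)).
    by rewrite Fu leNgt wX.
  by rewrite leNgt; apply/negP => /ltW /outer; rewrite Fu leNgt wZ.
have fin_all := fatou_chain (X := X) (W := W) (Z := Z) Gh _ _ WZ Z0 core.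
have [g' [c [Gg' jc Xc]]] := julia_inftyP pG ji X.
apply: (jul_julia pG Gg' jc); apply: fin_all => // z.
  by move=> zX; apply: hrh; apply: le_trans zX; apply: le_trans rX; clear -rhow P0; lra.
by move=> zX; apply: hCh => //; exact: le_trans rX.
Qed.
End InteriorInfinity.

(** * Connected components *)

Section Components.
Context {R : realType}.
Local Notation C := R[i].
Local Notation S := (sphere R).
Implicit Types (z w x y : C) (A B X Y O : set C) (K : set S).

Definition clopen_in X x A := [/\ closed A, closed (X `\` A), A `<=` X & A x].

(** Compactness applied to the sets [A] minus [O]: the clopen sets through [x] are closed under
    intersection, so these would form a filter base with a cluster point in every such [A] but
    outside [O]. *)
Lemma clopen_meet X x O : compact X -> X x -> open O ->
  (forall y, (forall A, clopen_in X x A -> A y) -> O y) -> exists2 A, clopen_in X x A & A `<=` O.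
Proof.
move=> cX Xx oO hO; apply: contrapT => no.
have clX : closed X by exact: compact_closed_c.
have topX : clopen_in X x X by split => //; rewrite setDv; exact: closed0.
pose F := filter_from (clopen_in X x) (fun A => A `\` O).
have FF : ProperFilter F.
  apply: filter_from_proper; last first.
    move=> A hA; apply: contrapT => e; apply: no; exists A => // y Ay.
    by apply: contrapT => Oy; apply: e; exists y.
  apply: filter_from_filter; first by exists X.
  move=> A B [cA cA' AX Ax] [cB cB' BX Bx]; exists (A `&` B).
    split; [exact: closedI| |by move=> y [/AX]|by []].
    by rewrite setDIr; exact: closedU.
  by move=> y [[Ay By] Oy].
have FX : F X by exists X => // y [].
have [y [Xy cy]] := cX F FF FX.
have Oy : O y.
  apply: hO => A hA; have [cA _ _ _] := hA; rewrite (closure_id A).1// => V nV.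
  by apply: cy => //; exists A => // u [].
have [u [[Au nOu] Ou]] := cy (X `\` O) O (ltac:(by exists X)) (open_nbhs_nbhs (conj oO Oy)).
exact: nOu.
Qed.

(** In a compact set the component of [x] is the intersection [Q] of the clopen sets through [x]: a
    separation of [Q] would extend to disjoint open sets, and a clopen [A] inside their union could
    be cut down to one of them. *)
Lemma quasi_component X x O : compact X -> X x -> open O -> connected_component X x `<=` O ->
  exists2 A, clopen_in X x A & A `<=` O.
Proof.
move=> cX Xx oO hO; apply: (clopen_meet cX Xx oO) => y Qy; apply: hO.
have clX : closed X by exact: compact_closed_c.
have topX : clopen_in X x X by split => //; rewrite setDv; exact: closed0.
pose Q := [set y | forall A, clopen_in X x A -> A y].
have Qx : Q x by move=> A [].
have QX : Q `<=` X by move=> u; apply.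
have clQ : closed Q.
  have -> : Q = \bigcap_(A in clopen_in X x) A by apply/seteqP; split.
  by apply: closed_bigI => A [].
suff cQ : connected Q by exact: (connected_component_max Qx QX cQ).
apply: contrapT => nc.
have [E [F [cE cF E0 F0 [QE EF]]]] := closed_in_separation clQ nc.
have key (E' F' : set C) : closed E' -> closed F' -> F' !=set0 -> Q = E' `|` F' -> E' `&` F' = set0 -> E' x -> False.
  move=> cE' cF' [f Ff] QE' EF' Ex.
  have [U [V [oU oV EU FV UV]]] := plane_separation cE' cF' (ex_intro _ x Ex) (ex_intro _ f Ff) EF'.
  have [A [cA cA' AX Ax] AUV] : exists2 A, clopen_in X x A & A `<=` U `|` V.
    apply: clopen_meet => //; first exact: openU.
    by move=> u Qu; have : Q u by []; rewrite QE' => -[/EU|/FV]; [left|right].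
  have AU : A `&` U = A `\` V.
    apply/seteqP; split=> u [Au h]; split=> //.
      by move=> Vu; have : (U `&` V) u by []; rewrite UV.
    by have [//|/h] := AUV u Au.
  have : clopen_in X x (A `&` U).
    split; [| |by move=> u [/AX]|by split=> //; exact: EU].
      by rewrite AU; apply: closedI => //; exact: open_closedC.
    have -> : X `\` (A `&` U) = (X `\` A) `|` (A `\` U).
      rewrite setDIr; apply/seteqP; split=> u [[Xu h]|[Xu h]]; try by left.
        by have [Au|nA] := pselect (A u); [right|left].
      by right; split=> //; exact: AX.
    by apply: closedU => //; apply: closedI => //; exact: open_closedC.
  have Qf : Q f by rewrite QE'; right.
  move=> /Qf [_ Uf]; have : (U `&` V) f by split=> //; exact: FV.
  by rewrite UV.
have : Q x by []; rewrite QE => -[Ex|Fx]; first exact: (key E F).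
by apply: (key F E) => //; [rewrite QE setUC|rewrite setIC].
Qed.

(** A chain of segments inside [U]. It is wanted compact, so that its complement is an open set to
    which [quasi_component] applies. *)
Lemma compact_chain (U B : set C) z w : open U -> connected B -> B `<=` U -> B z -> B w ->
  exists Y, [/\ compact Y, connected Y, Y `<=` U, Y z & Y w].
Proof.
move=> oU cB BU Bz Bw.
pose P w := exists Y, [/\ compact Y, connected Y, Y `<=` U, Y z & Y w].
apply: (@connected_locally_constant C B P cB _ z w) => //; last first.
  exists (segc z z); split; [exact: segc_compact|exact: segc_connected| |exact: segc_left|exact: segc_left].
  by move=> u [t _ <-]; rewrite subrr mulr0 addr0; exact: BU.
move=> x Bx; have [e e0 he] := (open_normcP U).1 oU x (BU x Bx).
have step u u' : normc (u - x) < e -> normc (u' - x) < e -> P u -> P u'.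
  move=> ux u'x [Y [cY conY YU Yz Yu]]; exists (Y `|` segc u u'); split.
  - by apply: compactU => //; exact: segc_compact.
  - apply: connectedU => //; [by exists u; split=> //; exact: segc_left|exact: segc_connected].
  - by move=> v [/YU//|sv]; apply: he; exact: (segc_cball ux u'x).
  - by left.
  by right; exact: segc_right.
apply/nbhs_normcP; exists e => // y yx _; split; apply: step => //; by rewrite subrr normc0.
Qed.

Definition fin_inv (x : S) : C := if x is Some z then z else 0.

Lemma plane_part_connected K : connected K -> ~ K infty -> connected (plane_part K).
Proof.
move=> cK nK; have -> : plane_part K = fin_inv @` K.
  apply/seteqP; split=> [z Kz|_ [[z|] Kz <-]//]; by exists (fin z).
apply: (image_connected cK) => -[z|//] Kz A nA.
by apply/nbhs_fin; apply/nbhs_normcP.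
Qed.

Lemma fin_connected A : connected A -> connected (@fin R @` A).
Proof. by move=> cA; apply: (image_connected cA) => z _; exact: fin_continuous. Qed.

Lemma fin_inj : injective (@fin R). Proof. by move=> z w []. Qed.

Lemma plane_part_fin A : plane_part (@fin R @` A) = A.
Proof. by apply/seteqP; split=> [z [w Aw /fin_inj <-]//|z Az]; exists z. Qed.

Lemma fin_plane_part K : ~ K infty -> @fin R @` plane_part K = K.
Proof. by move=> nK; apply/seteqP; split=> [_ [z Kz <-]//|[z|] Kz//]; exists z. Qed.

Lemma component_fin K z : ~ K infty ->
  connected_component K (fin z) = @fin R @` connected_component (plane_part K) z.
Proof.
move=> nK; have [Kz|nKz] := pselect (K (fin z)); last first.
  by rewrite !connected_component_out// image_set0.
apply/seteqP; split.
  have nc : ~ connected_component K (fin z) infty by move=> /connected_component_sub.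
  rewrite -[X in X `<=` _](fin_plane_part nc); apply: image_subset.
  apply: connected_component_max.
  - exact: connected_component_refl.
  - by move=> w /connected_component_sub.
  - by apply: plane_part_connected => //; exact: component_connected.
apply: connected_component_max.
- by exists z => //; exact: connected_component_refl.
- by move=> _ [w /connected_component_sub Kw <-].
by apply: fin_connected; exact: component_connected.
Qed.
End Components.

(** * Connectedness when infinity is in the Julia set *)

Section JuliaAtInfinity.
Context {R : realType}.
Local Notation C := R[i].
Local Notation S := (sphere R).
Variable G : set {poly C}.
Hypothesis pG : pcb G.

Lemma it_julia h n z : G h -> julia G (fin (it h n z)) -> julia G (fin z).
Proof. by move=> Gh jz Fz; apply: jz; exact: it_forward. Qed.

Lemma closure_fin (A : set C) z : closure A z -> closure (@fin R @` A) (fin z).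
Proof.
move=> cz B /nbhs_fin[e e0 he]; have [w Aw wz] := (closure_normcP _ _).1 cz e e0.
by exists (fin w); split; [exists w|exact: he].
Qed.

Lemma julia_connected : julia G infty -> connected (julia G).
Proof.
move=> ji; have /nbhs_infty[_ [r hr]] := interior_infty pG ji.
have bas h z : G h -> ~ Kf h z -> julia G (fin z).
  move=> Gh nK; have [r1 r11 hr1] := poly_escape (pcb_size pG Gh).
  have [n0 hn] := notKfP r11 hr1 nK r.
  by apply: (it_julia (n := n0) Gh); apply: hr; exact: hn.
pose E h := closure (@fin R @` (~` Kf h)).
have EJ h : G h -> E h `<=` julia G.
  move=> Gh; rewrite [X in _ `<=` X](closure_id (julia G)).1; last exact: closed_julia.
  by apply: closureS => _ [z nK <-]; exact: bas nK.
have Einf h : G h -> E h infty.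
  move=> Gh B /nbhs_infty[_ [r1 hB]]; have [r2 r21 hr2] := poly_escape (pcb_size pG Gh).
  have [w w1 _] := @exists_far R 0 0 (Num.max r1 r2).
  exists (fin w); split; last by apply: hB; apply: le_lt_trans w1; rewrite le_max lexx.
  exists w => //; apply: (far_notKf r21 hr2); apply: le_lt_trans w1.
  by rewrite le_max lexx orbT.
pose U := \bigcup_(h in G) E h.
have cU : connected U.
  apply: bigcup_connected; first by exists infty => h; exact: Einf.
  move=> h Gh; apply: connected_closure; apply: fin_connected.
  exact: basin_connected (pcb_size pG Gh).
suff -> : julia G = closure U by exact: connected_closure.
apply/seteqP; split; last first.
  rewrite [X in _ `<=` X](closure_id (julia G)).1; last exact: closed_julia.
  by apply: closureS => x [h Gh]; exact: EJ.
move=> [z|] jz; last first.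
  by have [[h Gh] _ _ _] := pG; apply: subset_closure; exists h => //; exact: Einf.
move=> B /nbhs_fin[e e0 he].
have [h [w [Gh jw wz]]] := (julia_finP pG z).1 jz e e0.
exists (fin w); split; last exact: he.
by exists h => //; apply: closure_fin; case: jw.
Qed.
End JuliaAtInfinity.

(** * The minimal component *)

Section MinimalComponent.
Context {R : realType}.
Local Notation C := R[i].
Local Notation S := (sphere R).
Implicit Types (z w : C) (e : R).
Variables (G : set {poly C}) (g : {poly C}) (z1 : C).
Hypotheses (pG : pcb G) (Gg : G g) (gz : g.[z1] = z1) (g'z : g^`().[z1] = 0).
Hypotheses (ninf : ~ julia G infty) (jz1 : julia G (fin z1)).

Let JP : set C := plane_part (julia G).
Let K0 : set C := connected_component JP z1.

Lemma K0_z1 : K0 z1.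
Proof. exact: (@connected_component_refl _ JP z1 jz1). Qed.

Lemma JP_closed : closed JP.
Proof.
apply: (@closed_comp _ _ (@fin R) (julia G)); last exact: closed_julia.
by move=> z _; exact: fin_continuous.
Qed.

Lemma JP_bounded : exists2 r : R, 0 < r & JP `<=` cdisc 0 r.
Proof.
have F : fatou G infty by exact: contrapT.
have /nbhs_infty[_ [r hr]] : nbhs infty (fatou G).
  by have := @open_fatou R G; rewrite openE => /(_ _ F).
exists (`|r| + 1); first by rewrite ltr_wpDl.
move=> z jz; rewrite /cdisc /= subr0 leNgt; apply/negP => h; apply: jz; apply: hr.
by have := ler_norm r; lra.
Qed.

Lemma JP_compact : compact JP.
Proof. by have [r _ h] := JP_bounded; exact: bounded_closed_compact_c JP_closed h. Qed.

Lemma jul_JP h : G h -> jul h `<=` JP.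
Proof. by move=> Gh z jz; exact: (jul_julia pG Gh jz). Qed.

Lemma z1_nbhd : exists2 e : R, 0 < e & forall w, normc (w - z1) < e -> JP w.
Proof. exact: (nbhs_fin _ _).1 (interior_superattracting pG Gg gz g'z jz1). Qed.

Lemma K0_nbhd e : 0 < e -> (forall w, normc (w - z1) < e -> JP w) -> forall w, normc (w - z1) < e -> K0 w.
Proof.
move=> e0 he w we.
have h := @connected_component_max _ JP (cball z1 e) z1 (cball_center z1 e0) he (@cball_connected R z1 e).
exact: (h w we).
Qed.

Lemma z1_Kf h : G h -> Kf h z1.
Proof. by move=> Gh; apply: (crit_Kf pG Gh); exists g, z1; rewrite gz. Qed.

(** If [K0] missed [jul g], it would lie in the set [B] of points attracted to [z1]: [B] is open,
    and relatively closed in [K0] since the iterates are equicontinuous in the interior of [Kf g].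
    As [B] is contained in the Julia set, [K0] would be open as well as closed in the plane, hence
    unbounded. *)
Lemma K0_meets_jul : K0 `&` jul g !=set0.
Proof.
apply: contrapT => no; have g2 := pcb_size pG Gg; have g1 := pcb_size1 pG Gg.
have [e1 e10 he1] := z1_nbhd.
have [r r0 hr] := superattracting_nbhd g1 gz g'z.
pose e := Num.min e1 r; have e0 : 0 < e by rewrite lt_min e10.
have K0z1 := K0_z1.
have contr w : normc (w - z1) < e -> normc (g.[w] - z1) <= normc (w - z1) / 2.
  rewrite lt_min => /andP[_ wr]; have [->|/eqP wz] := eqVneq w z1.
    by rewrite gz subrr normc0 mul0r.
  by have [] := hr w wr wz.
have contrn n w : normc (w - z1) < e -> normc (it g n.+1 w - z1) < e / 2.
  move=> we; elim: n => [|n IH].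
    by apply: le_lt_trans (contr w we) _; rewrite ltr_pM2r.
  have h := contr (it g n.+1 w) (ltac:(lra)); have -> : it g n.+2 w = g.[it g n.+1 w] by [].
  by lra.
pose B := [set z | exists n, normc (it g n z - z1) < e].
have oB : open B.
  apply/open_normcP => z [n zn].
  have [d d0 hd] := (continuous_normcP _ _).1 (@it_continuous R g n z) (e - normc (it g n z - z1)) (ltac:(by rewrite subr_gt0)).
  exists d => // w /hd h; exists n.
  by have := ler_distcD (it g n z) (it g n w) z1; lra.
have BJ : B `<=` JP.
  move=> z [n zn]; apply: (it_julia pG (n := n) Gg); apply: he1.
  by apply: lt_le_trans zn _; rewrite ge_min lexx.
have K0B : K0 `<=` B.
  move=> w K0w; have cK0 := @component_connected _ JP z1.
  apply: (@connected_locally_constant C K0 B cK0 _ z1 w) => //; last first.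
    by exists 0%N; rewrite /= subrr normc0.
  move=> z K0z; have [Bz|nBz] := pselect (B z).
    have [d d0 hd] := (open_normcP B).1 oB z Bz.
    by apply/nbhs_normcP; exists d => // y /hd By _.
  have Kz : Kf g z.
    apply: contrapT => nK; have [y yK yj] := conn_meets_jul g2 cK0 K0z1 K0z (z1_Kf Gg) nK.
    by apply: no; exists y.
  have [d d0 hd] := Kf_interior Kz (fun jz => no (ex_intro _ z (conj K0z jz))).
  have [rg rg1 hrg] := poly_escape g2.
  have d3 : 0 < d / 3 by rewrite divr_gt0.
  (* A common Lipschitz constant of the iterates near [z], by Cauchy's estimate: they map a disc in
     [Kf g] into the disc of radius [rg]. *)
  have [L LE] : exists L : R, L = 72 * rg / (d / 3) by exists (72 * rg / (d / 3)).
  have L0 : 0 < L by rewrite LE divr_gt0// mulr_gt0//; exact: lt_le_trans rg1.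
  have eL : 0 < e / 2 / L by rewrite !divr_gt0.
  have d6 : 0 < d / 6 by rewrite divr_gt0.
  pose d' := Num.min (d / 6) (e / 2 / L).
  have d'0 : 0 < d' by rewrite lt_min d6 eL.
  apply/nbhs_normcP; exists d' => // y; rewrite lt_min => /andP[y1 y2] K0y; split=> // -[n yn].
  exfalso; apply: nBz; exists n.+1; have h1 := contrn 0%N _ yn.
  have h2 : normc (it g n.+1 y - it g n.+1 z) <= L * normc (y - z).
    rewrite LE; have := @cauchy_lip R (it g n.+1) z y (d / 3) rg d3 _ _ (ltac:(lra)); apply.
      move=> u _; exists (piter g n.+1)^`().[u].
      exact: (eq_has_cderiv (fun v => horner_piter g n.+1 v) (has_cderiv_horner _ u)).
    by move=> u uz; apply: (KfP rg1 hrg u).1; apply: hd; lra.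
  have h3 : L * normc (y - z) < e / 2 by rewrite mulrC -ltr_pdivlMr.
  have h4 : it g 1 (it g n y) = it g n.+1 y by [].
  rewrite h4 in h1; have := ler_distcD (it g n.+1 y) (it g n.+1 z) z1.
  by rewrite (normc_distC (it g n.+1 z) (it g n.+1 y)); lra.
have oK0 : open K0.
  apply/open_normcP => z K0z; have [d d0 hd] := (open_normcP B).1 oB z (K0B z K0z).
  exists d => // w wd; have := same_connected_component K0z; rewrite -/K0 => ->.
  have h := @connected_component_max _ JP (cball z d) z (cball_center z d0) (fun u ud => BJ u (hd u ud)) (@cball_connected R z d).
  exact: (h w wd).
have cK0 : closed K0 by apply: component_closed; exact: JP_closed.
have all : forall z, K0 z.
  move=> z; apply: (@connected_locally_constant C setT K0 (@connected_setT_c R) _ z1 z) => // x _.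
  have [Kx|nKx] := pselect (K0 x).
    by have := open_nbhs_nbhs (conj oK0 Kx); apply: filterS => y Ky _.
  have oK : open (~` K0) by exact: closed_openC.
  by have := open_nbhs_nbhs (conj oK nKx); apply: filterS => y Ky _.
have [rj rj0 hj] := JP_bounded; have [w w1 _] := @exists_far R 0 0 rj.
have := hj w (connected_component_sub (all w)); rewrite /cdisc /= subr0.
by rewrite leNgt w1.
Qed.

Lemma jul_sub_K0 : jul g `<=` K0.
Proof.
have [x [K0x jx]] := K0_meets_jul; have := same_connected_component K0x; rewrite -/K0 => ->.
exact: (connected_component_max jx (jul_JP Gg) (pcb_jul_connected pG Gg)).
Qed.

Lemma Kf_far h z r : G h -> JP `<=` cdisc 0 r -> r < normc z -> ~ Kf h z.
Proof.
move=> Gh hj rz Kz; have [c jc zc] := jul_far 0 (pcb_size pG Gh) Kz.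
have := hj c (jul_JP Gh jc); rewrite /cdisc /=; rewrite subr0 in zc *; lra.
Qed.

Lemma K0_surrounded z' : JP z' -> ~ K0 z' ->
  surround_le K0 (connected_component JP z').
Proof.
move=> jz' nK0; right; set K' := connected_component JP z'.
have disj w : K0 w -> K' w -> False.
  move=> /same_connected_component E1 /same_connected_component E2; apply: nK0.
  by rewrite /K0 E1 -E2; exact: connected_component_refl.
have clK' : closed K' by apply: component_closed; exact: JP_closed.
have oU : open (~` K') by exact: closed_openC.
have K0z1 := K0_z1.
have Uz1 : (~` K') z1 by move=> /(disj z1); exact.
exists (connected_component (~` K') z1); split; first by exists z1.
  apply: contrapT => nb; have [r r0 hj] := JP_bounded.
  have [w [Bw wr]] : exists w, connected_component (~` K') z1 w /\ r < normc w.
    apply: contrapT => no; apply: nb; exists r%:C; split; first by apply: ger0_real; rewrite lecR ltW.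
    move=> t rt z Bz /=; apply: le_trans (ltW rt); rewrite normcE lecR leNgt; apply/negP => h.
    by apply: no; exists z.
  have [Y [cY conY YU Yz1 Yw]] := compact_chain oU (@component_connected _ _ _) (@connected_component_sub _ _ _)
    (connected_component_refl Uz1) Bw.
  have oY : open (~` Y) by apply: closed_openC; exact: compact_closed_c.
  (* A component need not contain any [jul h]. A clopen part [A] of the Julia set, still disjoint
     from [Y], is a neighbourhood of [z'] in it and therefore contains a whole [jul h]. *)
  have [A [cA cA' AJ Az'] AY] := quasi_component JP_compact jz' oY (fun u Ku Yu => YU u Yu Ku).
  have [d d0 hd] := closed_notin cA' (fun h : (JP `\` A) z' => h.2 Az').
  have [h [y [Gh jy yz]]] := (julia_finP pG z').1 jz' d d0.
  have Ay : A y by apply: contrapT => nA; exact: (hd y yz (conj (jul_JP Gh jy) nA)).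
  have jA : jul h `<=` A.
    move=> u ju; apply: contrapT => nAu.
    have cov : jul h `<=` A `|` (JP `\` A).
      move=> v jv; have [Av|nAv] := pselect (A v); first by left.
      by right; exact: (conj (jul_JP Gh jv) nAv).
    have dis : A `&` (JP `\` A) = set0 by rewrite setDE setICA setICr setI0.
    exact: (connected_closed_cover (pcb_jul_connected pG Gh) cA cA' cov dis
      (ex_intro _ y (conj jy Ay)) (ex_intro _ u (conj ju (conj (jul_JP Gh ju) nAu)))).
  have [x Yx jx] := conn_meets_jul (pcb_size pG Gh) conY Yz1 Yw (z1_Kf Gh) (Kf_far Gh hj wr).
  exact: AY (jA x jx) Yx.
have sub : K0 `<=` ~` K' by move=> w K0w K'w; exact: (disj w).
exact: (connected_component_max K0z1 sub (@component_connected _ JP z1)).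
Qed.

(** If no point of [Y] exceeded [|x|] in modulus, the exterior of the circle through [x] would avoid
    [Y] and, joined to [x] by a small disc, lie in the component [D], which is bounded. The largest
    modulus is thus strictly monotone for the surrounding order, which gives antisymmetry. *)
Lemma surround_far (X Y : set C) : compact Y -> Y !=set0 ->
  (exists D, [/\ conn_components (~` Y) D, bounded_set D & X `<=` D]) ->
  forall x, X x -> exists2 y, Y y & normc x < normc y.
Proof.
move=> cY Y0 [D [[d Yd DE] bD XD]] x Xx.
have [y /set_mem Yy hy] : exists2 y, y \in Y & forall z, z \in Y -> normc z <= normc y.
  by apply: compact_EVT_max => //; apply: continuous_in_subspaceT => z _; exact: continuous_normc.
exists y => //; rewrite ltNge; apply/negP => yx.
have Dx := XD x Xx; rewrite -DE in Dx.
have nYx : ~ Y x := connected_component_sub Dx.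
have [e e0 he] := closed_notin (compact_closed_c cY) nYx.
pose E := [set z | normc x < normc (z - 0)].
have EY : E `<=` ~` Y.
  move=> z xz Yz; have := hy z (mem_set Yz); rewrite /E /= subr0 in xz.
  by rewrite leNgt (le_lt_trans yx xz).
have [u ux xu] := poly_increase (p := 'X) x (ltac:(by rewrite size_polyX)) e0.
rewrite !hornerX in xu.
have cW : connected (cball x e `|` E).
  apply: connectedU; [|exact: cball_connected|exact: exterior_connected (normc_ge0 x)].
  by exists u; split=> //; rewrite /E /= subr0.
have WD : cball x e `|` E `<=` D.
  have sub : cball x e `|` E `<=` ~` Y by move=> z [/he|/EY].
  rewrite -DE (same_connected_component Dx).
  exact: (connected_component_max (or_introl (cball_center x e0)) sub cW).
have [M M0 hM] := ex_strict_bound_gt0 bD.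
have [w w1 _] := @exists_far R 0 0 (Num.max (normc x) (complex.Re M)).
have : `|w| < M.
  by apply: hM; apply: WD; right; rewrite /E /= subr0; apply: le_lt_trans w1; rewrite le_max lexx.
rewrite normcE ltcE /= => /andP[_]; rewrite ltNge => /negP; apply; apply: le_trans (ltW w1).
by rewrite le_max lexx orbT.
Qed.

Lemma surround_antisym (A B : set C) : compact A -> compact B -> A !=set0 -> B !=set0 ->
  surround_le A B -> surround_le B A -> A = B.
Proof.
move=> cA cB A0 B0 [//|AB] [//|BA]; exfalso.
have [a /set_mem Aa ha] : exists2 a, a \in A & forall z, z \in A -> normc z <= normc a.
  by apply: compact_EVT_max => //; apply: continuous_in_subspaceT => z _; exact: continuous_normc.
have [b Bb ab] := surround_far cB B0 AB Aa.
have [a' Aa' ba'] := surround_far cA A0 BA Bb.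
by have := ha a' (mem_set Aa'); rewrite leNgt (lt_trans ab ba').
Qed.

Lemma component_compact z : compact (connected_component JP z).
Proof.
apply: (subclosed_compact _ JP_compact); last exact: connected_component_sub.
by apply: component_closed; exact: JP_closed.
Qed.

Lemma finite_componentsP K : finite_julia_components G K <->
  exists2 z, JP z & K = @fin R @` connected_component JP z.
Proof.
split=> [[[[z|] jz KE] nK]|[z jz ->]].
- exists z => //; rewrite -KE; exact: component_fin.
- by exfalso; apply: nK; rewrite -KE; exact: connected_component_refl.
split; last by move=> [].
by exists (fin z) => //; exact: component_fin.
Qed.

Lemma K0_minimal : [set K | finite_julia_components G K /\ forall K', finite_julia_components G K' ->
  surround_le (plane_part K') (plane_part K) -> K' = K] (@fin R @` K0).
Proof.
split; first by apply/finite_componentsP; exists z1.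
move=> K' /finite_componentsP[z jz ->]; rewrite !plane_part_fin => le.
have [K0z|nK0z] := pselect (K0 z); first by rewrite /K0 (same_connected_component K0z).
congr (_ @` _); apply: surround_antisym le (K0_surrounded jz nK0z).
- exact: component_compact.
- exact: component_compact.
- by exists z; exact: connected_component_refl.
- by exists z1; exact: K0_z1.
Qed.

Lemma J_minE : J_min G = @fin R @` K0.
Proof.
have : [set K | finite_julia_components G K /\ forall K', finite_julia_components G K' ->
  surround_le (plane_part K') (plane_part K) -> K' = K] (J_min G).
  by apply: getPex; exists (@fin R @` K0); exact: K0_minimal.
move=> [/finite_componentsP[z jz ->] min].
have [K0z|nK0z] := pselect (K0 z); first by rewrite /K0 (same_connected_component K0z).
apply/esym; apply: min; first by have [] := K0_minimal.
by rewrite !plane_part_fin; exact: K0_surrounded.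
Qed.

Lemma part3 : interior (J_min G) (fin z1) /\ julia1 g `<=` J_min G.
Proof.
rewrite J_minE; split.
  have [e e0 he] := z1_nbhd; apply/nbhs_fin; exists e => // w we.
  by exists w => //; exact: K0_nbhd we.
by move=> x /(julia1_sub pG Gg)[z jz ->]; exists z => //; exact: jul_sub_K0.
Qed.
End MinimalComponent.

(** * Uniform perfectness *)

Section OpenMapping.
Context {R : realType}.
Local Notation C := R[i].
Implicit Types (z w y : C) (r e : R).

(** If a value [y] near [k z] were omitted, [1 / (k - y)] would be holomorphic, larger than [2 / e]
    at [z] and at most [2 / e] on a ring around [z], against the maximum principle. Injectivity
    keeps [k] away from [k z] on the ring. *)
Lemma injective_open (k : C -> C) z r : 0 < r ->
  (forall w, normc (w - z) < 3 * r -> cdiff k w) ->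
  (forall w, normc (w - z) < 3 * r -> k w = k z -> w = z) ->
  exists2 e, 0 < e & forall y, normc (y - k z) < e -> exists2 w, normc (w - z) < 3 * r & k w = y.
Proof.
move=> r0 dk ik; pose Q : set C := [set w | r <= normc (w - z) <= 2 * r].
have cN : continuous (fun w => normc (w - z)) by exact: continuous_normc_sub.
have cQ : compact Q.
  apply: (@bounded_closed_compact_c _ _ (normc z + 2 * r)).
    rewrite (_ : Q = (fun w => normc (w - z)) @^-1` `[r, 2 * r]%classic).
      by apply: preimage_closed => //; exact: interval_closed.
    by apply/seteqP; split=> w; rewrite /Q /= in_itv.
  move=> w /andP[_ h]; rewrite /cdisc /= subr0.
  by have := lerB_normc w z; lra.
have ckQ : closed (k @` Q).
  apply: compact_closed_c; apply: continuous_compact => //.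
  apply: continuous_in_subspaceT => w /set_mem /andP[_ h].
  by apply: cdiff_continuous; apply: dk; lra.
have nk : ~ (k @` Q) (k z).
  move=> [w /andP[h1 h2] /ik wz]; move: h1; rewrite wz ?subrr ?normc0; lra.
have [e e0 he] := closed_notin ckQ nk.
exists (e / 2); first by rewrite divr_gt0.
move=> y ye; apply: contrapT => ny.
have ky w : normc (w - z) < 3 * r -> k w - y != 0.
  by move=> wz; rewrite subr_eq0; apply/eqP => kw; apply: ny; exists w.
have ez : normc (k z - y) < e / 2 by rewrite normc_distC.
have kz0 : 0 < normc (k z - y) by rewrite normc_gt0; apply: ky; rewrite subrr normc0; lra.
suff : normc (k z - y)^-1 <= 2 / e.
  apply/negP; rewrite -ltNge normcV -[ltLHS]invrK invf_div ltf_pV2 ?posrE//.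
  exact: divr_gt0.
apply: (@max_principle _ (fun w => (k w - y)^-1) z r (2 / e) r0) => [w wz|w w1 w2].
- by apply: cdiffV; [exact: ky|apply: cdiffB; [exact: dk|exact: cdiff_cst]].
- have kwz : e <= normc (k w - k z).
    rewrite leNgt; apply/negP => /he; apply; exists w => //.
    by apply/andP; split=> //; exact: ltW.
  have := ler_distcD y (k w) (k z) => h.
  have h2 : e / 2 <= normc (k w - y) by lra.
  have e2 : 0 < e / 2 by rewrite divr_gt0.
  have k0 : 0 < normc (k w - y) by exact: lt_le_trans h2.
  by rewrite normcV -[leRHS]invrK invf_div lef_pV2 ?posrE.
Qed.

Lemma annulus_connected (a b : \bar R) : (0 <= a)%E ->
  connected [set z : C | (a < (normc z)%:E < b)%E].
Proof.
move=> a0; set A := [set z : C | _].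
have [->|/set0P[z0 Az0]] := eqVneq A set0; first exact: connected0.
have A0 z : A z -> 0 < normc z by move=> /andP[+ _] => /(le_lt_trans a0); rewrite lte_fin.
pose circle z : set C := [set z * u | u in [set u : C | normc u = 1]].
have cc z : connected (circle z).
  apply: image_connected; first exact: unit_circle_connected.
  by move=> u _; apply: cdiff_continuous; apply: cdiffM; [exact: cdiff_cst|exact: cdiff_id].
have cA z w : A z -> normc w = normc z -> A w by rewrite /A /= => + ->.
have circle_in z w : 0 < normc z -> normc w = normc z -> circle z w.
  move=> z1 wz; exists (w / z); first by rewrite /= normcM normcV wz divff// gt_eqF.
  by rewrite mulrC divfK// -normc_gt0.
pose q z := (normc z / normc z0)%:C * z0.
have nq z : normc (q z) = normc z.
  rewrite /q normcM normc_real ger0_norm ?divfK ?gt_eqF ?A0//.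
  by rewrite divr_ge0 ?normc_ge0.
pose P z := (circle z0 `|` segc z0 (q z)) `|` circle z.
have z00 := A0 _ Az0.
have -> : A = \bigcup_(z in A) P z.
  apply/seteqP; split=> [z Az|z [w Aw]]; first by exists z => //; right; apply: circle_in => //; exact: A0.
  case=> [[[u /= u1 <-]|[t /=]]|[u /= u1 <-]]; last 1 first.
  - by apply: (cA w) => //; rewrite normcM u1 mulr1.
  - by apply: (cA z0) => //; rewrite normcM u1 mulr1.
  rewrite in_itv /= => /andP[t0 t1] <-.
  have w0 := A0 _ Aw.
  have nE : normc (z0 + t%:C * (q w - z0)) = normc z0 + t * (normc w - normc z0).
    rewrite /q [X in normc X](_ : _ = (1 - t + t * (normc w / normc z0))%:C * z0); last first.
      by rewrite rmorphD rmorphM rmorphB /= rmorph1; ring.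
    rewrite normcM normc_real ger0_norm; last first.
      by rewrite addr_ge0 ?subr_ge0// mulr_ge0// divr_ge0 ?normc_ge0.
    by field; rewrite gt_eqF.
  have [le|le] := leP (normc z0) (normc w).
    have h1 : 0 <= t * (normc w - normc z0) by rewrite mulr_ge0// subr_ge0.
    have h2 : t * (normc w - normc z0) <= normc w - normc z0 by rewrite ler_piMl// subr_ge0.
    move: Az0 Aw; rewrite /A /= nE => /andP[h3 _] /andP[_ h4].
    apply/andP; split; first by apply: lt_le_trans h3 _; rewrite lee_fin; lra.
    by apply: le_lt_trans _ h4; rewrite lee_fin; lra.
  have h1 : 0 <= t * (normc z0 - normc w) by rewrite mulr_ge0// subr_ge0 ltW.
  have h2 : t * (normc z0 - normc w) <= normc z0 - normc w by rewrite ler_piMl// subr_ge0 ltW.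
  move: Az0 Aw; rewrite /A /= nE => /andP[_ h3] /andP[h4 _].
  apply/andP; split; first by apply: lt_le_trans h4 _; rewrite lee_fin; lra.
  by apply: le_lt_trans _ h3; rewrite lee_fin; lra.
apply: bigcup_connected.
  by exists z0 => z Az; left; left; exact: circle_in.
move=> z Az; apply: connectedU => //.
  exists (q z); split; first by right; exact: segc_right.
  by apply: circle_in; [exact: A0|exact: nq].
apply: connectedU => //; last exact: segc_connected.
by exists z0; split; [exact: circle_in|exact: segc_left].
Qed.
End OpenMapping.

(** * Conformal images of round annuli *)

Section RoundAnnulus.
Context {R : realType}.
Local Notation C := R[i].
Local Notation S := (sphere R).
Implicit Types (z w y : C) (r e : R) (x : S).
Variables (r1 r2 : \bar R) (f : S -> S) (A : set S).
Hypothesis r1_ge0 : (0 <= r1)%E.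
Hypothesis holf : holomorphic_on (round_annulus r1 r2) f.
Hypothesis bijf : set_bij (round_annulus r1 r2) A f.

Definition ring_dom (a b : \bar R) : set C := [set z | (a < (normc z)%:E < b)%E].
Local Notation Ann := (ring_dom r1 r2).

Lemma ring_dom_open z : Ann z -> exists2 e, 0 < e & forall w, normc (w - z) < e -> Ann w.
Proof.
case: holf => oA _ Az; have : nbhs (fin z) (round_annulus r1 r2).
  by apply: open_nbhs_nbhs; split=> //; exists z.
by case/nbhs_fin => e e0 he; exists e => // w /he[v Av [<-]].
Qed.

Lemma ann_inj z w : Ann z -> Ann w -> f (fin z) = f (fin w) -> z = w.
Proof.
move=> Az Aw fzw; apply: (@fin_inj R); have [_ inj _] := bijf.
by apply: inj => //; rewrite inE; [exists z|exists w].
Qed.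

Lemma ann_im z : Ann z -> A (f (fin z)).
Proof. by move=> Az; case: bijf => h _ _; apply: h; exists z. Qed.

Lemma ann_surj x : A x -> exists2 z, Ann z & f (fin z) = x.
Proof. by case: bijf => _ _ h /h[_ [z Az <-] <-]; exists z. Qed.

Lemma ann_cont z : Ann z -> {for z, continuous (fun w => f (fin w))}.
Proof.
case: holf => _ h Az; have [|cf _] := h (fin z); first by exists z.
by apply: (@continuous_comp _ _ _ (@fin R) f z); [exact: fin_continuous|exact: cf].
Qed.

(** At a pole of [f] the value is the junk 0, and because [0^-1 = 0] the inverse of [plane_map] is
    then exactly the expression of [f] in the chart at infinity. *)
Definition plane_map z := fin_inv (f (fin z)).

Lemma plane_mapE z : f (fin z) <> infty -> f (fin z) = fin (plane_map z).
Proof. by rewrite /plane_map; case: (f (fin z)). Qed.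

Lemma plane_map_neq0 z : plane_map z != 0 -> f (fin z) = fin (plane_map z).
Proof. by move=> h; apply: plane_mapE => fz; move: h; rewrite /plane_map fz eqxx. Qed.

Lemma ann_cdiff z : Ann z -> f (fin z) <> infty -> cdiff plane_map z.
Proof.
case: holf => _ h Az; have [|_ df] := h (fin z); first by exists z.
move=> fz; have E : local_expr f (fin z) = plane_map.
  rewrite /local_expr (plane_mapE fz); apply/funext => w; rewrite /plane_map /=.
  by case: (f (fin w)).
move: df; rewrite E => /derivableP df; eexists; apply/has_cderivP; exact: df.
Qed.

Lemma ann_cdiffV z : Ann z -> f (fin z) = infty -> cdiff (fun w => (plane_map w)^-1) z.
Proof.
case: holf => _ h Az; have [|_ df] := h (fin z); first by exists z.
move=> fz; have E : local_expr f (fin z) = fun w => (plane_map w)^-1.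
  rewrite /local_expr fz; apply/funext => w; rewrite /plane_map /=.
  by case: (f (fin w)) => //=; rewrite invr0.
move: df; rewrite E => /derivableP df; eexists; apply/has_cderivP; exact: df.
Qed.

Lemma ann_open z e : Ann z -> 0 < e -> nbhs (f (fin z)) [set f (fin w) | w in cball z e].
Proof.
move=> Az e0; have [e1 e10 he1] := ring_dom_open Az.
(* Near [z] one chart of the target suffices: either no value is infinite, or no value is 0 and
   [1 / plane_map] is holomorphic. *)
have : nbhs z (fun w => (f (fin z) <> infty -> f (fin w) <> infty) /\
    (f (fin z) = infty -> plane_map w != 0 \/ f (fin w) = infty)).
  have [fz|fz] := pselect (f (fin z) = infty).
    have : nbhs (f (fin z)) [set x : S | x = infty \/ fin_inv x != 0].
      rewrite fz; apply/nbhs_infty; split; first by left.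
      by exists 0 => w /= w0; right; rewrite -normc_gt0.
    move=> nb; have nb' : nbhs z (fun w => f (fin w) = infty \/ fin_inv (f (fin w)) != 0) := ann_cont Az nb.
    apply: filterS nb' => w h; split=> // _; by case: h; [right|left].
  have : nbhs (f (fin z)) [set x : S | x <> infty].
    by rewrite (plane_mapE fz); apply/nbhs_fin; exists 1.
  move=> nb; have nb' : nbhs z (fun w => f (fin w) <> infty) := ann_cont Az nb.
  by apply: filterS nb' => w h; split.
case/nbhs_normcP => e2 e20 he2.
have [r [r0 re re1 re2]] : exists r : R, [/\ 0 < r, 3 * r <= e, 3 * r <= e1 & 3 * r <= e2].
  exists (Num.min e (Num.min e1 e2) / 3); have -> (m : R) : 3 * (m / 3) = m by field.
  by split; rewrite ?divr_gt0 ?lt_min ?e0 ?e10 ?e20 ?ge_min ?lexx ?orbT.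
have Aw w : normc (w - z) < 3 * r -> Ann w by move=> wz; apply: he1; lra.
have near w : normc (w - z) < 3 * r -> (f (fin z) <> infty -> f (fin w) <> infty) /\
    (f (fin z) = infty -> plane_map w != 0 \/ f (fin w) = infty).
  by move=> wz; apply: he2; lra.
have zz : normc (z - z) < 3 * r by rewrite subrr normc0; lra.
have [fz|fz] := pselect (f (fin z) = infty); last first.
  have fin_w w (wz : normc (w - z) < 3 * r) : f (fin w) <> infty by have [h _] := near w wz; exact: h.
  have [|w wz wE|d d0 hd] := @injective_open _ plane_map z r r0.
  - by move=> w wz; apply: ann_cdiff; [exact: Aw|exact: fin_w].
  - apply: ann_inj => //; first exact: Aw.
    by rewrite (plane_mapE (fin_w _ wz)) (plane_mapE fz) wE.
  rewrite (plane_mapE fz); apply/nbhs_fin; exists d => // y /hd[w wz <-].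
  exists w; first by rewrite /cball /=; lra.
  exact/plane_mapE/fin_w.
have [|w wz wE|d d0 hd] := @injective_open _ (fun w => (plane_map w)^-1) z r r0.
- move=> w wz; have [fw|fw] := pselect (f (fin w) = infty); first by apply: ann_cdiffV => //; exact: Aw.
  apply: cdiffV; last by apply: ann_cdiff => //; exact: Aw.
  by have [_ /(_ fz)[]] := near w wz.
- apply: ann_inj => //; first exact: Aw.
  have [_ /(_ fz)[h|->//]] := near w wz.
  by move: wE h; rewrite /plane_map fz invr0 => /eqP; rewrite invr_eq0 => /eqP ->; rewrite eqxx.
have k0 : (plane_map z)^-1 = 0 by rewrite /plane_map fz invr0.
rewrite fz; apply/nbhs_infty; split; first by exists z => //; rewrite /cball /=; lra.
exists d^-1 => y yd; have y0 : 0 < normc y by apply: lt_trans yd; rewrite invr_gt0.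
have [|w wz wE] := hd y^-1.
  by rewrite k0 subr0 normcV -[ltRHS]invrK ltf_pV2 ?posrE ?invr_gt0.
have {}wE : plane_map w = y by exact: invr_inj.
exists w; first by rewrite /cball /=; lra.
by rewrite plane_map_neq0 wE// -normc_gt0.
Qed.

End RoundAnnulus.

(** * The two ends of a conformal annulus *)

Section Ends.
Context {R : realType}.
Local Notation C := R[i].
Local Notation S := (sphere R).
Implicit Types (z w y : C) (r e c d : R) (x : S).
Variables (r1 r2 : \bar R) (f : S -> S) (A : set S).
Hypothesis r1_ge0 : (0 <= r1)%E.
Hypothesis holf : holomorphic_on (round_annulus r1 r2) f.
Hypothesis bijf : set_bij (round_annulus r1 r2) A f.
Local Notation Ann := (ring_dom r1 r2).

(** Properness: since [f] is open, [Q] is covered by the images of open sub-annuli bounded away from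
    both ends, and finitely many suffice. *)
Lemma ann_compact (Q : set S) r : closed Q -> Q `<=` A -> (r1 < r%:E < r2)%E ->
  exists c d, [/\ (r1 < c%:E)%E, c <= r, r <= d, (d%:E < r2)%E &
    forall z, Ann z -> Q (f (fin z)) -> c <= normc z <= d].
Proof.
move=> clQ QA /andP[rr1 rr2].
have : compact Q by apply: subclosed_compact clQ (@sphere_compact R) _.
rewrite compact_cover => cQ.
have [|x Qx|D DU cD] := cQ (R * R)%type [set p : R * R | (r1 < p.1%:E)%E /\ (p.2%:E < r2)%E]
    (fun p => interior [set f (fin w) | w in ring_dom p.1%:E p.2%:E]).
- by move=> p _; exact: open_interior.
- have [z Az zx] := ann_surj bijf (QA _ Qx); have [z1 z2] := andP Az.
  have [c [c1 c2]] : exists c, (r1 < c%:E)%E /\ c < normc z.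
    case: r1 r1_ge0 z1 => [s| |]//; rewrite lte_fin => _ sz.
    by exists ((s + normc z) / 2); rewrite lte_fin; split; lra.
  have [d [d1 d2]] : exists d, (d%:E < r2)%E /\ normc z < d.
    case: r2 z2 => [s| |]//; rewrite ?lte_fin => sz.
      by exists ((s + normc z) / 2); rewrite lte_fin; split; lra.
    by exists (normc z + 1); rewrite ltry; split=> //; lra.
  exists (c, d) => //=; pose e := Num.min (normc z - c) (d - normc z).
  have e0 : 0 < e by rewrite lt_min !subr_gt0 c2 d2.
  have := ann_open holf bijf Az e0.
  rewrite /interior zx; apply: filterS => _ [w we <-]; exists w => //.
  move: we; rewrite /cball /= lt_min => /andP[h1 h2].
  have h3 := lerB_normc w z; have h4 := lerB_normc z w.
  have h5 : normc (z - w) = normc (w - z) by exact: normc_distC.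
  by rewrite /ring_dom /= !lte_fin; apply/andP; split; lra.
have {}DU p : p \in finmap.enum_fset D -> (r1 < p.1%:E)%E /\ (p.2%:E < r2)%E.
  by move=> pD; have := DU p pD; rewrite inE.
have {}cD z : Ann z -> Q (f (fin z)) -> exists2 p, p \in finmap.enum_fset D & p.1 <= normc z <= p.2.
  move=> Az /cD[p pD /interior_subset[w /andP[]]]; rewrite !lte_fin => h1 h2 fw; exists p => //.
  have [p1 p2] := DU p pD.
  rewrite (ann_inj bijf Az _ (esym fw)); first by rewrite !ltW.
  apply/andP; split; first by apply: lt_trans p1 _; rewrite lte_fin.
  by apply: lt_trans p2; rewrite lte_fin.
suff [c [d [h1 h2 h3 h4 h5]]] : exists c d, [/\ (r1 < c%:E)%E, c <= r, r <= d, (d%:E < r2)%E &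
    forall p : R * R, p \in finmap.enum_fset D -> c <= p.1 /\ p.2 <= d].
  exists c, d; split=> // z Az /(cD _ Az)[p /h5[pc pd] /andP[h6 h7]].
  by rewrite (le_trans pc h6) (le_trans h7 pd).
elim: (finmap.enum_fset D) {cD} DU => [|p s IH] hs.
  by exists r, r; split=> // p; rewrite in_nil.
have [q qs|c [d [h1 h2 h3 h4 h5]]] := IH; first by apply: hs; rewrite in_cons qs orbT.
have [p1 p2] := hs p (mem_head _ _).
exists (Num.min c p.1), (Num.max d p.2); split.
- by rewrite minEle; case: ifP.
- by rewrite ge_min h2.
- by rewrite le_max h3.
- by rewrite maxEle; case: ifP.
- move=> q; rewrite in_cons => /orP[/eqP ->|/h5[h6 h7]].
    by rewrite ge_min le_max !lexx !orbT.
  by rewrite ge_min le_max h6 h7.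
Qed.

Lemma ann_circles_closed c d : (r1 < c%:E)%E -> (d%:E < r2)%E ->
  closed [set f (fin z) | z in [set z | c <= normc z <= d]].
Proof.
move=> c1 d1; apply: compact_closed; first exact: sphere_hausdorff.
apply: (@continuous_compact _ _ (fun z => f (fin z))).
  apply: continuous_in_subspaceT => z /set_mem /andP[h1 h2].
  have Az : Ann z; last exact (ann_cont holf Az).
  apply/andP; split.
    by apply: lt_le_trans c1 _; rewrite lee_fin.
  by apply: le_lt_trans d1; rewrite lee_fin.
apply: (@bounded_closed_compact_c _ _ d).
  rewrite (_ : [set z | _] = (fun w => normc w) @^-1` `[c, d]%classic).
    by apply: preimage_closed => [z _|]; [exact: continuous_normc|exact: interval_closed].
  by apply/seteqP; split=> w; rewrite /= in_itv.
by move=> z /andP[_ h]; rewrite /cdisc /= subr0.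
Qed.

Lemma ann_side (U V : set S) (a b : \bar R) : open U -> open V -> U `&` V = set0 ->
  (r1 <= a)%E -> (b <= r2)%E -> (forall z, ring_dom a b z -> U (f (fin z)) \/ V (f (fin z))) ->
  (forall z, ring_dom a b z -> U (f (fin z))) \/ (forall z, ring_dom a b z -> V (f (fin z))).
Proof.
move=> oU oV UV ra br hUV.
have sub z : ring_dom a b z -> Ann z.
  by move=> /andP[h1 h2]; apply/andP; split; [exact: le_lt_trans h1|exact: lt_le_trans br].
have oP (O : set S) : open O -> open [set z | Ann z /\ O (f (fin z))].
  move=> oO; rewrite openE => z [Az Oz].
  have h1 : nbhs z Ann by have [e e0 he] := ring_dom_open holf Az; apply/nbhs_normcP; exists e.
  have h2 : nbhs z (fun w => O (f (fin w))) := ann_cont holf Az (open_nbhs_nbhs (conj oO Oz)).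
  exact: filterI h1 h2.
have [[z rz Uz]|nU] := pselect (exists2 z, ring_dom a b z & U (f (fin z))); last first.
  by right=> z rz; case: (hUV z rz) => // Uz; exfalso; apply: nU; exists z.
left=> w rw; case: (hUV w rw) => // Vw; exfalso.
apply: (connected_open_cover (@annulus_connected _ a b (le_trans r1_ge0 ra)) (oP _ oU) (oP _ oV)).
- by move=> v rv; case: (hUV v rv) => h; [left|right]; split=> //; exact: sub.
- apply/seteqP; split=> // v [[_ h1] [_ h2]].
  by have : (U `&` V) (f (fin v)) by []; rewrite UV.
- by exists z; split=> //; split=> //; exact: sub.
- by exists w; split=> //; split=> //; exact: sub.
Qed.

(** A small neighbourhood of a point of [B] meets the annulus only near its ends, because the image
    of [c <= |z| <= d] is closed and disjoint from [B]; at the other points openness comes from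
    [ann_open]. *)
Lemma open_piece (B U : set S) (Z : set C) c d : (r1 < c%:E)%E -> (d%:E < r2)%E ->
  open U -> B `<=` U -> B `&` A = set0 -> (forall x, U x -> B x \/ A x) ->
  open Z -> Z `<=` Ann ->
  (forall z, Ann z -> U (f (fin z)) -> ~ (c <= normc z <= d) -> Z z) ->
  open (B `|` [set f (fin z) | z in Z]).
Proof.
move=> c1 d1 oU BU BA hU oZ ZA hZ; rewrite openE => x [Bx|[z Zz <-]].
  have nx : ~ [set f (fin z) | z in [set z | c <= normc z <= d]] x.
    move=> [z /andP[h1 h2] zx]; have : (B `&` A) x.
      split=> //; rewrite -zx; apply: (ann_im bijf); apply/andP; split.
        by apply: lt_le_trans c1 _; rewrite lee_fin.
      by apply: le_lt_trans d1; rewrite lee_fin.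
    by rewrite BA.
  have oN : open (~` [set f (fin z) | z in [set z | c <= normc z <= d]]).
    by apply: closed_openC; exact: ann_circles_closed.
  have h1 : nbhs x U by apply: open_nbhs_nbhs; split=> //; exact: BU.
  have h2 := open_nbhs_nbhs (conj oN nx).
  apply: filterS (filterI h1 h2) => y [Uy ny].
  have [By|Ay] := hU y Uy; first by left.
  right; have [z Az zy] := ann_surj bijf Ay; exists z => //; apply: hZ => //; first by rewrite zy.
  by move=> cd; apply: ny; exists z.
have [e e0 he] : exists2 e, 0 < e & forall w, normc (w - z) < e -> Z w.
  by apply/nbhs_normcP; apply: open_nbhs_nbhs.
apply: filterS (ann_open holf bijf (ZA _ Zz) e0) => _ [w we <-]; right; exists w => //; exact: he.
Qed.

(** Outside [c <= |z| <= d] the values are near [B1] or near [B2], and constantly so at each end. If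
    the two ends go to different pieces, the circle cuts the annulus into an open part attached to
    [B1] and one attached to [B2], which disconnect [W]. If both go to the same piece, the other
    piece is open as well as closed, which disconnects the plane. *)
Lemma circle_separates (B1 B2 : set S) (W : set C) r w1 w2 : closed B1 -> closed B2 ->
  B1 `&` B2 = set0 -> ~` A = B1 `|` B2 -> (r1 < r%:E < r2)%E -> connected W ->
  (forall z, normc z = r -> ~ (@fin R @` W) (f (fin z))) ->
  W w1 -> W w2 -> B1 (fin w1) -> B2 (fin w2) -> False.
Proof.
move=> cB1 cB2 B12 nA r12 cW hW Ww1 Ww2 B1w B2w.
have [U [V [oU oV BU BV UV]]] : exists U V : set S, [/\ open U, open V, B1 `<=` U, B2 `<=` V & U `&` V = set0].
  have nS : normal_space S := compact_normal (@sphere_hausdorff R) (@sphere_compact R).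
  by move/(@normal_openP R) : nS; apply.
have UV0 x : U x -> V x -> False by move=> h1 h2; have : (U `&` V) x by []; rewrite UV.
have clQ : closed (~` (U `|` V)) by apply: open_closedC; exact: openU.
have cases x : A x \/ B1 x \/ B2 x.
  have [|] := pselect (A x); first by left.
  by move=> h; right; have : (~` A) x by []; rewrite nA.
have QA : ~` (U `|` V) `<=` A.
  by move=> x nx; have [|[/BU h|/BV h]] := cases x => //; exfalso; apply: nx; [left|right].
have [c [d [c1 cr rd d1 hcd]]] := ann_compact clQ QA r12.
have out z : Ann z -> ~ (c <= normc z <= d) -> U (f (fin z)) \/ V (f (fin z)).
  move=> Az ncd; apply: contrapT => nUV; apply: ncd; apply: hcd => //.
have [r1r rr2] := andP r12.
have sub_in : (r1 <= r1)%E /\ (c%:E <= r2)%E.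
  by split=> //; apply: le_trans (ltW rr2); rewrite lee_fin.
have sub_out : (r1 <= d%:E)%E /\ (r2 <= r2)%E.
  by split=> //; apply: le_trans (ltW r1r) _; rewrite lee_fin.
have ri z : ring_dom r1 c%:E z -> U (f (fin z)) \/ V (f (fin z)).
  move=> /andP[h1 h2]; apply: out.
    by apply/andP; split=> //; apply: lt_le_trans sub_in.2.
  by move: h2; rewrite lte_fin => h2 /andP[]; rewrite leNgt h2.
have ro z : ring_dom d%:E r2 z -> U (f (fin z)) \/ V (f (fin z)).
  move=> /andP[h1 h2]; apply: out.
    by apply/andP; split=> //; apply: le_lt_trans h1; exact: sub_out.1.
  by move: h1; rewrite lte_fin => h1 /andP[_]; rewrite leNgt h1.
have B1A : B1 `&` A = set0.
  apply/seteqP; split=> // x [h1 h2]; have : (~` A) x by rewrite nA; left.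
  exact.
have B2A : B2 `&` A = set0.
  apply/seteqP; split=> // x [h1 h2]; have : (~` A) x by rewrite nA; right.
  exact.
have U1 x : U x -> B1 x \/ A x.
  by move=> Ux; have [|[|/BV Vx]] := cases x; [right|left|case: (UV0 x)].
have V2 x : V x -> B2 x \/ A x.
  by move=> Vx; have [|[/BU Ux|]] := cases x; [right|case: (UV0 x)|left].
have oin : open (Ann `&` [set z | normc z < r]).
  apply: openI; first by apply/open_normcP => z Az; exact: (ring_dom_open holf Az).
  by rewrite (_ : [set z | _] = (fun w => normc w) @^-1` `]-oo, r[%classic);
    [apply: open_comp; [move=> + _; exact: continuous_normc|exact: interval_open]|
     apply/seteqP; split=> w; rewrite /= in_itv].
have oout : open (Ann `&` [set z | r < normc z]).
  apply: openI; first by apply/open_normcP => z Az; exact: (ring_dom_open holf Az).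
  by rewrite (_ : [set z | _] = (fun w => normc w) @^-1` `]r, +oo[%classic);
    [apply: open_comp; [move=> + _; exact: continuous_normc|exact: interval_open]|
     apply/seteqP; split=> w; rewrite /= in_itv /= ?andbT].
have oAnn : open (Ann `&` setT).
  by rewrite setIT; apply/open_normcP => z Az; exact: (ring_dom_open holf Az).
have o0 : open (Ann `&` set0) by rewrite setI0; exact: open0.
(* A pair of complementary open pieces of the annulus, one attached to [B1]
   and the other to [B2], disconnects [W']. *)
have split_sphere (Z1 Z2 W' : set C) : open (Ann `&` Z1) -> open (Ann `&` Z2) -> Z1 `&` Z2 = set0 ->
    (forall z, Ann z -> U (f (fin z)) -> ~ (c <= normc z <= d) -> Z1 z) ->
    (forall z, Ann z -> V (f (fin z)) -> ~ (c <= normc z <= d) -> Z2 z) ->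
    (forall z, Ann z -> (@fin R @` W') (f (fin z)) -> Z1 z \/ Z2 z) ->
    connected W' -> W' w1 -> W' w2 -> False.
  move=> o1 o2 Z12 h1 h2 h12 cW' W1' W2'.
  have s1 : open (B1 `|` [set f (fin z) | z in Ann `&` Z1]).
    apply: (open_piece c1 d1 oU BU B1A U1 o1); first by move=> z [].
    by move=> z Az Uz ncd; split=> //; exact: h1.
  have s2 : open (B2 `|` [set f (fin z) | z in Ann `&` Z2]).
    apply: (open_piece c1 d1 oV BV B2A V2 o2); first by move=> z [].
    by move=> z Az Vz ncd; split=> //; exact: h2.
  have pull (O : set S) : open O -> open (@fin R @^-1` O).
    by move=> oO; apply: open_comp => // z _; exact: fin_continuous.
  apply: (connected_open_cover cW' (pull _ s1) (pull _ s2)).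
  - move=> w Ww; have [Aw|[Bw|Bw]] := cases (fin w); [|by left; left|by right; left].
    have [z Az zw] := ann_surj bijf Aw.
    have [|h|h] := h12 z Az; first by rewrite zw; exists w.
      by left; right; exists z.
    by right; right; exists z.
  - apply/seteqP; split=> // w [] [b1|[z [Az z1] zw]] [b2|[v [Av v2] vw]].
    + by have : (B1 `&` B2) (fin w) by []; rewrite B12.
    + have : (B1 `&` A) (fin w) by split=> //; rewrite -vw; apply: (ann_im bijf).
      by rewrite B1A.
    + have : (B2 `&` A) (fin w) by split=> //; rewrite -zw; apply: (ann_im bijf).
      by rewrite B2A.
    + have zv : z = v by apply: (ann_inj bijf Az Av); rewrite zw vw.
      by have : (Z1 `&` Z2) z; [split=> //; rewrite zv|rewrite Z12].
  - by exists w1; split=> //; left.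
  - by exists w2; split=> //; left.
have trichotomy z : Ann z -> ~ (c <= normc z <= d) -> ring_dom r1 c%:E z /\ normc z < r \/ ring_dom d%:E r2 z /\ r < normc z.
  move=> /andP[h1 h2] h3; have [h4|h4] := ltP (normc z) c.
    by left; split; [rewrite /ring_dom /= h1 lte_fin|exact: lt_le_trans h4 cr].
  have [h5|h5] := ltP d (normc z); first by right; split; [rewrite /ring_dom /= h2 lte_fin h5|exact: le_lt_trans rd h5].
  by exfalso; apply: h3; rewrite h4 h5.
have off_circle z : Ann z -> (@fin R @` W) (f (fin z)) -> normc z < r \/ r < normc z.
  move=> Az Wz; have [|h|/hW//] := ltgtP (normc z) r; [by left|by right].
have [iU|iV] := ann_side oU oV UV sub_in.1 sub_in.2 ri; have [oU'|oV'] := ann_side oU oV UV sub_out.1 sub_out.2 ro.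
- apply: (split_sphere setT set0 setT) => //; rewrite ?setI0//.
  + move=> z Az Vz /(trichotomy _ Az)[][h _]; [case: (UV0 _ (iU _ h) Vz)|case: (UV0 _ (oU' _ h) Vz)].
  + by left.
  + exact: connected_setT_c.
- apply: (split_sphere _ _ W oin oout) => //.
  + by apply/seteqP; split=> // z [/= h1 h2]; have := lt_trans h1 h2; rewrite ltxx.
  + move=> z Az Uz /(trichotomy _ Az)[][h hr] //; by case: (UV0 _ Uz (oV' _ h)).
  + move=> z Az Vz /(trichotomy _ Az)[][h hr] //; by case: (UV0 _ (iU _ h) Vz).
- apply: (split_sphere _ _ W oout oin) => //.
  + by apply/seteqP; split=> // z [/= h1 h2]; have := lt_trans h1 h2; rewrite ltxx.
  + move=> z Az Uz /(trichotomy _ Az)[][h hr] //; by case: (UV0 _ Uz (iV _ h)).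
  + move=> z Az Vz /(trichotomy _ Az)[][h hr] //; by case: (UV0 _ (oU' _ h) Vz).
  + by move=> z Az /(off_circle _ Az)[]; [right|left].
- apply: (split_sphere set0 setT setT) => //; rewrite ?set0I//.
  + move=> z Az Uz /(trichotomy _ Az)[][h _]; [case: (UV0 _ Uz (iV _ h))|case: (UV0 _ Uz (oV' _ h))].
  + by right.
  + exact: connected_setT_c.
Qed.
End Ends.

(** * A core curve of small diameter *)

Section SmallCircle.
Context {R : realType}.
Local Notation C := R[i].
Local Notation S := (sphere R).
Implicit Types (z w v y : C) (r e c d s : R) (x : S).

(** Taking a principal square root at least halves |w - 1|^2, because |psqrt w + 1|^2 >= 2. *)
Lemma root_near_one v k : normc v = 1 ->
  exists w, [/\ w ^+ (2 ^ k) = v, normc w = 1 & normc (w - 1) ^+ 2 <= 4 / 2 ^+ k].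
Proof.
move=> v1; elim: k => [|k [w [wE w1 wk]]].
  exists v; split; [exact: expr1|exact: v1|].
  have h : normc (v - 1) <= 2 by have := ler_normcB v 1; rewrite v1 normc1; lra.
  have h0 := normc_ge0 (v - 1); rewrite expr0 divr1 expr2; nra.
exists (psqrt w); have s2 : psqrt w ^+ 2 = w := psqrtK w.
have s1 : normc (psqrt w) = 1.
  have := normcX (psqrt w) 2; rewrite s2 w1 => /esym/eqP; rewrite expr2 => /eqP h.
  by have := normc_ge0 (psqrt w); nra.
split=> //; first by rewrite expnS exprM s2.
have hE : w - 1 = (psqrt w - 1) * (psqrt w + 1) by rewrite -{1}s2; ring.
have h2 : 2 <= normc (psqrt w + 1) ^+ 2.
  have := sqr_normcE (psqrt w); rewrite s1 sqr_normcE ReD ImD /= addr0.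
  have := Re_psqrt_ge0 w; set a := complex.Re _; set b := complex.Im _ => a0 hab; move: hab a0; rewrite !expr2.
  clear; nra.
have -> : 4 / 2 ^+ k.+1 = 4 / 2 ^+ k / 2 :> R by rewrite (exprSr 2 k) invfM mulrA.
move: wk; rewrite hE normcM exprMn => wk.
have := sqr_ge0 (normc (psqrt w - 1)); move: h2 wk.
set a := normc (psqrt w + 1) ^+ 2; set b := normc (psqrt w - 1) ^+ 2; set q := 4 / 2 ^+ k.
clearbody a b q; clear; nra.
Qed.

(** The map [w |-> t * P * w ^+ n] with [n = 2 ^ k] plays the part of the exponential: it sends the
    disc of radius 1/2 about 1 into a sub-annulus, and already a small disc about 1 covers the
    circle of radius [t * P]. Its composite with [f] omits [b1] and [b2], so by [omit_lip] the image
    of the circle is small. *)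
Lemma small_circle d B e : 0 < d -> 0 < B -> 0 < e -> exists2 L, 0 < L &
  forall (r1 r2 : \bar R) (f : S -> S) (A : set S) b1 b2 s,
    (0 <= r1)%E -> holomorphic_on (round_annulus r1 r2) f -> set_bij (round_annulus r1 r2) A f ->
    normc b1 <= B -> normc b2 <= B -> d <= normc (b2 - b1) -> ~ A (fin b1) -> ~ A (fin b2) ->
    (r1 < s%:E)%E -> ((s * L)%:E < r2)%E ->
  exists r, [/\ 0 < r, (r1 < r%:E < r2)%E & forall z, normc z = r ->
    f (fin z) <> infty /\ chordal (f (fin r%:C)) (f (fin z)) <= e].
Proof.
have unit_range w : normc (w - 1) < 2^-1 -> 2^-1 < normc w /\ normc w < 2.
  move=> w1; split; first by have := lerB_normc 1 w; rewrite normc_distC normc1; lra.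
  by have := lerB_normc w 1; rewrite normc1; lra.
have at1 : normc (1 - 1 : C) < 2^-1 by rewrite subrr normc0 invr_gt0.
have half (n : R) : n < 2^-1 / 2 -> n < 2^-1 by lra.
have sq17 (n : R) : n ^+ 2 < 17^-1 -> n < 2^-1 / 2.
  by move=> n17; rewrite ltNge; apply/negP => h; move: n17; rewrite expr2; nra.
move=> d0 B0 e0; have [K K0 hK] := omit_lip d0 B0.
(* The bound 1/17 places [w] within 1/4 of 1, where [omit_lip] on radius 1/2 applies; the other
   bound makes the Lipschitz estimate [2 * K * |w - 1|] at most [e]. *)
pose mu := Num.min 17^-1 ((e / (2 * K)) ^+ 2).
have mu0 : 0 < mu by rewrite lt_min invr_gt0 ltr0n exprn_gt0// divr_gt0// mulr_gt0.
have [k hk] := @pow_unbounded R 2 (4 / mu) (lexx 2).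
have {}hk : 4 / 2 ^+ k < mu.
  by rewrite ltr_pdivrMr ?exprn_gt0// mulrC -ltr_pdivrMr.
have [n nE] : exists n, n = (2 ^ k)%N by exists (2 ^ k)%N.
have n0 : n != 0%N by rewrite nE -lt0n expn_gt0.
have [P [Q [P0 PE QE]]] : exists P Q : R, [/\ 0 < P, P = 2 ^+ n & Q = P * P].
  by exists (2 ^+ n), (2 ^+ n * 2 ^+ n); split=> //; rewrite exprn_gt0.
have P1 : 1 < P by rewrite PE exprn_egt1// ltr1n.
have Q1 : 1 < Q by rewrite QE; nra.
exists (Q * Q); first by nra.
move=> r1 r2 f A b1 b2 s r10 holf bijf b1B b2B b12 nb1 nb2 r1s sr2.
have s0 : 0 < s by move: (le_lt_trans r10 r1s); rewrite lte_fin.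
(* Of two consecutive sub-annuli of ratio [Q], at most one contains the pole of the injective map
   [f]; the other one is used. Hence the total ratio [Q * Q]. *)
have [t [t0 r1t tr2 np]] : exists t, [/\ 0 < t, (r1 < t%:E)%E, ((t * Q)%:E < r2)%E &
    forall z, t < normc z -> normc z < t * Q -> f (fin z) <> infty].
  have sQ : s < s * Q by rewrite ltr_pMr.
  have sQQ : s * Q < s * Q * Q by rewrite ltr_pMr// (lt_trans s0 sQ).
  rewrite mulrA in sr2.
  have [[z [z1 z2 fz]]|nz] := pselect (exists z, [/\ s < normc z, normc z < s * Q & f (fin z) = infty]).
    exists (s * Q); split=> //; first exact: lt_trans s0 sQ.
      by apply: lt_trans r1s _; rewrite lte_fin.
    move=> w w1 w2 fw; have zw : z = w.
      apply: (ann_inj bijf) (etrans fz (esym fw)); apply/andP; split.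
      + by apply: lt_trans r1s _; rewrite lte_fin.
      + by apply: lt_trans sr2; rewrite lte_fin (lt_trans z2 sQQ).
      + by apply: lt_trans r1s _; rewrite lte_fin (lt_trans sQ w1).
      + by apply: lt_trans sr2; rewrite lte_fin.
    by have := lt_trans z2 w1; rewrite zw ltxx.
  exists s; split=> //; first by apply: lt_trans sr2; rewrite lte_fin.
  by move=> z z1 z2 fz; apply: nz; exists z.
have tP : 0 < t * P by rewrite mulr_gt0.
have annt z : t < normc z -> normc z < t * Q -> ring_dom r1 r2 z.
  move=> h1 h2; apply/andP; split; first by apply: lt_trans r1t _; rewrite lte_fin.
  by apply: lt_trans tr2; rewrite lte_fin.
pose g w := plane_map f ((t * P)%:C * w ^+ n).
have range w : normc (w - 1) < 2^-1 -> t < normc ((t * P)%:C * w ^+ n) /\ normc ((t * P)%:C * w ^+ n) < t * Q.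
  move=> /unit_range[h1 h2].
  rewrite normcM normcX normc_real gtr0_norm//.
  have h3 : P^-1 < normc w ^+ n by rewrite PE -exprVn ltrXn2r ?nnegrE ?invr_ge0 ?normc_ge0.
  have h4 : normc w ^+ n < P by rewrite PE ltrXn2r ?nnegrE ?normc_ge0.
  split; last by rewrite QE mulrA ltr_pM2l.
  by rewrite -[ltLHS]mulr1 -[1](mulfV (lt0r_neq0 P0)) mulrA ltr_pM2l.
have gfin w : normc (w - 1) < 2^-1 -> f (fin ((t * P)%:C * w ^+ n)) = fin (g w).
  by move=> /range[h1 h2]; apply: plane_mapE; exact: np.
have gA w : normc (w - 1) < 2^-1 -> A (fin (g w)).
  by move=> w1; rewrite -gfin//; apply: (ann_im bijf); have [h1 h2] := range w w1; exact: annt.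
have lip : forall w, normc (w - 1) < 2^-1 / 2 -> chordal (fin (g 1)) (fin (g w)) <= K / 2^-1 * normc (1 - w).
  move=> w w1; apply: (hK b1 b2 g 1 2^-1 b1B b2B b12) => //; last by rewrite subrr normc0 divr_gt0 ?invr_gt0.
  move=> u u1; split.
    apply: (@cdiff_comp _ (fun u => (t * P)%:C * u ^+ n) (plane_map f)).
      by apply: cdiffM; [exact: cdiff_cst|apply: cdiffX; exact: cdiff_id].
    by have [h1 h2] := range u u1; apply: (ann_cdiff holf); [exact: annt|exact: np].
  by split; apply/eqP => gu; have := gA u u1; rewrite gu.
have g1 : f (fin (t * P)%:C) = fin (g 1).
  by rewrite -gfin ?expr1n ?mulr1.
exists (t * P); split=> //.
  apply/andP; split; first by apply: lt_trans r1t _; rewrite lte_fin ltr_pMr.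
  by apply: lt_trans tr2; rewrite lte_fin ltr_pM2l// QE ltr_pMr.
move=> z zr; have v1 : normc (z / (t * P)%:C) = 1.
  by rewrite normcM normcV normc_real gtr0_norm// zr divff// gt_eqF.
have [w [wE w1 wk]] := root_near_one k v1.
have zE : z = (t * P)%:C * w ^+ n.
  by rewrite nE wE mulrC divfK// -normc_gt0 normc_real gtr0_norm.
have w0 := normc_ge0 (w - 1).
have [wm1 wm2] : normc (w - 1) ^+ 2 < 17^-1 /\ normc (w - 1) ^+ 2 < (e / (2 * K)) ^+ 2.
  by have := le_lt_trans wk hk; rewrite lt_min => /andP[].
have w4 := sq17 _ wm1; have w2 := half _ w4.
have we : normc (w - 1) < e / (2 * K).
  have q0 : 0 <= e / (2 * K) by rewrite ltW// divr_gt0// mulr_gt0.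
  by move: wm2; rewrite ltr_pXn2r ?nnegrE.
split; first by rewrite zE gfin.
rewrite g1 zE gfin//.
apply: le_trans (lip w w4) _.
rewrite invrK normc_distC -ler_pdivlMl ?mulr_gt0//.
by move: we; rewrite mulrC (mulrC 2 K) => /ltW.
Qed.
End SmallCircle.

(** * The modulus and the complementary components *)

Section Modulus.
Context {R : realType}.
Local Notation C := R[i].
Local Notation S := (sphere R).
Implicit Types (z w y : C) (r e c d s : R) (x : S) (A : set S).

(** For a set not equivalent to any round annulus, [get] returns the default value 0, which is below
    the positive [c]. *)
Lemma modulus_lt A c : 0 < c -> (forall (r1 r2 : \bar R) f, (0 <= r1)%E -> (r1 < r2)%E ->
    holomorphic_on (round_annulus r1 r2) f -> set_bij (round_annulus r1 r2) A f ->
    (c%:E <= lne r2 - lne r1)%E -> False) -> (modulus A < c%:E)%E.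
Proof.
move=> c0 h; rewrite ltNge; apply/negP => hm; rewrite /modulus in hm.
set P := [set m | _] in hm.
have [ex|nex] := pselect (exists m, P m).
  have [r1 [r2 [r10 r12 [f [hf bf]] mE]]] : P (get P) := getPex ex.
  by apply: (h r1 r2 f) => //; rewrite -mE.
rewrite getPN in hm; last by move=> m Pm; apply: nex; exists m.
by move: hm; rewrite (_ : point = 0%E)// lee_fin leNgt c0.
Qed.

(** For finite positive radii [s = r1 * expR 2^-1] works, as the gap exceeds [ln L] by at least 1;
    the cases [r1 = 0] and [r2 = +oo], of infinite modulus, are treated apart. *)
Lemma lne_gap (r1 r2 : \bar R) L : 0 < L -> (0 <= r1)%E -> (r1 < r2)%E ->
  ((`|ln L| + 1)%:E <= lne r2 - lne r1)%E -> exists s, (r1 < s%:E)%E /\ ((s * L)%:E < r2)%E.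
Proof.
move=> L0; case: r1 => [a| |//]; last by move=> _; rewrite ltNge leey.
rewrite lee_fin => a0; case: r2 => [b| |//]; rewrite ?lte_fin => ab; last first.
  by move=> _; exists (a + 1); rewrite lte_fin ltry; split=> //; lra.
have b0 : 0 < b by exact: le_lt_trans ab.
have [a1|a1] := leP a 0.
  move=> _; exists (b / L / 2); rewrite !lte_fin; split.
    by apply: le_lt_trans a1 _; rewrite !divr_gt0.
  by rewrite mulrAC divfK ?gt_eqF//; lra.
rewrite /lne (lt_geF b0) (lt_geF a1) -EFinB lee_fin => h.
exists (a * expR 2^-1); rewrite !lte_fin; split.
  by rewrite ltr_pMr// expR_gt1 invr_gt0.
rewrite -ltr_ln ?posrE ?mulr_gt0 ?expR_gt0// !lnM ?posrE ?mulr_gt0 ?expR_gt0// expRK.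
by have := ler_norm (ln L); lra.
Qed.

Lemma dc_pieces A (K : set S) : doubly_connected_domain A -> separates A K -> exists B1 B2,
  [/\ closed B1 /\ closed B2, B1 `&` B2 = set0, ~` A = B1 `|` B2, B1 `&` K !=set0 /\ B2 `&` K !=set0
    & forall X, connected X -> X `<=` ~` A -> (X `&` B1 !=set0 -> X `<=` B1) /\ (X `&` B2 !=set0 -> X `<=` B2)].
Proof.
move=> [oA A0 cA [B1 [B2 [B12 E]]]] [AK hK].
have [x1 nx1 B1E] : conn_components (~` A) B1 by rewrite E; left.
have [x2 nx2 B2E] : conn_components (~` A) B2 by rewrite E; right.
have clA : closed (~` A) by exact: open_closedC.
have comp x X : connected X -> X `<=` ~` A -> X `&` connected_component (~` A) x !=set0 ->
    X `<=` connected_component (~` A) x.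
  move=> cX XA [y [Xy xy]]; rewrite (same_connected_component xy).
  exact: connected_component_max.
exists B1, B2; split.
- by rewrite -B1E -B2E; split; exact: component_closed.
- apply/seteqP; split=> // y []; rewrite -B1E -B2E => h1 h2; apply: B12.
  by rewrite -B1E -B2E (same_connected_component h1) (same_connected_component h2).
- apply/seteqP; split=> [y Ay|y].
    have : conn_components (~` A) (connected_component (~` A) y) by exists y.
    by rewrite E => -[<-|<-]; [left|right]; exact: connected_component_refl.
  by case; [rewrite -B1E|rewrite -B2E]; exact: connected_component_sub.
- by split; apply: hK; rewrite E; [left|right].
- by move=> X cX XA; rewrite -B1E -B2E; split; exact: comp.
Qed.
End Modulus.

(** * Annuli separating the Julia set *)

Section UniformlyPerfect.
Context {R : realType}.
Local Notation C := R[i].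
Local Notation S := (sphere R).
Implicit Types (z w y : C) (r e d s : R) (h : {poly C}) (A : set S).
Variable G : set {poly C}.
Hypothesis pG : pcb G.

(** Two critical values [p], [v] lie in every [Kf h], and by [jul_far] each [jul h] has points at
    least [|p - v|] apart. A single critical value [v] is not in the Julia set, which would
    otherwise be star-shaped about [v] by [monomial_julia] and so connected; a disc about [v] of
    some radius [e] then misses the Julia set, and [e] serves. *)
Lemma jul_spread : ~ connected (julia G) ->
  exists2 d, 0 < d & forall h, G h -> exists a b, [/\ jul h a, jul h b & d <= normc (b - a)].
Proof.
move=> nc; have ninf : ~ julia G infty by move=> /(julia_connected pG).
have two h z p r : G h -> Kf h p -> jul h z -> r <= normc (p - z) ->
    exists a b, [/\ jul h a, jul h b & r <= normc (b - a)].
  move=> Gh Kp jz rz; have [b jb bz] := jul_far z (pcb_size pG Gh) Kp.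
  by exists z, b; split=> //; exact: le_trans bz.
have [v cv] := crit_ex pG.
have [[p [cp pv]]|single] := pselect (exists p, crit_values G p /\ p != v).
  exists (normc (p - v)); first by rewrite normc_gt0 subr_eq0.
  move=> h Gh; have Kp := crit_Kf pG Gh cp; have Kv := crit_Kf pG Gh cv.
  have [c jc cv'] := jul_far v (pcb_size pG Gh) Kp.
  by apply: (two h c v) => //; apply: le_trans cv' _; rewrite normc_distC.
have hv : crit_values G `<=` [set v].
  by move=> p cp; apply: contrapT => /= /eqP pv; apply: single; exists p.
have nv : ~ julia G (fin v).
  move=> jv; apply: nc; rewrite -(fin_plane_part ninf); apply: fin_connected.
  apply: (@starshaped_connected _ _ v) => // w jw z [t]; rewrite /= in_itv /= => /andP[t0 t1] <-.
  apply: (monomial_julia pG hv jv jw).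
  by rewrite addrAC subrr add0r normcM normc_real ger0_norm// ler_piMl ?normc_ge0.
have [e e0 he] := closed_notin (@JP_closed _ G) nv.
exists e => // h Gh; have Kv := crit_Kf pG Gh cv.
have [c jc _] := jul_far v (pcb_size pG Gh) Kv.
apply: (two h c v) => //; rewrite leNgt normc_distC; apply/negP => /he; apply.
exact (jul_julia pG Gh jc).
Qed.

Lemma julia_uniformly_perfect : uniformly_perfect (julia G).
Proof.
have [G0 _ _ _] := pG; have [h0 Gh0] := G0.
split.
- by apply: subclosed_compact (@sphere_compact R) _; [exact: closed_julia|].
- have [a [b [ab ja jb]]] := jul_two pG Gh0; exists (fin a), (fin b); split.
  + exact (jul_julia pG Gh0 ja).
  + exact (jul_julia pG Gh0 jb).
  + by move=> /fin_inj/eqP; rewrite (negbTE ab).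
have [cJ|nJ] := pselect (connected (julia G)).
  exists 1 => // A dA sA; exfalso.
  have [B1 [B2 [_ B12 _ [[x1 [B1x J1]] [x2 [B2x J2]]] hX]]] := dc_pieces dA sA.
  have JA : julia G `<=` ~` A.
    by move=> x Jx Ax; have : (A `&` julia G) x by []; case: sA => ->.
  have [h1 _] := hX _ cJ JA.
  have : (B1 `&` B2) x2 by split=> //; apply: h1 => //; exists x1.
  by rewrite B12.
have ninf : ~ julia G infty by move=> /(julia_connected pG).
have [M M0 hM] := JP_bounded ninf.
have {}hM z : julia G (fin z) -> normc z <= M by move=> /hM; rewrite /cdisc /= subr0.
have [d d0 hd] := jul_spread nJ.
have quarter (n : R) : 2 * n <= d / 2 -> n <= d / 4 by lra.
have one_far (n m k : R) : d <= n -> n <= m + k -> k <= d / 4 -> d / 4 < m by lra.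
(* [R0] and [R1] are the thresholds of [chordal_far] for points within [M] and within [R0]. With [e]
   below both gaps, a circle whose image starts beyond [R0] stays off the disc of radius [M], and
   one that starts within [R0] stays within [R1], where Euclidean distances are at most [P / 2]
   times chordal ones. *)
pose R0 := 2 * (1 + M); pose R1 := 2 * (1 + R0).
have [R0E R1E] : R0 = 2 * (1 + M) /\ R1 = 2 * (1 + R0) by [].
clearbody R0 R1; have [R00 R10] : 0 < R0 /\ 0 < R1 by lra.
have RM : (1 + R0)^-1 <= (1 + M)^-1 by rewrite lef_pV2 ?posrE; lra.
have [P [P0 PE]] : exists P, 0 < P /\ P = (1 + R1) * (1 + R0).
  by exists ((1 + R1) * (1 + R0)); split=> //; rewrite mulr_gt0//; lra.
have [e [e0 e1 e2]] : exists e : R, [/\ 0 < e, e <= (1 + R0)^-1 & e <= d / 2 / P].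
  exists (Num.min (1 + R0)^-1 (d / 2 / P)); rewrite lt_min !ge_min !lexx orbT; split=> //.
  by rewrite invr_gt0 !divr_gt0//; lra.
have [L L0 hL] := small_circle d0 M0 e0.
exists (`|ln L| + 1); first by have := normr_ge0 (ln L); lra.
move=> A dA sA.
have [B1 [B2 [[cB1 cB2] B12 nA [[x1 [B1x J1]] [x2 [B2x J2]]] hX]]] := dc_pieces dA sA.
have JA x : julia G x -> (~` A) x.
  by move=> Jx Ax; have : (A `&` julia G) x by []; case: sA => ->.
apply: modulus_lt; first by have := normr_ge0 (ln L); lra.
move=> r1 r2 f r10 r12 holf bijf hm.
have [s [r1s sr2]] := lne_gap L0 r10 r12 hm.
have [a [b [ja jb ab]]] := hd _ Gh0.
have JF h z (Gh : G h) (jz : jul h z) : julia G (fin z) := jul_julia pG Gh jz.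
have [r [r0 rr hr]] := hL r1 r2 f A a b s r10 holf bijf (hM _ (JF _ _ Gh0 ja)) (hM _ (JF _ _ Gh0 jb)) ab
  (JA _ (JF _ _ Gh0 ja)) (JA _ (JF _ _ Gh0 jb)) r1s sr2.
have circA z : normc z = r -> A (f (fin z)).
  by move=> zr; apply: (ann_im bijf); rewrite /ring_dom /= zr.
have [y0 y0E] : exists y0, f (fin r%:C) = fin y0.
  have [|] := hr r%:C; first by rewrite normc_real gtr0_norm.
  by case: (f (fin r%:C)) => // y _ _; exists y.
have {}hr z : normc z = r -> exists2 y, f (fin z) = fin y & chordal (fin y0) (fin y) <= e.
  by move=> /hr; rewrite y0E; case: (f (fin z)) => [y|] [h1 h2]; [exists y|case: h1].
(* Each complementary piece contains a whole Julia set [J(h)]. *)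
have piece (B B' : set S) x : closed B' -> B `&` B' = set0 -> ~` A = B `|` B' ->
    (forall X, connected X -> X `<=` ~` A -> X `&` B !=set0 -> X `<=` B) -> B x -> julia G x ->
    exists2 h, G h & @fin R @` jul h `<=` B.
  case: x => [y|//] clB' BB' nA' hX' By Jy.
  have nB'y : ~ (@fin R @^-1` B') y by move=> B'y; have : (B `&` B') (fin y) by []; rewrite BB'.
  have clP : closed (@fin R @^-1` B') by apply: preimage_closed => // z _; exact: fin_continuous.
  have [eta eta0 heta] := closed_notin clP nB'y.
  have [h [w [Gh jw wy]]] := (julia_finP pG y).1 Jy eta eta0.
  exists h => //; apply: hX'.
  - by apply: fin_connected; exact (pcb_jul_connected pG Gh).
  - by move=> _ [z jz <-]; apply: JA; exact (JF _ _ Gh jz).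
  - exists (fin w); split; first by exists w.
    have : (~` A) (fin w) by apply: JA; exact (JF _ _ Gh jw).
    by rewrite nA' => -[//|] /(heta w wy).
have [h1 Gh1 hB1] := piece B1 B2 x1 cB2 B12 nA (fun X cX XA => (hX X cX XA).1) B1x J1.
have [h2 Gh2 hB2] : exists2 h, G h & @fin R @` jul h `<=` B2.
  apply: (piece B2 B1 x2 cB1) => //; [by rewrite setIC|by rewrite setUC|].
  by move=> X cX XA; exact: (hX X cX XA).2.
have [a1 [b1 [ja1 jb1 ab1]]] := hd _ Gh1.
have [a2 [b2 [ja2 jb2 ab2]]] := hd _ Gh2.
have B1a : B1 (fin a1) by apply: hB1; exists a1.
have B2a : B2 (fin a2) by apply: hB2; exists a2.
(* If the image circle lies far out, the disc of radius [M], which contains the Julia set, is a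
   connected set off the circle that joins the two pieces. *)
have [y0R|y0R] := ltP R0 (normc y0).
  apply: (@circle_separates _ r1 r2 f A r10 holf bijf B1 B2 (cdisc 0 M) r a1 a2) => //.
  - by apply: cdisc_connected; exact: ltW.
  - move=> z zr [w]; rewrite /cdisc /= subr0 => wM; have [y -> ye] := hr z zr => /fin_inj wy.
    have y0M : 2 * (1 + M) < normc y0 by rewrite -R0E.
    by have := chordal_far wM y0M; rewrite wy chordalC ltNge (le_trans ye (le_trans e1 RM)).
  - by rewrite /cdisc /= subr0; apply: hM; exact (JF _ _ Gh1 ja1).
  - by rewrite /cdisc /= subr0; apply: hM; exact (JF _ _ Gh2 ja2).
have near z y : normc z = r -> f (fin z) = fin y -> normc (y - y0) <= d / 4.
  move=> zr fy; have [y' y'E ye] := hr z zr.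
  have {y' y'E}ye : chordal (fin y0) (fin y) <= e by move: y'E; rewrite fy => /fin_inj ->.
  have yR : normc y <= R1.
    rewrite leNgt R1E; apply/negP => /(chordal_far y0R).
    by rewrite ltNge (le_trans ye e1).
  move: ye; rewrite chordal_fin ler_pdivrMr ?mulr_gt0 ?jap_gt0// => ye.
  have j1 := jap_le y0; have j2 := jap_le y; have j3 := jap_gt0 y0; have j4 := jap_gt0 y.
  have jP : jap y0 * jap y <= P.
    rewrite PE mulrC; apply: ler_pM; [exact: ltW|exact: ltW| |].
    - by apply: le_trans j2 _; rewrite lerD2l.
    - by apply: le_trans j1 _; rewrite lerD2l.
  have eP : e * P <= d / 2 by rewrite -ler_pdivlMr.
  have ej : e * (jap y0 * jap y) <= e * P by rewrite ler_pM2l.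
  by rewrite normc_distC; apply: quarter; exact: le_trans ye (le_trans ej eP).
have far (u v : C) : d <= normc (v - u) -> d / 4 < normc (u - y0) \/ d / 4 < normc (v - y0).
  move=> uv; have [|h3] := ltP (d / 4) (normc (u - y0)); first by left.
  by right; apply: (one_far _ _ _ uv (ler_distcD y0 v u)); rewrite normc_distC.
(* The image circle lies in the disc of radius [d / 4] about [y0]. A set with two points at least
   [d] apart cannot lie in that disc, so the exterior [E] meets both [jul h1] and [jul h2] and
   connects them. *)
pose E := [set z : C | d / 4 < normc (z - y0)].
have cE : connected E by apply: exterior_connected; rewrite ltW// divr_gt0.
have meet h u v : jul h u -> jul h v -> d <= normc (v - u) -> E `&` jul h !=set0.
  by move=> ju jv /far[]; [exists u|exists v].
apply: (@circle_separates _ r1 r2 f A r10 holf bijf B1 B2 ((E `|` jul h1) `|` jul h2) r a1 a2) => //.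
- apply: connectedU; last exact (pcb_jul_connected pG Gh2).
    by have [z [Ez jz]] := meet h2 _ _ ja2 jb2 ab2; exists z; split=> //; left.
  apply: connectedU => //; last exact (pcb_jul_connected pG Gh1).
  exact: (meet h1 a1 b1).
- move=> z zr [w Ww wf]; have Az := circA z zr; rewrite -wf in Az.
  have nz := near z w zr (esym wf).
  case: Ww => [[Ew|jw]|jw].
  + by move: Ew; rewrite /E /= ltNge nz.
  + exact: (JA _ (JF _ _ Gh1 jw) Az).
  + exact: (JA _ (JF _ _ Gh2 jw) Az).
- by left; right.
- by right.
Qed.
End UniformlyPerfect.

Theorem theorem2p22 (R : realType) :
  [/\ forall G : set {poly R[i]}, calG G ->
        uniformly_perfect (julia G) /\
        forall (z0 : sphere R) (g : {poly R[i]}), julia G z0 -> G g ->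
          superattracting_fixed (poly_map g) z0 -> interior (julia G) z0,
      forall G : set {poly R[i]}, calG G -> julia G infty ->
        calG_con G /\ interior (julia G) infty
    & forall G : set {poly R[i]}, calG_dis G ->
        forall (z1 : R[i]) (g : {poly R[i]}), julia G (fin z1) -> G g ->
          superattracting_fixed (poly_map g) (fin z1) ->
          interior (J_min G) (fin z1) /\ julia1 g `<=` J_min G].
Proof.
split=> [G /calG_pcb pG|G cG jinf|G [/calG_pcb pG nc] z1 g jz1 Gg /superattractingP[gz g'z]].
- split; first exact: julia_uniformly_perfect.
  move=> [z0|] g jz Gg; last by move=> _; exact (interior_infty pG jz).
  by move=> /superattractingP[gz g'z]; exact (interior_superattracting pG Gg gz g'z jz).
- have pG := calG_pcb cG; split; last exact (interior_infty pG jinf).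
  by split=> //; exact (julia_connected pG jinf).
- by apply: (part3 pG Gg gz g'z _ jz1) => /(julia_connected pG).
Qed.
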